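(* Let $x$ be a complex random variable with zero mean and unit variance, and let $X_n=(x_{ij})_{1\le i,j\le n}$ be $n\times n$ random matrices whose entries are iid copies of $x$. For each $n$ let $M_n$ be a deterministic $n\times n$ complex matrix with $\sup_n\frac{1}{n^2}\|M_n\|_2^2<\infty$, and let $A_n:=M_n+X_n$. Let $\mu$ be a probability measure on $\mathbb{C}$ with $\int|z|^2\,d\mu(z)<\infty$. Then the following are equivalent: (i) The ESD $\mu_{\frac{1}{\sqrt n}A_n}$ of $\frac{1}{\sqrt n}A_n$ converges in probability to $\mu$. (ii) For almost every complex number $z$, $\frac1n\log|\det(\frac{1}{\sqrt n}A_n-zI)|$ converges in probability to $\int_{\mathbb{C}}\log|w-z|\,d\mu(w)$. (iii) For almost every complex number $z$, there exists a sequence $\varepsilon_n>0$ of positive numbers converging to zero such that $$\frac1n\log\det\Big(\big(\tfrac{1}{\sqrt n}A_n-zI\big)\big(\tfrac{1}{\sqrt n}A_n-zI\big)^*+\varepsilon_nI\Big)$$ converges in probability to $2\int_{\mathbb{C}}\log|w-z|\,d\mu(w)$. If furthermore the ESDs $\mu_{(\frac{1}{\sqrt n}M_n-zI)(\frac{1}{\sqrt n}M_n-zI)^*}$ converge to a limit as $n\to\infty$ for almost every $z\in\mathbb{C}$, then the three statements obtained from (i), (ii) and (iii) by replacing ''converges in probability'' with ''converges almost surely'' in each of them are also equivalent to one another.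
   Context: For an $n\times n$ complex matrix $A$ with eigenvalues $\lambda_1,\dots,\lambda_n$ (with algebraic multiplicity), the empirical spectral distribution (ESD) is the probability measure $\mu_A=\frac1n\sum_{i=1}^n\delta_{\lambda_i}$ on $\mathbb{C}$. $\|A\|_2:=\mathrm{trace}(AA^* )^{1/2}$ is the Hilbert-Schmidt norm, $I$ the identity matrix. Zero mean and unit variance means $\mathbf{E}x=0$, $\mathbf{E}|x|^2=1$. ''Almost every $z$'' refers to Lebesgue measure on $\mathbb{C}$. Measures are given the vague topology (convergence of integrals against every continuous compactly supported $f:\mathbb{C}\to\mathbb{R}$). Random probability measures $\mu_n$ converge in probability to $\mu$ if $\int f\,d\mu_n\to\int f\,d\mu$ in probability for every such $f$; they converge almost surely to $\mu$ if with probability $1$, $\int f\,d\mu_n\to\int f\,d\mu$ for all such $f$. The $X_n$ are the upper-left $n\times n$ blocks of a single infinite array $(x_{ij})_{i,j\ge1}$ of iid copies of $x$. *)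

(* Defs.v *)
From HB Require Import structures.
From mathcomp Require Import all_boot all_order all_algebra.
From mathcomp Require Import spectral finmap complex.
From mathcomp Require Import all_classical all_reals all_analysis.

Set Implicit Arguments.
Unset Strict Implicit.
Unset Printing Implicit Defensive.

Import Order.TTheory GRing.Theory Num.Theory.
Import numFieldNormedType.Exports.

Local Open Scope classical_set_scope.
Local Open Scope ring_scope.
Local Open Scope complex_scope.
Local Open Scope sesquilinear_scope.

(* R[i] carries the topology of the modulus and its Borel sigma-algebra. *)
HB.instance Definition _ (R : realType) :=
  PseudoMetricNormedZmod.copy R[i] (R[i]^o).
HB.instance Definition _ (R : realType) :=
  Measurable.copy R[i] (g_sigma_algebraType (@open R[i])).

Notation normc := ComplexField.Normc.normc.

(* Almost every complex number: the Lebesgue measure on C is the image of the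
   Lebesgue measure on the plane under (x, y) |-> x + i y. *)
Definition ae_complex (R : realType) (Q : R[i] -> Prop) : Prop :=
  {ae ((@lebesgue_measure R) \x (@lebesgue_measure R))%E,
    forall p : R * R, Q (p.1 +i* p.2)}.

(* `eigenvalues A` lists the roots of the characteristic polynomial of A with
   multiplicity: char_poly A = \prod_(l <- eigenvalues A) ('X - l%:P). *)
Definition eigenvalues (R : realType) (n : nat) (A : 'M[R[i]]_n) : seq R[i] :=
  sval (closed_field_poly_normal (char_poly A)).

Definition esd (R : realType) (n : nat) (A : 'M[R[i]]_n) :
    {measure set R[i] -> \bar R} :=
  mscale (n%:R^-1)%:nng (msum (fun k => \d_((eigenvalues A)`_k)) n).

Definition hs_norm (R : realType) (n : nat) (A : 'M[R[i]]_n) : R :=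
  Num.sqrt (complex.Re (\tr (A *m A ^t*))).

Definition gram (R : realType) (n : nat) (B : 'M[R[i]]_n) : 'M[R[i]]_n :=
  B *m B ^t*.

Definition rescale (R : realType) (n : nat) (A : 'M[R[i]]_n) : 'M[R[i]]_n :=
  ((Num.sqrt n%:R)^-1)%:C *: A.

Definition test_function (R : realType) (f : R[i] -> R) : Prop :=
  continuous f /\ compact (closure [set z | f z != 0]).

Definition vague_cvg (R : realType) (nu : nat -> {measure set R[i] -> \bar R})
    (mu : {measure set R[i] -> \bar R}) : Prop :=
  forall f : R[i] -> R, test_function f ->
    \int[nu n]_z f z @[n --> \oo] --> \int[mu]_z f z.

Section random.
Context (d : measure_display) (T : measurableType d) (R : realType).
Variable P : probability T R.

(* Stated through neighbourhoods so that it covers the extended real line,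
   where log 0 = -oo lives; on R it is P(|Y n - c| < e) --> 1 for all e > 0. *)
Definition cvg_in_probability (V : topologicalType) (Y : nat -> T -> V)
    (c : V) : Prop :=
  forall U : set V, open_nbhs c U -> P [set w | U (Y n w)] @[n --> \oo] --> 1%E.

Definition cvg_almost_surely (V : topologicalType) (Y : nat -> T -> V)
    (c : V) : Prop :=
  {ae P, forall w, Y n w @[n --> \oo] --> c}.

Definition vague_cvg_in_probability
    (nu : nat -> T -> {measure set R[i] -> \bar R})
    (mu : {measure set R[i] -> \bar R}) : Prop :=
  forall f : R[i] -> R, test_function f ->
    cvg_in_probability (fun n w => \int[nu n w]_z f z) (\int[mu]_z f z).

Definition vague_cvg_almost_surely
    (nu : nat -> T -> {measure set R[i] -> \bar R})
    (mu : {measure set R[i] -> \bar R}) : Prop :=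
  {ae P, forall w, vague_cvg (nu ^~ w) mu}.

Definition mutually_independent (I : choiceType) d' (T' : measurableType d')
    (X : I -> {RV P >-> T'}) : Prop :=
  forall (J : {fset I}) (B : I -> set T'), (forall k, measurable (B k)) ->
    P (\bigcap_(k in [set` J]) X k @^-1` B k) =
    (\prod_(k <- J) P (X k @^-1` B k))%E.

Definition same_law d1 (T1 : measurableType d1) (P1 : probability T1 R)
    d' (T' : measurableType d') (X : {RV P >-> T'}) (x : {RV P1 >-> T'}) :
    Prop :=
  forall B : set T', measurable B -> distribution P X B = distribution P1 x B.

Definition iid_copies (I : choiceType)
    d1 (T1 : measurableType d1) (P1 : probability T1 R)
    d' (T' : measurableType d') (X : I -> {RV P >-> T'})
    (x : {RV P1 >-> T'}) : Prop :=
  mutually_independent X /\ forall k, same_law (X k) x.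

Definition zero_mean_unit_variance (x : {RV P >-> R[i]}) : Prop :=
  [/\ 'E_P[fun w => complex.Re (x w)] = 0, 'E_P[fun w => complex.Im (x w)] = 0
    & 'E_P[fun w => (normc (x w) ^+ 2)%R] = 1]%E.

Definition random_matrix (X : nat * nat -> {RV P >-> R[i]}) (n : nat) (w : T) :
    'M[R[i]]_n :=
  \matrix_(i < n, j < n) X (val i, val j) w.

End random.

(* The integral of log|w - z| and the logarithm of |det| are extended-real,
   with log 0 = -oo. *)
Definition log_potential (R : realType) (mu : {measure set R[i] -> \bar R})
    (z : R[i]) : \bar R :=
  (\int[mu]_w lne (normc (w - z))%:E)%E.

Definition mean_log_absdet (R : realType) (n : nat) (B : 'M[R[i]]_n) : \bar R :=
  ((n%:R^-1)%:E * lne (normc (\det B))%:E)%E.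

(* \det (gram B + e%:C%:M) is a positive real for e > 0. *)
Definition mean_log_regdet (R : realType) (n : nat) (e : R) (B : 'M[R[i]]_n) :
    \bar R :=
  (n%:R^-1 * ln (complex.Re (\det (gram B + (e%:C)%:M))))%:E.

(* Main.v *)
From HB Require Import structures.
Require Import Defs.
From mathcomp Require Import all_boot all_order all_algebra.
From mathcomp Require Import spectral finmap complex ring lra zify.
From mathcomp Require Import all_classical all_reals all_analysis measurable_realfun.

(** The comparison of log-determinants is universal: for every eta there is an e > 0 such that, for
every z, almost surely eventually the regularised determinant det(B B^* + e) of B = A_n / sqrt n - z
is at most exp(n eta) |det B|^2.  This follows from a quantitative gap between consecutive
regularisations, obtained by exposing the rows of X_n one at a time and using anti-concentration of
random sums; the entries are first rounded to finite alphabets, so that the probabilistic part is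
finite combinatorics, and Borel-Cantelli is applied to blocks of sizes k^20 <= n < (k+1)^20.
By Jensen's formula at roots of unity, the regularised determinant in turn bounds the truncated
potential a_n(z, r) = (1/n) sum_l log max(|l - z|, r) over the eigenvalues l, so that
(1/n) log|det B| lies within eta of a_n(z, r) for all small r.  Each of (i), (ii), (iii) is then
equivalent to the convergence of a_n(z, r) to the truncated potential of mu for all z and r: for (i)
because differences of such functions are test functions whose span is uniformly dense, for (ii)
because a_n(y, r) is nearly the average of (1/n) log|det| over roots of unity on a circle, whose
shift y is chosen by Tonelli's theorem so that the corresponding averages for mu are accurate. *)

Set Implicit Arguments.
Unset Strict Implicit.
Unset Printing Implicit Defensive.

Import Order.TTheory GRing.Theory Num.Theory.
Import numFieldNormedType.Exports.

Local Open Scope classical_set_scope.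
Local Open Scope ring_scope.
Local Open Scope complex_scope.

(** * Finite product probability spaces *)

(** The obstacle is the mass of small singular values of B when the entries have only two moments.
    Passing from 4u to u in det(B B^* + u) costs 3u tr (B B^* + u)^-1 in the exponent. A
    self-consistent inequality bounds u times this trace by n (k^-3 + C sqrt u) on average; its
    inputs are a second moment for a quadratic form in one column and Azuma's inequality over
    columns. The terms sqrt u sum geometrically to O(sqrt e), which is why e depends on eta only,
    and after k divisions by 4 the regularisation is far below the square of the least singular
    value, for which the crude bound n^-147 is enough. With k near n^(1/20) a given size fails with
    probability O(k^-21); a block holds O(k^19) sizes, whence a summable k^-2. Almost sure
    convergence and convergence in probability are both expressed as convergence along a filter on
    pairs (size, outcome), so that the equivalences are proved once for a general filter, and the
    almost sure comparison passes to the other filter because the events are measurable. *)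

Record law (R : realType) (V : finType) := Law {
  lawf :> V -> R;
  law_ge0 : forall v, 0 <= lawf v;
  law_sum : \sum_v lawf v = 1 }.

Section FiniteProbability.
Local Open Scope set_scope.
Local Open Scope ring_scope.
Variable R : realType.

Definition wt (V I : finType) (p : law R V) (m : {ffun I -> V}) : R :=
  \prod_i p (m i).

Definition Ex (V I : finType) (p : law R V) (f : {ffun I -> V} -> R) : R :=
  \sum_m wt p m * f m.

Definition ind (A : Prop) : R := (`[< A >])%:R.

Definition Pr (V I : finType) (p : law R V) (A : {ffun I -> V} -> Prop) : R :=
  Ex p (fun m => ind (A m)).

(** Resampling of the coordinates in [S]: averaging over [m'] is conditional expectation given the
    coordinates outside [S], so that conditioning needs no sigma-algebra. *)
Definition mix (V I : finType) (S : {set I}) (m m' : {ffun I -> V}) :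
  {ffun I -> V} := [ffun i => if i \in S then m' i else m i].

Lemma ind_ge0 A : 0 <= ind A. Proof. by rewrite /ind; case: asboolP. Qed.
Lemma ind_le1 A : ind A <= 1. Proof. by rewrite /ind; case: asboolP. Qed.
Lemma indT (A : Prop) : A -> ind A = 1.
Proof. by rewrite /ind => /asboolT ->. Qed.
Lemma indF (A : Prop) : ~ A -> ind A = 0.
Proof. by rewrite /ind => /asboolF ->. Qed.
Lemma ind_bool (b : bool) : ind b = b%:R.
Proof. by rewrite /ind asboolb. Qed.
Lemma ind_le (A B : Prop) : (A -> B) -> ind A <= ind B.
Proof.
move=> AB; have [a|a] := pselect A; first by rewrite !indT //; exact: AB.
by rewrite indF ?ind_ge0.
Qed.

Section Basics.
Variables (V I : finType) (p : law R V).
Implicit Types (m : {ffun I -> V}) (f g : {ffun I -> V} -> R)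
  (A B : {ffun I -> V} -> Prop).

Lemma wt_ge0 m : 0 <= wt p m.
Proof. by apply: prodr_ge0 => i _; exact: law_ge0. Qed.

Lemma Ex_prod (f : I -> V -> R) :
  Ex p (fun m => \prod_i f i (m i)) = \prod_i \sum_v p v * f i v.
Proof.
rewrite bigA_distr_bigA /=; apply: eq_bigr => m _.
by rewrite /wt -big_split.
Qed.

Lemma sum_wt : \sum_m wt p (m : {ffun I -> V}) = 1.
Proof.
rewrite -(bigA_distr_bigA (fun (i : I) v => p v)) big1 // => i _.
exact: law_sum.
Qed.

Lemma Ex_cst c : Ex p (fun _ : {ffun I -> V} => c) = c.
Proof. by rewrite /Ex -mulr_suml sum_wt mul1r. Qed.

Lemma eq_Ex f g : f =1 g -> Ex p f = Ex p g.
Proof. by move=> fg; apply: eq_bigr => m _; rewrite fg. Qed.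

Lemma le_Ex f g : (forall m, f m <= g m) -> Ex p f <= Ex p g.
Proof. by move=> fg; apply: ler_sum => m _; rewrite ler_wpM2l ?wt_ge0. Qed.

Lemma ExD f g : Ex p (fun m => f m + g m) = Ex p f + Ex p g.
Proof. by rewrite /Ex -big_split; apply: eq_bigr => m _; rewrite mulrDr. Qed.

Lemma ExZ c f : Ex p (fun m => c * f m) = c * Ex p f.
Proof. by rewrite /Ex mulr_sumr; apply: eq_bigr => m _; rewrite mulrCA. Qed.

Lemma ExN f : Ex p (fun m => - f m) = - Ex p f.
Proof. by rewrite /Ex -sumrN; apply: eq_bigr => m _; rewrite mulrN. Qed.

Lemma Ex_sum (K : finType) (P : pred K) (F : K -> {ffun I -> V} -> R) :
  Ex p (fun m => \sum_(k | P k) F k m) = \sum_(k | P k) Ex p (F k).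
Proof.
rewrite /Ex exchange_big /=; apply: eq_bigr => m _; exact: mulr_sumr.
Qed.

Lemma Pr_le1 A : Pr p A <= 1.
Proof. by rewrite -[leRHS](Ex_cst 1); apply: le_Ex => m; exact: ind_le1. Qed.

Lemma le_Pr A B : (forall m, A m -> B m) -> Pr p A <= Pr p B.
Proof. by move=> AB; apply: le_Ex => m; apply: ind_le; exact: AB. Qed.

Lemma Pr_or A B : Pr p (fun m => A m \/ B m) <= Pr p A + Pr p B.
Proof.
rewrite -ExD; apply: le_Ex => m.
have [a|a] := pselect (A m).
  by rewrite (indT (or_introl a)) (indT a) lerDl ind_ge0.
by rewrite (indF a) add0r ind_le // => -[].
Qed.

Lemma Pr_exists (K : finType) (A : K -> {ffun I -> V} -> Prop) :
  Pr p (fun m => exists k, A k m) <= \sum_k Pr p (A k).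
Proof.
rewrite -Ex_sum; apply: le_Ex => m.
have [[k a]|a] := pselect (exists k, A k m).
  rewrite indT; last by exists k.
  rewrite (bigD1 k) //= indT // lerDl sumr_ge0 // => j _; exact: ind_ge0.
by rewrite indF // sumr_ge0 // => j _; exact: ind_ge0.
Qed.

Lemma Pr_markov f c : (forall m, 0 <= f m) -> 0 < c ->
  Pr p (fun m => c <= f m) <= Ex p f / c.
Proof.
move=> f0 c0; rewrite ler_pdivlMr // mulrC -ExZ; apply: le_Ex => m.
have [a|a] := pselect (c <= f m); first by rewrite indT // mulr1.
by rewrite indF // mulr0.
Qed.

Lemma Pr_le_Ex A f : (forall m, 0 <= f m) -> (forall m, A m -> 1 <= f m) ->
  Pr p A <= Ex p f.
Proof.
move=> f0 Af; apply: le_Ex => m.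
by have [a|a] := pselect (A m); rewrite ?(indT a) ?(indF a) //; exact: Af.
Qed.

End Basics.

(** The coordinate maps may differ from one coordinate to another, which is what flipping one sign
    or choosing sides on a subset requires. *)
Lemma Ex_push (V W I : finType) (p : law R V) (q : law R W) (phi : I -> W -> V)
    (f : {ffun I -> V} -> R) :
  (forall i v, \sum_(w | phi i w == v) q w = p v) ->
  Ex q (fun m => f [ffun i => phi i (m i)]) = Ex p f.
Proof.
move=> pq; rewrite /Ex.
rewrite (partition_big (fun m : {ffun I -> W} => [ffun i => phi i (m i)])
  predT) //=.
apply: eq_bigr => m _; rewrite /wt.
under [in RHS]eq_bigr => i _ do rewrite -(pq i).
rewrite (bigA_distr_big_dep (fun i w => phi i w == m i)) mulr_suml.
apply: eq_big => [q'|q' /eqP <- //].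
apply/eqP/familyP => [<- i|fam]; first by rewrite unfold_in /= ffunE.
by apply/ffunP => i; rewrite ffunE; apply/eqP; exact: fam i.
Qed.

Lemma Ex_marginal (V I J : finType) (p : law R V) (h : J -> I)
    (f : {ffun J -> V} -> R) : injective h ->
  Ex p (fun m : {ffun I -> V} => f [ffun j => m (h j)]) = Ex p f.
Proof.
move=> hi; rewrite /Ex.
rewrite (partition_big (fun m : {ffun I -> V} => [ffun j => m (h j)])
  predT) //=.
apply: eq_bigr => r _; transitivity (
    \sum_(m in family (fun i v => [forall j, (h j == i) ==> (v == r j)]))
    wt p (m : {ffun I -> V}) * f r).
  apply: eq_big => [m|m /eqP <- //].
  apply/eqP/familyP => [<- i|fam].
    by apply/forallP => j; apply/implyP => /eqP <-; rewrite ffunE.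
  apply/ffunP => j; rewrite ffunE; apply/eqP.
  by have /forallP/(_ j) := fam (h j); rewrite eqxx.
rewrite -mulr_suml; congr (_ * _).
rewrite -(bigA_distr_big_dep (fun i v => [forall j, (h j == i) ==> (v == r j)])
  (fun _ v => p v)).
rewrite (bigID (fun i => i \in [set h j | j in J])) /= [X in _ * X]big1 ?mulr1.
  rewrite big_imset /=; last by move=> ? ? _ _; exact: hi.
  apply: eq_big => // j _; rewrite -[RHS](big_pred1_eq +%R (r j) p).
  apply: eq_bigl => v; apply/forallP/eqP => [/(_ j)|-> j'].
    by rewrite eqxx => /eqP.
  by apply/implyP => /eqP/hi ->.
move=> i iN; rewrite -(law_sum p); apply: eq_bigl => v; apply/forallP => j.
by apply/implyP => /eqP hj; rewrite -hj imset_f in iN.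
Qed.

Section Pairs.
Variables (V I : finType) (p : law R V).

Lemma pairlaw_sum : \sum_(w : V * V) p w.1 * p w.2 = 1.
Proof.
rewrite -(pair_bigA _ (fun v v' => p v * p v')) /=.
under eq_bigr do rewrite -mulr_sumr law_sum mulr1.
exact: law_sum.
Qed.

Definition pairlaw : law R (V * V)%type :=
  Law (fun w => mulr_ge0 (law_ge0 p w.1) (law_ge0 p w.2)) pairlaw_sum.

Definition choose_side (C : {set I}) (q : {ffun I -> V * V}) : {ffun I -> V} :=
  [ffun i => if i \in C then (q i).2 else (q i).1].

Lemma Ex_pick C (f : {ffun I -> V} -> R) :
  Ex pairlaw (fun q => f (choose_side C q)) = Ex p f.
Proof.
rewrite -(@Ex_push _ _ _ p pairlaw (fun i w => if i \in C then w.2 else w.1)) //.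
move=> i v; rewrite big_mkcond /=.
rewrite -(pair_bigA _ (fun a b =>
  if (if i \in C then b else a) == v then p a * p b else 0)) /=.
case: (i \in C) => /=.
  rewrite exchange_big /= (bigD1 v) //= eqxx -mulr_suml law_sum mul1r.
  by rewrite big1 ?addr0 // => j /negPf ->; rewrite big1.
rewrite (bigD1 v) //= eqxx -mulr_sumr law_sum mulr1.
by rewrite big1 ?addr0 // => j /negPf ->; rewrite big1.
Qed.

Lemma Ex_pairlaw (F : {ffun I -> V} -> {ffun I -> V} -> R) :
  Ex pairlaw (fun q => F [ffun i => (q i).1] [ffun i => (q i).2]) =
  Ex p (fun m => Ex p (F m)).
Proof.
rewrite /Ex; under [in RHS]eq_bigr do rewrite mulr_sumr.
rewrite pair_bigA /=.
rewrite (reindex (fun mm : {ffun I -> V} * {ffun I -> V} =>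
   [ffun i => (mm.1 i, mm.2 i)])) /=; last first.
  exists (fun q => ([ffun i => (q i).1], [ffun i => (q i).2])) => q _ /=.
    by case: q => a b /=; congr pair; apply/ffunP => i; rewrite !ffunE.
  by apply/ffunP => i; rewrite !ffunE /=; case: (q i).
apply: eq_bigr => -[a b] _ /=.
rewrite /wt mulrA -big_split /=; congr (_ * F _ _).
- by apply: eq_bigr => i _; rewrite ffunE.
- by apply/ffunP => i; rewrite !ffunE.
- by apply/ffunP => i; rewrite !ffunE.
Qed.

Lemma Ex_mix (S : {set I}) (f : {ffun I -> V} -> R) :
  Ex p (fun m => Ex p (fun m' => f (mix S m m'))) = Ex p f.
Proof.
rewrite -(Ex_pairlaw (fun m m' => f (mix S m m'))) -(Ex_pick S f).
by apply: eq_Ex => q; congr f; apply/ffunP => i; rewrite !ffunE.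
Qed.

(** Conditioning on the coordinates outside [S]: the second hypothesis makes [G] an event decided by
    them alone, and the first bounds [A] conditionally at every point of it. *)
Lemma Pr_mix_le (S : {set I}) (A G : {ffun I -> V} -> Prop) c :
  (forall m, G m -> Pr p (fun m' => A (mix S m m')) <= c) ->
  (forall m m', G (mix S m m') -> G m) ->
  Pr p (fun m => A m /\ G m) <= c * Pr p G.
Proof.
move=> Ac GS; rewrite /Pr -(Ex_mix S) -ExZ; apply: le_Ex => m.
have [g|g] := pselect (G m).
  rewrite (indT g) mulr1; apply: le_trans (Ac m g); apply: le_Ex => m'.
  by apply: ind_le => -[].
rewrite (indF g) mulr0 -[leRHS](Ex_cst I p 0); apply: le_Ex => m'.
by rewrite indF // => -[_ /GS].
Qed.

End Pairs.

(** * Exponential moment bounds for counts *)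

Section Chernoff.
Variables (V I : finType) (p : law R V).

Definition pr1 (b : pred V) : R := \sum_(v | b v) p v.

Lemma pr1_ge0 b : 0 <= pr1 b.
Proof. by apply: sumr_ge0 => v _; exact: law_ge0. Qed.

Lemma pr1C b : pr1 (predC b) = 1 - pr1 b.
Proof. by rewrite -(law_sum p) [in RHS](bigID b) /= addrAC subrr add0r. Qed.

Lemma pr1_le1 b : pr1 b <= 1.
Proof. by rewrite -subr_ge0 -pr1C pr1_ge0. Qed.

Lemma sum_law_if (b : pred V) (x y : R) :
  \sum_v p v * (if b v then x else y) = pr1 b * x + (1 - pr1 b) * y.
Proof.
rewrite (bigID b) /= -pr1C !mulr_suml; congr (_ + _).
  by apply: eq_bigr => v ->.
by apply: eq_bigr => v /negPf ->.
Qed.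

(** Markov's inequality for 2 to the power of the count: an index of probability q contributes the
    factor 1 + q <= exp q. *)
Lemma chernoff_upper (b : I -> pred V) (D : {set I}) (K : nat) :
  Pr p (fun m => (K <= #|[set i in D | b i (m i)]|)%N) <=
  expR (\sum_(i in D) pr1 (b i)) / 2 ^+ K.
Proof.
pose f (m : {ffun I -> V}) : R := \prod_i (if (i \in D) && b i (m i) then 2 else 1).
have fE m : f m = 2 ^+ #|[set i in D | b i (m i)]|.
  rewrite /f -big_mkcond /= prodr_const; congr (_ ^+ _); apply: eq_card => i.
  by rewrite !inE.
apply: (@le_trans _ _ (Pr p (fun m => 2 ^+ K <= f m))).
  by apply: le_Pr => m Km; rewrite fE ler_weXn2l // ler1n.
have f0 m : 0 <= f m by rewrite fE exprn_ge0.
apply: (le_trans (Pr_markov p f0 _)); first by rewrite exprn_gt0.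
rewrite ler_pM2r ?invr_gt0 ?exprn_gt0 //.
rewrite (Ex_prod p (fun i v => if (i \in D) && b i v then 2 else 1)).
rewrite expR_sum [leRHS]big_mkcond /=; apply: ler_prod => i _.
case: (boolP (i \in D)) => _ /=; last first.
  by under eq_bigr do rewrite mulr1; rewrite law_sum ler01 lexx.
rewrite sum_law_if; have := pr1_ge0 (b i); have := pr1_le1 (b i) => h1 h0.
apply/andP; split; first nra.
apply: le_trans (expR_ge1Dx _); lra.
Qed.

(** For w in [0, 1], exp(-w) <= 1 - w/2, so one index contributes at most 1 - c w/2 <= exp(-c w/2),
    and the threshold gives back half of this exponent. The weights are needed later for the
    diagonal entries of a matrix between 0 and 1. *)
Lemma chernoff_lower (b : I -> pred V) (w : I -> R) (c : R) :
  (forall i, 0 <= w i <= 1) -> (forall i, c <= pr1 (b i)) -> 0 <= c ->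
  Pr p (fun m => \sum_i (if b i (m i) then w i else 0) <= c / 4 * \sum_i w i)
  <= expR (- (c / 4 * \sum_i w i)).
Proof.
move=> w01 cb c0; set W := \sum_i w i.
pose f (m : {ffun I -> V}) : R := expR (c / 4 * W) *
  \prod_i (if b i (m i) then expR (- w i) else 1).
have fE m : f m = expR (c / 4 * W - \sum_i (if b i (m i) then w i else 0)).
  rewrite /f expRD expRN; congr (_ * _); rewrite expR_sum -prodfV.
  by apply: eq_bigr => i _; case: ifP; rewrite ?expR0 ?invr1 // expRN.
apply: (@le_trans _ _ (Ex p f)).
  apply: Pr_le_Ex => m; first by rewrite fE expR_ge0.
  by move=> h; rewrite fE -[leLHS](expR0 R) ler_expR subr_ge0.
rewrite ExZ (Ex_prod p (fun i v => if b i v then expR (- w i) else 1)).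
apply: (@le_trans _ _ (expR (c / 4 * W) * \prod_i expR (- (c / 2 * w i)))).
  rewrite ler_wpM2l ?expR_ge0 //; apply: ler_prod => i _.
  rewrite sum_law_if; have := pr1_ge0 (b i); have := pr1_le1 (b i) => h1 h0.
  have e0 := expR_gt0 (- w i); apply/andP; split; first nra.
  have := expR_ge1Dx (- (c / 2 * w i)); apply: le_trans.
  have /andP[wi0 wi1] := w01 i.
  have ew : expR (- w i) <= 1 - w i / 2.
    rewrite expRN -ler_pV2 ?inE ?unitfE; last 2 first.
    - by rewrite ?gt_eqF //= ; lra.
    - by rewrite invr_gt0 expR_gt0 invr_eq0 gt_eqF ?expR_gt0.
    rewrite invrK; apply: le_trans (expR_ge1Dx _).
    rewrite -div1r ler_pdivrMr; nra.
  have := cb i; nra.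
rewrite -expR_sum -expRD ler_expR sumrN -mulr_sumr -/W; lra.
Qed.

End Chernoff.

(** * Concentration of functions with bounded differences *)

Section Azuma.
Variables (V I : finType) (p : law R V).
Implicit Type f : {ffun I -> V} -> R.

Definition avg (S : {set I}) f m := Ex p (fun m' => f (mix S m m')).

Definition bdd_diff (S : {set I}) (c : R) f :=
  forall m m', `|f (mix S m m') - f m| <= c.

Lemma avg_avg S S' f m : avg S (avg S' f) m = avg (S :|: S') f m.
Proof.
rewrite -[RHS](Ex_mix p S' (fun m' => f (mix (S :|: S') m m'))).
apply: eq_Ex => m'; apply: eq_Ex => m''.
congr f; apply/ffunP => i; rewrite !ffunE inE.
by case: (i \in S); case: (i \in S').
Qed.

Lemma avg_bdd S S' c f : bdd_diff S c f -> bdd_diff S c (avg S' f).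
Proof.
move=> fc m m'; rewrite /avg -ExN -ExD.
apply: (@le_trans _ _ (Ex p (fun m'' => `|f (mix S' (mix S m m') m'') -
    f (mix S' m m'')|))).
  apply: (le_trans (ler_norm_sum _ _ _)); apply: ler_sum => m'' _.
  by rewrite normrM (ger0_norm (wt_ge0 _ _)).
rewrite -[leRHS](Ex_cst I p); apply: le_Ex => m''.
have -> : mix S' (mix S m m') m'' = mix S (mix S' m m'') (mix S' m' m'').
  by apply/ffunP => i; rewrite !ffunE; case: (i \in S); case: (i \in S').
exact: fc.
Qed.

(** From exp(-x) >= (1 - x/2)^2 and (1 + x + x^2)(1 - x/2)^2 = 1 + x^2 (1 - 3x + x^2)/4. *)
Lemma expR_quad (x : R) : `|x| <= 1 / 4 -> expR x <= 1 + x + x ^+ 2.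
Proof.
rewrite ler_norml => /andP[x0 x1].
rewrite -[x in leLHS]opprK expRN -div1r ler_pdivrMr ?expR_gt0 //.
have h := expR_ge1Dx (- x / 2).
have -> : - x = - x / 2 + - x / 2 by field.
rewrite expRD; set e := expR _ in h *.
have h2 : (1 + - x / 2) ^+ 2 <= e * e by rewrite expr2 ler_pM //; lra.
apply: (@le_trans _ _ ((1 + x + x ^+ 2) * (1 + - x / 2) ^+ 2)); last first.
  by rewrite ler_wpM2l //; nra.
have -> : (1 + x + x ^+ 2) * (1 + - x / 2) ^+ 2 =
  1 + x ^+ 2 / 4 * (1 - 3 * x + x ^+ 2) by field.
rewrite lerDl mulr_ge0 //; nra.
Qed.

Lemma hoeffding f c : 0 <= c <= 1 / 4 ->
  (forall m, `|f m - Ex p f| <= c) ->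
  Ex p (fun m => expR (f m)) <= expR (c ^+ 2) * expR (Ex p f).
Proof.
move=> /andP[c0 c1] fc; set a := Ex p f.
apply: (@le_trans _ _ (Ex p (fun m => expR a * (1 + c ^+ 2 + (f m - a))))).
  apply: le_Ex => m; rewrite -[f m in leLHS](addrNK a) expRD mulrC.
  rewrite ler_wpM2l ?expR_ge0 //.
  apply: (le_trans (expR_quad _)); first exact: le_trans (fc m) c1.
  have : (f m - a) ^+ 2 <= c ^+ 2.
    by rewrite -[leLHS]real_normK ?num_real // lerXn2r ?nnegrE.
  by set y := f m - a => h; lra.
rewrite ExZ 2!ExD !Ex_cst -/a subrr addr0 mulrC ler_wpM2r ?expR_ge0 //.
exact: expR_ge1Dx.
Qed.

(** The blocks are integrated out one after the other, each at the price exp(c^2). Averaging over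
    one block keeps the bounded differences in the others ([avg_bdd]), and the blocks may
    overlap. *)
Lemma azuma_seq (Ss : seq {set I}) f c : 0 <= c <= 1 / 4 ->
  (forall S, S \in Ss -> bdd_diff S c f) ->
  Ex p (fun m => expR (f m)) <= expR (c ^+ 2 *+ size Ss) *
    Ex p (fun m => expR (avg (\bigcup_(S <- Ss) S) f m)).
Proof.
move=> c01; elim: Ss f => [|S Ss IH] f fc.
  rewrite mulr0n expR0 mul1r big_nil; apply: le_Ex => m.
  rewrite /avg (@eq_Ex _ _ p _ (fun=> f m)) ?Ex_cst // => m'.
  by congr f; apply/ffunP => i; rewrite ffunE inE.
rewrite big_cons /=; apply: (@le_trans _ _ (expR (c ^+ 2) *
    Ex p (fun m => expR (avg S f m)))).
  rewrite -(Ex_mix p S) -ExZ; apply: le_Ex => m; rewrite /avg.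
  apply: hoeffding => // m'; rewrite -ExN -(Ex_cst I p (f _)) -ExD.
  apply: (@le_trans _ _ (Ex p (fun m'' => `|f (mix S m m') - f (mix S m m'')|))).
    apply: (le_trans (ler_norm_sum _ _ _)); apply: ler_sum => m'' _.
    by rewrite normrM (ger0_norm (wt_ge0 _ _)).
  rewrite -[leRHS](Ex_cst I p); apply: le_Ex => m''.
  have -> : mix S m m' = mix S (mix S m m'') m'.
    by apply/ffunP => i; rewrite !ffunE; case: (i \in S).
  by apply: fc; rewrite mem_head.
rewrite mulrS expRD -mulrA ler_wpM2l ?expR_ge0 //.
apply: (le_trans (IH _ _)).
  by move=> S' S'S; apply: avg_bdd; apply: fc; rewrite in_cons S'S orbT.
rewrite ler_wpM2l ?expR_ge0 //; apply: le_Ex => m.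
by rewrite avg_avg finset.setUC.
Qed.

(* Azuma's inequality, from the exponential moment. *)
Lemma azuma (K : finType) (S : K -> {set I}) f (t : R) :
  \bigcup_k S k = [set: I] -> (forall k, bdd_diff (S k) 1 f) -> 0 <= t <= 1 / 2 ->
  Pr p (fun m => f m <= Ex p f - t * #|K|%:R) <=
  expR (- (t ^+ 2 / 4 * #|K|%:R)).
Proof.
(* The factor t/2 balances the gain t^2/2 per block against the price (t/2)^2; t <= 1/2 keeps the
   differences below the 1/4 of [hoeffding]. *)
move=> cov fS /andP[t0 t2]; pose g m := - (t / 2) * f m.
have gE : Ex p g = - (t / 2) * Ex p f by exact: ExZ.
apply: (@le_trans _ _ (Ex p (fun m =>
    expR (- Ex p g - t ^+ 2 / 2 * #|K|%:R) * expR (g m)))).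
  apply: Pr_le_Ex => m; first by rewrite mulr_ge0 ?expR_ge0.
  move=> fm; rewrite -expRD -[leLHS](expR0 R) ler_expR gE /g; nra.
rewrite ExZ; apply: (@le_trans _ _ (expR (- Ex p g - t ^+ 2 / 2 * #|K|%:R) *
   (expR ((t / 2) ^+ 2 *+ #|K|) * expR (Ex p g)))); last first.
  rewrite -!expRD ler_expR -mulr_natr; lra.
rewrite ler_wpM2l ?expR_ge0 //.
have := @azuma_seq [seq S k | k <- enum K] g (t / 2).
rewrite size_map -cardE big_map big_enum cov; move=> /(_ _ _)/le_trans; apply.
- by apply/andP; split; lra.
- move=> _ /mapP[k _ ->] m m'; rewrite /g -mulrBr normrM normrN.
  have th : 0 <= t / 2 by lra.
  by rewrite (ger0_norm th) ler_piMr ?fS.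
rewrite ler_wpM2l ?expR_ge0 // -[leRHS](Ex_cst I p); apply: le_Ex => m.
rewrite ler_expR (_ : avg _ _ m = Ex p g) //; apply: eq_Ex => m'; congr g.
by apply/ffunP => i; rewrite ffunE inE.
Qed.

End Azuma.

End FiniteProbability.

(** * Anti-concentration of random sums *)

Section Binomials.

Lemma bin_le_succ n k : (k.*2 < n)%N -> ('C(n, k) <= 'C(n, k.+1))%N.
Proof.
move=> kn; rewrite -(leq_pmul2l (ltn0Sn k)) mul_bin_left leq_mul2r; lia.
Qed.

Lemma bin_le_half n k : ('C(n, k) <= 'C(n, n./2))%N.
Proof.
have low j : (j <= n./2)%N -> ('C(n, j) <= 'C(n, n./2))%N.
  move=> jn; rewrite -(subKn jn); elim: (n./2 - j)%N => [|d IH].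
    by rewrite subn0.
  apply: leq_trans IH; have [dn|dn] := ltnP d n./2.
    by rewrite -(subnSK dn); apply: bin_le_succ; lia.
  by have -> : (n./2 - d.+1 = n./2 - d)%N by lia.
have [kn|nk] := leqP k n; last by rewrite bin_small.
have [|kh] := leqP k n./2; first exact: low.
by rewrite -bin_sub //; apply: low; lia.
Qed.

(** Induction along (m+1) C(2m+2, m+1) = 2 (2m+1) C(2m, m), with (2m+1)(2m+3) <= 4 (m+1)^2. *)
Lemma central_bin_le m : ('C(m.*2, m) ^ 2 * m.*2.+1 <= 16 ^ m)%N.
Proof.
elim: m => // m IH; rewrite [(16 ^ _)%N]expnS.
have e : (m.+1 * 'C(m.+1.*2, m.+1) = (m.*2.+1).*2 * 'C(m.*2, m))%N.
  have := mul_bin_diag m.*2.+2 m; have := mul_bin_down m.*2.+1 m.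
  rewrite doubleS /= (_ : m.*2.+1 - m = m.+1)%N; last lia.
  by move=> h1 <-; rewrite -doubleS -muln2 mulnAC -h1; lia.
rewrite -(leq_pmul2l (_ : 0 < m.+1 ^ 2)%N) // mulnA -expnMn e.
move: IH; move: ('C(_, _)) (16 ^ m)%N => c b IH.
apply: (@leq_trans (4 * m.*2.+1 * m.*2.+3 * b)).
  by apply: leq_trans (leq_mul (leqnn (4 * m.*2.+1 * m.*2.+3)) IH); nia.
by rewrite mulnA leq_mul2r; apply/orP; right; nia.
Qed.

Lemma bin_sq_le n k : ('C(n, k) ^ 2 * n <= 4 ^ n)%N.
Proof.
apply: (@leq_trans ('C(n, n./2) ^ 2 * n)).
  by rewrite leq_mul2r leq_exp2r // bin_le_half orbT.
have e4 m : (4 ^ m.*2 = 16 ^ m)%N by rewrite -mul2n expnM.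
have [m [->|->]] : exists m, n = m.*2 \/ n = m.*2.+1.
  by exists n./2; have := odd_double_half n; case: (odd n); lia.
  rewrite half_double e4; apply: leq_trans (central_bin_le m).
  by rewrite leq_mul2l leqnSn orbT.
have -> : (m.*2.+1)./2 = m by lia.
have := central_bin_le m.+1.
have -> : ('C(m.+1.*2, m.+1) = 'C(m.*2.+1, m).*2)%N.
  rewrite doubleS binS -(@bin_sub m.*2.+1 m.+1); last lia.
  have -> : (m.*2.+1 - m.+1 = m)%N by lia.
  by lia.
rewrite -e4 doubleS !(expnS 4).
by move: ('C(_, _)) (4 ^ m.*2)%N => c b; nia.
Qed.

End Binomials.

(** * Families of subsets without long chains *)

Section ChainFree.

Import boot.fintype boot.finset.
Local Open Scope set_scope.
Local Open Scope ring_scope.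
Variables (R : realType) (T : finType) (h : {set T} -> R) (kap : R).
Hypothesis h_step : forall x (D : {set T}), x \notin D -> h D + kap <= h (x |: D).
Hypothesis kap_gt0 : 0 < kap.

Let cond (al : R) (r : nat) (D : {set T}) := (al <= h D) && (h D < al + kap * r%:R).

Lemma h_proper (D E : {set T}) : D \proper E -> h D + kap <= h E.
Proof.
elim/(@ltn_ind): {E}#|E| {-2}E (erefl #|E|) => n IH E nE DE.
have /properP[DsE [x xE xD]] := DE.
have [e|/= ne] := eqVneq D (E :\ x).
  have := h_step (x := x) (D := D); rewrite xD {2}e setD1K //; exact.
have DEx : D \proper E :\ x by rewrite properEneq ne subsetD1 DsE xD.
have := IH #|E :\ x| _ (E :\ x) (erefl _) DEx.
rewrite -nE (cardsD1 x E) xE add1n ltnSn => /(_ isT)/le_trans; apply.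
have := h_step (x := x) (D := E :\ x).
rewrite !inE eqxx setD1K // => /(_ isT); apply: le_trans.
by rewrite lerDl ltW.
Qed.

(* LYM inequality for a family in which the increasing function [h], whose steps are
   at least [kap], stays in an interval of length [r * kap]: its chains have length at most [r]. *)
Lemma lym (E : {set T}) (al : R) (r : nat) :
  \sum_(D : {set T} | (D \subset E) && cond al r D) ('C(#|E|, #|D|)%:R^-1 : R) <= r%:R.
Proof.
elim/(@ltn_ind): {E}#|E| {-2}E (erefl #|E|) r => n IH E nE r.
have main s : \sum_(D : {set T} | (D \proper E) && cond al s D)
    ('C(#|E|, #|D|)%:R^-1 : R) <= s%:R.
  have [n0|n0] := posnP n.
    by rewrite big_pred0 // => D; rewrite properEcard nE n0 ltn0 andbF.
  (* Since 1/C(n, d) = ((n-d)/n) / C(n-1, d), the weight of a proper subset is shared among the n-d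
     elements outside it. Each element x then collects a sum over subsets of E minus x, to which
     induction applies. *)
  rewrite (eq_bigr (fun D : {set T} => \sum_(x in E :\: D)
      (n%:R^-1 * 'C(n.-1, #|D|)%:R^-1 : R))); last first.
    move=> D /andP[DE _]; have /andP[DsE _] := DE.
    have Dn : (#|D| < n)%N by rewrite -nE proper_card.
    rewrite sumr_const cardsD (setIidPr DsE) nE -[RHS]mulr_natr -invfM -natrM.
    rewrite mul_bin_down natrM invfM -mulrA mulrCA mulVf ?mulr1 //.
    by rewrite pnatr_eq0 -lt0n subn_gt0.
  rewrite (exchange_big_dep (mem E)) /=; last first.
    by move=> D x _; rewrite inE => /andP[].
  apply: (@le_trans _ _ (\sum_(x in E) (n%:R^-1 * s%:R : R))); last first.
    rewrite sumr_const nE -[leLHS]mulr_natl mulrA divff ?mul1r //.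
    by rewrite pnatr_eq0 -lt0n.
  apply: ler_sum => x xE; rewrite -mulr_sumr ler_wpM2l //.
  have nEx : #|E :\ x| = n.-1 by rewrite -nE [in RHS](cardsD1 x E) xE.
  have := IH n.-1 _ (E :\ x) nEx s; rewrite prednK // => /(_ (leqnn n)).
  rewrite nEx; apply: le_trans.
  rewrite le_eqVlt; apply/orP; left; apply/eqP; apply: eq_bigl => D.
  rewrite subsetD1 inE xE andbT; case xD: (x \in D); rewrite /= ?andbF ?andbT //.
  rewrite properEneq; case: eqVneq => [DE|] //=.
  by rewrite DE xE in xD.
have [cE|cE] := boolP (cond al r E); last first.
  apply: le_trans (main r); rewrite le_eqVlt; apply/orP; left; apply/eqP.
  apply: eq_bigl => D; rewrite properEneq; case: eqVneq => [->|] //=.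
  by rewrite (negPf cE) andbF.
case: r cE => [|r] cE; first by move: cE; rewrite /cond mulr0 addr0; lra.
(* When [E] belongs to the family it contributes 1, and the other members are at least one step
   below it, hence in an interval shorter by [kap]. *)
rewrite (bigD1 E) /= ?subxx ?subset_refl // binn invr1 -natr1 addrC lerD2r.
apply: le_trans (main r); rewrite le_eqVlt; apply/orP; left; apply/eqP.
apply: eq_bigl => D; rewrite properEneq.
have [->|ne] := eqVneq D E; rewrite /= ?andbF // andbT.
case: (boolP (D \subset E)) => DE //=.
have /h_proper hD : D \proper E by rewrite properEneq ne.
move: cE; rewrite /cond -natr1 mulrDr mulr1 => /andP[_ cE]; congr andb.
apply/idP/idP => hDr; first lra.
by apply: lt_le_trans hDr _; rewrite addrA lerDl ltW.
Qed.

End ChainFree.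

(** * Counting subset sums in a small disc *)

Section Antichain.
Import boot.fintype boot.finset.
Local Open Scope set_scope.
Local Open Scope ring_scope.
Local Open Scope complex_scope.
Variables (R : realType) (T : finType) (G : {set T}) (w : T -> R[i])
  (kap t : R) (L : nat).
Hypothesis kap_gt0 : 0 < kap.
Hypothesis t_kap : 2 * t <= kap.
Hypothesis w_kap : forall j, j \in G -> kap <= complex.Re (w j) <= 8 * kap.
Hypothesis clusters :
  forall z, (#|[set j in G | (normc (w j - z) <= t)%R]| <= L)%N.

Let S (C : {set T}) : R[i] := \sum_(j in C) w j.

Lemma Re_le_normc (z : R[i]) : `|complex.Re z| <= normc z.
Proof.
by case: z => a b; have := normc_ge_Re (a +i* b); rewrite normc_def lecR.
Qed.

Let bad c0 (C : {set T}) := (C \subset G) && (normc (c0 + S C) <= t).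

Lemma bin_le_sqrt n k : ('C(n, k))%:R * Num.sqrt n%:R <= 2 ^+ n :> R.
Proof.
rewrite -(ler_pXn2r (_ : 0 < 2)%N) ?nnegrE ?mulr_ge0 ?sqrtr_ge0 ?exprn_ge0 //.
rewrite exprMn sqr_sqrtr // -!natrX -natrM ler_nat -expnM [(n * 2)%N]mulnC expnM.
exact: bin_sq_le.
Qed.

(* Removing an element of a large bad set lands in a family with short chains, and each
   member of that family is reached at most [L] times. *)
Lemma bad_large c0 :
  (#|[set C | bad c0 C && (#|G| <= (#|C|).*2)%N]| * #|G|)%:R * Num.sqrt #|G|%:R
  <= (18 * L)%:R * 2 ^+ #|G| :> R.
Proof.
(* Removing a weight with real part in [kap, 8 kap] from a bad sum leaves a real part in
   [al, al + 7 kap + 2t]. As 2t <= kap, nine steps contain it strictly. *)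
pose al := - complex.Re c0 - t - 8 * kap.
(* Elements outside [G] receive the weight [kap] only to make every step at least [kap] on the whole
   type. *)
pose h (D : {set T}) : R := \sum_(j in D) if j \in G then complex.Re (w j) else kap.
have h_step x (D : {set T}) : x \notin D -> h D + kap <= h (x |: D).
  move=> xD; rewrite /h big_setU1 //= [leLHS]addrC lerD //.
  by case: ifP => // /w_kap /andP[].
have hS (D : {set T}) : D \subset G -> h D = complex.Re (S D).
  move=> DG; rewrite /h /S raddf_sum; apply: eq_bigr => j jD.
  by rewrite (subsetP DG).
pose B := [set C | bad c0 C && (#|G| <= (#|C|).*2)%N].
pose B' := [set D : {set T} | (D \subset G) && ((al <= h D) && (h D < al + kap * 9%:R))].
have B'bound : #|B'|%:R * Num.sqrt #|G|%:R <= 9%:R * 2 ^+ #|G| :> R.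
  have := lym h_step kap_gt0 G al 9.
  rewrite -(ler_pM2r (_ : 0 < 2 ^+ #|G| :> R)) ?exprn_gt0 //; apply: le_trans.
  rewrite mulr_suml mulr_natl -sumr_const.
  rewrite [leRHS](eq_bigl (fun D => D \in B')); last by move=> D; rewrite inE.
  apply: ler_sum => D; rewrite inE => /andP[DG _].
  rewrite ler_pdivlMl ?bin_le_sqrt // ltr0n bin_gt0 subset_leq_card //.
have count : (#|B| * #|G| <= 2 * (L * #|B'|))%N.
  apply: (@leq_trans (\sum_(C in B) 2 * #|C|)).
    rewrite -sum_nat_const; apply: leq_sum => C; rewrite inE => /andP[_].
    by rewrite mul2n.
  rewrite -big_distrr leq_mul2l /=.
  under eq_bigr do rewrite -sum1_card.
  rewrite pair_big_dep /=.
  rewrite (partition_big (fun Cj : {set T} * T => Cj.1 :\ Cj.2) (mem B')) /=.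
    rewrite mulnC -sum_nat_const; apply: leq_sum => D DB'.
    rewrite sum1_card; apply: leq_trans (clusters (- (c0 + S D))).
    rewrite -(card_imset _ (_ : injective (fun j => (j |: D, j)))); last first.
      by move=> j j' [].
    apply: subset_leq_card; apply/subsetP => -[C j].
    rewrite unfold_in /= !inE => /andP[/andP[/andP[/andP[CG Ct] _] jC] /eqP CD].
    apply/imsetP; exists j; last by rewrite -CD setD1K.
    rewrite inE (subsetP CG) //= opprK addrC -addrA; move: Ct.
    by rewrite /S (big_setD1 _ jC) /= CD [in X in _ -> X](addrC _ (w j)).
  move=> -[C j] /=; rewrite !inE => /andP[/andP[/andP[CG Ct] _] jC].
  have DG : C :\ j \subset G by apply: subset_trans CG; rewrite subsetDl.
  rewrite DG hS //=.
  have /andP[w1 w2] := w_kap (subsetP CG j jC).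
  have := le_trans (Re_le_normc _) Ct.
  rewrite /S (big_setD1 _ jC) /= !raddfD /=; rewrite ler_norml -/(S (C :\ j)) /al => /andP[h1 h2].
  have k0 := kap_gt0; have tk := t_kap; apply/andP; split; lra.
rewrite -/B; apply: (@le_trans _ _ ((2 * (L * #|B'|))%:R * Num.sqrt #|G|%:R)).
  by rewrite ler_wpM2r ?sqrtr_ge0 // ler_nat.
rewrite !natrM -!mulrA (mulrCA L%:R).
by have := B'bound; have := ler0n R L; nra.
Qed.

(** A gain of order |G|/L over the Erdos bound 2^|G| / sqrt |G|, due to the hypothesis that no disc
    of radius [t] holds more than [L] weights. Sets with fewer than half of the elements are
    complemented, which replaces c0 by - c0 - S G. *)
Lemma antichain_count c0 :
  (#|[set C | bad c0 C]| * #|G|)%:R * Num.sqrt #|G|%:R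
  <= (36 * L)%:R * 2 ^+ #|G| :> R.
Proof.
have h1 := bad_large c0; have h2 := bad_large (- c0 - S G).
have : (#|[set C | bad c0 C]| <= #|[set C | bad c0 C && (#|G| <= (#|C|).*2)%N]| +
   #|[set C | bad (- c0 - S G)%R C && (#|G| <= (#|C|).*2)%N]|)%N.
  rewrite -(cardsID [set C : {set T} | (#|G| <= (#|C|).*2)%N]) leq_add //.
    by apply: subset_leq_card; apply/subsetP => C; rewrite !inE andbC.
  rewrite -(card_in_imset (f := fun C => G :\: C)); last first.
    move=> C C'; rewrite !inE => /and3P[_ CG _] /and3P[_ CG' _] e.
    have K (D : {set T}) : D \subset G -> G :\: (G :\: D) = D.
      by move=> DG; rewrite setDDr setDv set0U; exact/setIidPr.
    by rewrite -(K C) // e K.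
  apply: subset_leq_card; apply/subsetP => C' /imsetP[C].
  rewrite !inE => /and3P[nC CG Ct] ->; rewrite /bad subsetDl /=.
  rewrite cardsD (setIidPr CG).
  have -> : - c0 - S G + S (G :\: C) = - (c0 + S C).
    rewrite /S [in X in _ - X](big_setID C) /= (setIidPr CG).
    by ring.
  by rewrite normcN Ct; have := subset_leq_card CG; lia.
set a := #|_|; set b := #|_|; set c := #|_| => abc.
apply: (@le_trans _ _ (((b + c) * #|G|)%:R * Num.sqrt #|G|%:R)).
  by rewrite ler_wpM2r ?sqrtr_ge0 // ler_nat leq_mul2r abc orbT.
rewrite mulnDl natrD mulrDl; apply: (le_trans (lerD h1 h2)).
by rewrite -mulrDl -natrD (_ : 18 * L + 18 * L = 36 * L)%N //; lia.
Qed.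

End Antichain.

(** * A Littlewood-Offord estimate for clustered weights *)

Section SmallBall.
Import boot.fintype boot.finset.
Local Open Scope set_scope.
Local Open Scope ring_scope.
Local Open Scope complex_scope.
Variables (R : realType) (V : finType) (p : law R V) (xi : V -> R[i]).

(* The atoms have two regions of mass at least [p0] whose differences are all close to [y0]. *)
Definition spread (y0 : R[i]) (p0 : R) : Prop :=
  [/\ y0 != 0, 0 < p0 & exists D1 D2 : pred V,
   [/\ p0 <= pr1 p D1, p0 <= pr1 p D2 &
     forall v v', D1 v -> D2 v' -> normc (xi v' - xi v - y0) <= normc y0 / 8]].

Definition rsum (I : finType) (u : I -> R[i]) (m : {ffun I -> V}) : R[i] :=
  \sum_i xi (m i) * u i.

Definition conc (I : finType) (u : I -> R[i]) (t c : R) : Prop :=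
  forall a, Pr p (fun m => normc (rsum u m - a) <= t) <= c.

Lemma normc_ge0 (z : R[i]) : 0 <= normc z.
Proof. by case: z => a b; exact: sqrtr_ge0. Qed.

Lemma normc_gt0 (z : R[i]) : (0 < normc z) = (z != 0).
Proof.
rewrite lt_def normc_ge0 andbT; congr (~~ _); apply/eqP/eqP => [|->].
  exact: ComplexField.Normc.eq0_normc.
exact: ComplexField.Normc.normc0.
Qed.

Lemma normcM (z w : R[i]) : normc (z * w) = normc z * normc w.
Proof. exact: ComplexField.Normc.normcM. Qed.

Lemma normcV (z : R[i]) : normc z^-1 = (normc z)^-1.
Proof. exact: ComplexField.Normc.normcV. Qed.

Lemma normc_distC (z w : R[i]) : normc (z - w) = normc (w - z).
Proof. by rewrite -normcN opprB. Qed.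

Lemma normc_triangle (z w v : R[i]) : normc (z - v) <= normc (z - w) + normc (w - v).
Proof. by rewrite -(subrK w z) -addrA (le_trans (le_normcD _ _)) // addrK. Qed.

Lemma normcB_ge (z w : R[i]) : normc z - normc w <= normc (z - w).
Proof. by rewrite lerBlDr -{1}(subrK w z) le_normcD. Qed.

Lemma expR1_le4 (n : nat) : expR n%:R <= 4 ^+ n :> R.
Proof.
have h : expR (1 / 4) <= 1 + 1 / 4 + (1 / 4) ^+ 2 :> R.
  by apply: expR_quad; rewrite ger0_norm //; lra.
have -> : n%:R = (4 * n)%:R * (1 / 4) :> R by rewrite natrM; field.
rewrite expRM_natl exprM.
rewrite lerXn2r ?nnegrE ?exprn_ge0 ?expR_ge0 //.
apply: (@le_trans _ _ ((1 + 1 / 4 + (1 / 4) ^+ 2) ^+ 4)); last by lra.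
by rewrite lerXn2r ?nnegrE ?expR_ge0 //; lra.
Qed.

Section LittlewoodOfford.
Variables (I : finType) (y0 : R[i]) (p0 : R).
Variables (u : I -> R[i]) (J : {set I}) (d : R[i]) (rho t : R) (L k : nat).
Hypothesis t_ge0 : 0 <= t.
Hypothesis d1 : normc d = 1.
Hypothesis rho_gt0 : 0 < rho.
Hypothesis t_rho : 4 * t <= rho * normc y0.
Hypothesis uJ : forall j, j \in J -> rho <= normc (u j) <= 2 * rho.
Hypothesis udir : forall j, j \in J -> 5 / 8 * normc (u j) <= complex.Re (d * u j).
Hypothesis clusters : forall z,
  (#|[set j in J | (normc (u j - z) <= 4 * t / normc y0)%R]| <= L)%N.

Let N0 : R := p0 ^+ 2 / 4 * #|J|%:R.
Let K := (2 * L + k)%N.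

Variables (D1 D2 : pred V).
Hypothesis y0n0 : y0 != 0.
Hypothesis p0_gt0 : 0 < p0.
Hypothesis D1p : p0 <= pr1 p D1.
Hypothesis D2p : p0 <= pr1 p D2.
Hypothesis D12 : forall v v', D1 v -> D2 v' ->
  normc (xi v' - xi v - y0) <= normc y0 / 8.

Let jump (w : V * V) := xi w.2 - xi w.1.
Let good (w : V * V) := D1 w.1 && D2 w.2.
Let G (q : {ffun I -> V * V}) := [set j in J | good (q j)].
Let crowd (c : R[i]) i (v : V * V) :=
  good v && (normc (jump v * u i - c) <= 2 * t).
(** The jump at [i] is crowded: many other good indices have products within 2t of its own. If no
    index is crowded, the cluster hypothesis of [antichain_count] holds with [K]. *)
Let E (q : {ffun I -> V * V}) i :=
  (K <= #|[set j in J :\ i | crowd (jump (q i) * u i)%R j (q j)]|)%N.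
Let bad a (q : {ffun I -> V * V}) (C : {set I}) :=
  normc (rsum u (choose_side C q) - a) <= t.

Lemma jump_norm v : good v -> 7 / 8 * normc y0 <= normc (jump v).
Proof.
move=> /andP[v1 v2]; have := D12 v1 v2; rewrite -/(jump v) => h.
have := normcB_ge y0 (y0 - jump v); have -> : y0 - (y0 - jump v) = jump v by ring.
rewrite normc_distC; lra.
Qed.

Lemma jump_ratio v : good v -> normc (jump v / y0 - 1) <= 1 / 8.
Proof.
move=> /andP[v1 v2]; have := D12 v1 v2; rewrite -/(jump v) => h.
rewrite -(ler_pM2r (_ : 0 < normc y0)) ?normc_gt0 // -normcM mulrBl mul1r divfK //.
by apply: (le_trans h); rewrite mulrC mul1r.
Qed.

(** Given the pair at [i], each value of another jump puts at most [L] indices in the relevant disc,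
    so the expected crowd is at most [L]. With K = 2L + k, [chernoff_upper] gives exp(L) / 2^(2L+k),
    and exp(L) <= 4^L. *)
Lemma E_small i : i \in J -> Pr (pairlaw p) (fun q => E q i) <= 1 / 2 ^+ k.
Proof.
move=> iJ; rewrite /Pr -(Ex_mix _ (J :\ i)) -[leRHS](Ex_cst I (pairlaw p)).
apply: le_Ex => m; set c := jump (m i) * u i.
apply: (@le_trans _ _ (Pr (pairlaw p)
  (fun m' => K <= #|[set j in J :\ i | crowd c j (m' j)]|)%N)).
  apply: le_Pr => m'; rewrite /E ffunE !inE eqxx /= -/c.
  rewrite (_ : [set _ in _ | _] = [set j in J :\ i | crowd c j (m' j)]) //.
  apply/setP => j; rewrite !inE ffunE !inE; case: eqP => //= _.
  by case: (j \in J).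
apply: (le_trans (chernoff_upper _ _ _ _)).
have h : \sum_(j in J :\ i) pr1 (pairlaw p) (crowd c j) <= L%:R.
  apply: (@le_trans _ _ (\sum_(j in J) pr1 (pairlaw p) (crowd c j))).
    by rewrite [leRHS](big_setD1 i) //= lerDr pr1_ge0.
  rewrite /pr1; under eq_bigr do rewrite big_mkcond.
  rewrite exchange_big /= -[leRHS]mul1r -{1}(law_sum (pairlaw p)) mulr_suml.
  apply: ler_sum => v _; rewrite -big_mkcondr /= sumr_const -[leLHS]mulr_natr.
  apply: ler_wpM2l; first by rewrite mulr_ge0 ?law_ge0.
  rewrite ler_nat.
  have [gv|gv] := boolP (good v); last first.
    rewrite (_ : #|_| = 0%N) //; apply: eq_card0 => j.
    by rewrite unfold_in /= /crowd (negPf gv) andbF.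
  apply: leq_trans (clusters (c / jump v)); apply: subset_leq_card.
  apply/subsetP => j; rewrite unfold_in /= /crowd gv inE /= => /andP[-> h] /=.
  have y0p : 0 < normc y0 by rewrite normc_gt0.
  have jv := jump_norm gv; have jp : 0 < normc (jump v) by lra.
  rewrite -(ler_pM2l jp) -normcM mulrBr mulrCA divff -?normc_gt0 // mulr1.
  have t0 := t_ge0; apply: (le_trans h); rewrite mulrA ler_pdivlMr //; nra.
rewrite ler_pdivrMr ?exprn_gt0 // mul1r mulrC.
apply: (@le_trans _ _ (4 ^+ L)).
  by apply: le_trans (expR1_le4 L); rewrite ler_expR.
rewrite /K exprD mulrK ?unitfE ?expf_neq0 // exprM; apply: lerXn2r.
all: rewrite ?nnegrE ?exprn_ge0 //; lra.
Qed.

Lemma G_large : Pr (pairlaw p) (fun q => #|G q|%:R <= N0) <= expR (- N0).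
Proof.
have := @chernoff_lower R _ I (pairlaw p) (fun=> good) (fun i => (i \in J)%:R) (p0 ^+ 2).
have e : \sum_i (i \in J)%:R = #|J|%:R :> R.
  by rewrite -sum1_card natr_sum [RHS]big_mkcond; apply: eq_bigr => i _; case: ifP.
rewrite e -/N0 => h; apply: le_trans (h _ _ _); last 2 first.
- move=> i; rewrite /pr1 -(pair_big D1 D2 (fun a b => p a * p b)) /= expr2.
  under eq_bigr do rewrite -mulr_sumr.
  by rewrite -mulr_suml ler_pM // ltW.
- by rewrite exprn_ge0 // ltW.
- apply: le_Pr => q; congr (_ <= _); rewrite -sum1_card natr_sum big_mkcond /=.
  apply: eq_bigr => i _; rewrite inE; case: (good _); rewrite ?andbF //= andbT.
  by case: (i \in J).
- by move=> i; case: (i \in J); rewrite ?lexx ?ler01.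
Qed.

(** For frozen pairs, choosing sides produces a subset sum of the products of jumps and weights.
    Multiplied by s = d/y0, the products at good indices have real part between rho/2 and 4 rho, as
    [antichain_count] requires. Choices outside the good set are fixed in C0 and summed
    trivially. *)
Lemma count_bad a q : N0 < #|G q|%:R -> (forall i, i \in J -> ~~ E q i) ->
  (#|[set C : {set I} | (C \subset J) && bad a q C]|)%:R * (#|G q|%:R * Num.sqrt #|G q|%:R)
   <= (36 * K)%:R * 2 ^+ #|J| :> R.
Proof.
move=> GN nE; set g := G q.
have y0p : 0 < normc y0 by rewrite normc_gt0.
have gJ : g \subset J by apply/subsetP => j; rewrite inE => /andP[].
have gG j : j \in g -> good (q j) by rewrite inE => /andP[].
pose s := d / y0; pose w j := s * (jump (q j) * u j).
have sn : normc s * normc y0 = 1.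
  by rewrite normcM d1 mul1r normcV mulVf // gt_eqF.
have sgt : 0 < normc s by have := normc_ge0 s; nra.
have wE j : w j = d * u j + d * u j * (jump (q j) / y0 - 1).
  by rewrite /w /s; field.
have wk j : j \in g -> rho / 2 <= complex.Re (w j) <= 8 * (rho / 2).
  move=> jg; have jJ := subsetP gJ j jg.
  have := Re_le_normc (d * u j * (jump (q j) / y0 - 1)).
  have := Re_le_normc (d * u j).
  rewrite wE raddfD /= !normcM d1 mul1r !ler_norml.
  have := jump_ratio (gG j jg); have := normc_ge0 (jump (q j) / y0 - 1).
  have := udir jJ; have /andP := uJ jJ.
  set X := complex.Re _; set Y := complex.Re _; set a1 := normc (u j).
  set a2 := normc _; have rp := rho_gt0; move=> [h1 h2] h3 h4 h5 /andP[h6 h7] /andP[h8 h9].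
  have h10 : a1 * a2 <= a1 / 8 by have : 0 <= a1 by [exact: normc_ge0]; nra.
  by apply/andP; split; lra.
pose t' := normc s * t.
have t'k : 2 * t' <= rho / 2.
  have : normc s * (4 * t) <= normc s * (rho * normc y0) by rewrite ler_pM2l.
  by rewrite (mulrCA _ rho) sn mulr1 /t' => h; lra.
have cl z : (#|[set j in g | (normc (w j - z) <= t')%R]| <= K)%N.
  rewrite leqNgt; apply/negP => h.
  have [i iA] : exists i, i \in [set j in g | (normc (w j - z) <= t')%R].
    by apply/set0Pn; rewrite -card_gt0; apply: leq_trans h.
  have iJ : i \in J by move: iA; rewrite inE => /andP[/(subsetP gJ)].
  move/negP: (nE i iJ); apply; rewrite /E.
  have: (K <= #|[set j in g | (normc (w j - z) <= t')%R] :\ i|)%N.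
    by move: h; rewrite (cardsD1 i) iA.
  move/leq_trans; apply; apply: subset_leq_card; apply/subsetP => j.
  rewrite !inE => /and3P[-> /andP[jJ gj] jz] /=; rewrite jJ /crowd gj /=.
  rewrite -(ler_pM2l sgt) -normcM mulrBr -/(w j) -/(w i).
  apply: (le_trans (normc_triangle _ z _)).
  move: iA; rewrite inE [normc (w i - z)]normc_distC => /andP[_ iz].
  have : normc s * (2 * t) = t' + t' by rewrite /t'; ring.
  by move=> ->; rewrite lerD.
have main (C0 : {set I}) : C0 \subset J :\: g ->
    (#|[set C : {set I} | (C \subset J) && bad a q C && (C :\: g == C0)]| * #|g|)%:R *
     Num.sqrt #|g|%:R <= (36 * K)%:R * 2 ^+ #|g| :> R.
  move=> C0J.
  pose c0 := s * (\sum_i xi (q i).1 * u i + \sum_(i in C0) jump (q i) * u i - a).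
  have rp2 : 0 < rho / 2 by rewrite divr_gt0.
  apply: le_trans (antichain_count rp2 t'k wk cl c0).
  rewrite ler_wpM2r ?sqrtr_ge0 // ler_nat leq_mul2r; apply/orP; right.
  rewrite -(card_in_imset (f := fun C => C :&: g)); last first.
    move=> C C'; rewrite !inE => /andP[_ /eqP e1] /andP[_ /eqP e2] e3.
    by rewrite -(setID C g) e1 e3 -e2 setID.
  apply: subset_leq_card; apply/subsetP => D /imsetP[C].
  rewrite !inE => /andP[/andP[CJ Cb] /eqP CC0] ->; rewrite subsetIr /=.
  move: Cb; rewrite /bad -(ler_pM2l sgt) -normcM; congr (normc _ <= _).
  rewrite /w -mulr_sumr -mulrDr; congr (s * _).
  have -> : rsum u (choose_side C q) = \sum_i xi (q i).1 * u i + \sum_(i in C) jump (q i) * u i.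
    rewrite [X in _ + X]big_mkcond -big_split; apply: eq_bigr => i _ /=.
    by rewrite ffunE /jump; case: ifP; rewrite ?addr0 // mulrBl addrC subrK.
  rewrite (big_setID g) /= CC0; ring.
apply: (@le_trans _ _ (\sum_(C0 in powerset (J :\: g)) (36 * K)%:R * 2 ^+ #|g|)); last first.
  rewrite sumr_const card_powerset -[leLHS]mulr_natr natrX -mulrA -exprD.
  by rewrite cardsD (setIidPr gJ) subnKC // subset_leq_card.
have -> : (#|[set C : {set I} | (C \subset J) && bad a q C]| =
   \sum_(C0 in powerset (J :\: g))
   #|[set C : {set I} | (C \subset J) && bad a q C && (C :\: g == C0)]|)%N.
  rewrite -sum1_card (partition_big (fun C => C :\: g) (mem (powerset (J :\: g)))) /=.
    apply: eq_bigr => C0 _; rewrite -sum1_card; apply: eq_bigl => C.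
    by rewrite !inE.
  by move=> C; rewrite !inE => /andP[CJ _]; exact: setSD.
rewrite natr_sum mulr_suml; apply: ler_sum => C0; rewrite inE => /main.
by rewrite natrM mulrA.
Qed.

(** Choosing sides along a fixed [C] preserves the law, so averaging over all subsets of [J] does
    too: the probability is the mean proportion of bad subsets. The three terms stand for too few
    good pairs, a crowded index, and the bound of [count_bad]. *)
Lemma small_ball_pair : 0 < N0 -> conc u t
  (expR (- N0) + #|J|%:R / 2 ^+ k + (36 * K)%:R / (N0 * Num.sqrt N0)).
Proof.
move=> N0p a.
have e : Pr p (fun m => normc (rsum u m - a) <= t) = Ex (pairlaw p) (fun q =>
   (#|[set C : {set I} | (C \subset J) && bad a q C]|)%:R / 2 ^+ #|J|).
  transitivity (Ex (pairlaw p) (fun q => \sum_(C in powerset J)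
     (2 ^+ #|J|)^-1 * ind R (bad a q C))).
    rewrite Ex_sum (eq_bigr (fun=> (2 ^+ #|J|)^-1 *
      Pr p (fun m => normc (rsum u m - a) <= t))); last first.
      move=> C _; rewrite ExZ; congr (_ * _).
      exact: (Ex_pick _ C (fun m => ind R (normc (rsum u m - a) <= t))).
    rewrite sumr_const card_powerset -[RHS]mulr_natl natrX mulrA divff ?mul1r //.
  apply: eq_Ex => q; rewrite -mulr_sumr mulrC; congr (_ / _).
  rewrite -sum1_card natr_sum big_mkcond [RHS]big_mkcond; apply: eq_bigr => C _.
  rewrite !inE; case: (C \subset J) => //=.
  by rewrite /ind; case: asboolP => [->|/negP/negPf ->].
rewrite e; apply: (@le_trans _ _ (Ex (pairlaw p) (fun q => ind R (#|G q|%:R <= N0) +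
   \sum_(i in J) ind R (E q i) + (36 * K)%:R / (N0 * Num.sqrt N0)))).
  apply: le_Ex => q.
  have B0 : 0 <= (36 * K)%:R / (N0 * Num.sqrt N0).
    by rewrite divr_ge0 // mulr_ge0 ?sqrtr_ge0 // ltW.
  have S0 : 0 <= \sum_(i in J) ind R (E q i) by apply: sumr_ge0 => i _; exact: ind_ge0.
  have le1 : (#|[set C : {set I} | (C \subset J) && bad a q C]|)%:R / 2 ^+ #|J| <= 1 :> R.
    rewrite ler_pdivrMr ?exprn_gt0 // mul1r -natrX ler_nat -card_powerset.
    by apply: subset_leq_card; apply/subsetP => C; rewrite !inE => /andP[].
  have [GN|GN] := leP #|G q|%:R N0.
    by rewrite indT //; apply: (le_trans le1); rewrite -addrA lerDl addr_ge0.
  have [[i [iJ Ei]]|nE] := pselect (exists i, i \in J /\ E q i).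
    rewrite (bigD1 i) //= (indT R Ei); apply: (le_trans le1).
    rewrite -addrA; apply: ler_wpDl; first exact: ind_ge0.
    rewrite -addrA lerDl addr_ge0 // sumr_ge0 // => j _; exact: ind_ge0.
  have nE' i : i \in J -> ~~ E q i by move=> iJ; apply/negP => Ei; apply: nE; exists i.
  have := count_bad a GN nE'; set c := #|_|%:R => h.
  apply: (@le_trans _ _ ((36 * K)%:R / (N0 * Num.sqrt N0))); last first.
    by rewrite lerDr addr_ge0 // ind_ge0.
  have sg : 0 < Num.sqrt N0 by rewrite sqrtr_gt0.
  have NsN : 0 < N0 * Num.sqrt N0 by apply: mulr_gt0.
  rewrite ler_pdivrMr ?exprn_gt0 // mulrAC ler_pdivlMr //.
  apply: le_trans h; apply: ler_wpM2l; first exact: ler0n.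
  by apply: ler_pM; rewrite ?sqrtr_ge0 ?ler_wsqrtr // ltW.
set B := (36 * K)%:R / _.
have -> : Ex (pairlaw p) (fun q => ind R (#|G q|%:R <= N0) +
    \sum_(i in J) ind R (E q i) + B) = Pr (pairlaw p) (fun q => #|G q|%:R <= N0) +
    \sum_(i in J) Pr (pairlaw p) (fun q => E q i) + B.
  by rewrite -[B in RHS](Ex_cst I (pairlaw p)) -Ex_sum -!ExD.
rewrite lerD2r lerD ?G_large //.
apply: (@le_trans _ _ (\sum_(i in J) 1 / 2 ^+ k)).
  by apply: ler_sum => i; exact: E_small.
by rewrite sumr_const -[leLHS]mulr_natl mul1r.
Qed.

End LittlewoodOfford.
End SmallBall.

(** * Counting structured vectors *)

Section Nets.
Import boot.fintype boot.finset.
Local Open Scope set_scope.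
Local Open Scope ring_scope.
Local Open Scope complex_scope.
Variable R : realType.

Section Rows.
Variables (V : finType) (p : law R V) (xi : V -> R[i]).
Variables (I K E : finType) (h : K -> I -> E).
Hypothesis h_inj : forall k k' i i', h k i = h k' i' -> k = k' /\ i = i'.

Lemma rows_indep (u : I -> R[i]) (T c : R) (a : K -> R[i]) :
  0 <= c -> conc p xi u T c ->
  Pr p (fun m : {ffun E -> V} =>
    forall k, normc (\sum_i xi (m (h k i)) * u i - a k) <= T) <= c ^+ #|K|.
Proof.
move=> c0 uc; rewrite cardE.
apply: (@le_trans _ _ (Pr p (fun m : {ffun E -> V} =>
    forall k, k \in enum K -> normc (\sum_i xi (m (h k i)) * u i - a k) <= T))).
  by apply: le_Pr => m H k _.
elim: (enum K) (enum_uniq K) => [|k ks IH] /=; first by rewrite Pr_le1.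
move=> /andP[kks /IH{}IH]; rewrite exprS.
pose S := [set h k i | i in I].
apply: le_trans (ler_wpM2l c0 IH).
apply: le_trans (Pr_mix_le (S := S) (A := fun m => normc (\sum_i xi (m (h k i)) * u i
    - a k) <= T) _ _).
- apply: le_Pr => m H; split; first by apply: H; rewrite mem_head.
  by move=> j jks; apply: H; rewrite in_cons jks orbT.
- move=> m _; apply: le_trans (uc (a k)).
  have hk : injective (h k) by move=> i i' /h_inj[].
  rewrite /Pr -(Ex_marginal p _ hk); apply: le_Ex => m'; apply: ind_le.
  congr (normc (_ - _) <= _); apply: eq_bigr => i _.
  by rewrite !ffunE imset_f.
- move=> m m' H j jks; have := H j jks; congr (normc (_ - _) <= _).
  apply: eq_bigr => i _; rewrite ffunE; case: imsetP => // -[i' _ /h_inj[jk _]].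
  by rewrite -jk jks in kks.
Qed.

(** Resampling the coordinate of modulus one alone: values from the two regions are then at least
    7/8 |y0| > 2T apart, so the disc misses one of the regions, whose mass is at least p0. *)
Lemma conc_coord (y0 : R[i]) (p0 T : R) (u : I -> R[i]) (i0 : I) :
  spread p xi y0 p0 -> normc (u i0) = 1 -> 2 * T < 7 / 8 * normc y0 ->
  conc p xi u T (1 - p0).
Proof.
move=> [y0n0 p0p [D1 [D2 [D1p D2p D12]]]] u1 Ty a.
rewrite /Pr -(Ex_mix _ [set i0]) -[leRHS](Ex_cst I p); apply: le_Ex => m.
pose b := \sum_(i | i != i0) xi (m i) * u i - a.
pose B v := normc (xi v * u i0 + b) <= T.
have -> : Ex p (fun m' => ind R (normc (rsum xi u (mix [set i0] m m') - a) <= T)) = pr1 p B.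
  rewrite /pr1 big_mkcond -[LHS]mulr1 -[in LHS](Ex_cst I p 1) -[RHS]mulr1.
  transitivity (Ex p (fun m' : {ffun I -> V} =>
      \prod_i (if i == i0 then (B (m' i))%:R else 1))).
    rewrite Ex_cst mulr1; apply: eq_Ex => m'.
    rewrite (bigD1 i0) //= eqxx big1 ?mulr1; last by move=> i /negPf ->.
    rewrite ind_bool /B (_ : rsum _ _ _ - a = xi (m' i0) * u i0 + b) //.
    rewrite /rsum (bigD1 i0) //= ffunE inE eqxx -addrA; congr (_ + (_ - _)).
    by apply: eq_bigr => i ii0; rewrite ffunE inE (negPf ii0).
  rewrite (Ex_prod p (fun i v => if i == i0 then (B v)%:R else 1)).
  rewrite (bigD1 i0) //= eqxx [X in _ * X]big1 ?mulr1; last first.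
    by move=> i /negPf ->; under eq_bigr do rewrite mulr1; exact: law_sum.
  by apply: eq_bigr => v _; case: (B v); rewrite ?mulr1 ?mulr0.
have far v v' : D1 v -> D2 v' -> B v -> B v' -> False.
  move=> d1 d2; rewrite /B => b1 b2.
  have h1 := normc_triangle (xi v' * u i0 + b) 0 (xi v * u i0 + b).
  move: h1; rewrite subr0 sub0r normcN opprD addrACA subrr addr0 -mulrBl normcM u1 mulr1.
  have h2 := normcB_ge y0 (- (xi v' - xi v - y0)).
  move: h2; rewrite opprK addrCA subrr addr0 normcN.
  have := D12 _ _ d1 d2; lra.
have sub (D : pred V) : p0 <= pr1 p D -> (forall v, D v -> ~~ B v) -> pr1 p B <= 1 - p0.
  move=> Dp DB; apply: (@le_trans _ _ (pr1 p (predC D))); last by rewrite pr1C; lra.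
  rewrite /pr1 big_mkcond [leRHS]big_mkcond /=; apply: ler_sum => v _.
  have := DB v; case: (D v) => /=; first by move=> /(_ isT)/negPf ->.
  by case: (B v) => _; rewrite ?law_ge0.
have [[v /andP[v1 Bv]]|nv] := pselect (exists v, D1 v && B v).
  by apply: (sub D2) => // v' v2; apply/negP => /(far _ _ v1 v2 Bv).
by apply: (sub D1) => // v v1; apply/negP => Bv; apply: nv; exists v; rewrite v1.
Qed.

End Rows.

Section Codes.
Variables (I : finType) (D M s : nat).

(** Mesh 1/D on the square [-2, 2]^2, which contains every centre within distance 1 of the unit
    disc. *)
Definition gridpt (g : 'I_(4 * D).+1 * 'I_(4 * D).+1) : R[i] :=
  (g.1%:R / D%:R - 2) +i* (g.2%:R / D%:R - 2).

(** A vector up to rounding: for each coordinate the label of a centre or none, then the rounded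
    centres, then a list of at most [s] exceptional coordinates with their rounded values. Its
    cardinality is the price of the union bound. *)
Definition code : Type := ({ffun I -> option 'I_M} *
  {ffun 'I_M -> 'I_(4 * D).+1 * 'I_(4 * D).+1} *
  {ffun 'I_s -> option (I * ('I_(4 * D).+1 * 'I_(4 * D).+1))})%type.

Definition decode (c : code) (j : I) : R[i] :=
  if c.1.1 j is Some k then gridpt (c.1.2 k)
  else if [pick k | omap fst (c.2 k) == Some j] is Some k
       then if c.2 k is Some jg then gridpt jg.2 else 0
  else 0.

Lemma card_code :
  (#|{: code}| = M.+1 ^ #|I| * ((4 * D).+1 ^ 2) ^ M * (#|I| * (4 * D).+1 ^ 2).+1 ^ s)%N.
Proof.
by rewrite !card_prod !card_ffun !card_option !card_prod !card_ord mulnn.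
Qed.

Lemma floor_grid (x : R) : (0 < D)%N -> -2 <= x <= 2 ->
  exists g : 'I_(4 * D).+1, `|x - (g%:R / D%:R - 2)| <= D%:R^-1.
Proof.
move=> D0 /andP[x1 x2]; have Dp : 0 < D%:R :> R by rewrite ltr0n.
pose y := (x + 2) * D%:R.
have y0 : 0 <= y by apply: mulr_ge0; [lra|exact: ltW].
have yt : (Num.truncn y < (4 * D).+1)%N.
  rewrite ltnS -(ler_nat R); apply: le_trans (_ : y <= _).
    by have /andP[] := truncn_itv y0.
  by rewrite natrM /y ler_pM2r //; lra.
exists (Ordinal yt) => /=; have /andP[h1 h2] := truncn_itv y0.
have -> : x - ((Num.truncn y)%:R / D%:R - 2) = (y - (Num.truncn y)%:R) / D%:R.
  by rewrite /y; field; rewrite gt_eqF.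
rewrite ger0_norm; last by apply: divr_ge0; rewrite ?subr_ge0 // ltW.
rewrite ler_pdivrMr // mulVf ?gt_eqF //; move: h2; rewrite -natr1; lra.
Qed.

Lemma normc_le_ReIm (z : R[i]) : normc z <= `|complex.Re z| + `|complex.Im z|.
Proof.
case: z => a b /=.
rewrite -[leRHS]ger0_norm ?addr_ge0 // -sqrtr_sqr ler_wsqrtr //.
rewrite -[a ^+ 2]real_normK ?num_real // -[b ^+ 2]real_normK ?num_real //.
have := normr_ge0 a; have := normr_ge0 b; nra.
Qed.

Lemma gridP (z : R[i]) : (0 < D)%N -> normc z <= 2 ->
  exists g, normc (z - gridpt g) <= 2 / D%:R.
Proof.
move=> D0 z2; have h1 := le_trans (Re_le_normc z) z2.
have h2 : `|complex.Im z| <= 2.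
  by apply: le_trans z2; case: z {h1} => a b /=; rewrite -sqrtr_sqr ler_wsqrtr // lerDr sqr_ge0.
have [g1 e1] : exists g : 'I_(4 * D).+1, `|complex.Re z - (g%:R / D%:R - 2)| <= D%:R^-1.
  by apply: floor_grid => //; rewrite -ler_norml.
have [g2 e2] : exists g : 'I_(4 * D).+1, `|complex.Im z - (g%:R / D%:R - 2)| <= D%:R^-1.
  by apply: floor_grid => //; rewrite -ler_norml.
exists (g1, g2); apply: (le_trans (normc_le_ReIm _)).
by case: z {z2 h1 h2} e1 e2 => a b /= e1 e2; lra.
Qed.

(* All coordinates but [s] lie within [dl] of zero or of one of the [M] centers [zs]. *)
Definition clustered (dl : R) (u : I -> R[i]) := exists2 zs : seq R[i], (size zs <= M)%N &
  (#|[set j | (dl < normc (u j))%R && all (fun z => dl < normc (u j - z))%R zs]| <= s)%N.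

Lemma code_exists (dl : R) (u : I -> R[i]) : (0 < D)%N -> 0 <= dl <= 1 ->
  (forall j, normc (u j) <= 1) -> clustered dl u ->
  exists c : code, forall j, normc (u j - decode c j) <= dl + 2 / D%:R.
Proof.
move=> D0 /andP[dl0 dl1] u1 [zs zM].
set X := [set j | _] => Xs.
have /choice[gr grP] : forall z, exists g, normc z <= 2 -> normc (z - gridpt g) <= 2 / D%:R.
  move=> z; have [/(gridP D0)[g gP]|z2] := leP (normc z) 2; first by exists g.
  by exists (ord0, ord0).
have D20 : 0 <= 2 / D%:R :> R by rewrite divr_ge0.
pose near j (k : 'I_M) := (k < size zs)%N && (normc (u j - nth 0 zs k) <= dl).
pose lab : {ffun I -> option 'I_M} := [ffun j =>
  if normc (u j) <= dl then None else [pick k | near j k]].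
pose ctr : {ffun 'I_M -> _} := [ffun k : 'I_M => gr (nth 0 zs k)].
pose exc : {ffun 'I_s -> option (I * ('I_(4 * D).+1 * 'I_(4 * D).+1))} :=
  [ffun k : 'I_s => if insub (val k) is Some k' then
     Some (enum_val (A := mem X) k', gr (u (enum_val (A := mem X) k'))) else None].
exists (lab, ctr, exc) => j.
have excP k jg : exc k = Some jg -> (jg.1 \in X) /\ jg.2 = gr (u jg.1).
  by rewrite ffunE; case: insubP => // k' _ _ [<-] /=; rewrite enum_valP.
have exc_j : normc (u j) <= dl \/ (exists k, omap fst (exc k) = Some j) ->
  normc (u j - (if [pick k | omap fst (exc k) == Some j] is Some k
       then if exc k is Some jg then gridpt jg.2 else 0 else 0)) <= dl + 2 / D%:R.
  move=> H; case: pickP => [k /eqP|nk].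
    case ek: (exc k) => [[j' g]|] //= [j'j]; have [/= _ ->] := excP _ _ ek.
    rewrite j'j; apply: (le_trans (grP _ _)); last by lra.
    by apply: le_trans (u1 j) _; lra.
  case: H => [uj|[k kj]]; last by move: (nk k); rewrite kj eqxx.
  by rewrite subr0; lra.
move: exc_j; rewrite /decode /= (ffunE _ j) => exc_j.
case: (leP (normc (u j)) dl) => uj; first by apply: exc_j; left.
case: pickP => [k /andP[ks kd]|nk].
  rewrite ffunE; set z := nth 0 zs k in kd *.
  apply: (le_trans (normc_triangle _ z _)); rewrite lerD // grP //.
  have := normc_triangle z (u j) 0; rewrite !subr0 [normc (z - _)]normc_distC => h.
  by have := u1 j; lra.
apply: exc_j; right.
have jX : j \in X.
  rewrite inE uj /=; apply/allP => z zzs; rewrite ltNge; apply/negP => ujz.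
  have zi : (index z zs < M)%N by apply: leq_trans zM; rewrite index_mem.
  by have := nk (Ordinal zi); rewrite /near /= index_mem zzs nth_index // ujz.
have kX : (enum_rank_in jX j < s)%N by apply: leq_trans Xs.
exists (Ordinal kX); rewrite ffunE /=; case: insubP => [k' _ ek|]; last first.
  by rewrite ltn_ord.
by rewrite /= (_ : k' = enum_rank_in jX j) ?enum_rankK_in //; apply: val_inj.
Qed.

End Codes.

Section NetBound.
Variables (V : finType) (p : law R V) (xi : V -> R[i]).
Variables (I K E : finType) (h : K -> I -> E).
Hypothesis h_inj : forall k k' i i', h k i = h k' i' -> k = k' /\ i = i'.
Variables (A0 : K -> I -> R[i]) (La : R) (D M s : nat) (dl : R).
Hypothesis A0_le : forall k i, normc (A0 k i) <= La.
Hypothesis xi_le : forall v, normc (xi v) <= La.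

Definition form (u : I -> R[i]) (m : {ffun E -> V}) (k : K) : R[i] :=
  \sum_i (A0 k i + xi (m (h k i))) * u i.

Lemma form_diff u u' m k x : (forall i, normc (u i - u' i) <= x) ->
  normc (form u m k - form u' m k) <= #|I|%:R * (2 * La) * x.
Proof.
move=> ux; rewrite /form -sumrB.
apply: (@le_trans _ _ (\sum_(i : I) (2 * La) * x)); last first.
  by rewrite sumr_const -[leLHS]mulr_natl mulrA.
elim/big_ind2: _ => [|a b c e ab ce|i _].
- by rewrite ComplexField.Normc.normc0.
- by apply: (le_trans (le_normcD _ _)); rewrite lerD.
rewrite -mulrBr normcM ler_pM ?normc_ge0 //; apply: (le_trans (le_normcD _ _)).
by rewrite mulr_natl mulr2n lerD.
Qed.

(** Each code is represented by a genuine vector satisfying [Psi], not by the decoded one, because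
    the small-ball bound is only known under [Psi]. Vectors with the same code differ by at most 2
    (dl + 2/D) in each coordinate, and the enlarged radius absorbs this. *)
Lemma net_bound (Psi : (I -> R[i]) -> Prop) (T c : R) :
  (0 < D)%N -> 0 <= dl <= 1 -> 0 <= c ->
  (forall u, (forall j, normc (u j) <= 1) -> clustered M s dl u -> Psi u ->
     conc p xi u (T + #|I|%:R * (2 * La) * (2 * (dl + 2 / D%:R))) c) ->
  Pr p (fun m => exists u, [/\ forall j, normc (u j) <= 1, clustered M s dl u, Psi u &
     forall k, normc (form u m k) <= T]) <=
  (M.+1 ^ #|I| * ((4 * D).+1 ^ 2) ^ M * (#|I| * (4 * D).+1 ^ 2).+1 ^ s)%:R * c ^+ #|K|.
Proof.
move=> D0 dl01 c0 uc; rewrite -card_code.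
pose ok (kp : code I D M s) u := [/\ forall j, normc (u j) <= 1, clustered M s dl u, Psi u &
  forall j, normc (u j - decode kp j) <= dl + 2 / D%:R].
apply: (@le_trans _ _ (Pr p (fun m => exists kp, exists u, ok kp u /\
     forall k, normc (form u m k) <= T))).
  apply: le_Pr => m [u [u1 uM uP us]].
  by have [kp kpP] := code_exists D0 dl01 u1 uM; exists kp, u.
apply: (le_trans (Pr_exists _ _)).
apply: (@le_trans _ _ (\sum_(kp : code I D M s) c ^+ #|K|)); last first.
  by rewrite sumr_const -[leLHS]mulr_natl.
apply: ler_sum => kp _.
have [[u0 [u01 u0M u0P u0d]]|nok] := pselect (exists u, ok kp u); last first.
  rewrite /Pr (@eq_Ex _ _ _ _ _ (fun=> 0)) ?Ex_cst ?exprn_ge0 // => m.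
  by rewrite indF // => -[u [uk _]]; apply: nok; exists u.
apply: le_trans (rows_indep h_inj (fun k => - \sum_i A0 k i * u0 i) c0 (uc u0 u01 u0M u0P)).
apply: le_Pr => m [u [[u1 uM uP ud] us]] k.
have -> : \sum_i xi (m (h k i)) * u0 i - - (\sum_i A0 k i * u0 i) = form u0 m k.
  by rewrite opprK -big_split; apply: eq_bigr => i _; rewrite /= mulrDl addrC.
have := normc_triangle (form u0 m k) (form u m k) 0; rewrite !subr0 => /le_trans; apply.
rewrite addrC lerD // form_diff // => i.
apply: (le_trans (normc_triangle _ (decode kp i) _)).
rewrite [X in _ + X]normc_distC mulr_natl mulr2n lerD //.
Qed.

End NetBound.
End Nets.

(** * An inverse Littlewood-Offord statement *)

Section Clusters.
Import boot.fintype boot.finset.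
Local Open Scope set_scope.
Local Open Scope ring_scope.
Local Open Scope complex_scope.
Variable R : realType.

Definition dirs : seq R[i] := [:: 1; -1; 0 +i* 1; 0 -i* 1].

Lemma dir_norm (c : 'I_4) : normc (dirs`_c) = 1.
Proof.
by case: c => -[|[|[|[|//]]]] ? /=; rewrite ?oppr0 ?sqrrN ?expr0n ?expr1n ?addr0 ?add0r sqrtr1.
Qed.

(** Some axis makes an angle of cosine at least 1/sqrt 2 > 5/8 with any given vector. *)
Lemma dir_exists (z : R[i]) :
  exists c : 'I_4, 5 / 8 * normc z <= complex.Re (dirs`_c * z).
Proof.
case: z => a b; have zab : normc (a +i* b) ^+ 2 = a ^+ 2 + b ^+ 2.
  by rewrite /= sqr_sqrtr // addr_ge0 ?sqr_ge0.
have z0 := normc_ge0 (a +i* b); set z := normc _ in zab z0 *.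
have key x : 0 <= x -> z ^+ 2 <= 2 * x ^+ 2 -> 5 / 8 * z <= x.
  move=> x0 h; rewrite leNgt; apply/negP => h2.
  have : x * x < (5 / 8 * z) * (5 / 8 * z) by apply: ltr_pM.
  nra.
have [ab|ab] := leP (b ^+ 2) (a ^+ 2).
  have [a0|a0] := leP 0 a.
    by exists (inord 0); rewrite inordK //= mul1r mul0r subr0; apply: key => //; lra.
  exists (inord 1); rewrite inordK //= oppr0 mul0r subr0 mulN1r.
  by apply: key; rewrite ?sqrrN; lra.
have [b0|b0] := leP 0 b.
  exists (inord 3); rewrite inordK //= mul0r sub0r mulN1r opprK.
  by apply: key => //; lra.
exists (inord 2); rewrite inordK //= mul0r sub0r mul1r.
by apply: key; rewrite ?sqrrN; lra.
Qed.

Lemma dyadic_exists (x : R) (m : nat) : (2 ^+ m)^-1 < x -> x <= 1 ->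
  exists l : 'I_m, (2 ^+ l.+1)^-1 <= x <= 2 * (2 ^+ l.+1)^-1.
Proof.
elim: m => [|m IH] xm x1; first by move: xm; rewrite expr0 invr1; lra.
have [xm'|xm'] := ltP (2 ^+ m)^-1 x.
  have [l lP] := IH xm' x1; exists (widen_ord (leqnSn m) l); exact: lP.
exists ord_max; rewrite /= ltW //=; apply: le_trans xm' _.
by rewrite exprS invfM mulrA divff ?mul1r.
Qed.

Section FromConc.
Variables (V I : finType) (p : law R V) (xi : V -> R[i]) (y0 : R[i]) (p0 : R).
Hypothesis sp : spread p xi y0 p0.

(** The bound of [small_ball_pair] for a set of [N] indices. *)
Definition lo_bound (N L k : nat) : R :=
  expR (- (p0 ^+ 2 / 4 * N%:R)) + N%:R / 2 ^+ k +
  (36 * (2 * L + k))%:R / (p0 ^+ 2 / 4 * N%:R * Num.sqrt (p0 ^+ 2 / 4 * N%:R)).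

(** Contrapositive of [small_ball_pair]: among 4 m N coordinates larger than 2^-m, some N share a
    dyadic scale (m choices) and a direction (4 choices). *)
Lemma cluster_exists (u : I -> R[i]) (t : R) (m N L k : nat) (A : {set I}) :
  0 <= t -> (0 < N)%N -> (0 < m)%N -> 8 * t <= (2 ^+ m)^-1 * normc y0 ->
  (forall j, normc (u j) <= 1) -> (forall j, j \in A -> (2 ^+ m)^-1 < normc (u j)) ->
  (4 * m * N <= #|A|)%N -> ~ conc p xi u t (lo_bound N L k) ->
  exists z, (L < #|[set j in A | (normc (u j - z) <= 4 * t / normc y0)%R]|)%N.
Proof.
move=> t0 N0 m0 tm u1 uA AN; have [y0n0 p0p [D1 [D2 [D1p D2p D12]]]] := sp.
apply: contra_notP => noz.
pose cls (ld : 'I_m * 'I_4) := [set j in A |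
  [&& (2 ^+ ld.1.+1)^-1 <= normc (u j), normc (u j) <= 2 * (2 ^+ ld.1.+1)^-1 &
   5 / 8 * normc (u j) <= complex.Re (dirs`_ld.2 * u j)]].
have [[l c] big] : exists ld, (N <= #|cls ld|)%N.
  apply: contrapT => /forallNP small.
  suff : (#|A| <= \sum_(ld : 'I_m * 'I_4) N.-1)%N.
    rewrite sum_nat_const card_prod !card_ord => h; have := leq_trans AN h.
    by rewrite leqNgt => /negP; apply; rewrite [(m * 4)%N]mulnC ltn_pmul2l ?muln_gt0 // prednK.
  apply: (@leq_trans (\sum_ld #|cls ld|)); last first.
    by apply: leq_sum => ld _; rewrite -ltnS prednK // ltnNge; exact/negP/small.
  have sub : A \subset \bigcup_ld cls ld.
    apply/subsetP => j jA; have [l /andP[l1 l2]] := dyadic_exists (uA j jA) (u1 j).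
    have [c cP] := dir_exists (u j); apply/bigcupP; exists (l, c) => //.
    by rewrite inE jA l1 l2.
  apply: leq_trans (subset_leq_card sub) _.
  elim/big_rec2: _ => [|ld S x _ Sx]; first by rewrite cards0.
  by apply: leq_trans (leq_card_setU _ _) _; rewrite leq_add2l.
have /card_geqP[js [jsu jss jsA]] := big.
pose J := [set j in js]; have cJ : #|J| = N by rewrite cardsE (card_uniqP jsu).
have JA j : j \in J -> j \in cls (l, c) by rewrite inE; exact: jsA.
pose rho : R := (2 ^+ l.+1)^-1.
have rho0 : 0 < rho by rewrite invr_gt0 exprn_gt0.
have trho : 4 * t <= rho * normc y0.
  have : (2 ^+ m)^-1 <= rho.
    by rewrite lef_pV2 ?posrE ?exprn_gt0 // ler_weXn2l ?ler1n.
  by have := normc_ge0 y0; nra.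
have uJ j : j \in J -> rho <= normc (u j) <= 2 * rho.
  by move=> /JA; rewrite inE => /and4P[_ -> -> _].
have udir j : j \in J -> 5 / 8 * normc (u j) <= complex.Re (dirs`_c * u j).
  by move=> /JA; rewrite inE => /and4P[_ _ _ ->].
have cl z : (#|[set j in J | (normc (u j - z) <= 4 * t / normc y0)%R]| <= L)%N.
  rewrite leqNgt; apply/negP => h; apply: noz; exists z.
  apply: leq_trans h _; apply: subset_leq_card; apply/subsetP => j.
  by rewrite !inE => /andP[/jsA]; rewrite inE => /andP[-> _] ->.
have NN : 0 < p0 ^+ 2 / 4 * #|J|%:R.
  by rewrite cJ mulr_gt0 ?divr_gt0 ?exprn_gt0 // ltr0n.
have := small_ball_pair k t0 (dir_norm c) rho0 trho uJ udir cl y0n0 p0p D1p D2p D12 NN.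
by rewrite cJ.
Qed.

Lemma greedy_centers (u : I -> R[i]) (dl : R) (L s : nat) (A : {set I}) :
  (forall B : {set I}, B \subset A -> (s <= #|B|)%N ->
     exists z, (L < #|[set j in B | (normc (u j - z) <= dl)%R]|)%N) ->
  exists zs : seq R[i], (size zs * L.+1 <= #|A|)%N /\
    (#|[set j in A | all (fun z => dl < normc (u j - z))%R zs]| <= s)%N.
Proof.
elim/(@ltn_ind): {A}#|A| {-2}A (erefl #|A|) => n IH A nA clA.
have [As|sA] := leqP #|A| s.
  exists [::]; split => //; apply: leq_trans As; apply: subset_leq_card.
  by apply/subsetP => j; rewrite inE => /andP[].
have [z zL] := clA A (subxx A) (ltnW sA).
set Z := [set _ in _ | _] in zL.
have ZA : Z \subset A by apply/subsetP => j; rewrite inE => /andP[].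
have cAZ : (#|A :\: Z| + #|Z| = #|A|)%N by rewrite cardsD (setIidPr ZA) subnK // subset_leq_card.
have lt : (#|A :\: Z| < n)%N by rewrite -nA; lia.
have [B BA|zs [zsL zss]] := IH _ lt (A :\: Z) (erefl _).
  by apply: clA; apply: subset_trans BA _; rewrite subsetDl.
exists (z :: zs); split => /=; first by rewrite mulSn; lia.
apply: leq_trans zss; apply: subset_leq_card; apply/subsetP => j.
by rewrite !inE => /and3P[jA jz ->]; rewrite jA leNgt jz.
Qed.

(** Coordinates up to 2^-m count as zero; from the others, discs are extracted greedily as long as
    at least [s] coordinates remain. Every disc removes more than [L] of them, so at most #|I| /
    (L+1) discs are used. *)
Lemma conc_clustered (u : I -> R[i]) (t dl : R) (m N L k s M : nat) :
  0 <= t -> (0 < N)%N -> (0 < m)%N -> 8 * t <= (2 ^+ m)^-1 * normc y0 ->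
  (forall j, normc (u j) <= 1) -> (4 * m * N <= s)%N -> (#|I| %/ L.+1 <= M)%N ->
  4 * t / normc y0 <= dl -> (2 ^+ m)^-1 <= dl ->
  ~ conc p xi u t (lo_bound N L k) -> clustered M s dl u.
Proof.
move=> t0 N0 m0 tm u1 ms IM d1 d2 nc.
pose A := [set j | (2 ^+ m)^-1 < normc (u j)].
have [|zs [zsL zss]] := @greedy_centers u (4 * t / normc y0) L s A.
  move=> B BA Bs; apply: (cluster_exists t0 N0 m0 tm u1 _ _ nc).
    by move=> j /(subsetP BA); rewrite inE.
  exact: leq_trans ms Bs.
exists zs; first by apply: leq_trans IM; rewrite leq_divRL // (leq_trans zsL) // max_card.
apply: leq_trans zss; apply: subset_leq_card; apply/subsetP => j.
rewrite !inE => /andP[uj /allP ujz]; rewrite (le_lt_trans d2 uj) /=.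
by apply/allP => z /ujz; exact: le_lt_trans.
Qed.

End FromConc.
End Clusters.

(** * The least singular value *)

Section Asymptotics.
Variable R : realType.

Lemma pow_le_exp2 (a : nat) : \forall k \near \oo, (k ^ a <= 2 ^ k)%N.
Proof.
have key k : (k ^ a.+1 <= a.+1 ^ a.+1 * 2 ^ k)%N.
  have h : (k <= a.+1 * 2 ^ (k %/ a.+1))%N.
    have := ltn_expl (k %/ a.+1) (isT : 1 < 2)%N.
    by have := ltn_ceil k (ltn0Sn a); nia.
  rewrite -(@leq_exp2r _ _ a.+1) // expnMn -expnM in h; apply: leq_trans h _.
  by rewrite leq_mul2l leq_exp2l // leq_trunc_div orbT.
near=> k; rewrite -(leq_pmul2l (_ : 0 < k)%N); last by near: k; exact: nbhs_infty_gt.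
rewrite -expnS; apply: leq_trans (key k) _; rewrite leq_mul2r; apply/orP; right.
by near: k; exact: nbhs_infty_ge.
Unshelve. all: by end_near. Qed.

(** The dominant term is of order k^(24-i) / N^(3/2) <= k^(24-i) / k^(25.5) = k^-(i+1.5); the spare
    factor sqrt k absorbs the constants. *)
Lemma lo_bound_small (p0 : R) : 0 < p0 ->
  \forall k \near \oo, forall N i : nat, (k ^ 17 <= N <= k ^ 21)%N -> (i <= 21)%N ->
    lo_bound p0 N (k ^ (24 - i)) k <= (k%:R ^+ i.+1)^-1.
Proof.
move=> p00; have [c [cE c0]] : exists c, c = p0 ^+ 2 / 4 /\ 0 < c.
  by exists (p0 ^+ 2 / 4); rewrite divr_gt0 ?exprn_gt0.
near=> k => N i /andP[Nk1 Nk2] i21.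
pose x : R := k%:R.
have k3 : (6 <= k)%N by near: k; exact: nbhs_infty_ge.
have x1 : 1 <= x by rewrite ler1n; lia.
have x0 : 0 < x by lra.
have xp m : 0 < x ^+ m by rewrite exprn_gt0.
have N17 : x ^+ 17 <= N%:R by rewrite -natrX ler_nat.
have third : (x ^+ 22)^-1 <= (x ^+ i.+1)^-1.
  by rewrite lef_pV2 ?posrE // ler_weXn2l // ltnS.
have e1 : expR (- (c * N%:R)) <= (x ^+ 22)^-1 / 3.
  rewrite expRN -invfM lef_pV2 ?posrE ?expR_gt0 ?mulr_gt0 //.
  apply: le_trans (expR_ge1Dxn 1 _); last by rewrite mulr_ge0 // ltW.
  have h : x ^+ 22 * 3 <= (c * x ^+ 17) ^+ 2 / 2.
    have -> : (c * x ^+ 17) ^+ 2 / 2 = x ^+ 22 * (c ^+ 2 / 2 * x ^+ 12) by field.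
    rewrite ler_pM2l // -ler_pdivrMl ?divr_gt0 ?exprn_gt0 //.
    apply: (@le_trans _ _ x); last by rewrite -[leLHS]expr1 ler_weXn2l.
    by rewrite /x; near: k; exact: nbhs_infty_ger.
  have : (c * x ^+ 17) ^+ 2 <= (c * N%:R) ^+ 2.
    apply: lerXn2r; rewrite ?nnegrE ?ler_pM2l //; apply: mulr_ge0 => //; exact: ltW.
  rewrite (_ : 2`!%:R = 2 :> R) //; lra.
have e2 : N%:R / 2 ^+ k <= (x ^+ 22)^-1 / 3.
  rewrite -invfM ler_pdivrMr ?exprn_gt0 // mulrC ler_pdivlMr ?mulr_gt0 //.
  rewrite -!natrX -!natrM ler_nat.
  apply: (@leq_trans (k ^ 45)); last by near: k; exact: pow_le_exp2.
  apply: (@leq_trans (k ^ 21 * (k ^ 22 * k ^ 1))); last by rewrite -!expnD leq_pexp2l //; lia.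
  by rewrite leq_mul // leq_mul // expn1; lia.
have e3 : (36 * (2 * k ^ (24 - i) + k))%:R / (c * N%:R * Num.sqrt (c * N%:R)) <=
    (x ^+ i.+1)^-1 / 3.
  have h1 : (36 * (2 * k ^ (24 - i) + k))%:R <= 108 * x ^+ (24 - i).
    rewrite -natrX -natrM ler_nat.
    have : (k ^ 1 <= k ^ (24 - i))%N.
      by rewrite leq_pexp2l // ?subn_gt0 ?(leq_ltn_trans i21) // (leq_trans _ k3).
    by rewrite expn1; move: (k ^ _)%N => y; clear; lia.
  have sq : Num.sqrt c * x ^+ 8 * Num.sqrt x <= Num.sqrt (c * N%:R).
    have -> : Num.sqrt c * x ^+ 8 * Num.sqrt x = Num.sqrt (c * x ^+ 17).
      rewrite (exprSr x 16) mulrA sqrtrM; last by apply: mulr_ge0; exact: ltW.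
      by rewrite sqrtrM ?(ltW c0) // (exprM x 8 2) sqrtr_sqr ger0_norm // ltW.
    by apply: ler_wsqrtr; rewrite ler_pM2l.
  have sc : 0 < Num.sqrt c by rewrite sqrtr_gt0.
  have sx : 0 < Num.sqrt x by rewrite sqrtr_gt0.
  have den : c * x ^+ 17 * (Num.sqrt c * x ^+ 8 * Num.sqrt x) <=
     c * N%:R * Num.sqrt (c * N%:R).
    have a0 : 0 <= c * x ^+ 17 by rewrite ltW // mulr_gt0.
    have b0 : 0 <= Num.sqrt c * x ^+ 8 * Num.sqrt x by rewrite ltW // !mulr_gt0.
    by apply: ler_pM => //; rewrite ler_pM2l.
  have dp : 0 < c * x ^+ 17 * (Num.sqrt c * x ^+ 8 * Num.sqrt x) by rewrite !mulr_gt0.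
  apply: (@le_trans _ _ (108 * x ^+ (24 - i) / (c * x ^+ 17 * (Num.sqrt c * x ^+ 8 * Num.sqrt x)))).
    apply: ler_pM => //; first by rewrite invr_ge0 (le_trans (ltW dp)).
    by rewrite lef_pV2 ?posrE // (lt_le_trans dp).
  rewrite -invfM ler_pdivrMr // [leRHS]mulrC ler_pdivlMr ?mulr_gt0 //.
  have e : x ^+ 17 * x ^+ 8 = x ^+ (24 - i) * x ^+ i.+1.
    have ei : (17 + 8 = 24 - i + i.+1)%N.
      have := subnK (leq_trans i21 (isT : 21 <= 24)%N).
      by move: (24 - i)%N => y yi; rewrite [(y + _)%N]addnS yi.
    by rewrite -(exprD x 17 8) -(exprD x (24 - i) i.+1) ei.
  have -> : c * x ^+ 17 * (Num.sqrt c * x ^+ 8 * Num.sqrt x) =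
     (c * Num.sqrt c * Num.sqrt x) * (x ^+ 17 * x ^+ 8).
    by move: (x ^+ 17) (x ^+ 8) => y z; ring.
  have -> : 108 * x ^+ (24 - i) * (x ^+ i.+1 * 3) = 324 * (x ^+ (24 - i) * x ^+ i.+1).
    by move: (x ^+ (24 - i)) (x ^+ i.+1) => y z; ring.
  rewrite e; have := mulr_gt0 (xp (24 - i)%N) (xp i.+1).
  move: (x ^+ (24 - i) * x ^+ i.+1) => y y0.
  rewrite ler_pM2r // [leRHS]mulrC -ler_pdivrMr ?mulr_gt0 //.
  have q0 : 0 <= 324 / (c * Num.sqrt c).
    by apply: divr_ge0; [exact: ler0n|apply: mulr_ge0; exact: ltW].
  rewrite -[leLHS]ger0_norm // -sqrtr_sqr; apply: ler_wsqrtr.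
  by rewrite /x; near: k; exact: nbhs_infty_ger.
rewrite /lo_bound -cE; lra.
Unshelve. all: by end_near. Qed.

(** Large enough that X to this power being at most 2^n forces X <= exp(p0 n/16), which (1 -
    p0)^(n-1) beats. *)
Definition sparse_exp (p0 : R) := (Num.truncn (16 / p0)).+1.

(* Everything the size [n] of the matrix must satisfy, in terms of [k] of order [n ^ (1/20)]. *)
Record regime (y0n p0 : R) (k n : nat) : Prop := Regime {
  rg_k : (100 <= k)%N;
  rg_n : (k ^ 20 <= n <= k ^ 21)%N;
  rg_y : 16 <= y0n * n%:R;
  rg_grid : ((n * (4 * n ^ 140).+1 ^ 2).+1 ^ sparse_exp p0 <= 2 ^ k)%N;
  rg_lo : forall i, (i <= 21)%N ->
    lo_bound p0 (n %/ k ^ 3) (k ^ (24 - i)) k <= (k%:R ^+ i.+1)^-1;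
  rg_sparse : forall X : nat, (X ^ sparse_exp p0 <= 2 ^ n)%N ->
    X%:R * (1 - p0) ^+ n.-1 <= (k%:R ^+ 22)^-1 }.

Lemma sparse_count (p0 : R) : 0 < p0 <= 1 ->
  \forall k \near \oo, forall n X : nat, (k ^ 20 <= n)%N ->
    (X ^ sparse_exp p0 <= 2 ^ n)%N -> X%:R * (1 - p0) ^+ n.-1 <= (k%:R ^+ 22)^-1.
Proof.
move=> /andP[p00 p01]; near=> k => n X kn XN.
set c := sparse_exp p0 in XN.
have k2 : (2 <= k)%N by near: k; exact: nbhs_infty_ge.
have n2 : (2 <= n)%N.
  apply: leq_trans (kn); apply: leq_trans (k2) _.
  by rewrite -{1}(expn1 k) leq_pexp2l // (leq_trans _ k2).
have c16 : 16 / p0 <= c%:R.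
  have p16 : 0 <= 16 / p0 by apply: divr_ge0 => //; exact: ltW.
  by apply: ltW; have /andP[] := truncn_itv p16.
have cpos : 0 < c%:R :> R by rewrite ltr0n.
have hX : X%:R <= expR (p0 / 16 * n%:R).
  apply: (@le_trans _ _ (expR (n%:R / c%:R))); last first.
    rewrite ler_expR mulrC ler_wpM2r // -[leRHS]invrK lef_pV2 ?posrE ?invr_gt0 ?divr_gt0 //.
    by rewrite invf_div.
  rewrite -(@ler_pXn2r _ c) ?nnegrE ?expR_ge0 // -expRM_natl mulrC divfK ?gt_eqF //.
  apply: (@le_trans _ _ (2 ^+ n)); first by rewrite -!natrX ler_nat.
  rewrite -[n%:R]mulr1 expRM_natl lerXn2r ?nnegrE ?expR_ge0 //.
  by apply: le_trans (expR_ge1Dx 1); lra.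
have hp : (1 - p0) ^+ n.-1 <= expR (- (p0 / 2 * n%:R)).
  apply: (@le_trans _ _ (expR (- p0) ^+ n.-1)).
    by rewrite lerXn2r ?nnegrE ?expR_ge0 ?subr_ge0 // expR_ge1Dx.
  rewrite -expRM_natl ler_expR -subn1 natrB ?(ltnW n2) //.
  have : 2 <= n%:R :> R by rewrite ler_nat.
  nra.
apply: (@le_trans _ _ (expR (p0 / 16 * n%:R) * expR (- (p0 / 2 * n%:R)))).
  by rewrite ler_pM // exprn_ge0 // subr_ge0.
rewrite -expRD; apply: (@le_trans _ _ (expR (- (p0 / 4 * n%:R)))).
  by rewrite ler_expR; have := ler0n R n; nra.
pose x : R := k%:R.
have x1 : 1 <= x by rewrite ler1n ltnW.
have xn : x ^+ 20 <= n%:R by rewrite -natrX ler_nat.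
have x0 : 0 < x by lra.
rewrite expRN lef_pV2 ?posrE ?expR_gt0 ?exprn_gt0 //.
apply: le_trans (expR_ge1Dxn 1 _); last by rewrite mulr_ge0 // divr_ge0 // ltW.
rewrite (_ : 2`!%:R = 2 :> R) //.
apply: (@le_trans _ _ ((p0 / 4 * x ^+ 20) ^+ 2 / 2)); last first.
  apply: ler_wpDl => //; rewrite ler_pM2r ?invr_gt0 //; apply: lerXn2r.
  - by rewrite nnegrE mulr_ge0 ?exprn_ge0 ?divr_ge0 // ltW.
  - by rewrite nnegrE mulr_ge0 ?divr_ge0 // ltW.
  by rewrite ler_pM2l // divr_gt0.
have -> : (p0 / 4 * x ^+ 20) ^+ 2 / 2 = p0 ^+ 2 / 32 * x ^+ 40 by field.
rewrite (exprD x 22 18) mulrCA ler_peMr ?exprn_ge0 ?(ltW x0) //.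
rewrite -ler_pdivrMl ?divr_gt0 ?exprn_gt0 // mulr1.
apply: (@le_trans _ _ x); last by rewrite -[leLHS]expr1 ler_weXn2l.
by rewrite /x; near: k; exact: nbhs_infty_ger.
Unshelve. all: by end_near. Qed.

Lemma regime_near (y0n p0 : R) : 0 < y0n -> 0 < p0 <= 1 ->
  \forall k \near \oo, forall n, (k ^ 20 <= n <= k ^ 21)%N -> regime y0n p0 k n.
Proof.
move=> y0 p01; near=> k => n /andP[kn nk].
have k100 : (100 <= k)%N by near: k; exact: nbhs_infty_ge.
have k0 : (0 < k)%N by apply: leq_trans k100.
have n0 : (0 < n)%N by apply: leq_trans kn; rewrite expn_gt0 k0.
have le1 a b : (a <= b)%N -> (k ^ a <= k ^ b)%N by move=> ab; rewrite leq_pexp2l.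
have lo : forall N i : nat, (k ^ 17 <= N <= k ^ 21)%N -> (i <= 21)%N ->
    lo_bound p0 N (k ^ (24 - i)) k <= (k%:R ^+ i.+1)^-1.
  by near: k; apply: lo_bound_small; case/andP: p01.
have sc : forall n X : nat, (k ^ 20 <= n)%N ->
    (X ^ sparse_exp p0 <= 2 ^ n)%N -> X%:R * (1 - p0) ^+ n.-1 <= (k%:R ^+ 22)^-1.
  by near: k; exact: sparse_count.
split => //.
- by rewrite kn.
- rewrite mulrC -ler_pdivrMr //; apply: (@le_trans _ _ k%:R).
    by near: k; exact: nbhs_infty_ger.
  by rewrite ler_nat; apply: leq_trans kn; rewrite -[leqLHS]expn1 le1.
- have h : ((n * (4 * n ^ 140).+1 ^ 2).+1 <= k ^ (21 * 281 + 1))%N.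
    apply: (@leq_trans (26 * n ^ 281)).
      have : (0 < n ^ 140)%N by rewrite expn_gt0 n0.
      have -> : (n ^ 281 = n * (n ^ 140 * n ^ 140))%N by rewrite -expnD -expnS.
      by move: (n ^ 140)%N => y; nia.
    rewrite expnD expn1 mulnC expnM leq_mul //; last exact: leq_trans k100.
    by rewrite leq_exp2r.
  apply: (@leq_trans ((k ^ (21 * 281 + 1)) ^ sparse_exp p0)); first by rewrite leq_exp2r.
  by rewrite -expnM; near: k; exact: pow_le_exp2.
- move=> i i21; apply: lo => //.
  rewrite (leq_trans (leq_div _ _) nk) andbT leq_divRL ?expn_gt0 ?k0 //.
  by rewrite -expnD.
- by move=> X; exact: sc.
Unshelve. all: by end_near. Qed.

End Asymptotics.

Lemma leq_expl (a b e : nat) : (a <= b)%N -> (a ^ e <= b ^ e)%N.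
Proof. by case: e => // e ab; rewrite leq_exp2r. Qed.

Section LeastSingularValue.
Import boot.fintype boot.finset.
Local Open Scope set_scope.
Local Open Scope ring_scope.
Local Open Scope complex_scope.
Variables (R : realType) (V : finType) (p : law R V) (xi : V -> R[i]).
Variables (y0 : R[i]) (p0 : R) (k n : nat).
Hypothesis sp : spread p xi y0 p0.
Hypothesis rg : regime (normc y0) p0 k n.
Hypothesis xi_le : forall v, normc (xi v) <= n%:R ^+ 3.

Let y : R := n%:R.
Let x : R := k%:R.
Let s : nat := (4 * k * (n %/ k ^ 3))%N.
(** Radii of the multiscale argument. A factor n^6 separates consecutive ones, more than the 16 n^5
    lost when a vector known to precision 2n t(i+1) is paired with a row of entries bounded by
    n^3. *)
Let t (i : nat) : R := (y ^+ (8 + 6 * i))^-1.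

Lemma p0_le1 : p0 <= 1.
Proof.
by have [_ _ [D1 [_ [D1p _ _]]]] := sp; apply: le_trans D1p (pr1_le1 _ _).
Qed.

Lemma k_gt0 : (0 < k)%N. Proof. by apply: leq_trans (rg_k rg). Qed.

Lemma k_le_n : (k <= n)%N.
Proof.
have /andP[h _] := rg_n rg; apply: leq_trans h; rewrite -[leqLHS]expn1.
by rewrite leq_pexp2l // k_gt0.
Qed.

Lemma n_ge : (100 <= n)%N. Proof. exact: leq_trans (rg_k rg) k_le_n. Qed.

Lemma y_ge : 100 <= y. Proof. by rewrite ler_nat n_ge. Qed.

Lemma yV_le (a b : nat) : (a <= b)%N -> (y ^+ b)^-1 <= (y ^+ a)^-1.
Proof.
have := y_ge => yg ab; rewrite lef_pV2 ?posrE ?exprn_gt0 //; try lra.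
by rewrite ler_weXn2l //; lra.
Qed.

Lemma x_gt0 : 0 < x. Proof. by rewrite ltr0n k_gt0. Qed.

Lemma t_gt0 i : 0 < t i.
Proof. by rewrite invr_gt0 exprn_gt0 //; have := y_ge; lra. Qed.

Lemma tS i : t i = y ^+ 6 * t i.+1.
Proof.
have y0' : y != 0 by rewrite gt_eqF //; have := y_ge; lra.
rewrite /t (_ : (8 + 6 * i.+1 = 6 + (8 + 6 * i))%N); last by lia.
rewrite (exprD y 6 (8 + 6 * i)).
have h6 : y ^+ 6 != 0 by rewrite expf_neq0.
have h8 : y ^+ (8 + 6 * i) != 0 by rewrite expf_neq0.
by move: (y ^+ 6) (y ^+ (8 + 6 * i)) h6 h8 => a b a0 b0; field; rewrite a0 b0.
Qed.

Lemma t_le (i : nat) : t i <= y^-1.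
Proof.
have := y_ge => yg; rewrite lef_pV2 ?posrE ?exprn_gt0 //; try lra.
by rewrite -[leLHS]expr1 ler_weXn2l //; lra.
Qed.

Lemma grid_le : (((4 * n ^ 140).+1 ^ 2) <= 2 ^ k)%N /\ ((n * (4 * n ^ 140).+1 ^ 2).+1 <= 2 ^ k)%N.
Proof.
have h : ((n * (4 * n ^ 140).+1 ^ 2).+1 <= 2 ^ k)%N.
  apply: leq_trans (rg_grid rg); rewrite -[leqLHS]expn1 leq_pexp2l //.
split => //; apply: leq_trans h; apply: leqW; rewrite leq_pmull //.
exact: leq_trans n_ge.
Qed.

Lemma s_le : (s * k <= 4 * (n %/ k))%N /\ (s <= n %/ k)%N.
Proof.
have kg := rg_k rg; have k0 := k_gt0.
have h : (k ^ 2 * (n %/ k ^ 3) <= n %/ k)%N.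
  by rewrite leq_divRL // -mulnA [(_ * k)%N]mulnC mulnA -expnSr mulnC leq_trunc_div.
split; rewrite /s; first by move: h; rewrite -mulnn; move: (n %/ k ^ 3)%N (n %/ k)%N => a b; nia.
apply: leq_trans h; rewrite leq_mul2r -mulnn leq_mul2r; apply/orP; right; apply/orP; right.
exact: leq_trans kg.
Qed.

Lemma sparse_codes r : (r <= n %/ k)%N ->
  (1 ^ n * ((4 * n ^ 140).+1 ^ 2) ^ 0 * (n * (4 * n ^ 140).+1 ^ 2).+1 ^ r)%:R *
  (1 - p0) ^+ n.-1 <= (x ^+ 22)^-1.
Proof.
move=> rn; rewrite exp1n expn0 !mul1n; apply: (rg_sparse rg).
rewrite expnAC; apply: leq_trans (_ : ((2 ^ k) ^ r <= _)%N).
  by apply: leq_expl; exact: (rg_grid rg).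
rewrite -expnM leq_pexp2l //; apply: (leq_trans _ (leq_trunc_div n k)).
by rewrite mulnC leq_mul2r rn orbT.
Qed.

(** Labels cost (M+1)^n with M <= k^(i-3), grid points and exceptions together at most 2^n, while
    n-1 rows gain k^(-i(n-1)). The missing k^(3n) pays for 4^n <= k^(2n), for the lost row and for
    k^22. *)
Lemma struct_codes i : (4 <= i <= 21)%N ->
  ((n %/ (k ^ (24 - i)).+1).+1 ^ n * ((4 * n ^ 140).+1 ^ 2) ^ (n %/ (k ^ (24 - i)).+1)
   * (n * (4 * n ^ 140).+1 ^ 2).+1 ^ s)%:R * (x ^+ i)^-1 ^+ n.-1 <= (x ^+ 22)^-1.
Proof.
move=> /andP[i4 i21].
have e21 : (i - 3 + (24 - i) = 21)%N by clear -i4 i21; lia.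
have [j ej] : exists j, i = (j + 4)%N by exists (i - 4)%N; clear -i4; lia.
set M := (n %/ _)%N; have [g1 g2] := grid_le.
have [sk _] := s_le; have kg := rg_k rg; have k0 := k_gt0.
have /andP[nk1 nk2] := rg_n rg.
have M1 : (M <= k ^ (i - 3))%N.
  rewrite -ltnS ltn_divLR // (leq_ltn_trans nk2) //.
  apply: (@leq_trans (k ^ (i - 3) * (k ^ (24 - i)).+1)); last first.
    by move: (k ^ (i - 3))%N (k ^ (24 - i)).+1%N => a b; rewrite leq_mul2r leqnSn orbT.
  rewrite mulnS -expnD e21.
  by rewrite -[X in (X < _)%N]add0n ltn_add2r expn_gt0 k0.
have M2 : (k * M <= n %/ k)%N.
  rewrite leq_divRL //; apply: leq_trans nk1.
  apply: (@leq_trans (k * k ^ (i - 3) * k)).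
    by rewrite leq_mul2r leq_mul2l M1 !orbT.
  by rewrite -expnS -expnSr leq_pexp2l //; clear -i21; lia.
have nk : (n %/ k * 100 <= n)%N.
  by apply: (leq_trans _ (leq_trunc_div n k)); rewrite leq_mul2l kg orbT.
rewrite exprVn -exprM -[leLHS]mulrC ler_pdivrMl ?exprn_gt0 ?x_gt0 //.
rewrite mulrC ler_pdivlMl ?exprn_gt0 ?x_gt0 // -!natrX -natrM ler_nat.
apply: (@leq_trans (k ^ 22 * ((2 ^ n * (k ^ (i - 3)) ^ n) * 2 ^ n))).
  rewrite leq_mul2l -mulnA leq_mul ?orbT //.
    by rewrite -expnMn; apply: leq_expl; move: M1; move: (k ^ _)%N (expn_gt0 k (i - 3)) => a; rewrite k0 -ltnS; clear; lia.
  apply: (@leq_trans ((2 ^ k) ^ M * (2 ^ k) ^ s)); first by rewrite leq_mul // leq_expl.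
  rewrite -!expnM -expnD leq_pexp2l //.
  by move: sk M2 nk; rewrite [(s * k)%N]mulnC; move: (k * s)%N (k * M)%N (n %/ k)%N; clear; lia.
rewrite -!expnM.
have : (2 ^ n * 2 ^ n <= k ^ (2 * n))%N.
  by rewrite -expnMn expnM; apply: leq_expl; rewrite (leq_trans _ (leq_trans kg (leq_pmulr k k0))).
move=> h; apply: (@leq_trans (k ^ 22 * (k ^ ((i - 3) * n) * k ^ (2 * n)))).
  by rewrite leq_mul2l [X in (X <= _)%N]mulnAC [X in (X <= _)%N]mulnC leq_mul2l h !orbT.
rewrite -!expnD leq_pexp2l //.
have n0 : (0 < n)%N by apply: leq_trans n_ge.
rewrite -(prednK n0) ej (_ : j + 4 - 3 = j.+1)%N; last by clear; lia.
have n98 : (98 <= n.-1)%N by rewrite -ltnS prednK // (leq_trans _ n_ge).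
by move: n98 i21; rewrite ej /=; move: (n.-1) => n' n98 j17; clear -n98 j17; nia.
Qed.

Lemma sub_conc (I : finType) (u : I -> R[i]) (a a' c c' : R) :
  a' <= a -> c <= c' -> conc p xi u a c -> conc p xi u a' c'.
Proof.
move=> aa cc uc b; apply: le_trans (le_trans (uc b) cc).
by apply: le_Pr => m /le_trans; apply.
Qed.

Lemma t_conc (I : finType) (u : I -> R[i]) (T : R) : T <= y^-1 ->
  (exists j, normc (u j) = 1) -> conc p xi u T (1 - p0).
Proof.
move=> Ty [j uj]; apply: (conc_coord sp uj).
have yg := y_ge; have := rg_y rg; rewrite -/y -ler_pdivrMr; last by lra.
have := mulVf (_ : y != 0); rewrite gt_eqF; last by lra.
move: (y^-1) Ty => z Ty /(_ isT) yz h.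
have z0 : 0 < z by rewrite -(pmulr_lgt0 _ (_ : 0 < y)) ?yz //; lra.
by lra.
Qed.

Section Rows.
Variables (I K E : finType) (h : K -> I -> E) (A0 : K -> I -> R[i]).
Hypothesis h_inj : forall k k' i i', h k i = h k' i' -> k = k' /\ i = i'.
Hypothesis A0_le : forall k i, normc (A0 k i) <= y ^+ 3.
Hypothesis cI : #|I| = n.

(** With no centre at all the codes are so few that the trivial gain 1 - p0 per row of [conc_coord]
    suffices. *)
Lemma sparse_bound (T : R) : (n.-1 <= #|K|)%N -> 0 <= T <= (y ^+ 2)^-1 ->
  Pr p (fun m => exists u, [/\ forall j, normc (u j) <= 1, exists j, normc (u j) = 1,
     (#|[set j | ((y ^+ 6)^-1 < normc (u j))%R]| <= n %/ k)%N &
     forall k, normc (form xi h A0 u m k) <= T]) <= (x ^+ 22)^-1.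
Proof.
move=> cK /andP[T0 T1]; have yg := y_ge.
have p1 := p0_le1; have p00 : 0 < p0 by have [_ []] := sp.
apply: le_trans (sparse_codes (leqnn _)).
apply: (@le_trans _ _ ((1 ^ n * ((4 * n ^ 140).+1 ^ 2) ^ 0 *
    (n * (4 * n ^ 140).+1 ^ 2).+1 ^ (n %/ k))%:R * (1 - p0) ^+ #|K|)); last first.
  by apply: ler_wpM2l => //; rewrite ler_wiXn2l //; lra.
pose Psi (u : I -> R[i]) := exists j, normc (u j) = 1.
have c0 : 0 <= 1 - p0 by lra.
have D0 : (0 < n ^ 140)%N by rewrite expn_gt0; have := n_ge; case: (n).
have dl01 : 0 <= (y ^+ 6)^-1 <= 1.
  rewrite invr_ge0 exprn_ge0 ?invf_le1 ?exprn_gt0 ?exprn_ege1 //; lra.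
have := @net_bound _ _ p xi I K E h h_inj A0 (y ^+ 3) (n ^ 140) 0 (n %/ k) (y ^+ 6)^-1
   A0_le xi_le Psi T (1 - p0) D0 dl01 c0.
rewrite cI => nb; apply: le_trans (nb _); last first.
  move=> u _ _ [j uj]; apply: t_conc; last by exists j.
  have y2 : (n ^ 140)%:R^-1 <= (y ^+ 6)^-1.
    by rewrite natrX -/y; exact: yV_le.
  have -> : T + n%:R * (2 * y ^+ 3) * (2 * ((y ^+ 6)^-1 + 2 / (n ^ 140)%:R)) =
     T + 4 * y ^+ 4 * ((y ^+ 6)^-1 + 2 * (n ^ 140)%:R^-1) by rewrite -/y; ring.
  have y4 : 0 <= 4 * y ^+ 4 by rewrite mulr_ge0 ?exprn_ge0 //; lra.
  have : 4 * y ^+ 4 * ((y ^+ 6)^-1 + 2 * (n ^ 140)%:R^-1) <= 4 * y ^+ 4 * (3 * (y ^+ 6)^-1).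
    by apply: ler_wpM2l => //; lra.
  have -> : 4 * y ^+ 4 * (3 * (y ^+ 6)^-1) = 12 * (y ^+ 2)^-1 by field; lra.
  have : 100 * (y ^+ 2)^-1 <= y^-1.
    by rewrite expr2 invfM mulrA ler_piMl ?invr_ge0 ?ler_pdivrMr ?mul1r //; lra.
  have : 0 < (y ^+ 2)^-1 by rewrite invr_gt0 exprn_gt0 //; lra.
  lra.
apply: le_Pr => m [u [u1 uj us uT]]; exists u; split => //.
exists [::] => //; apply: leq_trans us; apply: subset_leq_card.
by apply/subsetP => j; rewrite !inE andbT.
Qed.

Lemma struct_step (u : I -> R[i]) (i : nat) : (i <= 21)%N ->
  (forall j, normc (u j) <= 1) -> ~ conc p xi u (t i.+1) (x ^+ i.+1)^-1 ->
  clustered (n %/ (k ^ (24 - i)).+1) s (2 * y * t i.+1) u.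
Proof.
move=> i21 u1 nc; have yg := y_ge; have ng := n_ge.
(* The dyadic depth for which 2^-m lies between n t(i+1) and twice that; it must not exceed [k], so
   that the exceptions fit in [s]. *)
pose m := trunc_log 2 (n ^ (7 + 6 * i.+1)).
have n1 : (1 < n)%N by apply: leq_trans ng.
have pn : (0 < n ^ (7 + 6 * i.+1))%N by rewrite expn_gt0 (ltnW n1).
have tE : y ^+ (7 + 6 * i.+1) = (y * t i.+1)^-1.
  rewrite /t (_ : 8 + 6 * i.+1 = (7 + 6 * i.+1).+1)%N // exprS.
  have yn0 : y != 0 by rewrite gt_eqF //; lra.
  have : y ^+ (7 + 6 * i.+1) != 0 by rewrite expf_neq0.
  by move: (y ^+ (7 + 6 * i.+1)) => a an0; field; rewrite yn0 an0.
have t0 := t_gt0 i.+1.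
have yt0 : 0 < y * t i.+1 by apply: mulr_gt0 => //; lra.
have m1 : 2 ^+ m * (y * t i.+1) <= 1.
  rewrite -ler_pdivlMr // mul1r -tE -!natrX ler_nat /m; exact: trunc_logP.
have m2 : (2 ^+ m)^-1 <= 2 * (y * t i.+1).
  have : (y * t i.+1)^-1 <= 2 ^+ m.+1.
    by rewrite -tE -!natrX ler_nat; apply: ltnW; exact: trunc_log_ltn.
  rewrite -[leLHS]mul1r ler_pdivrMr // -[leLHS]mul1r => hm.
  rewrite -[leLHS]mul1r ler_pdivrMr ?exprn_gt0 //; move: hm; rewrite exprS.
  by move: (2 ^+ m) (y * t i.+1) => a b; nra.
have y01 := rg_y rg; rewrite -/y in y01.
have mk : (m <= k)%N.
  rewrite -(@leq_exp2l 2) //; apply: leq_trans (_ : n ^ (7 + 6 * i.+1) <= _)%N.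
    exact: trunc_logP.
  have [g _] := grid_le; apply: leq_trans g.
  apply: (@leq_trans (n ^ 140)); first by rewrite leq_pexp2l ?(ltnW n1) //; clear -i21; lia.
  by move: (n ^ 140)%N => a; rewrite -mulnn; clear; nia.
have m0 : (0 < m)%N.
  rewrite trunc_log_gt0 //=; apply: leq_trans (n1) _.
  by rewrite -[leqLHS]expn1 leq_pexp2l // ltnW.
have N0 : (0 < n %/ k ^ 3)%N.
  rewrite divn_gt0 ?expn_gt0 ?k_gt0 //; have /andP[hn _] := rg_n rg.
  by apply: leq_trans hn; rewrite leq_pexp2l // k_gt0.
have m3 : 8 * t i.+1 <= (2 ^+ m)^-1 * normc y0.
  rewrite [leRHS]mulrC ler_pdivlMr ?exprn_gt0 //.
  rewrite -(ler_pM2l (_ : 0 < y)); last by lra.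
  move: m1; move: (2 ^+ m) (t i.+1) => a b; nra.
have Y0 : 0 < normc y0 by rewrite -(pmulr_lgt0 _ (_ : 0 < y)) //; lra.
apply: (@conc_clustered _ _ _ p xi y0 p0 sp u (t i.+1) _ m (n %/ k ^ 3) (k ^ (24 - i)) k) => //.
- exact: ltW.
- by rewrite /s leq_mul2r leq_mul2l mk !orbT.
- by rewrite cI.
- rewrite ler_pdivrMr //; move: t0 y01 Y0; move: (t i.+1) (normc y0) => a b; nra.
- by rewrite -mulrA.
- move=> hc; apply: nc; apply: sub_conc hc => //; exact: (rg_lo rg).
Qed.

(** Level 0 of the ladder of bounds k^-i at radius t i is trivial and level 22 fails, so some i
    holds while i+1 fails. The failure at i+1 makes the vector clustered, hence described by few
    codes; the success at i gives k^-i per row, and [struct_codes] compares the two. For i <= 3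
    there is no centre because n <= k^21, and 1 - p0 per row is enough. *)
Lemma struct_bound : #|K| = n.-1 ->
  Pr p (fun m => exists u, [/\ forall j, normc (u j) <= 1, exists j, normc (u j) = 1,
     ~ conc p xi u (t 22) (x ^+ 22)^-1 & forall k, form xi h A0 u m k = 0])
  <= 22 * (x ^+ 22)^-1.
Proof.
move=> cK; have yg := y_ge; have p1 := p0_le1; have p00 : 0 < p0 by have [_ []] := sp.
pose Psi i (u : I -> R[i]) := conc p xi u (t i) (x ^+ i)^-1 /\ exists j, normc (u j) = 1.
pose Ev (i : 'I_22) (m : {ffun E -> V}) := exists u, [/\ forall j, normc (u j) <= 1,
  clustered (n %/ (k ^ (24 - i)).+1) s (2 * y * t i.+1) u, Psi i u &
  forall k, normc (form xi h A0 u m k) <= 0].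
apply: (@le_trans _ _ (Pr p (fun m => exists i, Ev i m))).
  apply: le_Pr => m [u [u1 uj nc uk]].
  have [i [i1 i2]] : exists i : 'I_22, conc p xi u (t i) (x ^+ i)^-1 /\
      ~ conc p xi u (t i.+1) (x ^+ i.+1)^-1.
    apply: contrapT => no; apply: nc.
    have : forall i, (i <= 22)%N -> conc p xi u (t i) (x ^+ i)^-1.
      elim=> [_ a|i IH i22]; first by rewrite expr0 invr1 Pr_le1.
      apply: contrapT => ni; apply: no; exists (Ordinal i22); split => //=.
      by apply: IH; exact: ltnW.
    exact.
  exists i, u; split => //; first by apply: struct_step => //; rewrite -ltnS.
  by move=> k'; rewrite uk ComplexField.Normc.normc0.
apply: (le_trans (Pr_exists _ _)); apply: (@le_trans _ _ (\sum_(i < 22) (x ^+ 22)^-1)).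
  2: by rewrite sumr_const card_ord mulr_natl.
apply: ler_sum => i _; have i21 : (i <= 21)%N by rewrite -ltnS.
have D0 : (0 < n ^ 140)%N by rewrite expn_gt0; have := n_ge; case: (n).
have t0 := t_gt0 i.+1.
have yt : y * t i.+1 <= (y ^+ 6)^-1.
  rewrite -ler_pdivlMl; last by lra.
  by rewrite -invfM -exprS; apply: yV_le; clear; lia.
have y6 : 2 * (y ^+ 6)^-1 <= 1.
  rewrite mulrC ler_pdivrMl ?exprn_gt0 ?mulr1 //; try lra.
  by apply: (@le_trans _ _ y); [lra|rewrite -[leLHS]expr1 ler_weXn2l //; lra].
have dl01 : 0 <= 2 * y * t i.+1 <= 1.
  by rewrite -mulrA; apply/andP; split; [rewrite !mulr_ge0 ?(ltW t0) //; lra|lra].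
have D1 : (n ^ 140)%:R^-1 <= t i.+1.
  by rewrite natrX -/y; apply: yV_le; clear -i21; lia.
have Tt : 0 + #|I|%:R * (2 * y ^+ 3) * (2 * (2 * y * t i.+1 + 2 / (n ^ 140)%:R)) <= t i.
  rewrite cI add0r -/y (tS i).
  have -> : y * (2 * y ^+ 3) * (2 * (2 * y * t i.+1 + 2 / (n ^ 140)%:R)) =
     8 * y ^+ 4 * (y * t i.+1 + (n ^ 140)%:R^-1) by ring.
  apply: (@le_trans _ _ (8 * y ^+ 4 * (2 * (y * t i.+1)))).
    apply: ler_wpM2l; first by rewrite mulr_ge0 ?exprn_ge0 //; lra.
    have : t i.+1 <= y * t i.+1 by rewrite ler_peMl ?(ltW t0) //; lra.
    lra.
  have -> : 8 * y ^+ 4 * (2 * (y * t i.+1)) = (16 * y ^+ 5) * t i.+1 by ring.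
  rewrite (ler_pM2r t0) (exprS y 5) ler_wpM2r ?exprn_ge0 //; lra.
have := @net_bound _ _ p xi I K E h h_inj A0 (y ^+ 3) (n ^ 140)
   (n %/ (k ^ (24 - i)).+1) s (2 * y * t i.+1) A0_le xi_le (Psi i) 0.
move=> /(_ _ D0 dl01) nb; have [i3|i4] := leqP i 3.
  have M0 : (n %/ (k ^ (24 - i)).+1 = 0)%N.
    rewrite divn_small // ltnS; have /andP[_ hn] := rg_n rg; apply: leq_trans hn _.
    by rewrite leq_pexp2l ?k_gt0 //; clear -i3; lia.
  apply: le_trans (nb (1 - p0) _ _) _; first by lra.
    by move=> u _ _ [_ uj]; apply: t_conc => //; apply: le_trans Tt (t_le _).
  rewrite M0 cI cK; have := sparse_codes (s_le).2; exact.
have c0 : 0 <= (x ^+ i)^-1 by rewrite invr_ge0 exprn_ge0 // ltW // x_gt0.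
apply: le_trans (nb (x ^+ i)^-1 c0 _) _.
  by move=> u _ _ [uc _]; apply: sub_conc uc.
by rewrite cI cK; apply: struct_codes; rewrite i4.
Qed.

End Rows.
Section Square.
Variable A0 : 'I_n -> 'I_n -> R[i].
Hypothesis A0_le : forall i j, normc (A0 i j) <= y ^+ 3.

Let W (m : {ffun 'I_n * 'I_n -> V}) i j : R[i] := A0 i j + xi (m (i, j)).

Definition unit_sup (u : 'I_n -> R[i]) :=
  (forall j, normc (u j) <= 1) /\ exists j, normc (u j) = 1.

Lemma scale_sup (u : 'I_n -> R[i]) : (exists j, u j != 0) ->
  exists2 a, a != 0 & unit_sup (fun j => a * u j).
Proof.
move=> [j0 uj0]; pose j := [arg max_(j > j0) normc (u j)]%O.
have [jm] : exists jm, forall j, normc (u j) <= normc (u jm).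
  by exists j => l; rewrite /j; case: arg_maxP => // i _; apply.
move=> jmP; have um : 0 < normc (u jm) by apply: lt_le_trans (jmP j0); rewrite normc_gt0.
exists (u jm)^-1; first by rewrite invr_eq0 -normc_gt0.
split=> [l|]; last by exists jm; rewrite normcM normcV mulVf // gt_eqF.
by rewrite normcM normcV mulrC ler_pdivrMr // mul1r.
Qed.

(** Quantified over every unit normal of the other rows, so that the event can be tested on one
    normal chosen independently of row [i]. *)
Definition row_bad i m := forall u, unit_sup u ->
  (forall i', i' != i -> \sum_c W m i' c * u c = 0) -> normc (\sum_c W m i c * u c) <= t 22.

(** A null vector of the matrix whose row [i] is replaced by zero. *)
Lemma row_normal i m : exists2 u, unit_sup u &
  forall i', i' != i -> \sum_c W m i' c * u c = 0.
Proof.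
pose A := \matrix_(a, b) (if a == i then 0 else W m a b).
have dA : \det A = 0.
  rewrite (expand_det_row A i) big1 // => j _.
  by rewrite mxE eqxx mul0r.
have /det0P[v v0 vA] : \det A^T == 0 by rewrite det_tr dA.
have [|a a0 ua] := @scale_sup (fun j => v 0 j).
  apply: contrapT => h; case/negP: v0; apply/eqP/rowP => j; rewrite mxE.
  by apply/eqP; apply: contrapT => /negP vj; apply: h; exists j.
exists (fun j => a * v 0 j) => // i' ii'; have /matrixP/(_ 0 i') := vA.
rewrite !mxE => h; transitivity (a * \sum_j v 0 j * A^T j i'); last by rewrite h mulr0.
rewrite mulr_sumr; apply: eq_bigr => c _.
by rewrite !mxE (negPf ii') mulrCA [W _ _ _ * _]mulrC.
Qed.

(** The other rows determine a normal. Either it is structured, which has probability at most 22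
    k^-22, or row [i], independent of it, pairs with it below t 22 with probability at most
    k^-22. *)
Lemma row_bad_small i : Pr p (row_bad i) <= 23 * (x ^+ 22)^-1.
Proof.
pose K := {i' : 'I_n | i' != i}.
pose h (i' : K) (c : 'I_n) := (val i', c).
have h_inj k1 k2 i1 i2 : h k1 i1 = h k2 i2 -> k1 = k2 /\ i1 = i2.
  by move=> [/val_inj ? ?].
have cK : #|{: K}| = n.-1 by rewrite card_sig (cardC1 i) card_ord.
pose F m := exists u, [/\ forall j, normc (u j) <= 1, exists j, normc (u j) = 1,
     ~ conc p xi u (t 22) (x ^+ 22)^-1 & forall k, form xi h (fun k c => A0 (val k) c) u m k = 0].
have FP : Pr p F <= 22 * (x ^+ 22)^-1.
  by apply: struct_bound => //; rewrite card_ord.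
pose S := [set (i, c) | c in 'I_n].
have xS m m' c i' : i' != i -> mix S m m' (i', c) = m (i', c).
  move=> ii'; rewrite ffunE; case: imsetP => // -[c' _ [e _]].
  by rewrite e eqxx in ii'.
have xS' m m' c : mix S m m' (i, c) = m' (i, c) by rewrite ffunE imset_f.
apply: (@le_trans _ _ (Pr p F + Pr p (fun m => row_bad i m /\ ~ F m))).
  apply: le_trans (Pr_or _ _ _); apply: le_Pr => m bm.
  by have [f|f] := pselect (F m); [left|right].
suff : Pr p (fun m => row_bad i m /\ ~ F m) <= (x ^+ 22)^-1 by move: FP; lra.
have x22 : 0 <= (x ^+ 22)^-1 by rewrite invr_ge0 exprn_ge0 // ltW // x_gt0.
apply: (@le_trans _ _ ((x ^+ 22)^-1 * Pr p (fun m => ~ F m))); last first.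
  by rewrite ler_piMr // Pr_le1.
apply: (Pr_mix_le (S := S)) => [m nF|m m' nF [u [u1 u2 u3 u4]]]; last first.
  apply: nF; exists u; split => // i'; rewrite -[RHS](u4 i') /form.
  by apply: eq_bigr => c _; rewrite xS // (valP i').
have [u uu un] := row_normal i m.
have uc : conc p xi u (t 22) (x ^+ 22)^-1.
  apply: contrapT => nc; apply: nF; exists u; case: (uu) => u1 u2; split => // i'.
  exact: (un _ (valP i')).
have hi : injective (fun c : 'I_n => (i, c)) by move=> ? ? [].
apply: le_trans (uc (- \sum_c A0 i c * u c)).
rewrite [leRHS]/Pr -(Ex_marginal p _ hi); apply: le_Ex => m'; apply: ind_le => /(_ u uu).
rewrite (_ : \sum_c W _ i c * u c = rsum xi u [ffun c => m' (i, c)] - - \sum_c A0 i c * u c).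
  apply=> i' ii'; rewrite -[RHS](un _ ii'); apply: eq_bigr => c _.
  by rewrite /W xS.
rewrite opprK /rsum -big_split; apply: eq_bigr => c _.
by rewrite /W xS' ffunE mulrDl addrC.
Qed.

(** For a normal u of the other rows, evaluating v^T W u in two ways leaves v_i times the pairing of
    row [i] with u. It is at most n * n^-147, and dividing by |v_i| > n^-6 yields n^-140 = t 22. *)
Lemma many_rows_bad (m : {ffun 'I_n * 'I_n -> V}) (v : 'I_n -> R[i]) i : unit_sup v ->
  (forall c, normc (\sum_i W m i c * v i) <= (y ^+ 147)^-1) ->
  (y ^+ 6)^-1 < normc (v i) -> row_bad i m.
Proof.
move=> [v1 v2] vT vi u [u1 _] un; have yg := y_ge.
have y6 : 0 < (y ^+ 6)^-1 by rewrite invr_gt0 exprn_gt0 //; lra.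
have e : v i * (\sum_c W m i c * u c) = \sum_c (\sum_i W m i c * v i) * u c.
  transitivity (\sum_i' v i' * \sum_c W m i' c * u c).
    by rewrite [RHS](bigD1 i) //= [X in _ + X]big1 ?addr0 // => i' /un ->; rewrite mulr0.
  under eq_bigr do rewrite mulr_sumr; rewrite exchange_big; apply: eq_bigr => c _ /=.
  by rewrite mulr_suml; apply: eq_bigr => i' _; rewrite mulrCA mulrA.
have b : normc (v i) * normc (\sum_c W m i c * u c) <= y * (y ^+ 147)^-1.
  rewrite -normcM e; apply: (@le_trans _ _ (\sum_(c < n) (y ^+ 147)^-1)); last first.
    by rewrite sumr_const card_ord mulr_natl.
  elim/big_ind2: _ => [|a a' c c' ac ac'|c _].
  - by rewrite ComplexField.Normc.normc0.
  - by apply: (le_trans (le_normcD _ _)); rewrite lerD.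
  rewrite normcM -[leRHS]mulr1; apply: ler_pM; rewrite ?normc_ge0 //; exact: vT.
have b2 : (y ^+ 6)^-1 * normc (\sum_c W m i c * u c) <= y * (y ^+ 147)^-1.
  by apply: le_trans b; apply: ler_wpM2r (ltW vi); exact: normc_ge0.
have p6 : 0 < y ^+ 6 by rewrite exprn_gt0 //; lra.
move: b2; rewrite mulrC ler_pdivrMr //.
rewrite /t (_ : y / y ^+ 147 * y ^+ 6 = y ^- (8 + 6 * 22)) //.
rewrite (_ : 147 = (1 + 6 + (8 + 6 * 22)))%N // 2!exprD expr1.
have y0' : y != 0 by rewrite gt_eqF //; lra.
have h6 : y ^+ 6 != 0 by rewrite expf_neq0.
have h8 : y ^+ (8 + 6 * 22) != 0 by rewrite expf_neq0.
by move: (y ^+ 6) (y ^+ (8 + 6 * 22)) h6 h8 => a c an cn; field; rewrite an cn y0'.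
Qed.

(** The almost null vector is sparse, or more than n/k rows are bad. At most 23 n k^-22 rows are bad
    on average, so Markov's inequality loses a factor of order k where a union bound over the rows
    would lose n. *)
Lemma least_singular : Pr p (fun m => exists2 v, unit_sup v &
  forall c, normc (\sum_i W m i c * v i) <= (y ^+ 147)^-1) <= 47 * (x ^+ 21)^-1.
Proof.
have yg := y_ge; have x0 := x_gt0.
pose Sp (m : {ffun 'I_n * 'I_n -> V}) := exists u, [/\ forall j, normc (u j) <= 1,
   exists j, normc (u j) = 1,
   (#|[set j | ((y ^+ 6)^-1 < normc (u j))%R]| <= n %/ k)%N &
     forall k, normc (form xi (fun c i => (i, c)) (fun c i => A0 i c) u m k) <= (y ^+ 147)^-1].
have Sp_le : Pr p Sp <= (x ^+ 22)^-1.
  apply: sparse_bound; rewrite ?card_ord ?leq_pred //; first by move=> ? ? ? ? [].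
  by rewrite yV_le // invr_ge0 exprn_ge0 //; lra.
pose f m := \sum_i ind R (row_bad i m).
have s0 : (0 < n %/ k)%N by rewrite divn_gt0 ?k_gt0 // k_le_n.
have s0' : 0 < (n %/ k)%:R :> R by rewrite ltr0n.
apply: (@le_trans _ _ (Pr p Sp + Pr p (fun m => (n %/ k)%:R <= f m))).
  apply: le_trans (Pr_or _ _ _); apply: le_Pr => m [v [v1 v2] vT].
  pose B := [set j | ((y ^+ 6)^-1 < normc (v j))%R].
  have [Bs|sB] := leqP #|B| (n %/ k); [left|right]; first by exists v; split.
  rewrite /f (bigID (mem B)) /= (eq_bigr (fun=> 1)) => [|i].
    rewrite sumr_const -[leLHS]addr0; apply: lerD; first by rewrite ler_nat ltnW.
    by apply: sumr_ge0 => i _; exact: ind_ge0.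
  by rewrite inE => iB; rewrite indT //; apply: many_rows_bad iB.
have Pf : Pr p (fun m => (n %/ k)%:R <= f m) <= 46 * (x ^+ 21)^-1.
  apply: le_trans (Pr_markov _ _ _) _ => //.
    by move=> m; apply: sumr_ge0 => i _; exact: ind_ge0.
  rewrite ler_pdivrMr // Ex_sum.
  apply: (@le_trans _ _ (\sum_(i < n) 23 * (x ^+ 22)^-1)).
    by apply: ler_sum => i _; exact: row_bad_small.
  rewrite sumr_const card_ord -[leLHS]mulr_natl -/y.
  have yk : y <= 2 * x * (n %/ k)%:R.
    rewrite -natrM -natrM ler_nat; have := ltn_ceil n k_gt0.
    by have := k_gt0; move: (n %/ k)%N s0 => a; clear; nia.
  apply: le_trans (_ : (2 * x * (n %/ k)%:R) * (23 * (x ^+ 22)^-1) <= _).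
    by apply: ler_wpM2r => //; rewrite mulr_ge0 // invr_ge0 exprn_ge0 // ltW.
  rewrite (exprS x 21); have : x ^+ 21 != 0 by rewrite expf_neq0 // gt_eqF.
  move: (x ^+ 21) => a a0; rewrite le_eqVlt; apply/orP; left; apply/eqP; field.
  by rewrite a0 gt_eqF.
have : (x ^+ 22)^-1 <= (x ^+ 21)^-1.
  rewrite lef_pV2 ?posrE ?exprn_gt0 // ler_weXn2l // /x ler1n; exact: k_gt0.
lra.
Qed.

End Square.
End LeastSingularValue.

(** * Resolvents of Gram matrices *)

Section Resolvent.
Local Open Scope sesquilinear_scope.
Variable R : realType.
Local Notation C := R[i].

Lemma conjC_normc (z : C) : Num.conj z * z = (normc z ^+ 2)%:C.
Proof.
case: z => a b; apply/eqP; rewrite eq_complex /= sqr_sqrtr ?addr_ge0 ?sqr_ge0 //.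
by rewrite [X in _ && X](_ : _ = true); [rewrite andbT; apply/eqP; ring|apply/eqP; ring].
Qed.

Lemma conjC_real (x : R) : Num.conj (x%:C : C) = x%:C.
Proof. by apply/eqP; rewrite eq_complex /= oppr0 !eqxx. Qed.

Lemma Re_sum (I : finType) (F : I -> C) : complex.Re (\sum_i F i) = \sum_i complex.Re (F i).
Proof. by elim/big_ind2: _ => [|a b c d <- <-|] //; case: b => ? ?; case: d. Qed.

Lemma ReD (z w : C) : complex.Re (z + w) = complex.Re z + complex.Re w.
Proof. by case: z; case: w. Qed.

Lemma ReN (z : C) : complex.Re (- z) = - complex.Re z.
Proof. by case: z. Qed.

Lemma ReZ (x : R) (z : C) : complex.Re (x%:C * z) = x * complex.Re z.
Proof. by case: z => a b /=; rewrite mul0r subr0. Qed.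

Lemma Re_conjC (z : C) : complex.Re (Num.conj z) = complex.Re z.
Proof. by case: z. Qed.

Lemma real_Csum (I : finType) (F : I -> R) : (\sum_i F i)%:C = \sum_i (F i)%:C.
Proof. by rewrite rmorph_sum. Qed.

Lemma trmxCM m n p (A : 'M[C]_(m, n)) (B : 'M[C]_(n, p)) :
  (A *m B)^t* = B^t* *m A^t*.
Proof. by rewrite trmx_mul map_mxM. Qed.

Lemma trmxCD m n (A B : 'M[C]_(m, n)) : (A + B)^t* = A^t* + B^t*.
Proof. by rewrite linearD map_mxD. Qed.

Definition sqn m (z : 'cV[C]_m) : R := \sum_i normc (z i 0) ^+ 2.

Lemma sqn_ge0 m (z : 'cV[C]_m) : 0 <= sqn z.
Proof. by apply: sumr_ge0 => i _; exact: sqr_ge0. Qed.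

Lemma sqn_eq0 m (z : 'cV[C]_m) : sqn z = 0 -> z = 0.
Proof.
move=> /eqP; rewrite psumr_eq0 => [/allP h|i _]; last exact: sqr_ge0.
apply/colP => i; rewrite mxE; have := h i (mem_index_enum _).
rewrite sqrf_eq0 => /eqP; exact: ComplexField.Normc.eq0_normc.
Qed.

Lemma sqnE m (z : 'cV[C]_m) : z^t* *m z = ((sqn z)%:C)%:M.
Proof.
apply/matrixP => i j; rewrite !ord1 !mxE eqxx mulr1n real_Csum.
by apply: eq_bigr => l _; rewrite !mxE conjC_normc.
Qed.

Section Fixed.
Variables (n l : nat) (B : 'M[C]_(n, l)) (u : R).
Hypothesis u0 : 0 < u.

Definition reg : 'M[C]_n := B *m B^t* + (u%:C)%:M.
Definition res := invmx reg.

Lemma reg_herm : reg^t* = reg.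
Proof.
rewrite /reg trmxCD trmxCM trmxCK tr_scalar_mx; congr (_ + _).
by apply/matrixP => i j; rewrite !mxE rmorphMn /= conjC_real.
Qed.

Lemma reg_form (z : 'cV[C]_n) :
  z^t* *m reg *m z = ((sqn (B^t* *m z) + u * sqn z)%:C)%:M.
Proof.
rewrite /reg mulmxDr mulmxDl rmorphD raddfD /= -sqnE trmxCM trmxCK !mulmxA; congr (_ + _).
by rewrite mul_mx_scalar -scalemxAl sqnE rmorphM /= scale_scalar_mx.
Qed.

Lemma reg_unit : reg \in unitmx.
Proof.
rewrite unitmxE unitfE; apply/negP => /det0P[v v0 vA].
have := reg_form (v^t*); rewrite trmxCK vA mul0mx => /matrixP/(_ 0 0).
rewrite !mxE eqxx mulr1n => /(congr1 (@complex.Re R)) /= h.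
have : sqn (v^t*) = 0.
  have := sqn_ge0 (v^t*); have := sqn_ge0 (B^t* *m v^t*); move: h u0.
  by move: (sqn _) (sqn _) => a b; nra.
move=> /sqn_eq0 vv; case/negP: v0; apply/eqP; rewrite -(trmxCK v) vv.
by apply/matrixP => i j; rewrite !mxE rmorph0.
Qed.

Lemma reg_res : reg *m res = 1%:M.
Proof. by rewrite mulmxV // reg_unit. Qed.

Lemma res_uniq (A : 'M[C]_n) : reg *m A = 1%:M -> res = A.
Proof. by move=> h; rewrite -[RHS](mulKmx reg_unit) h mulmx1. Qed.

Lemma res_herm : res^t* = res.
Proof. by rewrite /res trmx_inv map_invmx /= -[in RHS]reg_herm. Qed.

(** The value of z^* (B B^* + u)^-1 z, in a form that is visibly real and nonnegative; see
    [rformE]. *)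
Definition rform (z : 'cV[C]_n) : R := sqn (B^t* *m (res *m z)) + u * sqn (res *m z).

Lemma rform_ge (z : 'cV[C]_n) : u * sqn (res *m z) <= rform z.
Proof. by rewrite lerDr sqn_ge0. Qed.

Lemma rform_scale (x : R) (z : 'cV[C]_n) : rform (x%:C *: z) = x ^+ 2 * rform z.
Proof.
have sZ m (v : 'cV[C]_m) : sqn (x%:C *: v) = x ^+ 2 * sqn v.
  rewrite /sqn mulr_sumr; apply: eq_bigr => i _; rewrite mxE normcM exprMn; congr (_ * _).
  by rewrite /= expr0n addr0 sqr_sqrtr ?sqr_ge0.
by rewrite /rform -!scalemxAr !sZ mulrDr mulrCA.
Qed.

Lemma rform_ge0 (z : 'cV[C]_n) : 0 <= rform z.
Proof. by apply: le_trans (rform_ge z); rewrite mulr_ge0 ?sqn_ge0 // ltW. Qed.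

Lemma rformE (z : 'cV[C]_n) : z^t* *m res *m z = ((rform z)%:C)%:M.
Proof.
by rewrite -reg_form trmxCM res_herm -!mulmxA [reg *m _]mulmxA reg_res mul1mx.
Qed.

Definition rtr : R := complex.Re (\tr res).

Lemma col_form m (A : 'M[C]_n) (D : 'M[C]_(n, m)) i :
  (D^t* *m A *m D) i i = ((col i D)^t* *m A *m col i D) 0 0.
Proof.
rewrite !mxE; apply: eq_bigr => a _; rewrite !mxE; congr (_ * _).
by apply: eq_bigr => b _; rewrite !mxE.
Qed.

Lemma rtr_sum : u * rtr = n%:R - \sum_j rform (col j B).
Proof.
have : \tr (reg *m res) = n%:R by rewrite reg_res mxtrace1.
rewrite {1}/reg mulmxDl raddfD /= mul_scalar_mx linearZ /= -mulmxA mxtrace_mulC.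
have -> : \tr (B^t* *m res *m B) = ((\sum_j rform (col j B))%:C).
  rewrite /mxtrace real_Csum; apply: eq_bigr => j _.
  by rewrite col_form rformE mxE eqxx mulr1n.
move=> /(congr1 (@complex.Re R)); rewrite ReD ReZ -/rtr /= => h.
move: h; have -> : complex.Re (n%:R : C) = n%:R.
  by elim: (n) => // a IH; rewrite -natr1 ReD IH -natr1.
lra.
Qed.

End Fixed.

Section RankOne.
Variables (n l : nat) (B : 'M[C]_(n, l)) (u : R) (j : 'I_l).
Hypothesis u0 : 0 < u.

Definition zcol : 'M[C]_(n, l) := \matrix_(a, b) (if b == j then 0 else B a b).

Let c := col j B.
Let x : R := rform zcol u c.

Lemma reg_zcol : reg B u = reg zcol u + c *m c^t*.
Proof.
rewrite /reg addrAC; congr (_ + _); apply/matrixP => a b; rewrite !mxE.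
rewrite (bigD1 j) //= addrC [X in _ = X + _](bigD1 j) //= !mxE eqxx mul0r add0r.
rewrite big_ord1 !mxE; congr (_ + _); apply: eq_bigr => k kj.
by rewrite !mxE (negPf kj).
Qed.

(** Sherman-Morrison formula for the rank one contribution of column [j]. *)
Lemma res_zcol : res B u = res zcol u -
  ((1 + x)^-1%:C) *: ((res zcol u *m c) *m (res zcol u *m c)^t*).
Proof.
have x1 : 1 + x != 0 by rewrite gt_eqF // ltr_pwDl // rform_ge0.
have e : reg B u *m (res zcol u *m c) = (1 + x)%:C *: c.
  rewrite reg_zcol mulmxDl mulmxA reg_res // mul1mx -mulmxA [c^t* *m _]mulmxA rformE //.
  have -> : (1 + x)%:C = 1 + x%:C by apply/eqP; rewrite eq_complex /= addr0 !eqxx.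
  by rewrite mul_mx_scalar -/x scalerDl scale1r.
apply: res_uniq => //; rewrite mulmxBr -scalemxAr mulmxA e trmxCM res_herm -scalemxAl.
rewrite scalerA -rmorphM mulVf //= scale1r reg_zcol mulmxDl reg_res // mulmxA.
by rewrite addrK.
Qed.

Lemma rform_col : rform B u c = x / (1 + x).
Proof.
have x1 : 1 + x != 0 by rewrite gt_eqF // ltr_pwDl // rform_ge0.
have /matrixP/(_ 0 0) := rformE B u0 c.
have e1 : c^t* *m (res zcol u *m c) = x%:C%:M by rewrite mulmxA rformE.
have e2 : (res zcol u *m c)^t* *m c = x%:C%:M by rewrite trmxCM res_herm rformE.
rewrite res_zcol mulmxBr mulmxBl -[_ *m res _ _ *m _]mulmxA e1 -scalemxAr -scalemxAl.
rewrite [c^t* *m (_ *m _^t*)]mulmxA e1 -mulmxA e2 -scalar_mxM scale_scalar_mx -raddfB /=.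
rewrite !mxE eqxx !mulr1n -!rmorphM -rmorphB /= => /complexI <-; field.
by rewrite x1.
Qed.

(** The correction is u |R c|^2 / (1 + c^* R c), R the resolvent without column [j], and u R^2 <=
    R. *)
Lemma rtr_zcol : 0 <= u * rtr zcol u - u * rtr B u <= 1.
Proof.
have x0 : 0 <= x by rewrite rform_ge0.
have -> : u * rtr zcol u - u * rtr B u = u * sqn (res zcol u *m c) / (1 + x).
  have e : \tr (res B u) =
      \tr (res zcol u) - (1 + x)^-1%:C * (sqn (res zcol u *m c))%:C.
    by rewrite res_zcol linearB linearZ /= mxtrace_mulC sqnE mxtrace_scalar mulr1n.
  rewrite /rtr e ReD ReN ReZ /=; ring.
have h := rform_ge zcol u c; rewrite -/x in h.
have s0 : 0 <= u * sqn (res zcol u *m c) by rewrite mulr_ge0 ?sqn_ge0 // ltW.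
apply/andP; split; first by rewrite divr_ge0 //; lra.
by rewrite ler_pdivrMr; lra.
Qed.

End RankOne.

(** The self-consistent equation: column [j] enters through its form against the resolvent built
    from the other columns, of which it is independent in the random model. *)
Lemma rtr_self (n : nat) (B : 'M[C]_n) (u : R) : 0 < u ->
  u * rtr B u = \sum_j (1 + rform (zcol B j) u (col j B))^-1.
Proof.
move=> u0; rewrite rtr_sum //.
rewrite (_ : n%:R = \sum_(j < n) (1 : R)); last by rewrite sumr_const card_ord.
rewrite -sumrB; apply: eq_bigr => j _; rewrite rform_col //.
have := rform_ge0 (zcol B j) u0 (col j B); move: (rform _ _ _) => x x0.
by field; rewrite gt_eqF //; lra.
Qed.

End Resolvent.

(** * Anticoncentration of quadratic forms *)

Section Signs.
Import boot.fintype boot.finset.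
Local Open Scope set_scope.
Local Open Scope ring_scope.
Local Open Scope complex_scope.
Variable R : realType.

Lemma Ex_swap (V W I J : finType) (p : law R V) (q : law R W)
    (F : {ffun I -> V} -> {ffun J -> W} -> R) :
  Ex p (fun m => Ex q (F m)) = Ex q (fun e => Ex p (F^~ e)).
Proof.
rewrite /Ex; under eq_bigr do rewrite mulr_sumr.
rewrite exchange_big; apply: eq_bigr => e _; rewrite mulr_sumr.
by apply: eq_bigr => m _; rewrite mulrCA.
Qed.

Lemma coin_ge0 (b : bool) : 0 <= 1 / 2 :> R. Proof. lra. Qed.
Lemma coin_sum : \sum_(b : bool) 1 / 2 = 1 :> R.
Proof. by rewrite big_bool /=; lra. Qed.
Definition coin : law R bool := Law coin_ge0 coin_sum.

Definition sg (b : bool) : R := if b then 1 else -1.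

Lemma sg_sqr b : sg b * sg b = 1.
Proof. by case: b; rewrite /= ?mulrNN mulr1. Qed.

Lemma sgN b : sg (~~ b) = - sg b.
Proof. by case: b; rewrite /= ?opprK. Qed.

Section Flip.
Variable I : finType.

Definition flip (i : I) (e : {ffun I -> bool}) : {ffun I -> bool} :=
  [ffun j => if j == i then ~~ e j else e j].

Lemma Ex_flip i f : Ex coin (fun e => f (flip i e)) = Ex coin f.
Proof.
apply: (@Ex_push _ _ _ _ coin coin (fun j b => if j == i then ~~ b else b)) => j b.
by rewrite big_mkcond big_bool /=; case: (j == i) => /=; case: b => /=; lra.
Qed.

Lemma Ex_odd i f : (forall e, f (flip i e) = - f e) -> Ex coin f = 0.
Proof.
move=> fi; have := Ex_flip i f; rewrite (eq_Ex _ fi) ExN; lra.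
Qed.

Lemma Ex_orthogonal (T : finType) (P : pred T) (chi : T -> {ffun I -> bool} -> R)
    (c : T -> R) :
  (forall t e, chi t e * chi t e = 1) ->
  (forall t t', P t -> P t' -> t != t' -> Ex coin (fun e => chi t e * chi t' e) = 0) ->
  Ex coin (fun e => (\sum_(t | P t) c t * chi t e) ^+ 2) = \sum_(t | P t) c t ^+ 2.
Proof.
move=> chi1 chi0; under eq_Ex => e do rewrite expr2 mulr_suml.
rewrite Ex_sum; apply: eq_bigr => t Pt; under eq_Ex => e do rewrite mulr_sumr.
rewrite Ex_sum (bigD1 t) //= [X in _ + X]big1 ?addr0 => [|t' /andP[Pt' tt']].
  rewrite -[RHS](Ex_cst I coin); apply: eq_Ex => e.
  by rewrite mulrACA chi1 mulr1 -expr2.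
under eq_Ex => e do rewrite mulrACA.
by rewrite ExZ chi0 ?mulr0 // eq_sym.
Qed.

End Flip.

Section Quadratic.
Variables (n : nat) (Q : 'I_n -> 'I_n -> R[i]).

Definition qform (z : 'I_n -> R[i]) : R :=
  complex.Re (\sum_i \sum_j Num.conj (z i) * Q i j * z j).

Hypothesis Q_herm : forall i j, Num.conj (Q i j) = Q j i.
Hypothesis Q_contr : forall z, \sum_i normc (\sum_j Q i j * z j) ^+ 2 <= qform z.

Lemma qform_ge0 z : 0 <= qform z.
Proof. by apply: le_trans (Q_contr z); apply: sumr_ge0 => i _; exact: sqr_ge0. Qed.

Lemma Q_col i : \sum_j normc (Q j i) ^+ 2 <= complex.Re (Q i i).
Proof.
pose z (j : 'I_n) : R[i] := (j == i)%:R.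
have Qz k : \sum_j Q k j * z j = Q k i.
  rewrite (bigD1 i) //= /z eqxx mulr1 big1 ?addr0 // => j /negPf ->; exact: mulr0.
have <- : qform z = complex.Re (Q i i).
  rewrite /qform (bigD1 i) //= [X in _ + X]big1 ?addr0 => [|j /negPf ji].
    rewrite -[in RHS](Qz i); congr complex.Re; apply: eq_bigr => j _.
    by rewrite /z eqxx rmorph1 mul1r.
  by rewrite /z ji big1 // => k _; rewrite rmorph0 !mul0r.
by apply: le_trans (Q_contr z); apply: ler_sum => j _; rewrite Qz.
Qed.

Lemma Q_diag i : 0 <= complex.Re (Q i i) <= 1.
Proof.
have c0 : 0 <= complex.Re (Q i i).
  by apply: le_trans (Q_col i); apply: sumr_ge0 => j _; exact: sqr_ge0.
have h : normc (Q i i) ^+ 2 <= complex.Re (Q i i).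
  apply: le_trans (Q_col i); rewrite [leRHS](bigD1 i) //= lerDl.
  by apply: sumr_ge0 => j _; exact: sqr_ge0.
have r := le_trans (ler_norm _) (Re_le_normc (Q i i)).
rewrite c0 /=; move: c0 h r (normc_ge0 (Q i i)).
by move: (normc _) (complex.Re _) => a b; nra.
Qed.

Lemma sum_sym (F : 'I_n -> 'I_n -> R) : (forall i j, F i j = F j i) ->
  \sum_i \sum_j F i j = \sum_i F i i + \sum_(t : 'I_n * 'I_n | (t.1 < t.2)%N) 2 * F t.1 t.2.
Proof.
move=> Fs; have swapK : involutive (fun t : 'I_n * 'I_n => (t.2, t.1)) by case.
rewrite pair_bigA /= (bigID (fun t : 'I_n * 'I_n => t.1 == t.2)) /=; congr (_ + _).
  rewrite (reindex_onto (fun i : 'I_n => (i, i)) fst) /=.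
    by apply: eq_bigl => i; rewrite !eqxx.
  by move=> [i j] /= /eqP ->.
rewrite (bigID (fun t : 'I_n * 'I_n => (t.1 < t.2)%N)) /=.
rewrite [X in _ + X](reindex_inj (inv_inj swapK)) /=.
under [RHS]eq_bigr do rewrite mulr_natl mulr2n.
rewrite big_split /=; congr (_ + _).
  by apply: eq_bigl => -[i j] /=; rewrite neq_ltn; case: ltngtP.
apply: eq_big => [[i j]|[i j] _] /=; last exact: Fs.
by rewrite neq_ltn -leqNgt; case: ltngtP.
Qed.

(** Two distinct pairs leave an index that occurs an odd number of times; flipping its sign negates
    the product. *)
Lemma sign_pairs (t t' : 'I_n * 'I_n) : (t.1 < t.2)%N -> (t'.1 < t'.2)%N -> t != t' ->
  Ex coin (fun e : {ffun 'I_n -> bool} => sg (e t.1) * sg (e t.2) * (sg (e t'.1) * sg (e t'.2))) = 0.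
Proof.
case: t t' => [i j] [a b] /= ij ab ne.
have lone k : (k == i) (+) (k == j) (+) ((k == a) (+) (k == b)) ->
  Ex coin (fun e : {ffun 'I_n -> bool} => sg (e i) * sg (e j) * (sg (e a) * sg (e b))) = 0.
  move=> h; apply: (@Ex_odd _ k) => e; rewrite !ffunE.
  move: h; rewrite ![k == _]eq_sym.
  by case: (i == k) (j == k) (a == k) (b == k) => [] [] [] [] //= _; rewrite !sgN; ring.
have ijn : (i == j) = false by apply/eqP => e; rewrite e ltnn in ij.
have abn : (a == b) = false by apply/eqP => e; rewrite e ltnn in ab.
have [ia|ia] := eqVneq i a.
  have bj : (j == b) = false by apply/eqP => e; rewrite ia e eqxx in ne.
  have bi : (j == a) = false by rewrite -ia eq_sym.
  by apply: (lone j); rewrite eqxx [j == i]eq_sym ijn bj bi.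
have [ib|ib] := eqVneq i b.
  have ja : (j == a) = false.
    by apply/eqP => e; rewrite e ib in ij; have := ltn_trans ij ab; rewrite ltnn.
  have jb : (j == b) = false by rewrite -ib eq_sym.
  by apply: (lone j); rewrite eqxx [j == i]eq_sym ijn ja jb.
by apply: (lone i); rewrite eqxx ijn (negPf ia) (negPf ib).
Qed.

Section Tail.
Variables (b w : 'I_n -> R[i]) (W : R).
Hypothesis w_le : forall i, normc (w i) <= W.

Let D : R := \sum_i complex.Re (Q i i) * normc (w i) ^+ 2.
Let l (i : 'I_n) : R := 2 * complex.Re (Num.conj (w i) * \sum_j Q i j * b j).
Let a (i j : 'I_n) : R := complex.Re (Num.conj (w i) * Q i j * w j).

Lemma a_sym i j : a i j = a j i.
Proof.
rewrite /a -Re_conjC !rmorphM /= conjCK Q_herm; congr complex.Re.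
ring.
Qed.

Lemma qform_signs (e : {ffun 'I_n -> bool}) :
  qform (fun i => b i + (sg (e i))%:C * w i) = qform b + D + (\sum_i l i * sg (e i)
   + \sum_(t : 'I_n * 'I_n | (t.1 < t.2)%N) (2 * a t.1 t.2) * (sg (e t.1) * sg (e t.2))).
Proof.
pose F i j := sg (e i) * sg (e j) * a i j.
have Fs i j : F i j = F j i by rewrite /F a_sym [sg _ * _]mulrC.
have -> : \sum_(t : 'I_n * 'I_n | (t.1 < t.2)%N) (2 * a t.1 t.2) * (sg (e t.1) * sg (e t.2))
   = \sum_i \sum_j F i j - D.
  rewrite (sum_sym Fs) [X in _ = X + _ - _](_ : _ = D) => [|].
    by rewrite [X in _ = X - _]addrC addrK; apply: eq_bigr => t _; rewrite /F; ring.
  apply: eq_bigr => i _; rewrite /F sg_sqr mul1r /a mulrAC conjC_normc mulrC.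
  by case: (Q i i) => x y /=; ring.
have -> : \sum_i l i * sg (e i) =
   complex.Re (\sum_i \sum_j Num.conj ((sg (e i))%:C * w i) * Q i j * b j)
   + complex.Re (\sum_i \sum_j Num.conj (b i) * Q i j * ((sg (e j))%:C * w j)).
  have h1 i : complex.Re (\sum_j Num.conj ((sg (e i))%:C * w i) * Q i j * b j) =
     sg (e i) * complex.Re (Num.conj (w i) * \sum_j Q i j * b j).
    rewrite -ReZ mulrA mulr_sumr; congr complex.Re; apply: eq_bigr => j _.
    by rewrite rmorphM /= conjC_real !mulrA.
  rewrite [X in _ = X + _]Re_sum -[X in _ = _ + X]Re_conjC.
  have -> : Num.conj (\sum_i \sum_j Num.conj (b i) * Q i j * ((sg (e j))%:C * w j)) =
     \sum_i \sum_j Num.conj ((sg (e i))%:C * w i) * Q i j * b j.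
    transitivity (\sum_i \sum_j Num.conj (Num.conj (b i) * Q i j * ((sg (e j))%:C * w j))).
      by rewrite rmorph_sum; apply: eq_bigr => i _; rewrite rmorph_sum.
    rewrite exchange_big; apply: eq_bigr => i _; apply: eq_bigr => j _ /=.
    rewrite !rmorphM /= conjCK Q_herm conjC_real; ring.
  rewrite Re_sum -big_split; apply: eq_bigr => i _; rewrite /= h1 /l; ring.
have -> : \sum_i \sum_j F i j = complex.Re (\sum_i \sum_j
    Num.conj ((sg (e i))%:C * w i) * Q i j * ((sg (e j))%:C * w j)).
  rewrite Re_sum; apply: eq_bigr => i _; rewrite Re_sum; apply: eq_bigr => j _.
  rewrite /F /a -ReZ; congr complex.Re.
  rewrite [Num.conj (_%:C * _)]rmorphM /= conjC_real [(sg _ * sg _)%:C]rmorphM /=; ring.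
rewrite /qform [D]lock addrAC -lock.
rewrite (_ : \sum_i \sum_j Num.conj (b i + (sg (e i))%:C * w i) * Q i j * (b j + (sg (e j))%:C * w j)
  = \sum_i \sum_j Num.conj (b i) * Q i j * b j
  + (\sum_i \sum_j Num.conj ((sg (e i))%:C * w i) * Q i j * b j
  + \sum_i \sum_j Num.conj (b i) * Q i j * ((sg (e j))%:C * w j))
  + \sum_i \sum_j Num.conj ((sg (e i))%:C * w i) * Q i j * ((sg (e j))%:C * w j)).
  rewrite !ReD; ring.
rewrite -!big_split; apply: eq_bigr => i _; rewrite -!big_split; apply: eq_bigr => j _ /=.
rewrite rmorphD /=; ring.
Qed.

(** The form equals its value Nb at [b] plus D plus a linear and a quadratic sum of orthogonal sign
    products. As Q^2 <= Q, their second moments are at most 4 W^2 Nb and 4 W^2 D, and Chebyshev's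
    inequality gives 32 W^2 / (Nb + D): the unknown Nb raises the mean enough to pay for the
    variance it adds. *)
Lemma sign_quad : 0 < D ->
  Pr coin (fun e : {ffun 'I_n -> bool} =>
    qform (fun i => b i + (sg (e i))%:C * w i) <= D / 2) <= 32 * W ^+ 2 / D.
Proof.
move=> D0; have b0 := qform_ge0 b; set Nb := qform b in b0.
pose f e := \sum_i l i * sg ((e : {ffun 'I_n -> bool}) i)
   + \sum_(t : 'I_n * 'I_n | (t.1 < t.2)%N) (2 * a t.1 t.2) * (sg (e t.1) * sg (e t.2)).
have M0 : 0 < (Nb + D) ^+ 2 / 4 by rewrite divr_gt0 ?exprn_gt0 //; lra.
have W0 : 0 <= W ^+ 2 by exact: sqr_ge0.
apply: (@le_trans _ _ (Pr coin (fun e => (Nb + D) ^+ 2 / 4 <= f e ^+ 2))).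
  apply: le_Pr => e; rewrite qform_signs -/Nb -/(f e) => h.
  have : (Nb + D) / 2 <= - f e by lra.
  rewrite -[f e ^+ 2]sqrrN (_ : _ / 4 = ((Nb + D) / 2) ^+ 2); last by field.
  by move=> h2; rewrite lerXn2r ?nnegrE //; lra.
apply: le_trans (Pr_markov _ _ M0) _ => [e|]; first exact: sqr_ge0.
have w2 i : normc (w i) ^+ 2 <= W ^+ 2.
  by rewrite lerXn2r ?nnegrE ?normc_ge0 //; apply: le_trans (w_le i); exact: normc_ge0.
have Re2 (z : R[i]) : complex.Re z ^+ 2 <= normc z ^+ 2.
  rewrite -[complex.Re z ^+ 2]real_normK ?num_real // lerXn2r ?nnegrE ?normc_ge0 //.
  exact: Re_le_normc.
have conjN (z : R[i]) : normc (Num.conj z) = normc z by case: z => x y /=; rewrite sqrrN.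
have El : Ex coin (fun e : {ffun 'I_n -> bool} => (\sum_i l i * sg (e i)) ^+ 2) <=
    4 * W ^+ 2 * Nb.
  rewrite (@Ex_orthogonal _ _ predT (fun i (e : {ffun 'I_n -> bool}) => sg (e i))) => [|i e|i j _ _ ij].
  - apply: (@le_trans _ _ (\sum_i 4 * W ^+ 2 * normc (\sum_j Q i j * b j) ^+ 2)).
      apply: ler_sum => i _; rewrite /l exprMn -mulrA (_ : 2 ^+ 2 = 4); last by ring.
      rewrite ler_pM2l //; apply: le_trans (Re2 _) _; rewrite normcM conjN exprMn.
      by apply: ler_wpM2r (w2 i); exact: sqr_ge0.
    by rewrite -mulr_sumr ler_wpM2l ?Q_contr // mulr_ge0.
  - exact: sg_sqr.
  - apply: (@Ex_odd _ i) => e; rewrite !ffunE eqxx eq_sym (negPf ij) sgN; ring.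
have Ea : Ex coin (fun e : {ffun 'I_n -> bool} => (\sum_(t : 'I_n * 'I_n | (t.1 < t.2)%N)
    (2 * a t.1 t.2) * (sg (e t.1) * sg (e t.2))) ^+ 2) <= 4 * W ^+ 2 * D.
  rewrite (@Ex_orthogonal _ _ (fun t : 'I_n * 'I_n => (t.1 < t.2)%N)
    (fun t (e : {ffun 'I_n -> bool}) => sg (e t.1) * sg (e t.2))) => [|t e|t t']; last first.
  - exact: sign_pairs.
  - by rewrite mulrACA !sg_sqr mulr1.
  apply: (@le_trans _ _ (\sum_i \sum_j 4 * a i j ^+ 2)).
    rewrite pair_bigA /= big_mkcond /=; apply: ler_sum => t _.
    have a2 := sqr_ge0 (a t.1 t.2); case: ifP => _; last by rewrite mulr_ge0.
    by rewrite le_eqVlt; apply/orP; left; apply/eqP; ring.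
  rewrite exchange_big mulr_sumr; apply: ler_sum => j _ /=.
  apply: (@le_trans _ _ (\sum_i (4 * W ^+ 2 * normc (w j) ^+ 2) * normc (Q i j) ^+ 2)).
    apply: ler_sum => i _.
    have : a i j ^+ 2 <= W ^+ 2 * (normc (Q i j) ^+ 2 * normc (w j) ^+ 2).
      apply: le_trans (Re2 _) _; rewrite !normcM conjN !exprMn -[leLHS]mulrA.
      apply: (ler_pM _ _ (w2 i) (lexx _)); first exact: sqr_ge0.
      by apply: mulr_ge0; exact: sqr_ge0.
    by move: (a i j ^+ 2) (W ^+ 2) (normc _ ^+ 2) (normc _ ^+ 2) => x y z t; lra.
  rewrite -mulr_sumr [complex.Re _ * _]mulrC [leRHS]mulrA; apply: ler_wpM2l (Q_col j).
  by apply: mulr_ge0; [exact: mulr_ge0|exact: sqr_ge0].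
rewrite ler_pdivrMr //.
apply: (@le_trans _ _ (2 * (4 * W ^+ 2 * Nb) + 2 * (4 * W ^+ 2 * D))).
  apply: (@le_trans _ _ (2 * Ex coin (fun e : {ffun 'I_n -> bool} => (\sum_i l i * sg (e i)) ^+ 2)
    + 2 * Ex coin (fun e : {ffun 'I_n -> bool} => (\sum_(t : 'I_n * 'I_n | (t.1 < t.2)%N)
    (2 * a t.1 t.2) * (sg (e t.1) * sg (e t.2))) ^+ 2))); last lra.
  rewrite -!ExZ -ExD; apply: le_Ex => e; rewrite /f.
  set x := \sum_i l i * _; set y := \sum_(_ | _) _.
  by have := sqr_ge0 (x - y); move: x y => x y; nra.
have -> : 32 * W ^+ 2 / D * ((Nb + D) ^+ 2 / 4) = 8 * W ^+ 2 * ((Nb + D) ^+ 2 / D).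
  by field; rewrite gt_eqF.
have -> : 2 * (4 * W ^+ 2 * Nb) + 2 * (4 * W ^+ 2 * D) = 8 * W ^+ 2 * (Nb + D) by ring.
apply: ler_wpM2l; first by rewrite mulr_ge0.
by rewrite ler_pdivlMr // expr2 ler_wpM2l //; lra.
Qed.

End Tail.
End Quadratic.
End Signs.

Section QuadTail.
Import boot.fintype boot.finset.
Local Open Scope set_scope.
Local Open Scope ring_scope.
Local Open Scope complex_scope.
Variables (R : realType) (V : finType) (p : law R V) (xi : V -> R[i]).
Variables (y0 : R[i]) (p0 : R).
Hypothesis sp : spread p xi y0 p0.

(** Half jumps are at least 7/16 |y0| and the good indices carry more than p0^2/4 of the trace q, so
    the diagonal sum is at least (49/1024) |y0|^2 p0^2 q, more than twice this level times q. In
    [tail_const], 216 = 4 + 212: the 4 pays for too few good indices, the 212 for [sign_quad]. *)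
Definition tail_level : R := normc y0 ^+ 2 * p0 ^+ 2 / 50.
Definition tail_const : R := 216 / p0 ^+ 2.

Lemma tail_const_gt0 : 0 < tail_const.
Proof. by have [_ p00 _] := sp; apply: divr_gt0; [exact: ltr0n|exact: exprn_gt0]. Qed.

Lemma tail_level_gt0 : 0 < tail_level.
Proof.
have [y0n0 p00 _] := sp; apply: divr_gt0; last exact: ltr0n.
by apply: mulr_gt0; apply: exprn_gt0; rewrite ?normc_gt0.
Qed.

Lemma expRN_le (t : R) : 0 < t -> expR (- t) <= t^-1.
Proof.
move=> t0; rewrite expRN lef_pV2 ?posrE ?expR_gt0 //.
by apply: le_trans (expR_ge1Dx _); rewrite lerDr.
Qed.

(** At a good index the random side is the midpoint of the pair plus a random sign times the half
    jump, so [sign_quad] applies; all other coordinates are frozen into the centre [b]. *)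
Lemma quad_tail (n : nat) (Q : 'I_n -> 'I_n -> R[i]) (a : 'I_n -> R[i]) :
  (forall i j, Num.conj (Q i j) = Q j i) ->
  (forall z, \sum_i normc (\sum_j Q i j * z j) ^+ 2 <= qform Q z) ->
  let q := \sum_i complex.Re (Q i i) in 0 < q ->
  Pr p (fun m : {ffun 'I_n -> V} => qform Q (fun i => a i + xi (m i)) <= tail_level * q)
  <= tail_const / q.
Proof.
move=> Qh Qc q q0; have [y0n0 p00 [D1 [D2 [D1p D2p D12]]]] := sp.
have Y0 : 0 < normc y0 by rewrite normc_gt0.
have Qd := Q_diag Qc.
pose good (v : V * V) := D1 v.1 && D2 v.2.
pose Dg (r : {ffun 'I_n -> V * V}) := \sum_i (if good (r i) then complex.Re (Q i i) else 0).
have Dg_large : Pr (pairlaw p) (fun r => Dg r <= p0 ^+ 2 / 4 * q) <= 4 / p0 ^+ 2 / q.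
  have := @chernoff_lower R _ 'I_n (pairlaw p) (fun=> good) (fun i => complex.Re (Q i i)) (p0 ^+ 2).
  rewrite -/q => h; apply: le_trans (h Qd _ _) _.
  - move=> i; rewrite /pr1 -(pair_big D1 D2 (fun a b => p a * p b)) /= expr2.
    under eq_bigr do rewrite -mulr_sumr.
    by rewrite -mulr_suml ler_pM // ltW.
  - by rewrite exprn_ge0 // ltW.
  - have t0 : 0 < p0 ^+ 2 / 4 * q by rewrite mulr_gt0 ?divr_gt0 ?exprn_gt0.
    by apply: le_trans (expRN_le t0) _; rewrite invfM invf_div.
pose X (r : {ffun 'I_n -> V * V}) (e : {ffun 'I_n -> bool}) : {ffun 'I_n -> V} :=
  choose_side [set i | e i] r.
pose A (m : {ffun 'I_n -> V}) := qform Q (fun i => a i + xi (m i)) <= tail_level * q.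
have -> : Pr p A = Ex (pairlaw p) (fun r => Pr (@coin R) (fun e => A (X r e))).
  rewrite /Pr Ex_swap -[LHS](Ex_cst 'I_n (@coin R)); apply: eq_Ex => e.
  by rewrite -(Ex_pick p [set i | e i]).
apply: (@le_trans _ _ (Ex (pairlaw p) (fun r : {ffun 'I_n -> V * V} =>
    ind R (Dg r <= p0 ^+ 2 / 4 * q) + 212 / p0 ^+ 2 / q))); last first.
  rewrite ExD Ex_cst; have -> : tail_const / q = 4 / p0 ^+ 2 / q + 212 / p0 ^+ 2 / q.
    by rewrite /tail_const -!mulrA -mulrDl; congr (_ * _); ring.
  by rewrite lerD2r.
apply: le_Ex => r; have c0 : 0 <= 212 / p0 ^+ 2 / q.
  by apply: divr_ge0 (ltW q0); apply: divr_ge0 (ler0n _ _) (sqr_ge0 _).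
have [d|d] := leP (Dg r) (p0 ^+ 2 / 4 * q).
  by rewrite indT // -[leLHS]addr0; apply: lerD; rewrite // Pr_le1.
rewrite indF // add0r.
pose G := [set i | good (r i)].
pose w i : R[i] := if good (r i) then (xi (r i).2 - xi (r i).1) / 2 else 0.
have wG i : good (r i) -> 7 / 16 * normc y0 <= normc (w i) <= 9 / 16 * normc y0.
  move=> gi; rewrite /w gi normcM normcV; have /andP[g1 g2] := gi.
  have := D12 _ _ g1 g2; set z := xi _ - xi _ => dz.
  have h1 := normcB_ge y0 (- (z - y0)); have h2 := normc_triangle z y0 0.
  move: h1 h2; rewrite opprK [y0 + _]addrC subrK normcN !subr0.
  have -> : normc (2 : R[i]) = 2.
    by rewrite (_ : 2 = 2%:C) /= ?expr0n /= ?addr0 ?sqrtr_sqr ?ger0_norm // rmorphD rmorph1.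
  by move=> h1 h2; apply/andP; split; lra.
have w_le i : normc (w i) <= 9 / 16 * normc y0.
  case gi : (good (r i)); first by have /andP[] := wG _ gi.
  by rewrite /w gi ComplexField.Normc.normc0 mulr_ge0 //; lra.
rewrite /Pr -(Ex_mix _ G) -[leRHS](Ex_cst 'I_n (@coin R)); apply: le_Ex => e0.
pose b i : R[i] := a i + (if good (r i) then (xi (r i).2 + xi (r i).1) / 2
  else xi (X r e0 i)).
have cy0 : 0 < 49 / 256 * normc y0 ^+ 2.
  by apply: mulr_gt0; [lra|rewrite exprn_gt0].
pose D : R := \sum_i complex.Re (Q i i) * normc (w i) ^+ 2.
have DD : 49 / 256 * normc y0 ^+ 2 * Dg r <= D.
  rewrite mulr_sumr; apply: ler_sum => i _; have /andP[Qi0 _] := Qd i.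
  case gi : (good (r i)); last by rewrite mulr0 mulr_ge0 ?sqr_ge0.
  rewrite [leRHS]mulrC; apply: ler_wpM2r => //; have /andP[h _] := wG _ gi.
  rewrite (_ : _ * _ = (7 / 16 * normc y0) ^+ 2); last by field.
  by apply: lerXn2r h; rewrite ?nnegrE ?normc_ge0 // mulr_ge0 //; lra.
have D2q : 2 * (tail_level * q) <= D.
  apply: le_trans DD; have y2 : 0 < normc y0 ^+ 2 by rewrite exprn_gt0.
  apply: (@le_trans _ _ (49 / 256 * normc y0 ^+ 2 * (p0 ^+ 2 / 4 * q))).
    rewrite /tail_level; have : 0 < normc y0 ^+ 2 * p0 ^+ 2 * q by rewrite !mulr_gt0 ?exprn_gt0.
    lra.
  by apply: ler_wpM2l (ltW d); exact: ltW.
have D0 : 0 < D.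
  by apply: lt_le_trans D2q; rewrite !mulr_gt0 // ?exprn_gt0 ?invr_gt0.
apply: le_trans (_ : Pr (@coin R) (fun e : {ffun 'I_n -> bool} =>
    qform Q (fun i => b i + (sg R (e i))%:C * w i) <= D / 2) <= _).
  apply: le_Ex => e; apply: ind_le; rewrite /A.
  have -> : qform Q (fun i => a i + xi (X r (mix G e0 e) i)) =
      qform Q (fun i => b i + (sg R (e i))%:C * w i).
    congr qform; apply/funext => i; rewrite /b /w /X !ffunE !inE ffunE inE.
    case gi : (good (r i)); last by rewrite mulr0 addr0.
    rewrite -addrA; congr (_ + _); case: (e i) => /=.
      rewrite rmorph1 mul1r; by field.
    rewrite rmorphN rmorph1 mulN1r; by field.
  move=> h; lra.
have sq := @sign_quad R n Q Qh Qc b w _ w_le D0.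
apply: (le_trans sq); rewrite -/D.
rewrite ler_pdivrMr //; apply: (@le_trans _ _ (212 / p0 ^+ 2 / q *
   (49 / 256 * normc y0 ^+ 2 * (p0 ^+ 2 / 4 * q)))).
  have -> : 212 / p0 ^+ 2 / q * (49 / 256 * normc y0 ^+ 2 * (p0 ^+ 2 / 4 * q)) =
     212 * 49 / 1024 * normc y0 ^+ 2 by field; rewrite !gt_eqF.
  by have := sqr_ge0 (normc y0); rewrite exprMn; lra.
apply: (ler_wpM2l c0); apply: le_trans DD; apply: ler_wpM2l (ltW d); exact: ltW.
Qed.

Section Bulk.
Variable n : nat.
Hypothesis n0 : (0 < n)%N.
Variable A0 : 'I_n -> 'I_n -> R[i].
Variable u : R.
Hypothesis u0 : 0 < u.

Let y : R := n%:R.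
Let sy : R := (Num.sqrt y)^-1.
Let y_gt0 : 0 < y. Proof. by rewrite ltr0n. Qed.

Definition model (m : {ffun 'I_n * 'I_n -> V}) : 'M[R[i]]_n :=
  \matrix_(i, j) ((Num.sqrt n%:R)^-1%:C * (A0 i j + xi (m (i, j)))).

Let h m : R := u * rtr (model m) u.
Let q j m : R := u * rtr (zcol (model m) j) u.
Let S j : {set 'I_n * 'I_n} := [set (i, j) | i in 'I_n].

Lemma zcol_mix j m m' : zcol (model (mix (S j) m m')) j = zcol (model m) j.
Proof.
apply/matrixP => a b; rewrite !mxE; case: eqP => // bj; rewrite ffunE.
by case: imsetP => // -[i _ [_ e]].
Qed.

Lemma h_q j m : h m <= q j m <= h m + 1.
Proof.
have key (a b : R) : 0 <= a - b <= 1 -> b <= a <= b + 1 by lra.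
exact: (key _ _ (rtr_zcol (model m) j u0)).
Qed.

(** Before and after resampling column [j], [h] lies in the same interval of length one below the
    value with that column erased. *)
Lemma h_bdd j : bdd_diff (S j) 1 h.
Proof.
move=> m m'; have := h_q j m; have := h_q j (mix (S j) m m').
have -> : q j (mix (S j) m m') = q j m by rewrite /q zcol_mix.
by rewrite ler_norml; move: (h (mix (S j) m m')) (q j m) (h m) => a b c; lra.
Qed.

Lemma cover_cols : \bigcup_j S j = [set: 'I_n * 'I_n].
Proof.
by apply/setP => -[i j]; rewrite inE; apply/bigcupP; exists j => //; rewrite imset_f.
Qed.

Lemma h_le m : h m <= y.
Proof.
rewrite /h rtr_self // -[leRHS](_ : \sum_(j < n) 1 = y); last by rewrite sumr_const card_ord.
apply: ler_sum => j _; have := rform_ge0 (zcol (model m) j) u0 (col j (model m)).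
by move: (rform _ _ _) => x x0; rewrite invf_le1; lra.
Qed.

Let Q (B : 'M[R[i]]_n) i j : R[i] := u%:C * res B u i j.

Lemma Q_qform B z : qform (Q B) z = u * rform B u (\col_i z i).
Proof.
have /matrixP/(_ 0 0) := rformE B u0 (\col_i z i); rewrite !mxE eqxx mulr1n => h0.
rewrite -[rform _ _ _]/(complex.Re (rform B u (\col_i z i))%:C) -h0 -ReZ /qform.
congr complex.Re; rewrite mulr_sumr exchange_big; apply: eq_bigr => j _ /=.
rewrite !mxE mulr_suml mulr_sumr; apply: eq_bigr => i _; rewrite !mxE /Q; ring.
Qed.

Lemma Q_trace B : \sum_i complex.Re (Q B i i) = u * rtr B u.
Proof. by rewrite /rtr /mxtrace Re_sum mulr_sumr; apply: eq_bigr => i _; rewrite ReZ. Qed.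

Lemma Q_hermitian B i j : Num.conj (Q B i j) = Q B j i.
Proof.
rewrite /Q rmorphM /= conjC_real; congr (_ * _).
by have /matrixP/(_ j i) := res_herm B u; rewrite !mxE.
Qed.

Lemma Q_contracts B z : \sum_i normc (\sum_j Q B i j * z j) ^+ 2 <= qform (Q B) z.
Proof.
rewrite Q_qform; apply: le_trans (ler_wpM2l (ltW u0) (rform_ge B u (\col_i z i))).
rewrite mulrA mulr_sumr le_eqVlt; apply/orP; left; apply/eqP; apply: eq_bigr => i _.
have -> : \sum_j Q B i j * z j = u%:C * (res B u *m \col_i z i) i 0.
  by rewrite !mxE mulr_sumr; apply: eq_bigr => j _; rewrite !mxE mulrA.
rewrite normcM exprMn; congr (_ * _).
by rewrite /= expr0n addr0 sqr_sqrtr ?sqr_ge0 // expr2.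
Qed.

(** Column [j] is independent of the matrix with column [j] erased, so [quad_tail] applies
    conditionally to the resolvent of the latter. *)
Lemma col_tail j (Th : R) : 0 < Th ->
  Pr p (fun m => qform (Q (zcol (model m) j)) (fun i => A0 i j + xi (m (i, j))) <=
     tail_level * q j m /\ Th <= q j m) <= tail_const / Th.
Proof.
move=> Th0; have p00 : 0 < p0 by have [_ []] := sp.
have tc := tail_const_gt0.
apply: (@le_trans _ _ (tail_const / Th * Pr p (fun m => Th <= q j m))); last first.
  by rewrite ler_piMr ?Pr_le1 // ltW // divr_gt0.
apply: (Pr_mix_le (S := S j)) => [m Tq|m m']; last by rewrite /q zcol_mix.
have q0 : 0 < q j m by apply: lt_le_trans Tq.
have tr := Q_trace (zcol (model m) j).
have := @quad_tail n (Q (zcol (model m) j)) (fun i => A0 i j) (@Q_hermitian _) (@Q_contracts _).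
rewrite /= tr => /(_ q0) t1.
have hi : injective (fun i : 'I_n => (i, j)) by move=> ? ? [].
apply: (@le_trans _ _ (tail_const / q j m)); last by rewrite ler_pM2l // lef_pV2 ?posrE.
apply: le_trans t1; rewrite /Pr -[leRHS](Ex_marginal p _ hi).
apply: le_Ex => m'; apply: ind_le; rewrite /q zcol_mix; congr (_ <= _).
by congr qform; apply/funext => i; rewrite !ffunE imset_f.
Qed.

(** Every term of the self-consistent equation is at most 1, and at most u y / (tail_level Th)
    unless [h] is below Th or the form of the column is abnormally small. *)
Lemma mean_self (Th : R) : 0 < Th ->
  Ex p h <= y * (Pr p (fun m => h m <= Th) + tail_const / Th + u * y / (tail_level * Th)).
Proof.
move=> Th0; have [y0n0 p00 _] := sp.
have tl := tail_level_gt0.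
have e0 : 0 <= u * y / (tail_level * Th).
  by apply: divr_ge0; apply: mulr_ge0; exact: ltW.
rewrite (@eq_Ex _ _ _ _ _ _ (fun m => rtr_self (model m) u0)) Ex_sum.
apply: (@le_trans _ _ (\sum_(j < n) (Pr p (fun m => h m <= Th) + tail_const / Th +
  u * y / (tail_level * Th)))); last by rewrite sumr_const card_ord mulr_natl.
apply: ler_sum => j _.
apply: le_trans (lerD (lerD (lexx _) (col_tail j Th0)) (lexx _)).
rewrite -[X in _ + X](Ex_cst ('I_n * 'I_n)%type p) -!ExD; apply: le_Ex => m.
have := rform_ge0 (zcol (model m) j) u0 (col j (model m)).
set x := rform _ _ _ => x0.
have x1 : (1 + x)^-1 <= 1 by rewrite invf_le1; lra.
have [hT|hT] := leP (h m) Th.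
  rewrite indT // -[leLHS]addr0 -addrA lerD // addr_ge0 //; exact: ind_ge0.
have Tq : Th <= q j m by have /andP[h1 _] := h_q j m; lra.
rewrite indF // add0r.
have [A|A] := leP (qform (Q (zcol (model m) j)) (fun i => A0 i j + xi (m (i, j))))
     (tail_level * q j m).
  by rewrite indT //; lra.
rewrite indF ?add0r; last by case.
have e : qform (Q (zcol (model m) j)) (fun i => A0 i j + xi (m (i, j))) = u * (y * x).
  rewrite Q_qform; congr (_ * _); rewrite /x.
  have -> : \col_i (A0 i j + xi (m (i, j))) = (Num.sqrt y)%:C *: col j (model m).
    apply/colP => i; rewrite !mxE mulrA -rmorphM /= mulfV ?mul1r //.
    by rewrite gt_eqF // sqrtr_gt0.
  by rewrite rform_scale sqr_sqrtr // ltW.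
move: A; rewrite e => A.
have A2 : tail_level * Th < u * (y * x).
  by apply: le_lt_trans A; rewrite ler_pM2l.
have T0 : 0 < tail_level * Th by exact: mulr_gt0.
rewrite ler_pdivlMr // ler_pdivrMl; last by lra.
have := mulr_gt0 u0 y_gt0; move: A2; move: (tail_level * Th) => a; nra.
Qed.

Lemma lower_tail (t : R) : 0 <= t <= 1 / 2 ->
  Pr p (fun m => h m <= Ex p h - t * y) <= expR (- (t ^+ 2 / 4 * y)).
Proof. by move=> t2; have := azuma p cover_cols h_bdd t2; rewrite card_ord. Qed.

Lemma upper_tail (t : R) : 0 <= t <= 1 / 2 ->
  Pr p (fun m => Ex p h + t * y <= h m) <= expR (- (t ^+ 2 / 4 * y)).
Proof.
move=> t2; have hN j : bdd_diff (S j) 1 (fun m => - h m).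
  by move=> m m'; rewrite -opprD normrN; exact: h_bdd.
have := azuma p cover_cols hN t2; rewrite card_ord; apply: le_trans.
by apply: le_Pr => m; rewrite ExN; lra.
Qed.

(** Bootstrap: let H be the mean and take the threshold H/2. Azuma's inequality gives P(h <= H/2) <=
    16 y/H^2, so [mean_self] becomes H^2 <= 16 y^2/H + 2 tail_const y + 2 u y^2 / tail_level. If H
    exceeded the claimed bound, the right-hand side would be smaller than H^2. *)
Lemma mean_bound (k : nat) : (100 <= k)%N -> (k ^ 20 <= n)%N -> 6 * tail_const <= k%:R ->
  Ex p h <= y * ((k%:R ^+ 3)^-1 + (6 / tail_level + 1) * Num.sqrt u).
Proof.
move=> k100 kn kc; set H := Ex p h; have [y0n0 p00 _] := sp.
have tl := tail_level_gt0.
have tc := tail_const_gt0.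
set x : R := k%:R in kc *; have x100 : 100 <= x by rewrite ler_nat.
have x0 : 0 < x by lra.
have su : 0 < Num.sqrt u by rewrite sqrtr_gt0.
set C0 := 6 / tail_level + 1; have C01 : 1 <= C0 by rewrite lerDr divr_ge0 // ltW.
rewrite leNgt; apply/negP => hH.
have X3 : 0 < (x ^+ 3)^-1 by rewrite invr_gt0 exprn_gt0.
have yn : x ^+ 20 <= y by rewrite -natrX ler_nat.
have H1 : y * (x ^+ 3)^-1 < H.
  apply: le_lt_trans hH; rewrite ler_pM2l // lerDl mulr_ge0 // ?(ltW su) //; lra.
have H2 : y * (C0 * Num.sqrt u) < H.
  by apply: le_lt_trans hH; rewrite ler_pM2l // lerDr ltW.
have H0 : 0 < H by apply: lt_trans H1; exact: mulr_gt0.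
have Hy : H <= y by rewrite -(Ex_cst ('I_n * 'I_n)%type p y); apply: le_Ex => m; exact: h_le.
have t01 : 0 <= H / (2 * y) <= 1 / 2.
  rewrite divr_ge0 ?mulr_ge0 ?(ltW H0) ?(ltW y_gt0) //= ler_pdivrMr ?mulr_gt0 //; lra.
have low := lower_tail t01.
have Th0 : 0 < H / 2 by rewrite divr_gt0.
have ms := mean_self Th0; rewrite -/H in ms low.
have e1 : H - H / (2 * y) * y = H / 2 by field; rewrite gt_eqF.
have e2 : (H / (2 * y)) ^+ 2 / 4 * y = H ^+ 2 / (16 * y) by field; rewrite gt_eqF.
rewrite e1 e2 in low.
have E1 : Pr p (fun m => h m <= H / 2) <= 16 * y / H ^+ 2.
  apply: le_trans low _; have q0 : 0 < H ^+ 2 / (16 * y) by rewrite divr_gt0 ?exprn_gt0 ?mulr_gt0.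
  by apply: le_trans (expRN_le q0) _; rewrite invf_div.
have ms2 : H ^+ 2 <= 16 * y ^+ 2 / H + 2 * tail_const * y + 2 * u * y ^+ 2 / tail_level.
  rewrite expr2 -ler_pdivlMl //; apply: le_trans ms _.
  apply: (@le_trans _ _ (y * (16 * y / H ^+ 2 + tail_const / (H / 2) +
      u * y / (tail_level * (H / 2))))); first by rewrite ler_pM2l //; lra.
  rewrite le_eqVlt; apply/orP; left; apply/eqP; field; by rewrite !gt_eqF.
have xH : y < H * x ^+ 3 by rewrite -ltr_pdivrMr ?exprn_gt0.
have b3 : 2 * u * y ^+ 2 / tail_level <= H ^+ 2 / 3.
  have : (y * (C0 * Num.sqrt u)) ^+ 2 <= H ^+ 2.
    by rewrite lerXn2r ?nnegrE ?(ltW H2) ?(ltW H0) // !mulr_ge0 ?(ltW su) ?(ltW y_gt0) //; lra.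
  rewrite !exprMn sqr_sqrtr ?(ltW u0) //; move=> hh.
  have C2 : 6 / tail_level <= C0 ^+ 2.
    rewrite /C0; have : 0 < 6 / tail_level by rewrite divr_gt0.
    by move: (6 / tail_level) => a; nra.
  have yu : 0 <= y ^+ 2 * u by rewrite ltW // mulr_gt0 ?exprn_gt0.
  have := ler_wpM2l yu C2; move: hh; move: (tail_level^-1) (C0 ^+ 2) (y ^+ 2) => a c z; lra.
have yH : y * x ^+ 14 <= H ^+ 2.
  have h1 : y ^+ 2 <= H ^+ 2 * x ^+ 6.
    rewrite (exprM x 3 2) -exprMn lerXn2r ?nnegrE ?(ltW xH) ?(ltW y_gt0) //.
    by rewrite mulr_ge0 ?(ltW H0) ?exprn_ge0 ?(ltW x0).
  rewrite -(ler_pM2r (_ : 0 < x ^+ 6)) ?exprn_gt0 //; apply: le_trans h1.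
  by rewrite -mulrA -exprD expr2 ler_pM2l.
have xpow a : x <= x ^+ a.+1.
  by rewrite exprS ler_peMr ?(ltW x0) // exprn_ege1 //; lra.
have x14 : 100 * x ^+ 3 <= x ^+ 14.
  rewrite (exprD x 11 3) ler_pM2r ?exprn_gt0 //; apply: le_trans x100 _.
  exact: xpow.
have x13 : x * 100 <= x ^+ 14.
  rewrite (exprS x 13) ler_pM2l //; apply: le_trans x100 _.
  exact: xpow.
have b1 : 16 * y ^+ 2 / H <= 16 * (y * x ^+ 3).
  rewrite ler_pdivrMr // expr2; have := ler_wpM2l (ltW y_gt0) (ltW xH).
  by move: (x ^+ 3) => c; lra.
have b1' := ler_wpM2l (ltW y_gt0) x14; have b2' := ler_wpM2l (ltW y_gt0) x13.
have b2 := ler_wpM2l (ltW y_gt0) kc.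
have z0 : 0 < y * x ^+ 14 by rewrite mulr_gt0 ?exprn_gt0.
move: ms2 b1 b1' b2' b2 b3 yH z0.
move: (16 * y ^+ 2 / H) (2 * u * y ^+ 2 / tail_level) (H ^+ 2) (x ^+ 14) (x ^+ 3) => A1 A2 A3 A4 A5.
by lra.
Qed.

End Bulk.
End QuadTail.

(** * Comparison of the regularised determinant with the determinant *)

Section GramSpectrum.
Local Open Scope sesquilinear_scope.
Variable R : realType.
Local Notation C := R[i].

Lemma real_C (z : C) : z \is Num.real -> z = (complex.Re z)%:C.
Proof. by move=> /complex_realP[x ->]. Qed.

Lemma gram_spectrum n (B : 'M[C]_n) : exists g : 'I_n -> R,
  [/\ forall u, \det (gram B + (u%:C)%:M) = (\prod_i (g i + u))%:C,
      forall i, 0 <= g i,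
      forall u, 0 < u -> rtr B u = \sum_i (g i + u)^-1 &
      forall i, exists2 v : 'cV[C]_n, v != 0 & sqn (B^t* *m v) = g i * sqn v].
Proof.
have GE : gram B = B *m B^t* by [].
move: (gram B) GE => G GE.
have Gh : G \is hermsymmx.
  by apply/is_hermitianmxP; rewrite expr0 scale1r GE trmxCM trmxCK.
have /hermitian_normalmx/orthomx_spectralP := Gh.
have := hermitian_spectral_diag_real Gh.
have Pu := spectral_unit G; have PU := spectral_unitarymx G.
move: (spectralmx G) (spectral_diag G) Pu PU => Pm dg Pu PU dr Gd.
pose g i := complex.Re (dg 0 i).
have dE i : dg 0 i = (g i)%:C by apply: real_C; exact: (mxOverP dr).
have shift u : G + (u%:C)%:M = invmx Pm *m diag_mx (\row_i ((g i + u)%:C)) *m Pm.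
  have -> : diag_mx (\row_i ((g i + u)%:C)) = diag_mx dg + (u%:C)%:M.
    by apply/matrixP => i j; rewrite !mxE dE rmorphD mulrnDl.
  by rewrite mulmxDr mulmxDl -Gd mul_mx_scalar -scalemxAl mulVmx // scalemx1.
have ev i : exists2 v : 'cV[C]_n, v != 0 & sqn (B^t* *m v) = g i * sqn v.
  have [v vE] : exists v, v = (row i Pm)^t* by exists ((row i Pm)^t*).
  exists v.
    apply/negP => /eqP v0; have r0 : row i Pm = 0.
      by rewrite -(trmxCK (row i Pm)) -vE v0; apply/matrixP => a b; rewrite !mxE rmorph0.
    have := mulmxV Pu => /matrixP/(_ i i); rewrite !mxE eqxx big1 => [/eqP|j _].
      by rewrite eq_sym oner_eq0.
    by have /matrixP/(_ 0 j) := r0; rewrite !mxE => ->; rewrite mul0r.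
  have vG : v^t* *m G = (g i)%:C *: v^t*.
    rewrite vE trmxCK -row_mul Gd !mulmxA mulmxV // mul1mx -dE.
    apply/rowP => j; rewrite !mxE (bigD1 i) //= !mxE eqxx mulr1n big1 ?addr0 // => l li.
    by rewrite !mxE eq_sym (negPf li) mulr0n mul0r.
  have : v^t* *m G *m v = ((sqn (B^t* *m v))%:C)%:M.
    by rewrite -sqnE trmxCM trmxCK [RHS]mulmxA -[in RHS](mulmxA (v^t*)) -GE.
  rewrite vG -scalemxAl sqnE => /matrixP/(_ 0 0); rewrite !mxE eqxx !mulr1n -rmorphM /=.
  by move=> /complexI <-.
have g0 i : 0 <= g i.
  have [v v0 e] := ev i; have sv : 0 < sqn v.
    rewrite lt_def sqn_ge0 andbT; apply/eqP => /sqn_eq0 v0'.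
    by rewrite v0' eqxx in v0.
  by rewrite -(pmulr_lge0 _ sv) -e sqn_ge0.
exists g; split => // [u|u u0].
  rewrite shift !det_mulmx det_diag mulrAC -det_mulmx mulVmx // det1 mul1r rmorph_prod.
  by apply: eq_bigr => i _; rewrite mxE.
have gu i : g i + u != 0 by rewrite gt_eqF // ltr_wpDl.
have -> : rtr B u = complex.Re (\tr (invmx Pm *m diag_mx (\row_i ((g i + u)^-1%:C)) *m Pm)).
  congr (complex.Re (\tr _)); apply: (res_uniq u0); rewrite /reg -GE shift.
  rewrite -!mulmxA mulKVmx // [diag_mx _ *m (_ *m _)]mulmxA mulmx_diag.
  rewrite (_ : (\row_j _) = const_mx 1) ?diag_const_mx ?mul1mx ?mulVmx //.
  by apply/rowP => j; rewrite !mxE -rmorphM /= mulfV // rmorph1.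
rewrite mxtrace_mulC mulmxA mulmxV // mul1mx /mxtrace Re_sum.
by apply: eq_bigr => i _; rewrite !mxE eqxx mulr1n.
Qed.

Lemma prod_le_exp n (f g h : 'I_n -> R) : (forall i, 0 <= f i <= expR (h i) * g i) ->
  \prod_i f i <= expR (\sum_i h i) * \prod_i g i.
Proof.
by move=> fg; rewrite expR_sum -big_split; apply: ler_prod => i _; exact: fg.
Qed.

(** Factor by factor, g + 4u = (1 + 3u/(g+u)) (g+u). *)
Lemma prod_shift n (g : 'I_n -> R) (u : R) : (forall i, 0 <= g i) -> 0 < u ->
  \prod_i (g i + 4 * u) <= expR (3 * (u * \sum_i (g i + u)^-1)) * \prod_i (g i + u).
Proof.
move=> g0 u0; rewrite !mulr_sumr; apply: prod_le_exp => i; have gi := g0 i.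
have gu : 0 < g i + u by lra.
apply/andP; split; first lra.
have -> : g i + 4 * u = (1 + 3 * (u * (g i + u)^-1)) * (g i + u) by field; lra.
by rewrite ler_pM2r // expR_ge1Dx.
Qed.

(* The regularisation is lowered from [e] to [e / 4 ^ k] one factor of four at a time. *)
Lemma prod_ladder n (g : 'I_n -> R) (e a b dl : R) (k : nat) :
  (forall i, dl <= g i) -> 0 < dl -> 0 < e ->
  (forall l, (l < k)%N -> e / 4 ^+ l.+1 * \sum_i (g i + e / 4 ^+ l.+1)^-1 <= a + b / 2 ^+ l.+1) ->
  0 <= b ->
  \prod_i (g i + e) <=
    expR (3 * (k%:R * a + b) + n%:R * (e / 4 ^+ k / dl)) * \prod_i g i.
Proof.
move=> gd d0 e0 hl b0; have g0 i : 0 <= g i by apply: ltW; apply: lt_le_trans (gd i).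
have e4 l : 0 < e / 4 ^+ l by rewrite divr_gt0 ?exprn_gt0.
have step l : (l <= k)%N -> \prod_i (g i + e) <=
    expR (3 * (l%:R * a + b * (1 - (2 ^+ l)^-1))) * \prod_i (g i + e / 4 ^+ l).
  elim: l => [_|l IH lk].
    by rewrite !expr0 invr1 subrr mulr0 mul0r addr0 mulr0 expR0 mul1r mulr1.
  apply: le_trans (IH (ltnW lk)) _.
  have -> : e / 4 ^+ l = 4 * (e / 4 ^+ l.+1).
    rewrite exprS; have h : 4 ^+ l != 0 :> R by rewrite expf_neq0.
    by field.
  apply: le_trans (ler_wpM2l (expR_ge0 _) (prod_shift g0 (e4 l.+1))) _.
  rewrite [leLHS]mulrA -expRD ler_wpM2r //.
    by apply: prodr_ge0 => i _; rewrite addr_ge0 // ltW.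
  rewrite ler_expR; have := hl _ lk; rewrite -natr1.
  have -> : (2 ^+ l)^-1 = 2 * (2 ^+ l.+1)^-1 :> R.
    by rewrite exprS invfM mulrA divff ?mul1r.
  by move: (e / _ * _) ((2 ^+ l.+1)^-1) => x y; lra.
apply: le_trans (step k (leqnn k)) _.
have last_step : \prod_i (g i + e / 4 ^+ k) <= expR (n%:R * (e / 4 ^+ k / dl)) * \prod_i g i.
  have -> : n%:R * (e / 4 ^+ k / dl) = \sum_(i < n) (e / 4 ^+ k / dl).
    by rewrite sumr_const card_ord mulr_natl.
  apply: prod_le_exp => i; have gi := gd i; have ek := e4 k; have gp := lt_le_trans d0 gi.
  rewrite addr_ge0 ?(ltW ek) //=; apply: (@le_trans _ _ ((1 + e / 4 ^+ k / g i) * g i)).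
    by rewrite mulrDl mul1r -mulrA mulVf ?mulr1 // gt_eqF.
  apply: (ler_wpM2r (g0 i)); apply: le_trans (expR_ge1Dx _) _.
  by rewrite ler_expR ler_pM2l // lef_pV2 ?posrE.
apply: le_trans (ler_wpM2l (expR_ge0 _) last_step) _; rewrite [leLHS]mulrA -expRD ler_wpM2r //.
  by apply: prodr_ge0 => i _; exact: g0.
by rewrite ler_expR lerD2r ler_pM2l // lerD2l ler_piMr // lerBlDr lerDl invr_ge0 exprn_ge0.
Qed.

End GramSpectrum.

Section FiniteComparison.
Import boot.fintype boot.finset.
Local Open Scope set_scope.
Local Open Scope ring_scope.
Local Open Scope complex_scope.
Local Open Scope sesquilinear_scope.
Variables (R : realType) (V : finType) (p : law R V) (xi : V -> R[i]).
Variables (y0 : R[i]) (p0 : R) (k n : nat).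
Hypothesis sp : spread p xi y0 p0.
Hypothesis rg : regime (normc y0) p0 k n.
Hypothesis tk : 6 * tail_const p0 <= k%:R.
Hypothesis xi_le : forall v, normc (xi v) <= n%:R ^+ 3.
Variable A0 : 'I_n -> 'I_n -> R[i].
Hypothesis A0_le : forall i j, normc (A0 i j) <= n%:R ^+ 3.

Let y : R := n%:R.
Let x : R := k%:R.

Definition bulk_const : R := 6 / tail_level y0 p0 + 1.

(** An eigenvector scaled to sup norm one has squared Euclidean norm at most n, and some column
    pairs with it above n^-147. Together with the normalisation 1/sqrt n this gives n^-294 / n /
    n. *)
Lemma spectrum_ge (m : {ffun 'I_n * 'I_n -> V}) (v : 'cV[R[i]]_n) (g : R) :
  ~ (exists2 v, unit_sup v & forall c, normc (\sum_i (A0 i c + xi (m (i, c))) * v i)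
      <= (y ^+ 147)^-1) ->
  v != 0 -> sqn ((model xi A0 m)^t* *m v) = g * sqn v -> (y ^+ 296)^-1 <= g.
Proof.
move=> nb v0 e; have yg : 100 <= y := y_ge rg; have y0' : 0 < y by lra.
have [|a a0 ua] := @scale_sup R n (fun i => Num.conj (v i 0)).
  apply: contrapT => h; case/negP: v0; apply/eqP/colP => i; rewrite mxE.
  apply/eqP; apply: contrapT => /negP vi; apply: h; exists i.
  by rewrite fmorph_eq0.
have aa : 0 < normc a ^+ 2 by rewrite exprn_gt0 // normc_gt0.
have conjN (z : R[i]) : normc (Num.conj z) = normc z by case: z => x' y' /=; rewrite sqrrN.
have [c cP] : exists c, (y ^+ 147)^-1 <
    normc (\sum_i (A0 i c + xi (m (i, c))) * (a * Num.conj (v i 0))).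
  apply: contrapT => nc; apply: nb; exists (fun i => a * Num.conj (v i 0)) => // c.
  by rewrite leNgt; apply/negP => h; apply: nc; exists c.
have s1 : sqn v * normc a ^+ 2 <= y.
  rewrite -[leRHS](_ : \sum_(i < n) 1 = y); last by rewrite sumr_const card_ord.
  rewrite mulr_suml; apply: ler_sum => i _; rewrite mulrC -[normc (v i 0)]conjN -exprMn -normcM.
  by have [u1 _] := ua; rewrite exprn_ile1 ?normc_ge0.
have s2 : (y ^+ 147)^-1 ^+ 2 / y <= sqn ((model xi A0 m)^t* *m v) * normc a ^+ 2.
  rewrite /sqn (bigD1 c) //= mulrDl; apply: (@le_trans _ _
    (normc (((model xi A0 m)^t* *m v) c 0) ^+ 2 * normc a ^+ 2)); last first.
    rewrite lerDl mulr_ge0 ?sqr_ge0 //; apply: sumr_ge0 => i _; exact: sqr_ge0.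
  rewrite -exprMn; set w := (_ *m v) c 0; rewrite [normc w * _]mulrC -[normc w]conjN -normcM.
  have -> : a * Num.conj w =
     (Num.sqrt y)^-1%:C * \sum_i (A0 i c + xi (m (i, c))) * (a * Num.conj (v i 0)).
    rewrite /w !mxE rmorph_sum !mulr_sumr; apply: eq_bigr => i _.
    rewrite !mxE rmorphM /= conjCK; ring.
  rewrite normcM exprMn mulrC; apply: ler_pM.
  - by rewrite invr_ge0 ltW.
  - exact: sqr_ge0.
  - by rewrite /= expr0n addr0 sqr_sqrtr ?sqr_ge0 // exprVn sqr_sqrtr // ltW.
  - by apply: lerXn2r (ltW cP); rewrite nnegrE ?normc_ge0 // invr_ge0 exprn_ge0 // ltW.
have sv : 0 < sqn v.
  rewrite lt_def sqn_ge0 andbT; apply/eqP => /sqn_eq0 v0'.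
  by rewrite v0' eqxx in v0.
have h1 : (y ^+ 147)^-1 ^+ 2 / y <= g * (sqn v * normc a ^+ 2) by rewrite mulrA -e.
have c0 : 0 < (y ^+ 147)^-1 ^+ 2 / y by rewrite divr_gt0 ?exprn_gt0 ?invr_gt0 ?exprn_gt0.
have g0 : 0 < g.
  by rewrite -(pmulr_lgt0 _ (mulr_gt0 sv aa)); exact: lt_le_trans h1.
have -> : (y ^+ 296)^-1 = (y ^+ 147)^-1 ^+ 2 / y / y.
  rewrite -!exprVn (_ : 296 = 147 * 2 + 1 + 1)%N // !exprD !exprM expr1 -exprM.
  by rewrite exprM.
rewrite ler_pdivrMr //; apply: le_trans h1 _; exact: (ler_wpM2l (ltW g0) s1).
Qed.

(** [k] rungs of [prod_ladder], each with a trace within n k^-3 of its mean: the k^-3 parts add up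
    to 6 n k^-2, the square roots to a geometric series, and the last rung costs n k^-2 because 4^k
    outgrows n^296 k^2. The exceptional events weigh 47 k^-21 and k * 32 k^-28 <= k^-21. *)
Lemma comparison_finite (e : R) : 0 < e <= 1 ->
  Pr p (fun m => expR (y * (7 * (x ^+ 2)^-1 + 3 * bulk_const * Num.sqrt e)) *
      complex.Re (\det (gram (model xi A0 m))) <
      complex.Re (\det (gram (model xi A0 m) + (e%:C)%:M))) <= 48 * (x ^+ 21)^-1.
Proof.
move=> /andP[e0 e1]; have yg : 100 <= y := y_ge rg; have x0 : 0 < x := x_gt0 rg.
have k100 := rg_k rg; have kn : (k ^ 20 <= n)%N by have /andP[] := rg_n rg.
have n0 : (0 < n)%N by rewrite -(ltr_nat R) -/y; lra.
have x100 : 100 <= x by rewrite ler_nat.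
have tl := tail_level_gt0 sp.
have C0 : 0 <= bulk_const by rewrite addr_ge0 // divr_ge0 // ltW.
have X3 : 0 < (x ^+ 3)^-1 by rewrite invr_gt0 exprn_gt0.
have t01 : 0 <= (x ^+ 3)^-1 <= 1 / 2.
  rewrite (ltW X3) /= ler_pdivlMr // mulrC ler_pdivrMr ?exprn_gt0 // mul1r.
  by apply: (@le_trans _ _ x); [lra|rewrite (exprS x 2) ler_peMr ?exprn_ege1 //; lra].
pose u l := e / 4 ^+ l.+1; have u0 l : 0 < u l by rewrite divr_gt0 ?exprn_gt0.
pose h l m := u l * rtr (model xi A0 m) (u l).
pose Bad l m := Ex p (h l) + (x ^+ 3)^-1 * y <= h l m.
have BadP l : Pr p (Bad l) <= 32 / x ^+ 28.
  apply: le_trans (upper_tail p xi A0 (u0 l) t01) _; rewrite -/y.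
  have q0 : x ^+ 14 / 4 <= ((x ^+ 3)^-1) ^+ 2 / 4 * y.
    rewrite [leRHS]mulrAC ler_pM2r ?invr_gt0 // exprVn -exprM mulrC ler_pdivlMr ?exprn_gt0 //.
    by rewrite -exprD -natrX ler_nat.
  apply: (@le_trans _ _ (expR (- (x ^+ 14 / 4)))); first by rewrite ler_expR lerN2.
  rewrite expRN -[leRHS]invf_div lef_pV2 ?posrE ?expR_gt0 ?divr_gt0 ?exprn_gt0 //.
  apply: le_trans (expR_ge1Dxn 1 _); last by rewrite divr_ge0 ?exprn_ge0 // ltW.
  rewrite (_ : 2`!%:R = 2 :> R) // exprMn -exprM; have := exprn_gt0 28 x0.
  have -> : (4^-1 : R) ^+ 2 = 1 / 16 by field.
  by move: (x ^+ 28) => a a0; lra.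
pose Ls m := exists2 v, unit_sup v & forall c, normc (\sum_i (A0 i c + xi (m (i, c))) * v i)
      <= (y ^+ 147)^-1.
have LsP : Pr p Ls <= 47 * (x ^+ 21)^-1 := least_singular sp rg xi_le A0_le.
apply: (@le_trans _ _ (Pr p Ls + Pr p (fun m => exists l : 'I_k, Bad l m))).
  apply: le_trans (Pr_or _ _ _); apply: le_Pr => m.
  have [ls|ls] := pselect (Ls m); first by left.
  have [bd|bd] := pselect (exists l : 'I_k, Bad l m); first by right.
  have [g [gdet g0 gtr gv]] := gram_spectrum (model xi A0 m).
  have gd i : (y ^+ 296)^-1 <= g i.
    by have [v v0 ev] := gv i; exact: (spectrum_ge ls v0 ev).
  have d0 : 0 < (y ^+ 296)^-1 by rewrite invr_gt0 exprn_gt0 //; lra.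
  have lad : forall l, (l < k)%N -> e / 4 ^+ l.+1 * \sum_i (g i + e / 4 ^+ l.+1)^-1 <=
      y * (2 * (x ^+ 3)^-1) + y * (bulk_const * Num.sqrt e) / 2 ^+ l.+1.
    move=> l lk; rewrite -(gtr _ (u0 l)) -/(u l) -/(h l m).
    have hb : h l m < Ex p (h l) + (x ^+ 3)^-1 * y.
      by rewrite ltNge; apply/negP => b; apply: bd; exists (Ordinal lk).
    have := mean_bound sp n0 A0 (u0 l) k100 kn tk; rewrite -/(h l) -/y -/x -/bulk_const.
    have -> : Num.sqrt (u l) = Num.sqrt e / 2 ^+ l.+1.
      have e4 : 4 ^+ l.+1 = (2 ^+ l.+1) ^+ 2 :> R.
        by rewrite -exprM mulnC exprM; congr (_ ^+ _); ring.
      have p2 : 0 <= 2 ^+ l.+1 :> R by exact: exprn_ge0.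
      by rewrite /u e4 sqrtrM ?(ltW e0) // sqrtrV ?sqr_ge0 // sqrtr_sqr (ger0_norm p2).
    by move: hb; move: (h l m) (Ex p (h l)) ((x ^+ 3)^-1) ((2 ^+ l.+1)^-1) => a b c d; lra.
  have b0 : 0 <= y * (bulk_const * Num.sqrt e).
    by rewrite !mulr_ge0 ?sqrtr_ge0 //; lra.
  have pl := prod_ladder gd d0 e0 lad b0.
  have gdet0 : \det (gram (model xi A0 m)) = (\prod_i g i)%:C.
    have := gdet 0; rewrite (_ : (0%:C)%:M = 0) ?addr0 => [->|].
      by congr (_%:C); apply: eq_bigr => i _; rewrite addr0.
    by apply/matrixP => i j; rewrite !mxE mul0rn.
  move=> bad; exfalso; move: bad; rewrite gdet gdet0 /= ltNge => /negP; apply.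
  apply: le_trans pl _; apply: ler_wpM2r; first by apply: prodr_ge0 => i _.
  rewrite ler_expR -/y invrK.
  have last : e / 4 ^+ k * y ^+ 296 <= (x ^+ 2)^-1.
    rewrite mulrAC ler_pdivrMr ?exprn_gt0 // [leRHS]mulrC ler_pdivlMr ?exprn_gt0 //.
    apply: (@le_trans _ _ (y ^+ 296 * y ^+ 2)).
      have xy : x <= y by rewrite ler_nat; exact: k_le_n rg.
      have y0g : 0 <= y by lra.
      have y296 : 0 <= y ^+ 296 by exact: exprn_ge0.
      apply: ler_pM (lerXn2r 2 _ _ xy); rewrite ?nnegrE ?(ltW x0) //.
      - by rewrite mulr_ge0 // ltW.
      - exact: sqr_ge0.
      - exact: ler_piMl.
    rewrite -exprD -natrX -natrX ler_nat.
    have [_ g2] := grid_le rg.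
    apply: (@leq_trans ((n * (4 * n ^ 140).+1 ^ 2).+1 ^ 2)); last first.
      by rewrite (_ : 4 = 2 ^ 2)%N // expnAC; exact: leq_expl.
    apply: (@leq_trans ((n ^ 281) ^ 2)); first by rewrite -expnM leq_pexp2l.
    apply: leq_expl; apply: leqW; rewrite (expnS n 280) leq_mul2l; apply/orP; right.
    by rewrite (expnM n 140 2); apply: leq_expl; move: (n ^ 140)%N => a; clear; lia.
  have X : k%:R * (y * (2 * (x ^+ 3)^-1)) = y * (2 * (x ^+ 2)^-1).
    have : x ^+ 2 != 0 by rewrite expf_neq0 // gt_eqF.
    by rewrite -/x (exprS x 2); move: (x ^+ 2) => a a0; field; rewrite a0 gt_eqF.
  rewrite X; have := ler_wpM2l (_ : 0 <= y) last => /(_ (ltW (lt_le_trans (ltr0Sn _ 99) yg))).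
  move: (e / _ * _) (x ^+ 2)^-1 (Num.sqrt e) => a b c; lra.
have : Pr p (fun m => exists l : 'I_k, Bad l m) <= (x ^+ 21)^-1.
  apply: le_trans (Pr_exists _ _) _; apply: (@le_trans _ _ (\sum_(l < k) 32 / x ^+ 28)).
    by apply: ler_sum => l _; exact: BadP.
  rewrite sumr_const card_ord -[leLHS]mulr_natl -/x mulrA ler_pdivrMr ?exprn_gt0 //.
  rewrite [leRHS]mulrC ler_pdivlMr ?exprn_gt0 // (_ : 28 = 21 + 1 + 6)%N // !exprD expr1.
  have : 32 <= x ^+ 6.
    apply: (@le_trans _ _ x); first lra.
    by rewrite (exprS x 5) ler_peMr ?exprn_ege1 //; lra.
  have : 0 < x ^+ 21 * x by rewrite mulr_gt0 ?exprn_gt0.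
  by move: (x ^+ 21) (x ^+ 6) => a b; nra.
move: LsP; lra.
Qed.

End FiniteComparison.

(** * From finite alphabets to arbitrary laws *)

Section Tends.
Local Open Scope sesquilinear_scope.
Variable R : realType.
Local Notation C := R[i].

Definition tends (u : nat -> C) (l : C) :=
  forall e : R, 0 < e -> exists N, forall m, (N <= m)%N -> normc (u m - l) < e.

Lemma tends_cst l : tends (fun=> l) l.
Proof. by move=> e e0; exists 0%N => m _; rewrite subrr ComplexField.Normc.normc0. Qed.

Lemma tends_ext u v l : u =1 v -> tends u l -> tends v l.
Proof. by move=> uv ul e e0; have [N h] := ul e e0; exists N => m /h; rewrite uv. Qed.

Lemma tendsD u v a b : tends u a -> tends v b -> tends (fun m => u m + v m) (a + b).
Proof.
move=> ua vb e e0; have e2 : 0 < e / 2 by lra.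
have [N1 h1] := ua _ e2; have [N2 h2] := vb _ e2.
exists (maxn N1 N2) => m; rewrite geq_max => /andP[/h1 x1 /h2 x2].
rewrite opprD addrACA; apply: le_lt_trans (le_normcD _ _) _; lra.
Qed.

Lemma tendsM u v a b : tends u a -> tends v b -> tends (fun m => u m * v m) (a * b).
Proof.
move=> ua vb e e0; have a0 := normc_ge0 a; have b0 := normc_ge0 b.
have [N0 h0] := vb 1 ltr01.
have d1 : 0 < e / (2 * (normc b + 1)) by apply: divr_gt0 => //; lra.
have d2 : 0 < e / (2 * (normc a + 1)) by apply: divr_gt0 => //; lra.
have [N1 h1] := ua _ d1; have [N2 h2] := vb _ d2.
exists (maxn N0 (maxn N1 N2)) => m; rewrite !geq_max => /and3P[/h0 x0 /h1 x1 /h2 x2].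
have -> : u m * v m - a * b = (u m - a) * v m + a * (v m - b) by ring.
apply: le_lt_trans (le_normcD _ _) _; rewrite !normcM.
have vm : normc (v m) <= normc b + 1.
  have := normc_triangle (v m) b 0; rewrite !subr0; lra.
move: x1 x2; rewrite !ltr_pdivlMr; try lra.
have := ler_wpM2l (normc_ge0 (u m - a)) vm; have := normc_ge0 (v m - b).
move: (normc (u m - a)) (normc (v m - b)) (normc (v m)) (normc a) (normc b).
by move=> U W v' A B; lra.
Qed.

Lemma tends_conj u a : tends u a -> tends (fun m => Num.conj (u m)) (Num.conj a).
Proof.
move=> ua e e0; have [N h] := ua e e0; exists N => m /h.
rewrite -rmorphB /=; by case: (u m - a) => x y /=; rewrite sqrrN.
Qed.

Lemma tends_sum (I : Type) (s : seq I) (P : pred I) (u : I -> nat -> C) (l : I -> C) :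
  (forall i, P i -> tends (u i) (l i)) ->
  tends (fun m => \sum_(i <- s | P i) u i m) (\sum_(i <- s | P i) l i).
Proof.
move=> ul; elim: s => [|i s IH].
  by rewrite big_nil; apply: tends_ext (tends_cst 0) => m; rewrite big_nil.
rewrite big_cons; case: ifP => Pi.
  by apply: tends_ext (tendsD (ul i Pi) IH) => m; rewrite big_cons Pi.
by apply: tends_ext IH => m; rewrite big_cons Pi.
Qed.

Lemma tends_prod (I : Type) (s : seq I) (P : pred I) (u : I -> nat -> C) (l : I -> C) :
  (forall i, P i -> tends (u i) (l i)) ->
  tends (fun m => \prod_(i <- s | P i) u i m) (\prod_(i <- s | P i) l i).
Proof.
move=> ul; elim: s => [|i s IH].
  by rewrite big_nil; apply: tends_ext (tends_cst 1) => m; rewrite big_nil.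
rewrite big_cons; case: ifP => Pi.
  by apply: tends_ext (tendsM (ul i Pi) IH) => m; rewrite big_cons Pi.
by apply: tends_ext IH => m; rewrite big_cons Pi.
Qed.

Lemma tends_det n (A : nat -> 'M[C]_n) (B : 'M[C]_n) :
  (forall i j, tends (fun m => A m i j) (B i j)) -> tends (fun m => \det (A m)) (\det B).
Proof.
move=> AB; apply: tends_sum => s _; apply: tendsM; first exact: tends_cst.
by apply: tends_prod => i _; exact: AB.
Qed.

Lemma tends_gram n (A : nat -> 'M[C]_n) (B : 'M[C]_n) i j :
  (forall i j, tends (fun m => A m i j) (B i j)) ->
  tends (fun m => gram (A m) i j) (gram B i j).
Proof.
move=> AB; have e (D : 'M[C]_n) : gram D i j = \sum_k D i k * Num.conj (D j k).
  by rewrite mxE; apply: eq_bigr => k _; rewrite !mxE.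
rewrite e; apply: tends_ext (fun m => esym (e (A m))) _.
by apply: tends_sum => k _; apply: tendsM => //; exact: tends_conj.
Qed.

End Tends.

Section Transfer.
Context (R : realType) (d0 : measure_display) (T0 : measurableType d0) (P0 : probability T0 R)
  (d : measure_display) (T : measurableType d) (P : probability T R).
Local Notation C := R[i].
Variables (x : {RV P0 >-> C}) (X : nat * nat -> {RV P >-> C}).
Hypothesis Xx : iid_copies X x.

Lemma measure_finite d' (U : measurableType d') (mu : probability U R) (W : finType) (D : pred W)
    (F : W -> set U) : (forall w w' z, F w z -> F w' z -> w = w') ->
  (forall w, measurable (F w)) ->
  mu (\bigcup_(w in [set w | D w]) F w) = (\sum_(w | D w) mu (F w))%E.
Proof.
move=> tF mF; rewrite (_ : [set w | D w] = [set` enum D]); last first.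
  by apply/seteqP; split=> w /=; rewrite mem_enum.
rewrite measure_fin_bigcup //.
- by rewrite -fsbig_seq ?enum_uniq // big_enum.
- by move=> w w' _ _ [z [zw zw']]; exact: tF zw zw'.
Qed.

Section Alphabet.
Variables (W : finType) (phi : C -> W).
Hypothesis mphi : forall w, measurable (phi @^-1` [set w]).

Let cell w : set T0 := x @^-1` (phi @^-1` [set w]).

Lemma cell_measurable w : measurable (cell w).
Proof. by rewrite -[cell w]setTI; exact: measurable_funPT. Qed.

Lemma prob_fine d' (U : measurableType d') (mu : probability U R) (A : set U) :
  measurable A -> (fine (mu A))%:E = mu A.
Proof. by move=> mA; rewrite fineK // fin_num_measure. Qed.

Lemma image_law_sum : \sum_w fine (P0 (cell w)) = 1.
Proof.
apply: EFin_inj; rewrite -sumEFin (eq_bigr (fun w => P0 (cell w))); last first.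
  by move=> w _; rewrite prob_fine //; exact: cell_measurable.
rewrite -(measure_finite P0 predT); last exact: cell_measurable.
  rewrite -[RHS](@probability_setT _ _ _ P0); congr (P0 _).
  by apply/seteqP; split=> // z _; exists (phi (x z)).
by move=> w w' z; rewrite /cell /= => -> ->.
Qed.

Definition image_law : law R W :=
  Law (fun w => fine_ge0 (measure_ge0 P0 (cell w))) image_law_sum.

Lemma pr1_image_law (D : pred W) :
  (pr1 image_law D)%:E = P0 [set z | D (phi (x z))].
Proof.
rewrite /pr1 -sumEFin (eq_bigr (fun w => P0 (cell w))); last first.
  by move=> w _; rewrite /= prob_fine //; exact: cell_measurable.
rewrite -(measure_finite P0 D); last exact: cell_measurable.
  congr (P0 _); apply/seteqP; split=> z /=; last by exists (phi (x z)).
  by move=> [w /= Dw]; rewrite /cell /= => ->.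
by move=> w w' z; rewrite /cell /= => -> ->.
Qed.

Definition symbols n (w : T) : {ffun 'I_n * 'I_n -> W} :=
  [ffun e => phi (X (val e.1, val e.2) w)].

Let box n (m : {ffun 'I_n * 'I_n -> W}) : set T := [set w | symbols n w = m].

Lemma box_prob n (m : {ffun 'I_n * 'I_n -> W}) :
  measurable (box m) /\ P (box m) = (wt image_law m)%:E.
Proof.
pose h (e : 'I_n * 'I_n) := (val e.1, val e.2).
have hi : injective h by move=> [i j] [i' j'] [/val_inj -> /val_inj ->].
pose J : {fset nat * nat} := [fset h e | e in {: 'I_n * 'I_n}]%fset.
pose B k : set C := if [pick e | h e == k] is Some e then phi @^-1` [set m e] else setT.
have Bh e : B (h e) = phi @^-1` [set m e].
  rewrite /B; case: pickP => [e' /eqP/hi -> //|/(_ e)]; by rewrite eqxx.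
have mB k : measurable (B k).
  by rewrite /B; case: pickP => [e _|_]; [exact: mphi|exact: measurableT].
have e : box m = \bigcap_(k in [set` J]) X k @^-1` B k.
  apply/seteqP; split=> w /=.
    move=> wm k /= /imfsetP[e _ ->]; rewrite Bh /= -wm ffunE; reflexivity.
  move=> H; apply/ffunP => e; rewrite ffunE.
  have := H (h e); rewrite /= Bh; apply.
  by apply/imfsetP; exists e.
split; first by rewrite e; apply: fin_bigcap_measurable => // k _;
  rewrite -[_ @^-1` _]setTI; exact: measurable_funPT.
rewrite e (Xx.1 J B mB) big_imfset /=; last by move=> ? ? _ _; exact: hi.
rewrite /wt -prodEFin big_enum /=; apply: eq_bigr => i _.
rewrite Bh prob_fine; last exact: cell_measurable.
by have := Xx.2 (h i) _ (mphi (m i)).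
Qed.

(** The event is a finite union of boxes, and independence gives each box its product weight. *)
Lemma transfer n (A : {ffun 'I_n * 'I_n -> W} -> Prop) :
  measurable [set w | A (symbols n w)] /\
  P [set w | A (symbols n w)] = (Pr image_law A)%:E.
Proof.
have -> : [set w | A (symbols n w)] = \bigcup_(m in [set m | `[< A m >]]) box m.
  apply/seteqP; split=> w /=; last by move=> [m /= /asboolP Am]; rewrite /box /= => ->.
  by move=> Aw; exists (symbols n w) => //=; apply/asboolP.
split.
  by apply: fin_bigcup_measurable => // m _; have [] := box_prob m.
rewrite (@measure_finite _ _ P _ (fun m => `[< A m >])); first last.
- by move=> m; have [] := box_prob m.
- by move=> m m' w; rewrite /box /= => -> ->.
rewrite /Pr /Ex -sumEFin [LHS]big_mkcond; apply: eq_bigr => m _.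
rewrite (box_prob m).2 /ind; case: asboolP => _; first by rewrite mulr1.
by rewrite mulr0.
Qed.

End Alphabet.

(** The lower limit of the events is an increasing union of intersections and inherits the uniform
    bound. It is used to let the mesh of the rounding tend to zero. *)
Lemma eventually_bound (E : nat -> set T) (c : R) : (forall N, measurable (E N)) ->
  (forall N, (P (E N) <= c%:E)%E) ->
  exists F, [/\ measurable F, (P F <= c%:E)%E &
    forall w, (exists M, forall N, (M <= N)%N -> E N w) -> F w].
Proof.
move=> mE Ec; pose G M := \bigcap_(N in [set N | (M <= N)%N]) E N.
have mG M : measurable (G M) by apply: bigcap_measurable => //; exists M => /=.
exists (\bigcup_M G M); split.
- exact: bigcup_measurable.
- have nd : nondecreasing_seq G.
    move=> M M' MM'; apply/subsetPset => w Gw N /= MN; apply: Gw => /=.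
    exact: leq_trans MN.
  have cv := nondecreasing_cvg_mu (mu := P) mG (bigcup_measurable (fun k _ => mG k)) nd.
  rewrite -(cvg_lim _ cv) //; apply: lime_le; first by apply/cvg_ex; eexists; exact: cv.
  apply: nearW => M; apply: le_trans (Ec M).
  apply: le_measure; rewrite ?inE; [exact: mG|exact: mE|].
  by move=> w; apply=> /=.
- by move=> w [M MP]; exists M.
Qed.

End Transfer.

(** * Borel measurability on the complex plane *)

Section ComplexMeasurability.
Variable R : realType.
Local Notation C := R[i].

Lemma open_normc (A : set C) :
  (forall z, A z -> exists2 e : R, 0 < e & forall w, normc (z - w) < e -> A w) -> open A.
Proof.
move=> h; rewrite openE => z /h[e e0 eA]; apply/nbhs_ballP; exists e%:C => /=.
  by rewrite ltcR.
by move=> w; rewrite /ball /= => zw; apply: eA; rewrite -ltcR.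
Qed.

Lemma measurable_openC (A : set C) : open A -> measurable A.
Proof. by move=> oA; exact: sub_sigma_algebra. Qed.

Lemma continuous_measurableC (f : C -> R) :
  (forall z (e : R), 0 < e -> exists2 r : R, 0 < r & forall w, normc (z - w) < r -> `|f z - f w| < e) ->
  measurable_fun setT f.
Proof.
move=> cf; apply: (measurability _ (RGenOpens.measurableE R)).
move=> _ [_ [a [b ->]] <-]; apply: measurableI => //; apply: measurable_openC.
apply: open_normc => z /=; rewrite in_itv /= => /andP[az zb].
have e0 : 0 < Num.min (f z - a) (b - f z) by rewrite lt_min !subr_gt0 az zb.
have [r r0 rP] := cf z _ e0; exists r => // w /rP.
by rewrite in_itv /= lt_min !ltr_norml => /andP[/andP[h1 h2] /andP[h3 h4]]; lra.
Qed.

Lemma lipschitz_measurableC (f : C -> R) :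
  (forall z w, `|f z - f w| <= normc (z - w)) -> measurable_fun setT f.
Proof.
move=> lf; apply: continuous_measurableC => z e e0; exists e => // w zw.
exact: le_lt_trans (lf z w) zw.
Qed.

Lemma measurable_Re : measurable_fun setT (@complex.Re R).
Proof.
apply: lipschitz_measurableC => z w; rewrite -ReN -ReD; exact: Re_le_normc.
Qed.

Lemma Im_le_normc (z : C) : `|complex.Im z| <= normc z.
Proof. by case: z => a b /=; rewrite -sqrtr_sqr ler_wsqrtr // lerDr sqr_ge0. Qed.

Lemma measurable_Im : measurable_fun setT (@complex.Im R).
Proof.
apply: lipschitz_measurableC => z w.
have -> : complex.Im z - complex.Im w = complex.Im (z - w) by case: z; case: w.
exact: Im_le_normc.
Qed.

Lemma normc_lipschitz (a z w : C) : `|normc (z - a) - normc (w - a)| <= normc (z - w).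
Proof.
have h1 := normc_triangle z w a; have h2 := normc_triangle w z a.
by move: h2; rewrite [normc (w - z)]normc_distC ler_norml => h2; lra.
Qed.

Lemma measurable_normcB (a : C) : measurable_fun setT (fun z : C => normc (z - a)).
Proof. by apply: lipschitz_measurableC => z w; exact: normc_lipschitz. Qed.

Lemma measurable_normc : measurable_fun setT (@normc R).
Proof.
rewrite (_ : @normc R = fun z : C => normc (z - 0)); first exact: measurable_normcB.
by apply/funext => z; rewrite subr0.
Qed.

Lemma measurable_disc (a : C) (r : R) : measurable [set z : C | normc (z - a) < r].
Proof.
rewrite -[X in measurable X]setTI; have := measurable_normcB a.
by move=> /(_ measurableT _ (measurable_itv `]-oo, r[)); congr (measurable (_ `&` _));
  apply/seteqP; split=> z /=; rewrite in_itv.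
Qed.

End ComplexMeasurability.

(** * Two separated regions of positive mass *)

Section TwoAtoms.
Context (R : realType) (d0 : measure_display) (T0 : measurableType d0) (P0 : probability T0 R).
Variable x : {RV P0 >-> R[i]}.
Hypothesis x01 : zero_mean_unit_variance x.
Local Notation C := R[i].

Lemma preimage_measurable (A : set C) : measurable A -> measurable (x @^-1` A).
Proof. by move=> mA; rewrite -[X in measurable X]setTI; exact: measurable_funPT. Qed.

Lemma grid_cover (m r : R) : 0 < m -> 0 < r -> exists s : seq C,
  forall z, normc z < m -> exists2 g, g \in s & normc (z - g) < r.
Proof.
move=> m0 r0; pose D := (Num.truncn (2 * m / r)).+1.
have D0 : (0 < D)%N by [].
have Dr : 2 * m / D%:R < r.
  rewrite ltr_pdivrMr ?ltr0n // [ltRHS]mulrC -ltr_pdivrMr //.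
  have h : 0 <= 2 * m / r by rewrite divr_ge0 ?mulr_ge0 // ltW.
  by have /andP[] := truncn_itv h.
exists [seq m%:C * gridpt R g | g <- enum {: 'I_(4 * D).+1 * 'I_(4 * D).+1}] => z zm.
have mz : z = m%:C * (m^-1%:C * z).
  by rewrite mulrA -rmorphM /= mulfV ?mul1r // gt_eqF.
have nm (a : R) : 0 <= a -> normc (a%:C : C) = a.
  by move=> a0; rewrite /= expr0n addr0 sqrtr_sqr ger0_norm.
have z2 : normc (m^-1%:C * z) <= 2.
  rewrite normcM nm ?invr_ge0 ?(ltW m0) // mulrC ler_pdivrMr //; lra.
have [g gP] := gridP D0 z2; exists (m%:C * gridpt R g).
  by apply/mapP; exists g => //; rewrite mem_enum.
rewrite {1}mz -mulrBr normcM nm ?(ltW m0) //; apply: le_lt_trans Dr.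
by rewrite [2 * m]mulrC -mulrA ler_pM2l.
Qed.

(** Finitely many discs cover the bounded set; if all those that meet [A] were null, [A] would be
    null. *)
Lemma positive_disc (A : set C) (m r : R) : measurable A -> 0 < m -> 0 < r ->
  (forall z, A z -> normc z < m) -> P0 (x @^-1` A) != 0%E ->
  exists a, (exists2 z, A z & normc (z - a) < r) /\
    P0 (x @^-1` [set z : C | normc (z - a) < r]) != 0%E.
Proof.
move=> mA m0 r0 Am PA; have [s sP] := grid_cover m0 r0.
apply: contrapT => no; case/negP: PA; apply/eqP.
pose Q a := x @^-1` (A `&` [set z : C | normc (z - a) < r]).
have mQ a : measurable (Q a).
  by apply: preimage_measurable; apply: measurableI => //; exact: measurable_disc.
have Q0 a : P0 (Q a) = 0%E.
  have [[z Az za]|nz] := pselect (exists2 z, A z & normc (z - a) < r).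
    apply/eqP; rewrite eq_le measure_ge0 andbT.
    have -> : 0%E = P0 (x @^-1` [set z : C | normc (z - a) < r]).
      apply/esym/eqP; apply: contrapT => h; apply: no; exists a.
      by split; [exists z|apply/negP].
    apply: le_measure; rewrite ?inE; [exact: mQ| |by move=> w []].
    by apply: preimage_measurable; exact: measurable_disc.
  rewrite (_ : Q a = set0) ?measure0 //; apply/seteqP; split=> // w [Aw wa].
  by apply: nz; exists (x w).
apply/eqP; rewrite eq_le measure_ge0 andbT.
apply: (@le_trans _ _ (P0 (\big[setU/set0]_(a <- s) Q a))).
  apply: le_measure; rewrite ?inE; first exact: preimage_measurable.
    by apply: bigsetU_measurable => a _; exact: mQ.
  move=> w Aw; have [g gs wg] := sP (x w) (Am _ Aw).
  by rewrite -bigcup_seq; exists g.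
elim: (s) => [|a s' IH]; first by rewrite big_nil measure0.
have ms' : measurable (\big[setU/set0]_(b <- s') Q b).
  by apply: bigsetU_measurable => b _; exact: mQ.
rewrite big_cons; apply: (@le_trans _ _ (P0 (Q a) + P0 (\big[setU/set0]_(b <- s') Q b))%E).
  exact: measureU2.
by rewrite Q0 add0e.
Qed.

(** If the positive part of a centred function vanished almost surely, so would the negative part.
    The bound on the modulus and the positive level come from a countable union. *)
Lemma two_sides (c : C -> R) : measurable_fun setT c ->
  (\int[P0]_w (c (x w))%:E = 0)%E -> ~ (forall e : R, 0 < e ->
     P0 (x @^-1` [set z : C | e < `|c z|]) = 0%E) ->
  exists2 e : R, 0 < e & P0 (x @^-1` [set z : C | e < c z /\ normc z < e^-1]) != 0%E.
Proof.
move=> mc Ec nz; apply: contrapT => no.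
pose A k := x @^-1` [set z : C | k.+1%:R^-1 < c z /\ normc z < k.+1%:R].
have mcI (I : interval R) : measurable [set z : C | c z \in I].
  by rewrite -[X in measurable X]setTI; exact: (mc measurableT _ (measurable_itv I)).
have mset (e m : R) : measurable [set z : C | e < c z /\ normc z < m].
  rewrite (_ : mkset _ = [set z : C | c z \in `]e, +oo[] `&` [set z : C | normc (z - 0) < m]).
    by apply: measurableI; [exact: mcI|exact: measurable_disc].
  by apply/seteqP; split=> z /=; rewrite in_itv /= andbT subr0.
have mA k : measurable (A k) by apply: preimage_measurable; exact: mset.
have A0 k : P0 (A k) = 0%E.
  apply/eqP; apply: contrapT => /negP h; apply: no; exists k.+1%:R^-1; last by rewrite invrK.
  by rewrite invr_gt0.
have mpos : measurable (x @^-1` [set z : C | 0 < c z]).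
  apply: preimage_measurable; rewrite (_ : mkset _ = [set z : C | c z \in `]0, +oo[]); first exact: mcI.
  by apply/seteqP; split=> z /=; rewrite in_itv /= andbT.
have Ppos : P0 (x @^-1` [set z : C | 0 < c z]) = 0%E.
  apply/eqP; rewrite eq_le measure_ge0 andbT.
  have sub : x @^-1` [set z : C | 0 < c z] `<=` \bigcup_k A k.
    move=> w /= cw; pose k := Num.truncn (Num.max (c (x w))^-1 (normc (x w))).
    exists k => //; rewrite /A /=.
    have mx0 : 0 <= Num.max (c (x w))^-1 (normc (x w)) by rewrite le_max normc_ge0 orbT.
    have /andP[_] := truncn_itv mx0; rewrite gt_max -/k => /andP[h1 h2]; split => //.
    by rewrite -[ltRHS]invrK ltf_pV2 ?posrE ?invr_gt0 // ltr0n.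
  have := @measure_sigma_subadditive _ _ _ P0 _ A mA mpos sub.
  by rewrite eseries0 // => k _ _; exact: A0.
have mcx : measurable_fun setT (fun w => c (x w)) by apply: measurableT_comp => //; exact: measurable_funPT.
have abs0 : (\int[P0]_w `|(c (x w))%:E| = 0)%E.
  rewrite -[RHS]oppe0 -[X in (- X)%E]Ec.
  have e2 : (\int[P0]_w (c (x w))%:E = \int[P0]_w - `|(c (x w))%:E|)%E.
    apply: ae_eq_integral => //.
    - exact/measurable_EFinP.
    - by apply: measurableT_comp => //; apply: measurableT_comp => //; exact/measurable_EFinP.
    - exists (x @^-1` [set z : C | 0 < c z]); split => // w /= h.
      rewrite /= ltNge; apply/negP => cw; apply: h => _.
      by rewrite /= ler0_norm // opprK.
  by rewrite e2 integral_ge0N ?oppeK // => w _; exact: abse_ge0.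
apply: nz => e e0; have := abs0.
have /(ae_eq_integral_abs P0 measurableT) -> : measurable_fun setT (EFin \o (fun w => c (x w))).
  exact/measurable_EFinP.
move=> [N [mN N0 sN]]; apply/eqP; rewrite eq_le measure_ge0 andbT -N0.
apply: le_measure; rewrite ?inE //.
  apply: preimage_measurable; rewrite (_ : mkset _ = [set z : C | c z \in `]e, +oo[] `|` [set z : C | c z \in `]-oo, -e[]).
    by apply: measurableU; exact: mcI.
  apply/seteqP; split=> z /=; rewrite !in_itv /= andbT ltr_normr.
    by move=> /orP[h|h]; [left|right]; lra.
  by move=> [h|h]; apply/orP; [left|right]; lra.
move=> w /= ew; apply: sN => /= h; have := h I => -[c0].
by move: ew; rewrite c0 normr0; lra.
Qed.

(** The real or the imaginary part: if both vanished almost surely, the second moment would be 0 and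
    not 1. *)
Lemma not_null : exists c : C -> R, [/\ forall z w, `|c z - c w| <= normc (z - w),
  (forall z w, c (z - w) = c z - c w), (\int[P0]_w (c (x w))%:E = 0)%E & ~ (forall e : R, 0 < e ->
     P0 (x @^-1` [set z : C | e < `|c z|]) = 0%E)].
Proof.
have [E1 E2 E3] := x01; move: E1 E2 E3; rewrite unlock => E1 E2 E3.
apply: contrapT => no.
have ae0 (c : C -> R) : measurable_fun setT c -> (forall e : R, 0 < e ->
     P0 (x @^-1` [set z : C | e < `|c z|]) = 0%E) -> {ae P0, forall w, c (x w) = 0}.
  move=> mc h; pose A k := x @^-1` [set z : C | k.+1%:R^-1 < `|c z|].
  have mA k : measurable (A k).
    apply: preimage_measurable; rewrite (_ : mkset _ = (fun z : C => `|c z|) @^-1` `]k.+1%:R^-1, +oo[%classic).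
      rewrite -[X in measurable X]setTI.
      by apply: (measurableT_comp _ mc) => //; exact: measurable_normr.
    by apply/seteqP; split=> z /=; rewrite in_itv /= andbT.
  exists (\bigcup_k A k); split; first exact: bigcupT_measurable.
    apply/eqP; rewrite eq_le measure_ge0 andbT.
    have := @measure_sigma_subadditive _ _ _ P0 _ A mA (bigcupT_measurable _ mA) (@subset_refl _ _).
    by rewrite eseries0 // => k _ _; apply: h; rewrite invr_gt0.
  move=> w /= cw; have c0 : 0 < `|c (x w)| by rewrite normr_gt0; apply/eqP.
  have i0 : 0 <= `|c (x w)|^-1 by rewrite invr_ge0.
  exists (Num.truncn `|c (x w)|^-1) => //; have /andP[_ h2] := truncn_itv i0.
  by rewrite /A /= -[ltRHS]invrK ltf_pV2 ?posrE ?invr_gt0 // ltr0n.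
have small (c : C -> R) : (forall z w, `|c z - c w| <= normc (z - w)) ->
  (forall z w, c (z - w) = c z - c w) -> (\int[P0]_w (c (x w))%:E = 0)%E ->
  {ae P0, forall w, c (x w) = 0}.
  move=> lc ac Ec; apply: ae0; first exact: lipschitz_measurableC.
  by apply: contrapT => h; apply: no; exists c.
have ReB (z w : C) : complex.Re (z - w) = complex.Re z - complex.Re w by case: z; case: w.
have ImB (z w : C) : complex.Im (z - w) = complex.Im z - complex.Im w by case: z; case: w.
have a1 := small _ (fun z w => eq_ind _ (fun a => `|a| <= _) (Re_le_normc (z - w)) _ (ReB z w)) ReB E1.
have a2 := small _ (fun z w => eq_ind _ (fun a => `|a| <= _) (Im_le_normc (z - w)) _ (ImB z w)) ImB E2.
have : (\int[P0]_w (normc (x w) ^+ 2)%:E = \int[P0]_w (cst 0 w))%E.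
  apply: ae_eq_integral => //.
    apply/measurable_EFinP; apply: measurable_funX.
    by apply: measurableT_comp; [exact: measurable_normc|exact: measurable_funPT].
  apply: filterS2 a1 a2 => w /= r0 i0 _.
  by move: r0 i0; case: (x w) => a b /= -> ->; rewrite expr0n addr0 sqrtr0 expr0n.
by rewrite E3 integral0 => /eqP; rewrite onee_eq0.
Qed.

(* Centring and unit variance give mass to two discs that are far apart compared with their radii. *)
Lemma two_atoms : exists a1 a2 : C, exists r p0 : R,
  [/\ 0 < r, 0 < p0, r <= normc (a2 - a1) / 40 &
    (p0%:E <= P0 (x @^-1` [set z : C | (normc (z - a1) < r)%R]))%E /\
    (p0%:E <= P0 (x @^-1` [set z : C | (normc (z - a2) < r)%R]))%E].
Proof.
have [c [lc ac Ec nz]] := not_null.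
have cN z : c (- z) = - c z.
  by have := ac 0 z; have := ac 0 0; rewrite subr0 sub0r => h1 h2; lra.
have mc := lipschitz_measurableC lc.
have [e1 e10 P1] := two_sides mc Ec nz.
have [|||e2 e20 P2] := @two_sides (fun z => - c z).
- exact: measurableT_comp.
- rewrite (_ : (fun w => _) = (fun w => - (c (x w))%:E)%E) //.
  move: Ec; rewrite integralE [in X in _ -> X]integralE funeposN funenegN.
  move: (integral _ _ _) (integral _ _ _) => [a| |] [b| |] //= [ab].
  by rewrite -EFinB; congr EFin; lra.
- by move=> h; apply: nz => e e0; rewrite -(h e e0); congr (P0 (_ @^-1` _));
    apply/seteqP; split=> z /=; rewrite normrN.
(* Points with c > e and c < -e are 2e apart, so discs of radius e/40 around nearby centres leave
   these more than e apart. The ratio 40 anticipates the rounding, which doubles the radius: a jump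
   then deviates by at most 4r <= |y0|/10. *)
pose e := Num.min e1 e2; have e0 : 0 < e by rewrite lt_min e10.
have r0 : 0 < e / 40 by rewrite divr_gt0.
have mI (b : C -> R) (m : R) : measurable_fun setT b ->
    measurable [set z : C | e < b z /\ normc z < m].
  move=> mb; rewrite (_ : mkset _ = b @^-1` `]e, +oo[%classic `&` [set z : C | normc (z - 0) < m]).
    apply: measurableI; last exact: measurable_disc.
    by rewrite -[X in measurable X]setTI; exact: (mb measurableT _ (measurable_itv _)).
  by apply/seteqP; split=> z /=; rewrite in_itv /= andbT subr0.
have grow (b : C -> R) (e' : R) : measurable_fun setT b -> e <= e' -> 0 < e' ->
    P0 (x @^-1` [set z : C | e' < b z /\ normc z < e'^-1]) != 0%E ->
    measurable (x @^-1` [set z : C | e' < b z /\ normc z < e'^-1]) ->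
    P0 (x @^-1` [set z : C | e < b z /\ normc z < e^-1]) != 0%E.
  move=> mb ee e'0 nz0 m'; apply/negP => /eqP h; case/negP: nz0.
  rewrite eq_le measure_ge0 andbT -h; apply: le_measure; rewrite ?inE //.
    by apply: preimage_measurable; exact: mI.
  move=> w /= [h1 h2]; split; first exact: le_lt_trans h1.
  by apply: lt_le_trans h2 _; rewrite lef_pV2 ?posrE.
have mI' (b : C -> R) (e' : R) : measurable_fun setT b ->
    measurable (x @^-1` [set z : C | e' < b z /\ normc z < e'^-1]).
  move=> mb; apply: preimage_measurable.
  rewrite (_ : mkset _ = b @^-1` `]e', +oo[%classic `&` [set z : C | normc (z - 0) < e'^-1]).
    apply: measurableI; last exact: measurable_disc.
    by rewrite -[X in measurable X]setTI; exact: (mb measurableT _ (measurable_itv _)).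
  by apply/seteqP; split=> z /=; rewrite in_itv /= andbT subr0.
have mNc : measurable_fun setT (fun z : C => - c z) by exact: measurableT_comp.
have ee1 : e <= e1 by rewrite ge_min lexx.
have ee2 : e <= e2 by rewrite ge_min lexx orbT.
have ei0 : 0 < e^-1 by rewrite invr_gt0.
have [a1 [[z1 [z1e _] za1] Q1]] := positive_disc (mI c e^-1 mc) ei0 r0 (fun z h => h.2)
  (grow c e1 mc ee1 e10 P1 (mI' c e1 mc)).
have [a2 [[z2 [z2e _] za2] Q2]] := positive_disc (mI _ e^-1 mNc) ei0 r0 (fun z h => h.2)
  (grow _ e2 mNc ee2 e20 P2 (mI' _ e2 mNc)).
pose D a := x @^-1` [set z : C | normc (z - a) < e / 40].
have mD a : measurable (D a) by apply: preimage_measurable; exact: measurable_disc.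
have fp a : P0 (D a) != 0%E -> 0 < fine (P0 (D a)).
  by move=> h; rewrite -lte_fin prob_fine // lt0e h measure_ge0.
exists a1, a2, (e / 40), (Num.min (fine (P0 (D a1))) (fine (P0 (D a2)))); split => //.
- by rewrite lt_min !fp.
- rewrite ler_pM2r ?invr_gt0 //; have := lc a1 a2; have := lc z1 a1; have := lc z2 a2.
  rewrite [normc (a1 - a2)]normc_distC !ler_norml => /andP[h1 h2] /andP[h3 h4] /andP[h5 h6].
  by move: z1e z2e za1 za2 h1 h2 h3 h4 h5 h6; lra.
- split.
    by rewrite -[leRHS](prob_fine P0 (mD a1)) lee_fin ge_min lexx.
  by rewrite -[leRHS](prob_fine P0 (mD a2)) lee_fin ge_min lexx orbT.
Qed.

End TwoAtoms.

Section BorelCantelli.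
Context (R : realType) (d : measure_display) (T : measurableType d) (P : probability T R).

Lemma borel_cantelli (G : nat -> set T) (b : nat -> R) (B : R) :
  (forall k, measurable (G k)) -> (forall k, (P (G k) <= (b k)%:E)%E) ->
  (forall N, \sum_(k < N) b k <= B) ->
  {ae P, forall w, \forall k \near \oo, ~ G k w}.
Proof.
move=> mG Gb bB; exists (lim_sup_set G); split.
- apply: bigcap_measurable => // k _; exact: bigcup_measurable.
- apply: lim_sup_set_cvg0 => //; apply: (@le_lt_trans _ _ B%:E); last exact: ltry.
  apply: lime_le; first exact: is_cvg_nneseries.
  apply: nearW => N; apply: (@le_trans _ _ (\sum_(0 <= k < N) (b k)%:E)%E).
    by apply: lee_sum => k _; exact: Gb.
  by rewrite sumEFin lee_fin big_mkord.
- move=> w /= h k _; apply: contrapT => no; apply: h; exists k => // j /= kj Gj.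
  by apply: no; exists j.
Qed.

Lemma measure_bigU_le (I : Type) (s : seq I) (F : I -> set T) (b : I -> R) :
  (forall i, measurable (F i)) -> (forall i, (P (F i) <= (b i)%:E)%E) ->
  (P (\big[setU/set0]_(i <- s) F i) <= (\sum_(i <- s) b i)%:E)%E.
Proof.
move=> mF Fb; elim: s => [|i s IH]; first by rewrite !big_nil measure0.
have ms : measurable (\big[setU/set0]_(i <- s) F i) by exact: bigsetU_measurable.
rewrite !big_cons EFinD; apply: le_trans (leeD (Fb i) IH); exact: measureU2.
Qed.

End BorelCantelli.

Section BoolAlphabet.
Context (R : realType).
Local Notation C := R[i].

(** Several yes-or-no tests are read as one symbol, so that overlapping discs can serve as an
    alphabet. *)
Definition bits (V : finType) (b : V -> C -> bool) (z : C) : {ffun V -> bool} := [ffun v => b v z].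

Lemma measurable_bits (V : finType) (b : V -> C -> bool) :
  (forall v, measurable [set z | b v z]) ->
  forall f, measurable (bits b @^-1` [set f]).
Proof.
move=> mb f.
rewrite (_ : _ @^-1` _ = \bigcap_(v in [set: V])
    (if f v then [set z | b v z] else ~` [set z | b v z])).
  apply: fin_bigcap_measurable => // v _; case: (f v) => //; exact: measurableC.
apply/seteqP; split=> z /=.
  by move=> <- v _; rewrite ffunE; case: ifP => //= /negbT/negP.
move=> h; apply/ffunP => v; rewrite ffunE; have := h v I.
by case: (f v) => //= /negP/negbTE.
Qed.

End BoolAlphabet.

Section FiniteVariance.
Variables (R : realType) (V I : finType) (p : law R V) (g : V -> R).

Lemma Ex_coord (e : I) (h : V -> R) :
  Ex p (fun m : {ffun I -> V} => h (m e)) = \sum_v p v * h v.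
Proof.
transitivity (Ex p (fun m : {ffun I -> V} => \prod_i (if i == e then h (m i) else 1))).
  apply: eq_Ex => m; rewrite (bigD1 e) //= eqxx big1 ?mulr1 // => i /negPf -> //.
rewrite (Ex_prod p (fun i v => if i == e then h v else 1)) (bigD1 e) //= eqxx.
rewrite [X in _ * X]big1 ?mulr1 // => i /negPf ->.
by under eq_bigr do rewrite mulr1; exact: law_sum.
Qed.

Lemma Ex_variance : \sum_v p v * g v = 0 ->
  Ex p (fun m : {ffun I -> V} => (\sum_e g (m e)) ^+ 2) = #|I|%:R * \sum_v p v * g v ^+ 2.
Proof.
move=> g0; under eq_Ex => m do rewrite expr2 mulr_suml.
rewrite Ex_sum -[LHS](_ : \sum_(e : I) \sum_v p v * g v ^+ 2 = _).
  by rewrite sumr_const mulr_natl.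
apply: eq_bigr => e _; under eq_Ex => m do rewrite mulr_sumr.
rewrite Ex_sum (bigD1 e) //= [X in _ = _ + X]big1 ?addr0 => [|e' ee'].
  rewrite -(Ex_coord e (fun v => g v ^+ 2)); apply: eq_Ex => m; exact: esym (expr2 _).
transitivity (Ex p (fun m : {ffun I -> V} =>
   \prod_i (if (i == e) || (i == e') then g (m i) else 1))).
  apply: eq_Ex => m; rewrite (bigD1 e) //= eqxx (bigD1 e') //= eqxx orbT.
  by rewrite big1 ?mulr1 // => i /andP[/negPf -> /negPf ->].
rewrite (Ex_prod p (fun i v => if (i == e) || (i == e') then g v else 1)) (bigD1 e) //= eqxx.
by rewrite g0 mul0r.
Qed.

End FiniteVariance.

(** * Almost sure bound on the sum of squared entries *)

Section HilbertSchmidt.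
Context (R : realType) (d0 : measure_display) (T0 : measurableType d0) (P0 : probability T0 R)
  (d : measure_display) (T : measurableType d) (P : probability T R).
Local Notation C := R[i].
Variables (x : {RV P0 >-> C}) (X : nat * nat -> {RV P >-> C}).
Hypothesis Xx : iid_copies X x.
Hypothesis x01 : zero_mean_unit_variance x.

Let big (j : nat) : set C := [set z | 4 ^+ j < normc z ^+ 2].

Lemma measurable_big j : measurable (big j).
Proof.
have m2 : measurable_fun setT (fun z : C => normc z ^+ 2).
  by apply: measurable_funX; exact: measurable_normc.
rewrite /big (_ : mkset _ = (fun z : C => normc z ^+ 2) @^-1` `]4 ^+ j, +oo[%classic).
  by rewrite -[X in measurable X]setTI; exact: (m2 measurableT _ (measurable_itv _)).
by apply/seteqP; split=> z /=; rewrite in_itv /= andbT.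
Qed.

Let mbig0 j : measurable (x @^-1` big j).
Proof. by apply: preimage_measurable; exact: measurable_big. Qed.

Definition tailp (j : nat) : R := fine (P0 (x @^-1` big j)).

Lemma tailp_ge0 j : 0 <= tailp j.
Proof. by rewrite fine_ge0. Qed.

Lemma tail_pointwise (a : R) (L : nat) : 0 <= a ->
  \sum_(j < L) (if 4 ^+ j < a then 4 ^+ j else 0) <= 4 / 3 * a.
Proof.
move=> a0; have key K : \sum_(j < K) 4 ^+ j <= 4 ^+ K / 3 :> R.
  elim: K => [|K IH]; first by rewrite big_ord0 expr0; lra.
  by rewrite big_ord_recr /= exprS; lra.
elim: L => [|L IH]; first by rewrite big_ord0; lra.
rewrite big_ord_recr /=; case: ifP => h; last by rewrite addr0.
apply: (@le_trans _ _ (\sum_(j < L) 4 ^+ j + 4 ^+ L)).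
  rewrite lerD2r; apply: ler_sum => j _; case: ifP => // _; exact: exprn_ge0.
by have := key L; lra.
Qed.

Lemma tail_sum (L : nat) : \sum_(j < L) 4 ^+ j * tailp j <= 4 / 3.
Proof.
have [_ _] := x01; rewrite unlock => E2.
rewrite -lee_fin -sumEFin.
pose f (j : 'I_L) w : \bar R := ((4 ^+ j)%:E * (\1_(x @^-1` big j) w)%:E)%E.
have mind j : measurable_fun setT (fun w => (\1_(x @^-1` big j) w)%:E : \bar R).
  by apply/measurable_EFinP; exact: measurable_indic.
have fE (j : 'I_L) : (4 ^+ j * tailp j)%:E = (\int[P0]_w f j w)%E.
  rewrite (ge0_integralZl P0 measurableT (mind j)) ?lee_fin ?exprn_ge0 //.
  by rewrite integral_indic // setIT EFinM prob_fine.
under eq_bigr do rewrite fE.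
rewrite -ge0_integral_sum //; last 2 first.
- move=> j; apply: emeasurable_funM => //; exact: mind.
- by move=> j w _; rewrite mule_ge0 // lee_fin ?exprn_ge0.
have mx2 : measurable_fun setT (fun w => (4 / 3 * normc (x w) ^+ 2)%:E).
  apply/measurable_EFinP; apply: measurable_funM => //; apply: measurable_funX.
  by apply: measurableT_comp; [exact: measurable_normc|exact: measurable_funPT].
apply: (@le_trans _ _ (\int[P0]_w (4 / 3 * normc (x w) ^+ 2)%:E)%E).
  apply: ge0_le_integral => //.
  - by move=> w _; apply: sume_ge0 => j _; rewrite mule_ge0 // lee_fin ?exprn_ge0.
  - apply: emeasurable_sum => j.
    by apply: emeasurable_funM => //; exact: mind.
  - move=> w _; rewrite /f; under eq_bigr do rewrite -EFinM.
    rewrite sumEFin lee_fin; apply: le_trans (tail_pointwise L (sqr_ge0 (normc (x w)))).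
    apply: ler_sum => j _; rewrite indicE.
    case: ifP => h; first by rewrite mem_set ?mulr1.
    by rewrite memNset ?mulr0 //= /big /= h.
under eq_integral do rewrite EFinM.
have mx : measurable_fun setT (fun w => (normc (x w) ^+ 2)%:E).
  apply/measurable_EFinP; apply: measurable_funX.
  by apply: measurableT_comp; [exact: measurable_normc|exact: measurable_funPT].
rewrite (ge0_integralZl P0 measurableT mx) ?lee_fin //; first by rewrite E2 mule1.
by move=> w _; rewrite lee_fin sqr_ge0.
Qed.

Section Block.
Variable l : nat.

Let b (j : 'I_l.+2) (z : C) : bool := 4 ^+ j < normc z ^+ 2.

Let mb j : measurable [set z | b j z]. Proof. exact: measurable_big. Qed.

Let q := image_law x (measurable_bits mb).

(** On the bits of a number a, the tests 4^i < a, the sum telescopes to s^j with j the number of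
    positive tests: s = 4 rounds a up to a power of 4, as long as it is within range, and s = 16
    gives the square of that value. *)
Definition size_val (f : {ffun 'I_l.+2 -> bool}) (s : R) : R :=
  1 + \sum_(j < l.+1) (if f (widen_ord (leqnSn _) j) then (s - 1) * s ^+ j else 0).

Lemma size_valE (a : R) (L : nat) : 0 <= a ->
  exists j, [/\ 1 + \sum_(i < L) (if 4 ^+ i < a then (4 - 1) * 4 ^+ i else 0 : R) = 4 ^+ j,
    1 + \sum_(i < L) (if 4 ^+ i < a then (16 - 1) * 16 ^+ i else 0 : R) = 16 ^+ j &
    a <= 4 ^+ L -> a <= 4 ^+ j].
Proof.
move=> a0; elim: L => [|L [j [IH1 IH2 IH3]]].
  by exists 0%N; rewrite !big_ord0 !addr0 !expr0.
rewrite !big_ord_recr /=; case: ifP => h; last first.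
  by exists j; rewrite !addr0; split => // _; apply: IH3; rewrite leNgt h.
have full (s : R) : \sum_(i < L) (if 4 ^+ i < a then (s - 1) * s ^+ i else 0 : R) = s ^+ L - 1.
  rewrite subrX1 mulr_sumr; apply: eq_bigr => i _; rewrite (_ : 4 ^+ i < a) //.
  by apply: le_lt_trans h; apply: ler_weXn2l; [lra|exact: ltnW].
by exists L.+1; rewrite !full !exprS; split => //; ring.
Qed.

Lemma law_support (f : {ffun 'I_l.+2 -> bool}) : q f != 0 -> exists z, f = bits b z.
Proof.
move=> qf; apply: contrapT => no; case/negP: qf; apply/eqP.
rewrite /= (_ : _ @^-1` _ = set0) ?measure0 //.
by apply/seteqP; split=> // w /= h; apply: no; exists (x w).
Qed.

Lemma law_size (s : R) : \sum_f q f * size_val f s =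
  1 + \sum_(j < l.+1) (s - 1) * s ^+ j * tailp j.
Proof.
under eq_bigr do rewrite mulrDr mulr1.
rewrite big_split; congr (_ + _); first exact: (law_sum q).
under eq_bigr do rewrite mulr_sumr; rewrite exchange_big; apply: eq_bigr => j _ /=.
pose D (f : {ffun 'I_l.+2 -> bool}) := f (widen_ord (leqnSn _) j).
have -> : tailp j = pr1 q D.
  apply: EFin_inj; rewrite pr1_image_law prob_fine //; congr (P0 _).
  by apply/seteqP; split=> w; rewrite /D /= ffunE.
rewrite /pr1 mulr_sumr [RHS]big_mkcond; apply: eq_bigr => f _; rewrite /D.
by case: ifP => _; rewrite ?mulr0 // mulrC.
Qed.

(** Chebyshev's bound for the truncated squares, plus the union bound for an entry whose square
    exceeds 4^(l+1). *)
Definition block_bound : R := (1 + 15 * \sum_(j < l.+1) 16 ^+ j * tailp j) / 4 ^+ l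
  + 4 ^+ l * tailp l.+1.

Lemma block_event : exists F, [/\ measurable F, (P F <= block_bound%:E)%E &
  forall w, ~ F w -> \sum_(e : 'I_(2 ^ l) * 'I_(2 ^ l)) normc (X (val e.1, val e.2) w) ^+ 2 <= 6 * 4 ^+ l].
Proof.
pose E := ('I_(2 ^ l) * 'I_(2 ^ l))%type.
have cE : #|{: E}|%:R = 4 ^+ l :> R.
  by rewrite card_prod !card_ord natrM natrX -exprMn; congr (_ ^+ _); lra.
pose over (m : {ffun E -> {ffun 'I_l.+2 -> bool}}) := exists e, m e ord_max.
pose large (m : {ffun E -> {ffun 'I_l.+2 -> bool}}) :=
  6 * 4 ^+ l <= \sum_e size_val (m e) 4.
have [mO PO] := transfer Xx (measurable_bits mb) over.
have [mL PL] := transfer Xx (measurable_bits mb) large.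
exists ([set w | large (symbols X (bits b) (2 ^ l) w)] `|` [set w | over (symbols X (bits b) (2 ^ l) w)]).
split; first exact: measurableU.
- apply: le_trans (measureU2 _ _ _) _ => //; rewrite /block_bound EFinD; apply: leeD.
    rewrite [leLHS]PL lee_fin; set mu := \sum_f q f * size_val f 4.
    (* The mean is at most 1 + 3 * 4/3 = 5 by [tail_sum]; against the threshold 6 this leaves a
       deviation of 4^l for the sum of 4^l terms. *)
    have mu5 : mu <= 5.
      rewrite /mu law_size; have := tail_sum l.+1; rewrite -(ler_pM2l (_ : 0 < 3)) //.
      have -> : \sum_(j < l.+1) (4 - 1) * 4 ^+ j * tailp j = 3 * \sum_(j < l.+1) 4 ^+ j * tailp j.
        by rewrite mulr_sumr; apply: eq_bigr => j _; rewrite -mulrA; congr (_ * _); lra.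
      lra.
    have g0 : \sum_f q f * (size_val f 4 - mu) = 0.
      under eq_bigr do rewrite mulrBr.
      by rewrite sumrB -mulr_suml (law_sum q) mul1r subrr.
    have V := @Ex_variance _ _ E q (fun f => size_val f 4 - mu) g0.
    have p4 : 0 < 4 ^+ l :> R by rewrite exprn_gt0.
    apply: (@le_trans _ _ (Pr q (fun m : {ffun E -> _} =>
       (4 ^+ l) ^+ 2 <= (\sum_e (size_val (m e) 4 - mu)) ^+ 2))).
      apply: le_Pr => m; rewrite /large => h.
      have h2 : 4 ^+ l <= \sum_e (size_val (m e) 4 - mu).
        rewrite sumrB sumr_const -[mu *+ _]mulr_natl cE.
        by have := ler_wpM2l (ltW p4) mu5; lra.
      by rewrite lerXn2r ?nnegrE ?(ltW p4) // (le_trans (ltW p4)).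
    apply: le_trans (Pr_markov _ _ _) _ => [m||]; [exact: sqr_ge0|exact: exprn_gt0|].
    rewrite V cE (_ : _ / _ = (\sum_f q f * (size_val f 4 - mu) ^+ 2) / 4 ^+ l); last first.
      by have := lt0r_neq0 p4; move: (4 ^+ l) => c c0; field.
    rewrite ler_pM2r ?invr_gt0 //.
    have -> : 1 + 15 * \sum_(j < l.+1) 16 ^+ j * tailp j = \sum_f q f * size_val f 16.
      rewrite law_size mulr_sumr; congr (_ + _); apply: eq_bigr => j _.
      by rewrite mulrA; congr (_ * _ * _); lra.
    (* The identity holds only for the bits of an actual value; other strings have weight zero. *)
    have e16 f : q f * size_val f 4 ^+ 2 = q f * size_val f 16.
      have [->|/law_support[z ->]] := eqVneq (q f) 0; first by rewrite !mul0r.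
      congr (_ * _); rewrite /size_val; under eq_bigr do rewrite ffunE.
      under [in RHS]eq_bigr do rewrite ffunE.
      have [j [-> -> _]] := size_valE l.+1 (sqr_ge0 (normc z)).
      by rewrite exprAC; congr (_ ^+ _); ring.
    rewrite -(eq_bigr _ (fun f _ => e16 f)) -subr_ge0 -sumrB.
    rewrite (_ : \sum_(f | _) _ = mu ^+ 2) ?sqr_ge0 //.
    transitivity (\sum_f (2 * mu * (q f * size_val f 4) - mu ^+ 2 * q f)).
      by apply: eq_bigr => f _; move: (q f) => a; ring.
    by rewrite sumrB -!mulr_sumr (law_sum q) -/mu; ring.
  rewrite [leLHS]PO lee_fin; apply: le_trans (Pr_exists _ _) _.
  rewrite -cE; apply: (@le_trans _ _ (\sum_(e : E) tailp l.+1)); last first.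
    by rewrite sumr_const mulr_natl.
  apply: ler_sum => e _.
  rewrite /Pr (Ex_coord q e (fun f => ind R (f ord_max))).
  have -> : tailp l.+1 = pr1 q (fun f : {ffun 'I_l.+2 -> bool} => f ord_max).
    apply: EFin_inj; rewrite pr1_image_law prob_fine //; congr (P0 _).
    by apply/seteqP; split=> w; rewrite /= ffunE.
  rewrite /pr1 [leRHS]big_mkcond; apply: ler_sum => f _; rewrite ind_bool.
  by case: (f ord_max); rewrite ?mulr1 ?mulr0.
- move=> w nF; have [nL nO] : ~ large (symbols X (bits b) (2 ^ l) w) /\
    ~ over (symbols X (bits b) (2 ^ l) w).
    by split=> h; apply: nF; [left|right].
  move/negP: nL; rewrite -ltNge => /ltW; apply: le_trans; apply: ler_sum => e _.
  have ne : ~~ b ord_max (X (val e.1, val e.2) w).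
    by apply/negP => h; apply: nO; exists e; rewrite !ffunE.
  rewrite /size_val; under eq_bigr do rewrite !ffunE.
  have [j [-> _ h]] := size_valE l.+1 (sqr_ge0 (normc (X (val e.1, val e.2) w))).
  by apply: h; rewrite leNgt.
Qed.

End Block.

(** Apart from a geometric series, both parts are controlled by the sum of 4^j [tailp] j. For the
    first, the exchange of the two summations takes the form of the recursion A(l+1) = A(l)/4 +
    4^(l+1) t(l+1). *)
Lemma block_bound_sum (N : nat) : \sum_(l < N) block_bound l <= 100.
Proof.
pose t := tailp; pose A l := (\sum_(j < l.+1) 16 ^+ j * t j) / 4 ^+ l.
have p4 l : 0 < 4 ^+ l :> R by rewrite exprn_gt0.
have A0 l : 0 <= A l.
  apply: divr_ge0 (ltW (p4 l)); apply: sumr_ge0 => j _.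
  by rewrite mulr_ge0 ?tailp_ge0 ?exprn_ge0.
have AS l : A l.+1 = A l / 4 + 4 ^+ l.+1 * t l.+1.
  rewrite /A big_ord_recr /= mulrDl exprS invfM.
  rewrite (_ : 16 ^+ l.+1 = 4 ^+ l.+1 * 4 ^+ l.+1 :> R); last by rewrite -exprMn; congr (_ ^+ _); ring.
  rewrite exprS; have := lt0r_neq0 (p4 l); move: (4 ^+ l) => c c0; field; by rewrite c0.
have HA M : \sum_(l < M.+1) A l + A M / 3 <= 4 / 3 * \sum_(l < M.+1) 4 ^+ l * t l.
  elim: M => [|M IH].
    by rewrite !big_ord1 /A big_ord1 !expr0 invr1 !mulr1 !mul1r; lra.
  by rewrite big_ord_recr [in leRHS]big_ord_recr /= AS; lra.
have H4 M : \sum_(l < M) (4 ^+ l)^-1 + (4 ^+ M)^-1 * 4 / 3 <= 4 / 3 :> R.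
  elim: M => [|M IH]; first by rewrite big_ord0 expr0 invr1; lra.
  by rewrite big_ord_recr /= exprS invfM; move: IH; move: ((4 ^+ M)^-1) => c; lra.
case: N => [|N]; first by rewrite big_ord0.
have -> : \sum_(l < N.+1) block_bound l = \sum_(l < N.+1) (4 ^+ l)^-1 +
    15 * \sum_(l < N.+1) A l + 4^-1 * \sum_(l < N.+1) 4 ^+ l.+1 * t l.+1.
  rewrite !mulr_sumr -!big_split; apply: eq_bigr => l _.
  rewrite /block_bound /A /= exprS -/t; have := lt0r_neq0 (p4 l).
  by move: (4 ^+ l) => c c0; field.
have h1 := tail_sum N.+1; have h2 := tail_sum N.+2; have h3 := H4 N.+1; have h4 := HA N.
rewrite big_ord_recl /= in h2; have h5 : 0 <= 4 ^+ 0 * tailp 0 by rewrite mulr_ge0 ?tailp_ge0.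
have h6 : 0 <= (4 ^+ N.+1)^-1 :> R by rewrite invr_ge0 ltW.
have h7 := A0 N; move: h1 h2 h3 h4 h5 h6 h7; rewrite -/t.
have -> : \sum_(i < N.+1) 4 ^+ bump 0 i * t (bump 0 i) = \sum_(l < N.+1) 4 ^+ l.+1 * t l.+1 by [].
lra.
Qed.

Lemma hs_bound_as : {ae P, forall w, \forall n \near \oo,
  \sum_(i < n) \sum_(j < n) normc (X (val i, val j) w) ^+ 2 <= 24 * n%:R ^+ 2}.
Proof.
have /choice[F FP] := block_event.
have mF l : measurable (F l) by have [] := FP l.
have PF l : (P (F l) <= (block_bound l)%:E)%E by have [] := FP l.
apply: filterS (borel_cantelli mF PF block_bound_sum) => w [L _ LP].
exists (2 ^ L).+1 => // n /= Ln; pose l := up_log 2 n.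
have n1 : (1 < n)%N by apply: leq_trans Ln; rewrite ltnS expn_gt0.
have nl : (n <= 2 ^ l)%N by exact: up_logP.
have ln : (2 ^ l <= 2 * n)%N.
  have := up_log_bounds (isT : 1 < 2)%N n1; rewrite -/l => /andP[h _].
  have l0 : (0 < l)%N by rewrite /l up_log_gt0 n1.
  by rewrite -(prednK l0) expnS leq_mul2l /= ltnW.
have Ll : (L <= l)%N.
  by rewrite -(leq_exp2l _ _ (isT : 1 < 2)%N) (leq_trans _ nl) // ltnW.
have [_ _ /(_ w (LP l Ll)) h] := FP l.
(* The dyadic block around n has side at most 2n, whence 24 = 6 * 4. *)
apply: (@le_trans _ _ (6 * 4 ^+ l)); last first.
  have : (2 ^ l)%:R <= (2 * n)%:R :> R by rewrite ler_nat.
  rewrite natrX natrM (_ : 4 ^+ l = (2 ^+ l) ^+ 2); last by rewrite exprAC; congr (_ ^+ _); ring.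
  have : 0 <= 2 ^+ l :> R by exact: exprn_ge0.
  by move: (2 ^+ l) (n%:R) => a c; nra.
apply: le_trans h; rewrite -(pair_bigA _ (fun i j : 'I_(2 ^ l) => normc (X (val i, val j) w) ^+ 2)) /=.
pose G i := \sum_(j < n) normc (X (i, val j) w) ^+ 2.
rewrite (big_ord_widen _ G nl) big_mkcond /=; apply: ler_sum => i _.
have G0 : 0 <= \sum_(j < 2 ^ l) normc (X (val i, val j) w) ^+ 2.
  by apply: sumr_ge0 => j _; exact: sqr_ge0.
case: ifP => // _; rewrite /G (big_ord_widen _ (fun j => normc (X (val i, j) w) ^+ 2) nl).
by rewrite big_mkcond /=; apply: ler_sum => j _; case: ifP => // _; exact: sqr_ge0.
Qed.

End HilbertSchmidt.

Lemma gap_step (R : realType) (c g h : R) : 0 < c -> c * g < h ->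
  exists2 dt, 0 < dt & forall g' h', g' - g < dt -> - dt < h' - h -> c * g' < h'.
Proof.
move=> c0 gap; have c1 : 0 < 2 * (c + 1) by lra.
exists ((h - c * g) / (2 * (c + 1))); first by rewrite divr_gt0 ?subr_gt0.
move=> g' h'; have : (h - c * g) / (2 * (c + 1)) * (2 * (c + 1)) = h - c * g.
  by rewrite mulfVK // gt_eqF.
by move: (_ / _) => t; nra.
Qed.

(** * Rounding the entries to a fine grid *)

Section Rounding.
Context (R : realType) (d0 : measure_display) (T0 : measurableType d0) (P0 : probability T0 R)
  (d : measure_display) (T : measurableType d) (P : probability T R).
Local Notation C := R[i].
Variables (x : {RV P0 >-> C}) (X : nat * nat -> {RV P >-> C}).
Hypothesis Xx : iid_copies X x.
Variables (a1 a2 : C) (r p0 : R).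
Hypothesis r0 : 0 < r.
Hypothesis p00 : 0 < p0.
Hypothesis ra : r <= normc (a2 - a1) / 40.
Hypothesis Pa1 : (p0%:E <= P0 (x @^-1` [set z : C | (normc (z - a1) < r)%R]))%E.
Hypothesis Pa2 : (p0%:E <= P0 (x @^-1` [set z : C | (normc (z - a2) < r)%R]))%E.

Let y0 := a2 - a1.

Section Fixed.
Variables (n D : nat).
Hypothesis n0 : (0 < n)%N.
Hypothesis D0 : (0 < D)%N.

Let V := ('I_(4 * D).+1 * 'I_(4 * D).+1)%type.
Let L : R := n%:R ^+ 3.
Let dl : R := 2 * L / D%:R.
Let pt (v : V) : C := (L / 2)%:C * gridpt R v.
Let b (v : V) (z : C) : bool := normc (z - pt v) < dl.
Let mb v : measurable [set z | b v z]. Proof. exact: measurable_disc. Qed.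

Definition rounding_law := image_law x (measurable_bits mb).
(** Any marked grid point is close to the entry. Points of modulus above n^3 are refused and the
    default is 0, so that [rounded_le] holds for every symbol, including those that no entry
    produces. *)
Definition rounded (f : {ffun V -> bool}) : C :=
  if [pick v | f v && (normc (pt v) <= L)] is Some v then pt v else 0.
Definition round_symbols (w : T) := symbols X (bits b) n w.

Lemma round_transfer (A : {ffun 'I_n * 'I_n -> {ffun V -> bool}} -> Prop) :
  measurable [set w | A (round_symbols w)] /\
  P [set w | A (round_symbols w)] = (Pr rounding_law A)%:E.
Proof. exact: transfer. Qed.

Let L0 : 0 < L. Proof. by rewrite exprn_gt0 // ltr0n. Qed.

Lemma rounded_le f : normc (rounded f) <= n%:R ^+ 3.
Proof.
rewrite /rounded; case: pickP => [v /andP[] //|_].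
by rewrite ComplexField.Normc.normc0 ltW.
Qed.

Lemma rounded_close z : normc z <= L - dl -> normc (rounded (bits b z) - z) < dl.
Proof.
move=> zL; have D0' : 0 < D%:R :> R by rewrite ltr0n.
have dl0 : 0 < dl by rewrite divr_gt0 // mulr_gt0.
have nm (a : R) : 0 <= a -> normc (a%:C : C) = a.
  by move=> a0; rewrite /= expr0n addr0 sqrtr_sqr ger0_norm.
have l2 : 0 < L / 2 by rewrite divr_gt0.
pose u := (L / 2)^-1%:C * z.
have zu : z = (L / 2)%:C * u by rewrite /u mulrA -rmorphM /= mulfV ?mul1r // gt_eqF.
have u2 : normc u <= 2.
  by rewrite /u normcM nm ?invr_ge0 ?(ltW l2) // mulrC ler_pdivrMr //; lra.
have [g gP] := gridP D0 u2.
have zg : normc (z - pt g) <= L / D%:R.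
  rewrite {1}zu /pt -mulrBr normcM nm ?(ltW l2) //.
  by apply: le_trans (ler_wpM2l (ltW l2) gP) _; rewrite mulrA mulfVK.
have LD : L / D%:R < dl.
  by rewrite /dl -mulrA mulr_natl mulr2n ltrDl divr_gt0.
rewrite /rounded; case: pickP => [v /andP[]|/(_ g)].
  by rewrite ffunE /b normc_distC.
rewrite ffunE /b (le_lt_trans zg LD) /= => /negP[].
have := normc_triangle (pt g) z 0; rewrite !subr0 [normc (pt g - z)]normc_distC => h.
by apply: le_trans h _; move: zg LD zL; lra.
Qed.

Lemma rounding_spread : dl <= r -> normc a1 + r <= L - dl -> normc a2 + r <= L - dl ->
  spread rounding_law rounded y0 p0.
Proof.
move=> dr A1 A2.
have y00 : 0 < normc y0 by have := ra; have := r0; rewrite -/y0; lra.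
pose D_ a (f : {ffun V -> bool}) := normc (rounded f - a) < 2 * r.
have key a : (p0%:E <= P0 (x @^-1` [set z : C | (normc (z - a) < r)%R]))%E ->
    normc a + r <= L - dl -> p0 <= pr1 rounding_law (D_ a).
  move=> Pa aL; rewrite -lee_fin pr1_image_law; apply: le_trans Pa _.
  apply: le_measure; rewrite ?inE.
  - by apply: preimage_measurable; exact: measurable_disc.
  - rewrite (_ : mkset _ = \bigcup_(f in [set f | D_ a f]) (x @^-1` (bits b @^-1` [set f]))).
      apply: fin_bigcup_measurable => [|f _]; first exact: finite_finset.
      apply: preimage_measurable.
      exact: measurable_bits.
    by apply/seteqP; split=> w /=; [exists (bits b (x w))|move=> [f /= h ->]].
  - move=> w /= xa; rewrite /D_.
    have xL : normc (x w) <= L - dl.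
      by have := normc_triangle (x w) a 0; rewrite !subr0; lra.
    have := rounded_close xL; have := normc_triangle (rounded (bits b (x w))) (x w) a; lra.
split=> //; first by rewrite -normc_gt0.
exists (D_ a1), (D_ a2); split; [exact: key|exact: key|].
move=> v v'; rewrite /D_ => h1 h2.
have -> : rounded v' - rounded v - y0 = (rounded v' - a2) - (rounded v - a1).
  by rewrite /y0; ring.
have := normc_triangle (rounded v' - a2) 0 (rounded v - a1).
by rewrite subr0 sub0r normcN; have := ra; rewrite -/y0; lra.
Qed.

End Fixed.

Section Comparison.
Variables (k n : nat) (A0 : 'I_n -> 'I_n -> C) (e : R).
Hypothesis rg : regime (normc y0) p0 k n.
Hypothesis tk : 6 * tail_const p0 <= k%:R.
Hypothesis A0_le : forall i j, normc (A0 i j) <= n%:R ^+ 3.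
Hypothesis e01 : 0 < e <= 1.
Hypothesis a1n : normc a1 + r + 1 <= n%:R ^+ 3.
Hypothesis a2n : normc a2 + r + 1 <= n%:R ^+ 3.

Definition sample (w : T) : 'M[C]_n :=
  \matrix_(i, j) ((Num.sqrt n%:R)^-1%:C * (A0 i j + X (val i, val j) w)).

Definition exceed (B : 'M[C]_n) : Prop :=
  expR (n%:R * (7 * (k%:R ^+ 2)^-1 + 3 * bulk_const y0 p0 * Num.sqrt e)) *
      complex.Re (\det (gram B)) < complex.Re (\det (gram B + (e%:C)%:M)).

(** [exceed] is a strict inequality between continuous functions of the entries, so it persists for
    all sufficiently fine roundings, and [eventually_bound] transports the bound of
    [comparison_finite]. *)
Lemma comparison_prob : exists F, [/\ measurable F, (P F <= (48 * (k%:R ^+ 21)^-1)%:E)%E &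
  forall w, (forall i j : 'I_n, normc (X (val i, val j) w) <= n%:R ^+ 3 - 1) ->
    exceed (sample w) -> F w].
Proof.
have n0 : (0 < n)%N by apply: leq_trans (n_ge rg).
pose L : R := n%:R ^+ 3; have L0 : 0 < L by rewrite exprn_gt0 // ltr0n.
pose m := Num.min r 1; have m0 : 0 < m by rewrite lt_min r0 ltr01.
pose N0 := (Num.truncn (2 * L / m)).+1.
pose D N := (N0 + N)%N; have D0 N : (0 < D N)%N by [].
have dlm N : 2 * L / (D N)%:R <= m.
  rewrite ler_pdivrMr ?ltr0n // [leRHS]mulrC -ler_pdivrMr //.
  have h : 0 <= 2 * L / m by rewrite divr_ge0 ?mulr_ge0 // ltW.
  have /andP[_ h2] := truncn_itv h; apply: le_trans (ltW h2) _.
  by rewrite ler_nat leq_addr.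
have mr : m <= r by rewrite ge_min lexx.
have m1 : m <= 1 by rewrite ge_min lexx orbT.
pose ev N (s : {ffun 'I_n * 'I_n -> _}) := exceed (model (@rounded n (D N)) A0 s).
pose E N := [set w | ev N (round_symbols n (D N) w)].
have trN N := @round_transfer n (D N) (ev N).
have EN N : measurable (E N) /\ (P (E N) <= (48 * (k%:R ^+ 21)^-1)%:E)%E.
  have [mE PE] := trN N; split => //; rewrite [leLHS]PE lee_fin.
  apply: (comparison_finite _ rg tk) => //; last exact: rounded_le.
  have h1 := a1n; have h2 := a2n; rewrite -/L in h1 h2.
  by apply: rounding_spread => //; have := dlm N; rewrite -/L; lra.
have [F [mF PF FP]] := eventually_bound (fun N => (EN N).1) (fun N => (EN N).2).
exists F; split => // w Xw exc; apply: FP.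
have close i j : tends (fun N => model (@rounded n (D N)) A0 (round_symbols n (D N) w) i j)
    (sample w i j).
  rewrite mxE; apply: tends_ext (fun N => esym (mxE _ _ _ _)) _.
  apply: tendsM; first exact: tends_cst.
  apply: tendsD; first exact: tends_cst.
  move=> e' e'0; pose N1 := (Num.truncn (2 * L / e')).+1; exists N1 => N N1N.
  rewrite ffunE /=; apply: lt_le_trans (rounded_close n0 (D0 N) _) _.
    by apply: le_trans (Xw i j) _; have := dlm N; rewrite -/L; lra.
  rewrite -/L ler_pdivrMr ?ltr0n // [leRHS]mulrC -ler_pdivrMr //.
  have h : 0 <= 2 * L / e' by rewrite divr_ge0 ?mulr_ge0 // ltW.
  have /andP[_ h2] := truncn_itv h; apply: le_trans (ltW h2) _.
  by rewrite ler_nat (leq_trans N1N) // leq_addl.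
have tg := tends_det (fun i j => tends_gram i j close).
have te : tends (fun N => \det (gram (model (@rounded n (D N)) A0 (round_symbols n (D N) w)) + (e%:C)%:M))
    (\det (gram (sample w) + (e%:C)%:M)).
  apply: tends_det => i j; rewrite mxE; apply: tends_ext (fun N => esym (mxE _ _ _ _)) _.
  by apply: tendsD; [exact: tends_gram|exact: tends_cst].
move: exc; rewrite /exceed; set c := expR _; set g := \det _ in tg *; set h := \det _ in te *.
move=> gap;
have c0 : 0 < c by exact: expR_gt0.
have [dt dt0 dtP] := gap_step c0 gap.
have [N1 H1] := tg _ dt0; have [N2 H2] := te _ dt0.
exists (maxn N1 N2) => N; rewrite geq_max => /andP[/H1 h1 /H2 h2].
rewrite /E /ev /= /exceed -/c.
have r1 := le_lt_trans (Re_le_normc _) h1; have r2 := le_lt_trans (Re_le_normc _) h2.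
move: r1 r2; rewrite !ReD !ReN !ltr_norml => /andP[_ r1] /andP[r2 _].
exact: dtP r1 r2.
Qed.

End Comparison.
End Rounding.

Lemma frac_cancel (F : realFieldType) (a b c : F) : a != 0 -> b != 0 ->
  48 * (a * b)^-1 * (20 * c * a) = 48 * (20 * c) * b^-1.
Proof. by move=> a0 b0; field; rewrite a0 b0. Qed.

(** * The almost sure comparison of determinants *)

Section AlmostSureComparison.
Local Open Scope sesquilinear_scope.
Context (R : realType) (d0 : measure_display) (T0 : measurableType d0) (P0 : probability T0 R)
  (d : measure_display) (T : measurableType d) (P : probability T R).
Local Notation C := R[i].
Variables (x : {RV P0 >-> C}) (X : nat * nat -> {RV P >-> C}).
Hypothesis Xx : iid_copies X x.
Hypothesis x01 : zero_mean_unit_variance x.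

Lemma pow_succ_le (k m : nat) : (k.+1 ^ m.+1 <= k ^ m.+1 + m.+1 * k.+1 ^ m)%N.
Proof.
elim: m => [|m IH]; first by rewrite !expn1 expn0; lia.
rewrite (expnS _ m.+1) (expnS k m.+1) [X in (_ + X)%N]mulSn.
have h := leq_mul (leqnn k.+1) IH; apply: leq_trans h _.
have h2 : (k ^ m.+1 <= k.+1 ^ m.+1)%N by apply: leq_expl.
by rewrite (expnS k.+1 m) in h2 *; move: (k ^ m.+1)%N (k.+1 ^ m)%N h2 => a b; clear; nia.
Qed.

Lemma root_exists (n : nat) : exists k, (k ^ 20 <= n < k.+1 ^ 20)%N.
Proof.
elim: n => [|n [k /andP[k1 k2]]]; first by exists 0%N; rewrite exp0n // exp1n.
have [h|h] := ltnP n.+1 (k.+1 ^ 20); first by exists k; rewrite leqW.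
exists k.+1; rewrite h /=; apply: (leq_ltn_trans k2); by rewrite ltn_exp2r.
Qed.

Lemma root_unique (n k l : nat) : (k ^ 20 <= n < k.+1 ^ 20)%N ->
  (l ^ 20 <= n < l.+1 ^ 20)%N -> k = l.
Proof.
move=> /andP[k1 k2] /andP[l1 l2]; apply/eqP; rewrite eqn_leq.
have h1 := leq_ltn_trans k1 l2; have h2 := leq_ltn_trans l1 k2.
by rewrite !ltn_exp2r // !ltnS in h1 h2; rewrite h1 h2.
Qed.

Lemma inv_sqr_sum (N : nat) : \sum_(k < N) (k%:R ^+ 2)^-1 <= 2 :> R.
Proof.
have key M : \sum_(k < M.+2) (k%:R ^+ 2)^-1 <= 2 - M.+1%:R^-1 :> R.
  elim: M => [|M IH].
    by rewrite big_ord_recr big_ord1 /= expr0n /= invr0 expr1n invr1; lra.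
  rewrite big_ord_recr /=; apply: le_trans (lerD IH (lexx _)) _.
  have m0 : 0 < M.+1%:R :> R by [].
  rewrite -[M.+2%:R]natr1; move: (M.+1%:R) m0 => a a0.
  have a1 : 0 < a + 1 by lra.
  have : ((a + 1) ^+ 2)^-1 <= a^-1 - (a + 1)^-1; last by lra.
  rewrite -[a^-1]mulr1 -[(a + 1)^-1]mulr1.
  have -> : a^-1 * 1 - (a + 1)^-1 * 1 = (a * (a + 1))^-1 by field; rewrite !gt_eqF.
  by rewrite lef_pV2 ?posrE ?exprn_gt0 ?mulr_gt0 // expr2 ler_pM2r //; lra.
case: N => [|[|N]].
- by rewrite big_ord0.
- by rewrite big_ord1 expr0n invr0.
- by apply: le_trans (key N) _; rewrite gerBl invr_ge0.
Qed.

Lemma hs_norm_sqr n (A : 'M[C]_n) : hs_norm A ^+ 2 = \sum_i \sum_j normc (A i j) ^+ 2.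
Proof.
have e : \tr (A *m A^t*) = (\sum_i \sum_j normc (A i j) ^+ 2)%:C.
  rewrite /mxtrace real_Csum; apply: eq_bigr => i _; rewrite mxE real_Csum.
  by apply: eq_bigr => j _; rewrite !mxE -conjC_normc mulrC.
rewrite /hs_norm e /= sqr_sqrtr //; apply: sumr_ge0 => i _; apply: sumr_ge0 => j _.
exact: sqr_ge0.
Qed.

Lemma entry_le_hs n (A : 'M[C]_n) i j : normc (A i j) ^+ 2 <= hs_norm A ^+ 2.
Proof.
rewrite hs_norm_sqr (bigD1 i) //= (bigD1 j) //= -addrA lerDl addr_ge0 //.
  by apply: sumr_ge0 => *; exact: sqr_ge0.
by apply: sumr_ge0 => *; apply: sumr_ge0 => *; exact: sqr_ge0.
Qed.

Lemma det_gram n (B : 'M[C]_n) : \det (gram B) = (normc (\det B) ^+ 2)%:C.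
Proof. by rewrite /gram det_mulmx det_map_mx det_tr -conjC_normc mulrC. Qed.

Variable M : forall n : nat, 'M[C]_n.
Variable Kb : R.
Hypothesis M_le : forall n, (0 < n)%N -> hs_norm (M n) ^+ 2 / n%:R ^+ 2 <= Kb.

Definition shifted (n : nat) (w : T) (z : C) : 'M[C]_n :=
  rescale (M n + random_matrix X n w) - z%:M.

Lemma shifted_sample n w z : (0 < n)%N ->
  shifted n w z = sample X (fun i j => M n i j - (Num.sqrt n%:R)%:C * (z *+ (i == j))) w.
Proof.
move=> n0; apply/matrixP => i j; rewrite !mxE.
have s0 : (Num.sqrt n%:R : R) != 0 by rewrite gt_eqF // sqrtr_gt0 ltr0n.
have e : (Num.sqrt n%:R)^-1%:C * (Num.sqrt n%:R)%:C = 1 :> C by rewrite -rmorphM /= mulVf.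
rewrite [RHS]mulrDr mulrBr mulrA e mul1r mulrDr; ring.
Qed.

Lemma comparison_as (eta : R) : 0 < eta -> exists2 e, 0 < e <= 1 &
  forall z, {ae P, forall w, \forall n \near \oo,
    complex.Re (\det (gram (shifted n w z) + (e%:C)%:M)) <=
    expR (n%:R * eta) * normc (\det (shifted n w z)) ^+ 2}.
Proof.
move=> eta0; have [a1 [a2 [r [p0 [r0 p00 ra [Pa1 Pa2]]]]]] := two_atoms x01.
pose y0 := a2 - a1; have y00 : 0 < normc y0 by rewrite /y0; lra.
have p01 : p0 <= 1.
  rewrite -lee_fin; apply: le_trans Pa1 _; apply: probability_le1.
  by apply: preimage_measurable; exact: measurable_disc.
have p001 : 0 < p0 <= 1 by rewrite p00.
have rn := regime_near y00 p001.
pose Cb := bulk_const y0 p0.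
have Cb1 : 1 <= Cb.
  rewrite /Cb /bulk_const lerDr; apply: divr_ge0 => //.
  by rewrite /tail_level; apply: divr_ge0; [apply: mulr_ge0; exact: sqr_ge0|exact: ler0n].
(* With e = q^2 the term 3 Cb sqrt e is at most eta/2; the other half of eta covers 7/k^2 once k is
   large. *)
pose q := Num.min 1 (eta / (6 * Cb)).
have q0 : 0 < q by rewrite lt_min ltr01 divr_gt0 // mulr_gt0 //; lra.
have q1 : q <= 1 by rewrite ge_min lexx.
have qe : q * (6 * Cb) <= eta.
  by rewrite -ler_pdivlMr ?ge_min ?lexx ?orbT // mulr_gt0 //; lra.
exists (q ^+ 2) => [|z]; first by rewrite exprn_gt0 //= expr2 mulr_ile1 // ltW.
have /choice[K KP] := root_exists.
pose A0 n (i j : 'I_n) := M n i j - (Num.sqrt n%:R)%:C * (z *+ (i == j)).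
pose good n := [/\ regime (normc y0) p0 (K n) n, 6 * tail_const p0 <= (K n)%:R,
  forall i j, normc (A0 n i j) <= n%:R ^+ 3, normc a1 + r + 1 <= n%:R ^+ 3 &
  normc a2 + r + 1 <= n%:R ^+ 3].
have /choice[F FP] : forall n, exists F, [/\ measurable F,
    (P F <= (48 * ((K n)%:R ^+ 21)^-1)%:E)%E &
    good n -> forall w, (forall i j : 'I_n, normc (X (val i, val j) w) <= n%:R ^+ 3 - 1) ->
    exceed a1 a2 p0 (K n) (q ^+ 2) (sample X (A0 n) w) -> F w].
  move=> n; have [[g1 g2 g3 g4 g5]|ng] := pselect (good n).
    have q01 : 0 < q ^+ 2 <= 1 by rewrite exprn_gt0 //= expr2 mulr_ile1 // ltW.
    have [F [F1 F2 F3]] := comparison_prob Xx r0 p00 ra Pa1 Pa2 g1 g2 g3 q01 g4 g5.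
    by exists F.
  exists set0; split => //; rewrite measure0 lee_fin mulr_ge0 // invr_ge0 exprn_ge0 //.
(* A block has at most 20 * 2^19 k^19 sizes, each failing with probability at most 48 k^-21: a
   multiple of k^-2. *)
pose G k := \big[setU/set0]_(n <- index_iota (k ^ 20) (k.+1 ^ 20)) F n.
have mG k : measurable (G k) by apply: bigsetU_measurable => n _; have [] := FP n.
pose c : R := 48 * (20 * 2 ^+ 19); have c0 : 0 <= c by rewrite !mulr_ge0 ?exprn_ge0.
have PG k : (P (G k) <= (c * (k%:R ^+ 2)^-1)%:E)%E.
  apply: le_trans (measure_bigU_le _ (b := fun n => 48 * ((K n)%:R ^+ 21)^-1) _ _) _.
  - by move=> n; have [] := FP n.
  - by move=> n; have [] := FP n.
  rewrite lee_fin big_seq (eq_bigr (fun=> 48 * (k%:R ^+ 21)^-1)) => [|n]; last first.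
    by rewrite mem_index_iota => h; rewrite (root_unique (KP n) h).
  rewrite -big_seq big_const_seq count_predT size_iota.
  set b := 48 * (k%:R ^+ 21)^-1; have -> : iter (k.+1 ^ 20 - k ^ 20) (+%R b) 0 = b * (k.+1 ^ 20 - k ^ 20)%:R.
    elim: (_ - _)%N => [|m IH]; first by rewrite mulr0.
    by rewrite iterS IH -natr1 mulrDr mulr1 addrC.
  rewrite /b {b}.
  case: k => [|k]; first by rewrite expr0n invr0 mulr0 mul0r mulr_ge0 // invr_ge0 sqr_ge0.
  have k0 : 0 < k.+1%:R :> R by [].
  have cnt : (k.+2 ^ 20 - k.+1 ^ 20)%:R <= 20 * 2 ^+ 19 * k.+1%:R ^+ 19 :> R.
    apply: (@le_trans _ _ (20 * k.+2%:R ^+ 19)).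
      rewrite -natrX -natrM ler_nat leq_subLR; exact: (pow_succ_le k.+1 19).
    rewrite -mulrA ler_pM2l // -exprMn lerXn2r ?nnegrE ?mulr_ge0 //.
    by rewrite -natrM ler_nat mul2n -addnn addSn ltnS leq_addl.
  have i0 : 0 <= 48 * (k.+1%:R ^+ 21)^-1 :> R by rewrite mulr_ge0 // invr_ge0 exprn_ge0.
  apply: le_trans (ler_wpM2l i0 cnt) _.
  rewrite /c (exprD _ 19 2) le_eqVlt; apply/orP; left; apply/eqP.
  by apply: frac_cancel; rewrite expf_neq0 // gt_eqF.
have cs N : \sum_(k < N) c * (k%:R ^+ 2)^-1 <= c * 2.
  by rewrite -mulr_sumr ler_wpM2l // inv_sqr_sum.
apply: filterS2 (borel_cantelli mG PG cs) (hs_bound_as Xx x01) => w gw xw.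
have Koo m : \forall n \near \oo, (m <= K n)%N.
  exists (m ^ 20)%N => // n /= mn; have /andP[_ h] := KP n.
  by have := leq_ltn_trans mn h; rewrite ltn_exp2r.
have Kev (Q : nat -> Prop) : (\forall k \near \oo, Q k) -> \forall n \near \oo, Q (K n).
  by move=> [m _ mQ]; have [m' _ h] := Koo m; exists m' => // n /= /h; exact: mQ.
have big (b : R) : \forall n \near \oo, b * n%:R <= n%:R ^+ 3 :> R.
  near=> n; have n1 : 1 <= n%:R :> R by rewrite ler1n; near: n; exact: nbhs_infty_gt.
  have nb : b <= n%:R by near: n; exact: nbhs_infty_ger.
  have : b * n%:R <= n%:R * n%:R by rewrite ler_pM2r //; lra.
  by rewrite !exprS expr0 mulr1; nra.
near=> n.
have n0 : (0 < n)%N by near: n; exact: nbhs_infty_gt.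
have n1 : 1 <= n%:R :> R by rewrite ler1n.
have kn := KP n.
have rgn : regime (normc y0) p0 (K n) n.
  have h : (forall m, (K n ^ 20 <= m <= K n ^ 21)%N -> regime (normc y0) p0 (K n) m).
    near: n; apply: (Kev (fun k => forall m, (k ^ 20 <= m <= k ^ 21)%N -> regime (normc y0) p0 k m)).
    exact: rn.
  apply: h; have /andP[-> h2] := kn; apply: ltnW; apply: leq_trans h2 _.
  have k2 : (2 ^ 20 <= K n)%N by near: n; exact: Koo.
  have k1 : (1 <= K n)%N by near: n; exact: Koo.
  rewrite (expnS (K n) 20); apply: leq_trans (_ : (2 * K n) ^ 20 <= _)%N.
    by apply: leq_expl; rewrite mul2n -addnn -addn1 leq_add2l.
  by rewrite expnMn leq_mul2r k2 orbT.
have gn : good n.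
  split => //.
  - near: n; apply: (Kev (fun k => 6 * tail_const p0 <= k%:R)); exact: nbhs_infty_ger.
  - move=> i j; have hM := entry_le_hs (M n) i j.
    have hK := M_le n0; rewrite ler_pdivrMr ?exprn_gt0 ?ltr0n // in hK.
    have bb : (Num.sqrt Kb + normc z) * n%:R <= n%:R ^+ 3 by near: n; exact: big.
    have mij : normc (M n i j) <= Num.sqrt Kb * n%:R.
      rewrite -[leLHS]ger0_norm ?normc_ge0 // -sqrtr_sqr -[n%:R]ger0_norm // -sqrtr_sqr.
      by rewrite -sqrtrM ?ler_wsqrtr ?(le_trans hM) // (le_trans _ (M_le n0)) // divr_ge0 ?sqr_ge0.
    have zn : normc ((Num.sqrt n%:R)%:C * (z *+ (i == j))) <= normc z * n%:R.
      rewrite normcM mulrC; apply: ler_pM; rewrite ?normc_ge0 //.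
        by case: (i == j); rewrite ?mulr1n // mulr0n ComplexField.Normc.normc0 normc_ge0.
      rewrite /= expr0n addr0 sqrtr_sqr ger0_norm ?sqrtr_ge0 //.
      rewrite -[leRHS]ger0_norm // -sqrtr_sqr ler_wsqrtr // expr2 ler_peMr //.
    have := normc_triangle (M n i j) 0 ((Num.sqrt n%:R)%:C * (z *+ (i == j))).
    by rewrite subr0 sub0r normcN /A0; lra.
  - apply: (@le_trans _ _ ((normc a1 + r + 1) * n%:R)).
      by rewrite ler_peMr //; have := normc_ge0 a1; lra.
    by near: n; exact: big.
  - apply: (@le_trans _ _ ((normc a2 + r + 1) * n%:R)).
      by rewrite ler_peMr //; have := normc_ge0 a2; lra.
    by near: n; exact: big.
have nGw : ~ G (K n) w by near: n; exact: (Kev (fun k => ~ G k w)).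
have nFw : ~ F n w.
  move=> fw; apply: nGw; rewrite /G -bigcup_seq; exists n => //=.
  by rewrite mem_index_iota.
have xn : forall i j : 'I_n, normc (X (val i, val j) w) <= n%:R ^+ 3 - 1.
  move=> i j; have s24 : \sum_(i < n) \sum_(j < n) normc (X (val i, val j) w) ^+ 2 <= 24 * n%:R ^+ 2.
    by near: n.
  have h5 : normc (X (val i, val j) w) <= 5 * n%:R.
    have h : normc (X (val i, val j) w) ^+ 2 <= 24 * n%:R ^+ 2.
      apply: le_trans s24; rewrite (bigD1 i) //= (bigD1 j) //= -addrA lerDl addr_ge0 //.
        by apply: sumr_ge0 => *; exact: sqr_ge0.
      by apply: sumr_ge0 => *; apply: sumr_ge0 => *; exact: sqr_ge0.
    have := normc_ge0 (X (val i, val j) w); move: h; move: (normc _) => a; nra.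
  have : 6 * n%:R <= n%:R ^+ 3 :> R by near: n; exact: big.
  lra.
have [_ _ /(_ gn w xn) h] := FP n.
rewrite (shifted_sample w z n0) -/(A0 n).
have : ~ exceed a1 a2 p0 (K n) (q ^+ 2) (sample X (A0 n) w) by move=> /h.
rewrite /exceed => /negP; rewrite -leNgt => /le_trans; apply.
rewrite det_gram /= ler_wpM2r ?sqr_ge0 // ler_expR ler_wpM2l //.
rewrite sqrtr_sqr ger0_norm ?(ltW q0) //.
have : 14 / eta <= (K n)%:R by near: n; apply: (Kev (fun k => 14 / eta <= k%:R)); exact: nbhs_infty_ger.
have K1 : 1 <= (K n)%:R :> R by rewrite ler1n; near: n; exact: (Koo 1%N).
rewrite ler_pdivrMr // => h14.
have K2 : ((K n)%:R ^+ 2)^-1 * 14 <= eta.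
  rewrite mulrC ler_pdivrMr ?exprn_gt0 //; last by lra.
  by apply: le_trans h14 _; rewrite mulrC ler_wpM2l ?(ltW eta0) // expr2 ler_peMr //; lra.
move: qe; rewrite -/Cb; move: (_^-1) K2 => t; lra.
Unshelve. all: by end_near. Qed.

End AlmostSureComparison.

(** * Determinants and logarithmic potentials *)

Section Deterministic.
Local Open Scope sesquilinear_scope.
Variable R : realType.
Local Notation C := R[i].

Lemma normc_real (a : R) : 0 <= a -> normc (a%:C : C) = a.
Proof. by move=> a0; rewrite /= expr0n addr0 sqrtr_sqr ger0_norm. Qed.

Lemma normcX (z : C) m : normc (z ^+ m) = normc z ^+ m.
Proof.
elim: m => [|m IH]; last by rewrite !exprS normcM IH.
by rewrite !expr0 -[1]/(1%:C) normc_real.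
Qed.

Lemma normc_prod (I : Type) (s : seq I) (F : I -> C) :
  normc (\prod_(i <- s) F i) = \prod_(i <- s) normc (F i).
Proof.
elim: s => [|i s IH]; last by rewrite !big_cons normcM IH.
by rewrite !big_nil -[1]/(1%:C) normc_real.
Qed.

Lemma le_normc_sum (I : Type) (s : seq I) (F : I -> C) :
  normc (\sum_(i <- s) F i) <= \sum_(i <- s) normc (F i).
Proof.
elim: s => [|i s IH]; first by rewrite !big_nil ComplexField.Normc.normc0.
by rewrite !big_cons (le_trans (le_normcD _ _)) // lerD2l.
Qed.

(* The solutions of [x ^+ (2 ^ m) = z], extracted by successive square roots. *)
Fixpoint nodes m (z : C) : seq C :=
  if m is m'.+1 then flatten [seq [:: sqrtC y; - sqrtC y] | y <- nodes m' z]
  else [:: z].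

Lemma size_nodes m z : size (nodes m z) = (2 ^ m)%N.
Proof.
elim: m => //= m; rewrite expnS mul2n => <-.
by elim: (nodes m z) => //= y s; rewrite doubleS => ->.
Qed.

Lemma nodes_norm m z x : x \in nodes m z -> normc x ^+ (2 ^ m) = normc z.
Proof.
elim: m x => [|m IH] x /=; first by rewrite inE => /eqP ->; rewrite expr1.
move=> /flattenP[t /mapP[y ys ->]]; rewrite !inE => xy.
have : normc x ^+ 2 = normc y.
  by rewrite -normcX; case/orP: xy => /eqP ->; rewrite ?sqrrN sqrtCK.
by rewrite expnS exprM => ->; exact: IH.
Qed.

Lemma nodes_normr m (r : R) x : 0 < r -> x \in nodes m (r ^+ (2 ^ m))%:C -> normc x = r.
Proof.
move=> r0 /nodes_norm; rewrite normc_real ?exprn_ge0 ?(ltW r0) // => /eqP.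
by rewrite eqrXn2 ?expn_gt0 ?normc_ge0 ?(ltW r0) // => /eqP.
Qed.

Lemma nodes_prod m (z w : C) : \prod_(x <- nodes m z) (w - x) = w ^+ (2 ^ m) - z.
Proof.
elim: m w => [|m IH] w /=; first by rewrite big_seq1 expr1.
rewrite big_flatten big_map /= expnS exprM -IH; apply: eq_bigr => y _.
by rewrite big_cons big_seq1 opprK -subr_sqr sqrtCK.
Qed.

(* Summing [q x] and [q (- x)] keeps the even part, a polynomial in [x ^+ 2] of half the degree. *)
Lemma nodes_mean m z (q : {poly C}) : (size q <= 2 ^ m)%N ->
  \sum_(x <- nodes m z) q.[x] = (2 ^ m)%:R * q.[0].
Proof.
elim: m q => [|m IH] q sq /=.
  by rewrite big_seq1 mul1r (size1_polyC sq) !hornerC.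
have se : (size (even_poly q) <= 2 ^ m)%N.
  apply: leq_trans (size_even_poly q) _; rewrite expnS mul2n in sq.
  by move: (size q) (2 ^ m)%N sq => a b; clear; lia.
have ev y : q.[y] = (even_poly q).[y ^+ 2] + (odd_poly q).[y ^+ 2] * y.
  by rewrite -{1}(poly_even_odd q) hornerD hornerM !horner_comp !hornerXn hornerX.
have q0 : q.[0] = (even_poly q).[0] by rewrite ev mulr0 addr0 expr0n.
rewrite big_flatten big_map /= q0 expnS natrM -mulrA -(IH _ se) mulr_sumr.
by apply: eq_bigr => y _; rewrite big_cons big_seq1 !ev sqrrN sqrtCK; ring.
Qed.

(* Replacing [w - X] by [r - w^* X / r] when [normc w < r] does not change the modulus on the
   circle, and makes the modulus at [0] the product of the maxima. *)
Lemma mahler (s : seq C) (z0 : C) (r : R) m : 0 < r -> (size s < 2 ^ m)%N ->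
  (2 ^ m)%:R * \prod_(l <- s) Num.max (normc (l - z0)) r <=
  \sum_(x <- nodes m (r ^+ (2 ^ m))%:C) \prod_(l <- s) normc (l - (z0 + x)).
Proof.
move=> r0 sm; pose f (w : C) : {poly C} :=
  if r <= normc w then w%:P - 'X else (r%:C)%:P - (Num.conj w / r%:C)%:P * 'X.
pose q := \prod_(l <- s) f (l - z0).
have f0 w : normc (f w).[0] = Num.max (normc w) r.
  rewrite /f; case: leP => h.
    by rewrite hornerD hornerN hornerX hornerC subr0.
  by rewrite hornerD hornerN hornerM hornerX !hornerC mulr0 subr0 normc_real ?(ltW r0).
have fz w ze : normc ze = r -> normc (f w).[ze] = normc (w - ze).
  move=> zr; rewrite /f; case: leP => h.
    by rewrite hornerD hornerN hornerX hornerC.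
  rewrite hornerD hornerN hornerM hornerX !hornerC.
  have rn : r%:C != 0 :> C by rewrite -normc_gt0 normc_real // ltW.
  have rr : r%:C * r%:C = Num.conj ze * ze by rewrite conjC_normc zr -rmorphM.
  have -> : r%:C - Num.conj w / r%:C * ze = (ze / r%:C) * Num.conj (ze - w).
    rewrite rmorphB /= mulrBr; congr (_ - _); last first.
      by rewrite mulrAC [RHS]mulrAC; congr (_ / _); exact: mulrC.
    by rewrite mulrAC -[ze * _]mulrC -rr mulfK.
  rewrite normcM normcM normcV zr normc_real ?(ltW r0) // mulfV ?gt_eqF // mul1r.
  have conjN (u : C) : normc (Num.conj u) = normc u by case: u => x' y' /=; rewrite sqrrN.
  by rewrite conjN normc_distC.
have sf w : (size (f w) <= 2)%N.
  have sX (c d : C) : (size (c%:P - d%:P * 'X)%R <= 2)%N.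
    apply: leq_trans (size_polyD _ _) _; rewrite size_polyN geq_max.
    rewrite (leq_trans (size_polyC_leq1 _)) //= (leq_trans (size_polyMleq _ _)) // size_polyX.
    by rewrite addn2 /= ltnS size_polyC_leq1.
  by rewrite /f; case: ifP => _ //; rewrite -['X]mul1r -polyC1; exact: sX.
have sq : (size q <= 2 ^ m)%N.
  apply: leq_trans sm; rewrite /q; elim: (s) => [|l t IH]; first by rewrite big_nil size_poly1.
  rewrite big_cons (leq_trans (size_polyMleq _ _)) //.
  have := leq_add (sf (l - z0)) IH; rewrite /=; move: (size _) (size _) => a b; clear; lia.
have hp (y : C) : normc q.[y] = \prod_(l <- s) normc (f (l - z0)).[y].
  by rewrite /q horner_prod normc_prod.
have := le_normc_sum (nodes m (r ^+ (2 ^ m))%:C) (fun x => q.[x]).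
rewrite (nodes_mean _ sq) normcM hp (_ : normc (2 ^ m)%:R = (2 ^ m)%:R); last first.
  by rewrite -(rmorph_nat (real_complex R)) normc_real.
under eq_bigr do rewrite f0.
move=> /le_trans; apply; rewrite big_seq [leRHS]big_seq; apply: ler_sum => x xs.
rewrite hp; apply: ler_prod => l _; rewrite normc_ge0 fz ?(nodes_normr r0 xs) //=.
by rewrite -addrA -opprD.
Qed.

Lemma det_eigen n (A : 'M[C]_n) z :
  normc (\det (A - z%:M)) = \prod_(l <- eigenvalues A) normc (l - z).
Proof.
have h : (char_poly A).[z] = \prod_(l <- eigenvalues A) (z - l).
  rewrite /eigenvalues; case: closed_field_poly_normal => s /= e.
  rewrite {1}e (monicP (char_poly_monic A)) scale1r horner_prod.
  by apply: eq_bigr => l _; rewrite hornerXsubC.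
have e : (char_poly A).[z] = \det (z%:M - A).
  rewrite /char_poly -[LHS]/(horner_eval z _) -det_map_mx; congr (\det _).
  apply/matrixP => i j; rewrite !mxE.
  by rewrite -[LHS]/(('X *+ (i == j) - (A i j)%:P).[z]) hornerD hornerN hornerMn hornerX hornerC.
have -> : A - z%:M = (-1) *: (z%:M - A) by rewrite scaleN1r opprB.
rewrite detZ normcM normcX normcN -[1]/(1%:C) normc_real // expr1n mul1r -e h normc_prod.
by apply: eq_bigr => l _; rewrite normc_distC.
Qed.

Lemma size_eigenvalues n (A : 'M[C]_n) : size (eigenvalues A) = n.
Proof.
rewrite /eigenvalues; case: closed_field_poly_normal => s /= e.
have := size_char_poly A; rewrite e (monicP (char_poly_monic A)) scale1r.
by rewrite size_prod_XsubC => -[].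
Qed.

Lemma herm_spectrum n (H : 'M[C]_n) : H^t* = H -> exists g : 'I_n -> R,
  [/\ \det H = (\prod_i g i)%:C, \tr H = (\sum_i g i)%:C &
   forall i, exists2 v : 'cV[C]_n, v != 0 &
    v^t* *m H *m v = ((g i * sqn v)%:C)%:M].
Proof.
move=> HH; have Gh : H \is hermsymmx.
  by apply/is_hermitianmxP; rewrite expr0 scale1r HH.
have /hermitian_normalmx/orthomx_spectralP := Gh.
have := hermitian_spectral_diag_real Gh.
have Pu := spectral_unit H; move: (spectralmx H) (spectral_diag H) Pu => Pm dg Pu dr Gd.
pose g i := complex.Re (dg 0 i).
have dE i : dg 0 i = (g i)%:C by apply: real_C; exact: (mxOverP dr).
exists g; split.
- rewrite Gd !det_mulmx det_diag mulrAC -det_mulmx mulVmx // det1 mul1r rmorph_prod.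
  by apply: eq_bigr => i _; rewrite dE.
- rewrite Gd mxtrace_mulC mulmxA mulmxV // mul1mx /mxtrace real_Csum.
  by apply: eq_bigr => i _; rewrite !mxE eqxx mulr1n dE.
move=> i; have [v vE] : exists v, v = (row i Pm)^t* by exists ((row i Pm)^t*).
exists v.
  apply/negP => /eqP v0; have r0 : row i Pm = 0.
    by rewrite -(trmxCK (row i Pm)) -vE v0; apply/matrixP => a b; rewrite !mxE rmorph0.
  have := mulmxV Pu => /matrixP/(_ i i); rewrite !mxE eqxx big1 => [/eqP|j _].
    by rewrite eq_sym oner_eq0.
  by have /matrixP/(_ 0 j) := r0; rewrite !mxE => ->; rewrite mul0r.
have vG : v^t* *m H = (g i)%:C *: v^t*.
  rewrite vE trmxCK -row_mul Gd !mulmxA mulmxV // mul1mx -dE.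
  apply/rowP => j; rewrite !mxE (bigD1 i) //= !mxE eqxx mulr1n big1 ?addr0 // => l li.
  by rewrite !mxE eq_sym (negPf li) mulr0n mul0r.
by rewrite vG -scalemxAl sqnE scale_scalar_mx -rmorphM.
Qed.

(* [u^* (B - z) v = (B^* u)^* v - z (u^* v)], by Cauchy-Schwarz for the pairs [(B^* u, sqrt e u)]. *)
Lemma cauchy_shift n (B : 'M[C]_n) (z : C) (e : R) (u v : 'cV[C]_n) : 0 < e ->
  normc ((u^t* *m (B - z%:M) *m v) 0 0) ^+ 2 <=
  (1 + normc z ^+ 2 / e) * sqn v * (sqn (B^t* *m u) + e * sqn u).
Proof.
move=> e0.
have CS (k : nat) (a b : 'cV[C]_k) : normc ((a^t* *m b) 0 0) ^+ 2 <= sqn a * sqn b.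
  have n1 : normc ((a^t* *m b) 0 0) <= \sum_i normc (a i 0) * normc (b i 0).
    rewrite mxE; elim/big_ind2: _ => [|p q p' q' pq pq'|i _].
    - by rewrite ComplexField.Normc.normc0.
    - by apply: (le_trans (le_normcD _ _)); rewrite lerD.
    - rewrite !mxE normcM; by case: (a i 0) => x' y' /=; rewrite sqrrN.
  apply: (@le_trans _ _ ((\sum_i normc (a i 0) * normc (b i 0)) ^+ 2)).
    by rewrite lerXn2r ?nnegrE ?normc_ge0 // (le_trans (normc_ge0 _) n1).
  have [sa|sa] := eqVneq (sqn a) 0.
    have a0 := sqn_eq0 sa; rewrite sa mul0r (_ : \sum_i _ = 0) ?expr0n // big1 // => i _.
    by rewrite a0 mxE ComplexField.Normc.normc0 mul0r.
  have sa0 : 0 < sqn a by rewrite lt_def sa sqn_ge0.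
  set S := \sum_i _ * _; have : 0 <= \sum_i (sqn a * normc (b i 0) - S * normc (a i 0)) ^+ 2.
    by apply: sumr_ge0 => i _; exact: sqr_ge0.
  have ex (al S' : R) : \sum_i (al * normc (b i 0) - S' * normc (a i 0)) ^+ 2 =
     al ^+ 2 * sqn b - 2 * al * S' * S + S' ^+ 2 * sqn a.
    rewrite /S /sqn !mulr_sumr -sumrB -big_split; apply: eq_bigr => i _ /=; ring.
  rewrite ex.
  have -> : sqn a ^+ 2 * sqn b - 2 * sqn a * S * S + S ^+ 2 * sqn a =
     sqn a * (sqn a * sqn b - S ^+ 2) by ring.
  by rewrite pmulr_rge0 // subr_ge0.
have -> : (u^t* *m (B - z%:M) *m v) 0 0 = ((B^t* *m u)^t* *m v) 0 0 - z * (u^t* *m v) 0 0.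
  rewrite mulmxBr mulmxBl trmxCM trmxCK mul_mx_scalar -scalemxAl.
  by rewrite [LHS]mxE; congr (_ + _); rewrite [LHS]mxE; congr (- _); rewrite [LHS]mxE.
set p := (_ *m v) 0 0; set q := (_ *m v) 0 0.
have hp : normc p ^+ 2 <= sqn (B^t* *m u) * sqn v by exact: CS.
have hq : normc q ^+ 2 <= sqn u * sqn v by exact: CS.
have tri : normc (p - z * q) <= normc p + normc z * normc q.
  by apply: le_trans (le_normcD _ _) _; rewrite normcN normcM.
have s : (normc p + normc z * normc q) ^+ 2 <=
    (1 + normc z ^+ 2 / e) * (normc p ^+ 2 + e * normc q ^+ 2).
  have -> : (1 + normc z ^+ 2 / e) * (normc p ^+ 2 + e * normc q ^+ 2) =
     (normc p + normc z * normc q) ^+ 2 + (normc z * normc p - e * normc q) ^+ 2 / e.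
    by field; rewrite gt_eqF.
  by rewrite lerDl divr_ge0 ?sqr_ge0 // ltW.
have z1 : 0 <= 1 + normc z ^+ 2 / e by rewrite addr_ge0 // divr_ge0 ?sqr_ge0 // ltW.
apply: le_trans (_ : _ <= (normc p + normc z * normc q) ^+ 2) _.
  by rewrite lerXn2r ?nnegrE ?normc_ge0 // addr_ge0 ?mulr_ge0 ?normc_ge0.
apply: le_trans s _; rewrite -mulrA; apply: (ler_wpM2l z1).
by move: hp hq e0; move: (normc p ^+ 2) (normc q ^+ 2) (sqn v) (sqn u) (sqn _) => a b c d' f; nra.
Qed.

(** With N = B - z, the matrix N^* (B B^* + e)^-1 N has eigenvalues at most 1 + |z|^2/e by
    [cauchy_shift], and its determinant is |det N|^2 divided by det(B B^* + e). *)
Lemma det_shift n (B : 'M[C]_n) (z : C) (e : R) : 0 < e ->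
  normc (\det (B - z%:M)) ^+ 2 <=
  (1 + normc z ^+ 2 / e) ^+ n * complex.Re (\det (gram B + (e%:C)%:M)).
Proof.
move=> e0; set N := B - z%:M; pose H := N^t* *m res B e *m N.
have HH : H^t* = H by rewrite /H !trmxCM trmxCK res_herm mulmxA.
have [g [gdet _ gv]] := herm_spectrum HH.
have g_le i : 0 <= g i <= 1 + normc z ^+ 2 / e.
  have [v v0 ev] := gv i; pose u := res B e *m (N *m v).
  have sv : 0 < sqn v.
    by rewrite lt_def sqn_ge0 andbT; apply/eqP => /sqn_eq0 v0'; rewrite v0' eqxx in v0.
  have e1 : v^t* *m H *m v = ((rform B e (N *m v))%:C)%:M.
    by rewrite -rformE // trmxCM /H !mulmxA.
  have gr : g i * sqn v = rform B e (N *m v).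
    by move: e1; rewrite ev => /matrixP/(_ 0 0); rewrite !mxE eqxx !mulr1n => /complexI.
  have cs := cauchy_shift B z u v e0.
  have uN : (u^t* *m N *m v) 0 0 = (rform B e (N *m v))%:C.
    by rewrite /u trmxCM res_herm -mulmxA rformE // mxE eqxx mulr1n.
  have r0 := rform_ge0 B e0 (N *m v).
  move: cs; rewrite -/N uN normc_real // -[_ + _ * sqn u]/(rform B e (N *m v)).
  rewrite -gr in r0 *; move=> cs; have g0 : 0 <= g i by rewrite -(pmulr_lge0 _ sv).
  rewrite g0 /=; have [->|gn] := eqVneq (g i) 0; first by rewrite addr_ge0 // divr_ge0 ?sqr_ge0 // ltW.
  have gs : 0 < g i * sqn v by rewrite mulr_gt0 // lt_def gn g0.
  by move: cs; rewrite expr2 ler_pM2r // ler_pM2r.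
have detS : complex.Re (\det (gram B + (e%:C)%:M)) * \prod_i g i = normc (\det N) ^+ 2.
  have h : \det (reg B e) * \det (res B e) = 1 by rewrite -det_mulmx reg_res // det1.
  have : \det (reg B e) * \det H = (normc (\det N) ^+ 2)%:C.
    transitivity (\det (reg B e) * \det (res B e) * (Num.conj (\det N) * \det N)).
      by rewrite /H !det_mulmx det_map_mx det_tr; ring.
    by rewrite h mul1r conjC_normc.
  rewrite gdet -[\det (reg B e)]/(\det (gram B + (e%:C)%:M)).
  by move=> /(congr1 (@complex.Re R)); rewrite mulrC ReZ /= mulrC.
have [g' [gd' g0' _ _]] := gram_spectrum B.
have S0 : 0 <= complex.Re (\det (gram B + (e%:C)%:M)).
  by rewrite gd' /=; apply: prodr_ge0 => i _; rewrite addr_ge0 // ltW.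
rewrite -detS mulrC ler_wpM2r //.
apply: (@le_trans _ _ (\prod_(i < n) (1 + normc z ^+ 2 / e))); last first.
  by rewrite prodr_const card_ord.
by apply: ler_prod => i _; exact: g_le.
Qed.

(** Arithmetic-geometric mean inequality for the eigenvalues g of B B^*, through g/c <= exp(g/c -
    1). *)
Lemma det_hs n (B : 'M[C]_n) (c : R) : 0 < c -> hs_norm B ^+ 2 <= n%:R * c ->
  normc (\det B) ^+ 2 <= c ^+ n.
Proof.
move=> c0 Bc; have HH : (gram B)^t* = gram B by rewrite /gram trmxCM trmxCK.
have [g [gdet gtr gv]] := herm_spectrum HH.
have g0 i : 0 <= g i.
  have [v v0 ev] := gv i.
  have sv : 0 < sqn v.
    by rewrite lt_def sqn_ge0 andbT; apply/eqP => /sqn_eq0 v0'; rewrite v0' eqxx in v0.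
  have : v^t* *m gram B *m v = ((sqn (B^t* *m v))%:C)%:M.
    by rewrite -sqnE trmxCM trmxCK /gram !mulmxA.
  rewrite ev => /matrixP/(_ 0 0); rewrite !mxE eqxx !mulr1n => /complexI e.
  by rewrite -(pmulr_lge0 _ sv) e sqn_ge0.
have sg : \sum_i g i <= n%:R * c.
  apply: le_trans Bc; rewrite /hs_norm gtr /= sqr_sqrtr //.
  by apply: sumr_ge0 => i _; exact: g0.
have : normc (\det B) ^+ 2 = \prod_i g i by apply: complexI; rewrite -gdet det_gram.
move=> ->; apply: (@le_trans _ _ (expR (\sum_i (g i / c - 1)) * \prod_(i < n) c)).
  apply: prod_le_exp => i; rewrite g0 /= -ler_pdivrMr //.
  by have := expR_ge1Dx (g i / c - 1); rewrite addrC subrK.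
rewrite prodr_const card_ord -[leRHS]mul1r ler_wpM2r ?exprn_ge0 ?(ltW c0) //.
rewrite -[leRHS]expR0 ler_expR sumrB -mulr_suml sumr_const card_ord subr_le0.
by rewrite ler_pdivrMr //; exact: sg.
Qed.

End Deterministic.

(** * Truncated logarithmic potentials *)

Section LogMax.
Variable R : realType.
Local Notation C := R[i].

Definition lnm (r : R) (w : C) : R := ln (Num.max (normc w) r).

Lemma max_gt0 (r : R) (w : C) : 0 < r -> 0 < Num.max (normc w) r.
Proof. by move=> r0; rewrite lt_max r0 orbT. Qed.

Lemma lnm_ge (r : R) w : 0 < r -> ln r <= lnm r w.
Proof. by move=> r0; rewrite ler_ln ?posrE ?max_gt0 // le_max lexx orbT. Qed.

Lemma ln_le_lnm (r : R) w : 0 < r -> 0 < normc w -> ln (normc w) <= lnm r w.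
Proof. by move=> r0 w0; rewrite ler_ln ?posrE ?max_gt0 // le_max lexx. Qed.

Lemma lnm_mono (r s : R) w : 0 < r -> r <= s -> lnm r w <= lnm s w.
Proof.
move=> r0 rs; have s0 := lt_le_trans r0 rs.
by rewrite ler_ln ?posrE ?max_gt0 // ge_max !le_max lexx rs orbT.
Qed.

Lemma ln_addr (a b : R) : 0 < a -> 0 <= b -> ln (a + b) <= ln a + b / a.
Proof.
move=> a0 b0; have ba : 0 <= b / a by rewrite divr_ge0 // ltW.
have -> : a + b = a * (1 + b / a) by field; rewrite gt_eqF.
rewrite lnM ?posrE //; last by lra.
rewrite lerD2l -ler_expR lnK ?expR_ge1Dx // posrE; lra.
Qed.

Lemma lnm_lip (r : R) v w : 0 < r -> lnm r v <= lnm r w + normc (v - w) / r.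
Proof.
move=> r0; have m0 := max_gt0 w r0; have n0 := normc_ge0 (v - w).
apply: (@le_trans _ _ (ln (Num.max (normc w) r + normc (v - w)))).
  rewrite ler_ln ?posrE ?max_gt0 //; last by rewrite ltr_wpDr.
  rewrite ge_max; apply/andP; split; last by rewrite ler_wpDr // le_max lexx orbT.
  have := le_normcD w (v - w); rewrite addrC subrK => /le_trans; apply.
  by rewrite lerD2r le_max lexx.
apply: le_trans (ln_addr m0 n0) _; rewrite lerD2l ler_wpM2l // lef_pV2 ?posrE //.
by rewrite le_max lexx orbT.
Qed.

Lemma lnm_shift (r : R) v : 0 < r -> lnm r v <= ln r + normc v / r.
Proof.
move=> r0; have := lnm_lip v 0 r0; rewrite subr0 /lnm.
by rewrite ComplexField.Normc.normc0 (@max_r _ _ 0 r (ltW r0)).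
Qed.

Lemma binomial_le (a b : R) n : 0 <= a -> 0 <= b -> a ^+ n.+1 + n.+1%:R * a ^+ n * b <= (a + b) ^+ n.+1.
Proof.
move=> a0 b0; elim: n => [|n IH]; first by rewrite !expr1 expr0 !mul1r.
rewrite [(a + b) ^+ _]exprS; apply: le_trans (ler_wpM2l (addr_ge0 a0 b0) IH).
rewrite !(exprS a) -[n.+2%:R]natr1; have := exprn_ge0 n a0; have : 0 <= n.+1%:R :> R by [].
move: (a ^+ n) (n.+1%:R) => p q q0 p0; rewrite -subr_ge0.
have -> : (a + b) * (a * p + q * p * b) - (a * (a * p) + (q + 1) * (a * p) * b) = b ^+ 2 * q * p.
  by ring.
by rewrite !mulr_ge0.
Qed.

Lemma normc_cmul (a : R) (w : C) : 0 <= a -> normc (a%:C * w) = a * normc w.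
Proof. by move=> a0; rewrite normcM normc_real. Qed.

(** The product of |v - x| over the nodes is |v^N - Q^N|, which may vanish on the circle. Moving v
    radially by at most Q/N makes it at least max(|v|, Q)^N / 2, and each of the N truncated
    logarithms changes by at most Q/(N r). *)
Lemma nodes_lower (Q r : R) m (v : C) : 0 < Q -> 0 < r ->
  (2 ^ m)%:R * lnm Q v <=
  \sum_(x <- nodes m (Q ^+ (2 ^ m))%:C) lnm r (v - x) + ln 2 + Q / r.
Proof.
move=> Q0 r0; set N := (2 ^ m)%N; have N0 : (0 < N)%N by rewrite expn_gt0.
have NR : 0 < N%:R :> R by rewrite ltr0n.
suff [v' vv' vN] : exists2 v', normc (v - v') <= Q / N%:R &
    Num.max (normc v) Q ^+ N <= 2 * normc (v' ^+ N - (Q ^+ N)%:C).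
  have m0 := max_gt0 v Q0; have mN := exprn_gt0 N m0.
  have p0 : 0 < normc (v' ^+ N - (Q ^+ N)%:C) by move: vN mN; lra.
  have pE : normc (v' ^+ N - (Q ^+ N)%:C) =
      \prod_(x <- nodes m (Q ^+ N)%:C) normc (v' - x) by rewrite -normc_prod nodes_prod.
  have -> : N%:R * lnm Q v = ln (Num.max (normc v) Q ^+ N) by rewrite mulr_natl lnXn.
  apply: (@le_trans _ _ (ln (2 * normc (v' ^+ N - (Q ^+ N)%:C)))).
    by rewrite ler_ln ?posrE ?mulr_gt0.
  rewrite lnM ?posrE // pE.
  have x0 x : x \in nodes m (Q ^+ N)%:C -> 0 < normc (v' - x).
    move=> xs; rewrite lt_def normc_ge0 andbT; apply/negP => /eqP h.
    move: p0; rewrite pE; suff -> : \prod_(y <- nodes m (Q ^+ N)%:C) normc (v' - y) = 0 by rewrite ltxx.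
    by apply/eqP; rewrite prodf_seq_eq0; apply/hasP; exists x => //=; apply/eqP.
  have -> : ln (\prod_(x <- nodes m (Q ^+ N)%:C) normc (v' - x)) =
      \sum_(x <- nodes m (Q ^+ N)%:C) ln (normc (v' - x)).
    have [] // : 0 < \prod_(x <- nodes m (Q ^+ N)%:C) normc (v' - x) /\
       ln (\prod_(x <- nodes m (Q ^+ N)%:C) normc (v' - x)) =
      \sum_(x <- nodes m (Q ^+ N)%:C) ln (normc (v' - x)).
    elim: (nodes m (Q ^+ N)%:C) x0 => [|x s IH] x0; first by rewrite !big_nil ln1.
    have [h1 h2] : 0 < \prod_(x <- s) normc (v' - x) /\
      ln (\prod_(x <- s) normc (v' - x)) = \sum_(x <- s) ln (normc (v' - x)).
      by apply: IH => y ys; apply: x0; rewrite inE ys orbT.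
    have hx := x0 x (mem_head _ _).
    by rewrite !big_cons mulr_gt0 // lnM ?posrE // h2.
  have : \sum_(x <- nodes m (Q ^+ N)%:C) ln (normc (v' - x)) <=
     \sum_(x <- nodes m (Q ^+ N)%:C) (lnm r (v - x) + Q / N%:R / r).
    rewrite big_seq [leRHS]big_seq; apply: ler_sum => x xs.
    apply: le_trans (ln_le_lnm r0 (x0 x xs)) _.
    apply: le_trans (lnm_lip _ (v - x) r0) _; rewrite lerD2l ler_pM2r ?invr_gt0 //.
    by rewrite opprB addrA subrK normc_distC.
  rewrite big_split /= (big_const_seq 0 +%R) count_predT size_nodes -/N.
  have -> : iter N (+%R (Q / N%:R / r)) 0 = Q / r.
    have -> : forall b : R, iter N (+%R b) 0 = N%:R * b.
      by move=> b; elim: (N) => [|k IH]; rewrite ?mul0r // iterS IH -natr1; ring.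
    by field; rewrite !gt_eqF.
  by move=> h; lra.
(* Inside the circle v is shrunk by 1 - 1/N, whose N-th power is at most 1/2. Outside, |v| grows by
   Q/N and its N-th power by at least Q^N, since N |v|^(N-1) Q/N >= Q^N. *)
have [vQ|vQ] := ltP (normc v) Q.
  exists ((1 - N%:R^-1)%:C * v).
    have -> : v - (1 - N%:R^-1)%:C * v = (N%:R^-1)%:C * v by rewrite rmorphB rmorph1; ring.
    by rewrite normc_cmul ?invr_ge0 // mulrC ler_wpM2r ?invr_ge0 // ltW.
  have i1 : N%:R^-1 <= 1 :> R by rewrite invf_le1 // ler1n.
  have i0 : 0 <= N%:R^-1 :> R by rewrite invr_ge0.
  have h2 : (1 - N%:R^-1) ^+ N <= 2^-1 :> R.
    have e2 : 2 <= (1 + N%:R^-1) ^+ N :> R.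
      have := @binomial_le 1 (N%:R^-1) N.-1 ler01 i0; rewrite prednK // !expr1n mulr1 mulfV ?gt_eqF //.
    have : (1 - N%:R^-1) ^+ N * (1 + N%:R^-1) ^+ N <= 1 :> R.
      rewrite -exprMn exprn_ile1 //; move: (N%:R^-1) i0 i1 => a a0 a1; nra.
    have : 0 <= (1 - N%:R^-1) ^+ N :> R by rewrite exprn_ge0 // subr_ge0.
    by move: (_ ^+ N) (_ ^+ N) e2 => a b; nra.
  have := normc_triangle (Q ^+ N)%:C 0 (((1 - N%:R^-1)%:C * v) ^+ N).
  rewrite subr0 sub0r normcN normcX normc_cmul ?subr_ge0 // exprMn => h.
  have hv : normc v ^+ N <= Q ^+ N by rewrite lerXn2r ?nnegrE ?normc_ge0 // ltW.
  have h3 := le_normcD ((Q ^+ N)%:C - ((1 - N%:R^-1)%:C * v) ^+ N) (((1 - N%:R^-1)%:C * v) ^+ N).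
  rewrite subrK normc_real ?exprn_ge0 ?(ltW Q0) // normc_distC normcX normc_cmul ?subr_ge0 // exprMn in h3.
  have q0 : 0 <= Q ^+ N by rewrite exprn_ge0 // ltW.
  have v0 : 0 <= normc v ^+ N by rewrite exprn_ge0 // normc_ge0.
  have p0 : 0 <= (1 - N%:R^-1) ^+ N :> R by rewrite exprn_ge0 // subr_ge0.
  have h4 : (1 - N%:R^-1) ^+ N * normc v ^+ N <= 2^-1 * Q ^+ N by apply: ler_pM.
  by move: h3; rewrite ?exprMn => h3; lra.
have v0 : 0 < normc v by apply: lt_le_trans vQ.
pose k := 1 + Q / N%:R / normc v; have k0 : 0 <= k.
  by rewrite addr_ge0 // !divr_ge0 ?normc_ge0 // ltW.
exists (k%:C * v).
  have -> : v - k%:C * v = - ((Q / N%:R / normc v)%:C * v) by rewrite /k rmorphD rmorph1; ring.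
  by rewrite normcN normc_cmul ?divr_ge0 ?normc_ge0 ?(ltW Q0) // divfK // gt_eqF.
have kv : normc (k%:C * v) = normc v + Q / N%:R.
  by rewrite normc_cmul // /k; field; rewrite !gt_eqF.
have h3 := le_normcD ((k%:C * v) ^+ N - (Q ^+ N)%:C) (Q ^+ N)%:C.
rewrite subrK normc_real ?exprn_ge0 ?(ltW Q0) // normcX kv in h3.
have := @binomial_le (normc v) (Q / N%:R) N.-1 (normc_ge0 v) (divr_ge0 (ltW Q0) (ltW NR)).
rewrite prednK // => hb.
have hq : Q ^+ N <= N%:R * normc v ^+ N.-1 * (Q / N%:R).
  have -> : N%:R * normc v ^+ N.-1 * (Q / N%:R) = normc v ^+ N.-1 * Q.
    by move: (normc v ^+ N.-1) => a; field; rewrite gt_eqF.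
  by rewrite -{1}(prednK N0) exprSr ler_pM2r // lerXn2r ?nnegrE ?normc_ge0 // ltW.
have n0 := normc_ge0 ((k%:C * v) ^+ N - (Q ^+ N)%:C).
by lra.
Qed.

(** [mahler] with the nodes themselves as roots: at a point x of modulus r the product is |(v + x)^N
    - Q^N| up to the sign conventions, at most 2 (max(|v|, Q) + r)^N. *)
Lemma nodes_upper (Q r : R) m (v : C) : 0 < Q -> 0 < r ->
  \sum_(x <- nodes m (Q ^+ (2 ^ m))%:C) lnm r (v - x) <=
  (2 ^ m)%:R * (lnm Q v + r / Q) + ln 2.
Proof.
move=> Q0 r0; set N := (2 ^ m)%N; set s := nodes m _.
have m0 := max_gt0 v Q0.
have lnE (t : seq C) : ln (\prod_(x <- t) Num.max (normc (x - v)) r) = \sum_(x <- t) lnm r (v - x)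
    /\ 0 < \prod_(x <- t) Num.max (normc (x - v)) r.
  elim: t => [|x t [IH IH0]]; first by rewrite !big_nil ln1.
  have h := max_gt0 (x - v) r0; rewrite !big_cons mulr_gt0 // lnM ?posrE // IH.
  by rewrite /lnm [normc (v - x)]normc_distC.
have [sE s0] := lnE s; rewrite -sE.
have k0 : (size s < 2 ^ m.+1)%N by rewrite size_nodes ltn_exp2l.
have := mahler v r0 k0; set P := \prod_(l <- s) _ => hP.
have b0 : 0 < Num.max (normc v) Q + r by rewrite addr_gt0.
have PB : P <= 2 * (Num.max (normc v) Q + r) ^+ N.
  have p0 : 0 < (2 ^ m.+1)%:R :> R by rewrite ltr0n expn_gt0.
  rewrite -(ler_pM2l p0); apply: le_trans hP _.
  apply: (@le_trans _ _ (\sum_(x <- nodes m.+1 (r ^+ (2 ^ m.+1))%:C) 2 * (Num.max (normc v) Q + r) ^+ N)).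
    rewrite big_seq [leRHS]big_seq; apply: ler_sum => x xs; have xr := nodes_normr r0 xs.
    under eq_bigr do rewrite normc_distC.
    rewrite -normc_prod nodes_prod.
    apply: le_trans (le_normcD _ _) _; rewrite normcN normc_real ?exprn_ge0 ?(ltW Q0) // normcX mulr2n mulrDl !mul1r.
    apply: lerD; rewrite lerXn2r ?nnegrE ?normc_ge0 ?(ltW Q0) ?(ltW b0) //.
      by apply: le_trans (le_normcD _ _) _; rewrite xr lerD2r le_max lexx.
    by rewrite ler_wpDr ?(ltW r0) // le_max lexx orbT.
  rewrite (big_const_seq 0 +%R) count_predT size_nodes.
  have -> : forall b : R, iter (2 ^ m.+1) (+%R b) 0 = (2 ^ m.+1)%:R * b => //.
  by move=> b; elim: (2 ^ m.+1)%N => [|k IH]; rewrite ?mul0r // iterS IH -natr1; ring.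
apply: (@le_trans _ _ (ln (2 * (Num.max (normc v) Q + r) ^+ N))).
  by rewrite ler_ln ?posrE // mulr_gt0 // exprn_gt0.
rewrite lnM ?posrE ?exprn_gt0 // lnXn // -[ln _ *+ N]mulr_natl addrC lerD2r ler_wpM2l //.
apply: le_trans (ln_addr m0 (ltW r0)) _; rewrite lerD2l ler_pM2l // lef_pV2 ?posrE //.
by rewrite le_max lexx orbT.
Qed.

End LogMax.

Section EigenvalueAverage.
Local Open Scope sesquilinear_scope.
Context (R : realType) (n : nat).
Local Notation C := R[i].
Implicit Types (A B : 'M[C]_n) (f g : C -> R).

Definition eig_avg B f : R := n%:R^-1 * \sum_(l <- eigenvalues B) f l.

Lemma avgD B f g : eig_avg B (fun l => f l + g l) = eig_avg B f + eig_avg B g.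
Proof. by rewrite /eig_avg big_split mulrDr. Qed.

Lemma avgZ B (c : R) f : eig_avg B (fun l => c * f l) = c * eig_avg B f.
Proof. by rewrite /eig_avg -mulr_sumr mulrCA. Qed.

Lemma avg_cst B (c : R) : (0 < n)%N -> eig_avg B (fun=> c) = c.
Proof.
move=> n0; rewrite /eig_avg (big_const_seq 0 +%R) count_predT size_eigenvalues.
have -> : iter n (+%R c) 0 = n%:R * c.
  by elim: (n) => [|k IH]; rewrite ?mul0r // iterS IH -natr1; ring.
by rewrite mulrA mulVf ?mul1r // gt_eqF // ltr0n.
Qed.

Lemma le_avg B f g : (forall l, f l <= g l) -> eig_avg B f <= eig_avg B g.
Proof. by move=> fg; rewrite /eig_avg ler_wpM2l ?invr_ge0 // ler_sum. Qed.

Lemma ln_prod_max (s : seq C) (r : R) z : 0 < r ->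
  0 < \prod_(l <- s) Num.max (normc (l - z)) r /\
  ln (\prod_(l <- s) Num.max (normc (l - z)) r) = \sum_(l <- s) lnm r (l - z).
Proof.
move=> r0; elim: s => [|x t [IH0 IH]]; first by rewrite !big_nil ln1.
have h := max_gt0 (x - z) r0.
by rewrite !big_cons mulr_gt0 // lnM ?posrE // IH.
Qed.

Lemma absdet_le B z (r : R) : (0 < n)%N -> 0 < r -> \det (B - z%:M) != 0 ->
  n%:R^-1 * ln (normc (\det (B - z%:M))) <= eig_avg B (fun l => lnm r (l - z)).
Proof.
move=> n0 r0 d0; rewrite /eig_avg ler_wpM2l ?invr_ge0 //.
have [p0 <-] := ln_prod_max (eigenvalues B) z r0.
rewrite ler_ln ?posrE ?normc_gt0 // det_eigen; apply: ler_prod => l _.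
by rewrite normc_ge0 le_max lexx.
Qed.

(* Every node [x] of the circle of radius [r] satisfies the bound of [det_shift]; conclude by [mahler]. *)
Lemma avg_le_nodes B z (r b : R) : (0 < n)%N -> 0 < r -> 0 < b ->
  (forall x, normc x = r -> normc (\det (B - (z + x)%:M)) <= b ^+ n) ->
  eig_avg B (fun l => lnm r (l - z)) <= ln b.
Proof.
move=> n0 r0 b0 hb; have [p0 pE] := ln_prod_max (eigenvalues B) z r0.
have nR : 0 < n%:R :> R by rewrite ltr0n.
rewrite /eig_avg -pE ler_pdivrMl // mulr_natl -lnXn // ler_ln ?posrE ?exprn_gt0 //.
have sz : (size (eigenvalues B) < 2 ^ n)%N by rewrite size_eigenvalues ltn_expl.
have := mahler z r0 sz; set s := nodes _ _ => h.
have P0 : 0 < (2 ^ n)%:R :> R by rewrite ltr0n expn_gt0.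
rewrite -(ler_pM2l P0); apply: le_trans h _.
apply: (@le_trans _ _ (\sum_(x <- s) b ^+ n)).
  rewrite big_seq [leRHS]big_seq; apply: ler_sum => x xs; rewrite -det_eigen.
  by apply: hb; exact: nodes_normr r0 xs.
rewrite (big_const_seq 0 +%R) count_predT size_nodes.
have -> : forall c : R, iter (2 ^ n) (+%R c) 0 = (2 ^ n)%:R * c => //.
by move=> c; elim: (2 ^ n)%N => [|k IH]; rewrite ?mul0r // iterS IH -natr1; ring.
Qed.

Lemma regdet_gt0 B (e : R) : 0 < e -> 0 < complex.Re (\det (gram B + (e%:C)%:M)).
Proof.
move=> e0; have [g [-> g0 _ _]] := gram_spectrum B; rewrite /=.
by apply: prodr_gt0 => i _; rewrite ltr_wpDl.
Qed.

Lemma avg_le_regdet B z (r e : R) : (0 < n)%N -> 0 < r -> 0 < e ->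
  eig_avg B (fun l => lnm r (l - z)) <= 2^-1 * ln (1 + r ^+ 2 / e) +
    2^-1 * (n%:R^-1 * ln (complex.Re (\det (gram (B - z%:M) + (e%:C)%:M)))).
Proof.
move=> n0 r0 e0; set D := complex.Re _; have D0 : 0 < D by exact: regdet_gt0.
have nR : 0 < n%:R :> R by rewrite ltr0n.
set c := 1 + r ^+ 2 / e.
have c0 : 0 < c by rewrite ltr_wpDr // divr_ge0 ?sqr_ge0 // ltW.
pose b := expR (2^-1 * ln c + 2^-1 * (n%:R^-1 * ln D)).
rewrite -[leRHS]expRK -/b; apply: avg_le_nodes => //; first exact: expR_gt0.
move=> x xr; have := det_shift (B - z%:M) x e0; rewrite xr -/D -/c => h.
have bn : (b ^+ n) ^+ 2 = c ^+ n * D.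
  have -> : c ^+ n = expR (n%:R * ln c) by rewrite expRM_natl lnK ?posrE.
  have DE : expR (ln D) = D by rewrite lnK ?posrE.
  rewrite /b -!expRM_natl -[X in _ = _ * X]DE -expRD; congr expR.
  by move: (ln c) (ln D) => u v; field; rewrite gt_eqF.
have -> : B - (z + x)%:M = B - z%:M - x%:M by rewrite raddfD opprD addrA.
by rewrite -(@ler_pXn2r _ 2) ?nnegrE ?normc_ge0 ?exprn_ge0 ?expR_ge0 // bn.
Qed.

(** Tightness of the eigenvalues. For |x| = K the Hilbert-Schmidt norm of B - x is at most sqrt n (K
    + s), so [det_hs] bounds its determinant by (K + s)^n, and [avg_le_nodes] concludes. *)
Lemma avg_le_hs B (K s : R) : (0 < n)%N -> 0 < K -> 0 < s -> hs_norm B ^+ 2 <= n%:R * s ^+ 2 ->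
  eig_avg B (fun l => lnm K l) <= ln K + s / K.
Proof.
move=> n0 K0 s0 hB; have -> : eig_avg B (fun l => lnm K l) = eig_avg B (fun l => lnm K (l - 0)).
  by congr (_ * _); apply: eq_bigr => l _; rewrite subr0.
apply: le_trans (ln_addr K0 (ltW s0)); apply: avg_le_nodes => //; first by rewrite addr_gt0.
move=> x xK; rewrite add0r -(@ler_pXn2r _ 2) ?nnegrE ?normc_ge0 ?exprn_ge0 ?addr_ge0 ?(ltW K0) ?(ltW s0) //.
rewrite -exprM mulnC exprM; apply: det_hs; first by rewrite exprn_gt0 // addr_gt0.
rewrite hs_norm_sqr in hB; rewrite hs_norm_sqr.
have ent i j : normc ((B - x%:M) i j) ^+ 2 <=
    (1 + K / s) * normc (B i j) ^+ 2 + (1 + s / K) * (K ^+ 2 *+ (i == j)).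
  have ab (a b : R) : 0 <= a -> 0 <= b -> (a + b) ^+ 2 <= (1 + K / s) * a ^+ 2 + (1 + s / K) * b ^+ 2.
    move=> a0 b0; have -> : (1 + K / s) * a ^+ 2 + (1 + s / K) * b ^+ 2 =
       (a + b) ^+ 2 + (K * a - s * b) ^+ 2 / (K * s) by field; rewrite !gt_eqF.
    by rewrite lerDl divr_ge0 ?sqr_ge0 // mulr_ge0 // ltW.
  have -> : K ^+ 2 *+ (i == j) = normc (x *+ (i == j)) ^+ 2.
    by case: (i == j); rewrite ?mulr1n ?xK // !mulr0n ComplexField.Normc.normc0 expr0n.
  apply: le_trans (ab _ _ (normc_ge0 _) (normc_ge0 _)).
  rewrite lerXn2r ?nnegrE ?addr_ge0 ?normc_ge0 // !mxE.
  by apply: le_trans (le_normcD _ _) _; rewrite normcN.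
apply: (@le_trans _ _ (\sum_i \sum_j ((1 + K / s) * normc (B i j) ^+ 2 + (1 + s / K) * (K ^+ 2 *+ (i == j))))).
  by apply: ler_sum => i _; apply: ler_sum => j _; exact: ent.
under eq_bigr do rewrite big_split -!mulr_sumr /=.
rewrite big_split -!mulr_sumr /=.
have -> : \sum_(i < n) \sum_(j < n) K ^+ 2 *+ (i == j) = n%:R * K ^+ 2.
  rewrite (eq_bigr (fun=> K ^+ 2)) => [|i _]; first by rewrite sumr_const card_ord mulr_natl.
  by rewrite (bigD1 i) //= eqxx big1 ?addr0 // => j ji; rewrite eq_sym (negPf ji).
have k1 : 0 <= 1 + K / s by rewrite addr_ge0 // divr_ge0 // ltW.
apply: le_trans (lerD (ler_wpM2l k1 hB) (lexx _)) _; rewrite le_eqVlt; apply/orP; left; apply/eqP.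
by field; rewrite !gt_eqF.
Qed.

Lemma integral_esd B f : measurable_fun setT f -> (\int[esd B]_z (f z)%:E)%E = (eig_avg B f)%:E.
Proof.
have ge0 g : measurable_fun setT g -> (forall l, 0 <= g l) ->
    (\int[esd B]_z (g z)%:E)%E = (eig_avg B g)%:E.
  move=> mg g0; have mg' : measurable_fun setT (EFin \o g) by exact/measurable_EFinP.
  rewrite ge0_integral_mscale //; last by move=> *; rewrite lee_fin.
  rewrite (ge0_integral_measure_sum _ _) //; last by move=> *; rewrite lee_fin.
  under eq_bigr do rewrite integral_dirac // diracT mul1e.
  rewrite sumEFin -EFinM /eig_avg (big_nth 0) size_eigenvalues big_mkord //.
move=> mf; rewrite integralE.
have e1 : (fun z => (EFin \o f) z)^\+%E = EFin \o (fun z => Num.max (f z) 0).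
  by apply/funext => z; rewrite /= funeposE -EFin_max.
have e2 : (fun z => (EFin \o f) z)^\-%E = EFin \o (fun z => Num.max (- f z) 0).
  by apply/funext => z; rewrite /= funenegE -EFin_max.
rewrite e1 e2 ge0 ?ge0 //.
- rewrite -EFinB; congr EFin; rewrite /eig_avg -mulrBr -sumrB; congr (_ * _); apply: eq_bigr => l _.
  by case: (leP (f l) 0) => h1; case: (leP (- f l) 0) => h2; lra.
- by apply: measurable_maxr => //; exact: measurable_funN.
- by move=> l; rewrite le_max lexx orbT.
- by apply: measurable_maxr.
- by move=> l; rewrite le_max lexx orbT.
Qed.

End EigenvalueAverage.

(** * Potentials of the limit measure *)

(** The product measure under a name of its own, to carry the sigma-finite structure that Tonelli's
    theorem asks for. *)
Definition plane_measure (R : realType) := ((@lebesgue_measure R) \x (@lebesgue_measure R))%E.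
HB.instance Definition _ (R : realType) := Measure.on (@plane_measure R).
Lemma plane_sigma_finite (R : realType) : sigma_finite setT (@plane_measure R).
Proof.
pose I n : set (measurableTypeR R) := `[(- n%:R), n%:R]%classic.
exists (fun n => I n `*` I n).
  apply/esym/seteqP; split => // -[a b] _; exists (Num.trunc (`|a| + `|b|)).+1 => //=.
  have := truncnS_gt (`|a| + `|b|); have := normr_ge0 a; have := normr_ge0 b.
  have := ler_norm a; have := ler_norm b; have := ler_norm (- a); have := ler_norm (- b).
  by rewrite !normrN /I /= !in_itv /= => *; split; apply/andP; split; lra.
move=> n; have mI : measurable (I n) by exact: measurable_itv.
split; first exact: measurableX.
have -> : plane_measure (I n `*` I n) = (lebesgue_measure (I n) * lebesgue_measure (I n))%E.
  exact: product_measure1E.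
rewrite /I lebesgue_measure_itv /= lte_fin.
by case: ifP => _; rewrite ?mule0 // -!EFinB -EFinM ltry.
Qed.
HB.instance Definition _ (R : realType) :=
  Measure_isSigmaFinite.Build _ _ _ (@plane_measure R) (@plane_sigma_finite R).

Section Potential.
Variable R : realType.
Local Notation C := R[i].
Variable mu : probability C R.
Hypothesis mom : (\int[mu]_z (normc z ^+ 2)%:E < +oo)%E.

Lemma measurable_lnm (r : R) (z : C) : 0 < r -> measurable_fun setT (fun w : C => lnm r (w - z)).
Proof.
move=> r0; apply: continuous_measurableC => a e e0; exists (e * r); first by rewrite mulr_gt0.
move=> b ab; rewrite ltr_norml; have ab' : normc (a - b) / r < e by rewrite ltr_pdivrMr.
have h1 := lnm_lip (a - z) (b - z) r0; have h2 := lnm_lip (b - z) (a - z) r0.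
rewrite opprB addrA subrK in h1; rewrite opprB addrA subrK [normc (b - a)]normc_distC in h2.
by apply/andP; split; lra.
Qed.

Lemma integrable_cst (c : R) : mu.-integrable setT (fun=> c%:E).
Proof. by apply: finite_measure_integrable_cst. Qed.

Lemma abs_lnm (r : R) v : 0 < r -> `|lnm r v| <= `|ln r| + normc v / r.
Proof.
move=> r0; have h1 := lnm_ge v r0; have h2 := lnm_shift v r0.
have h3 : 0 <= normc v / r by rewrite divr_ge0 ?normc_ge0 // ltW.
rewrite ler_norml; apply/andP; split.
  by have := ler_norm (- ln r); rewrite normrN; lra.
by have := ler_norm (ln r); lra.
Qed.

Lemma measurable_normc2 : measurable_fun setT (fun z : C => normc z ^+ 2).
Proof. by apply: measurable_funX; exact: measurable_normc. Qed.

Lemma integrable_normc2 : mu.-integrable setT (fun w : C => (normc w ^+ 2)%:E).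
Proof.
apply/integrableP; split; first by apply/measurable_EFinP; exact: measurable_normc2.
by under eq_integral do rewrite gee0_abs ?lee_fin ?sqr_ge0 //.
Qed.

Lemma integrable_lnm (r : R) (z : C) : 0 < r ->
  mu.-integrable setT (fun w : C => (lnm r (w - z))%:E).
Proof.
move=> r0; have i2 := integrable_normc2.
have i3 : mu.-integrable setT (fun w : C => (`|ln r| + (1 + normc z) / r)%:E + (r^-1)%:E * (normc w ^+ 2)%:E)%E.
  by apply: integrableD => //; [exact: integrable_cst|exact: integrableZl].
apply: le_integrable i3 => //; first by apply/measurable_EFinP; exact: measurable_lnm.
move=> w _ /=; rewrite lee_fin; apply: le_trans (abs_lnm _ r0) _.
rewrite [leRHS]ger0_norm; last first.
  by rewrite !addr_ge0 ?mulr_ge0 ?addr_ge0 ?normc_ge0 ?invr_ge0 ?sqr_ge0 ?(ltW r0).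
rewrite -addrA lerD2l [r^-1 * _]mulrC -mulrDl ler_pM2r ?invr_gt0 //.
apply: le_trans (le_normcD _ _) _; rewrite normcN.
by move: (normc_ge0 w); move: (normc w) (normc z) => a b; nra.
Qed.

Definition Lpot (r : R) (z : C) : R := \int[mu]_w lnm r (w - z).

Lemma LpotE (r : R) z : 0 < r -> (\int[mu]_w (lnm r (w - z))%:E)%E = (Lpot r z)%:E.
Proof.
by move=> r0; rewrite /Lpot /Rintegral fineK //; apply: integrable_fin_num => //; exact: integrable_lnm.
Qed.

Lemma Lpot_le (r s : R) z : 0 < r -> r <= s -> Lpot r z <= Lpot s z.
Proof.
move=> r0 rs; have s0 := lt_le_trans r0 rs; apply: le_Rintegral => //.
- exact: integrable_lnm.
- exact: integrable_lnm.
- by move=> w _; exact: lnm_mono.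
Qed.

Lemma Lpot_cst (c : R) : \int[mu]_w c = c.
Proof.
transitivity (c * fine (mu setT)); first exact: Rintegral_cst.
by rewrite (_ : mu setT = 1%E) ?mulr1 //; exact: probability_setT.
Qed.

Lemma Lpot_lip (r : R) z z' : 0 < r -> Lpot r z <= Lpot r z' + normc (z - z') / r.
Proof.
move=> r0; rewrite -[X in _ <= _ + X]Lpot_cst -RintegralD //; last 2 first.
- exact: integrable_lnm.
- exact: integrable_cst.
apply: le_Rintegral => //; first exact: integrable_lnm.
  by apply: (integrableD measurableT (integrable_lnm z' r0) (integrable_cst _)).
move=> w _; apply: le_trans (lnm_lip _ (w - z') r0) _.
by rewrite opprB [w - z + _]addrC addrA subrK normc_distC.
Qed.

Lemma Lpot_diff (r s : R) z : 0 < r -> 0 < s ->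
  (\int[mu]_w (lnm s (w - z) - lnm r (w - z))%:E)%E = (Lpot s z - Lpot r z)%:E.
Proof.
move=> r0 s0; rewrite EFinB -!LpotE // -integralB_EFin //; exact: integrable_lnm.
Qed.

Let f (z w : C) : \bar R := lne (normc (w - z))%:E.

Lemma lnm1_pos z w : ((fun w => f z w)^\+)%E w = (lnm 1 (w - z))%:E.
Proof.
rewrite funeposE /f /lnm; have := normc_ge0 (w - z); move: (normc _) => a a0.
have [->|an] := eqVneq a 0; first by rewrite le0_lneNy // max_r ?ltW // max_r ?ln1 // leNye.
have a0' : 0 < a by rewrite lt_def an.
rewrite lne_EFin // -EFin_max; congr EFin; case: (leP a 1) => h.
  by rewrite ln1 max_r // -ln1 ler_ln ?posrE.
by rewrite max_l // -ln1 ler_ln ?posrE // ltW.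
Qed.

Let g (z : C) (k : nat) (w : C) : \bar R := (lnm 1 (w - z) - lnm (2 ^- k) (w - z))%:E.

Lemma inv2X_le (k l : nat) : (k <= l)%N -> 2 ^- l <= 2 ^- k :> R.
Proof. by move=> kl; rewrite lef_pV2 ?posrE ?exprn_gt0 // ler_eXn2l // ltr1n. Qed.

Lemma inv2X_gt0 (k : nat) : 0 < 2 ^- k :> R. Proof. by rewrite invr_gt0 exprn_gt0. Qed.

Lemma g_neg_cvg z w : g z k w @[k --> \oo] --> ((fun w => f z w)^\-)%E w.
Proof.
rewrite funenegE /f /g /lnm; have := normc_ge0 (w - z); move: (normc _) => a a0.
have [->|an] := eqVneq a 0.
  rewrite le0_lneNy // (_ : Order.max _ _ = +oo%E) ?maxey //; apply/cvgeyPge => A.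
  near=> k; have p0 := inv2X_gt0 k.
  rewrite (max_r (ltW (@ltr01 R))) (max_r (ltW p0)) ln1 lee_fin sub0r lnV ?posrE ?exprn_gt0 // opprK lnXn //.
  have l2 : 0 < ln 2 :> R by rewrite ln_gt0 // ltr1n.
  have : A / ln 2 <= k%:R by near: k; exact: nbhs_infty_ger.
  by rewrite ler_pdivrMr // mulr_natl.
have a0' : 0 < a by rewrite lt_def an.
apply: cvg_near_cst; near=> k.
have ka : 2 ^- k <= a.
  rewrite -[leRHS]invrK lef_pV2 ?posrE ?invr_gt0 ?exprn_gt0 //.
  have h : a^-1 <= k%:R by near: k; exact: nbhs_infty_ger.
  by apply: le_trans h _; rewrite -natrX ler_nat ltnW // ltn_expl.
rewrite (max_l ka) lne_EFin // -EFinN -EFin_max; congr EFin; case: (leP a 1) => h.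
  by rewrite ln1 sub0r max_l // oppr_ge0 -ln1 ler_ln ?posrE.
by rewrite subrr max_r // oppr_le0 -ln1 ler_ln ?posrE // ltW.
Unshelve. all: by end_near. Qed.

Lemma g_nd z w : {homo (fun k => g z k w) : k l / (k <= l)%N >-> (k <= l)%E}.
Proof. by move=> k l kl; rewrite lee_fin lerB // lnm_mono ?inv2X_gt0 // inv2X_le. Qed.

Lemma g_ge0 z k w : (0 <= g z k w)%E.
Proof.
by rewrite lee_fin subr_ge0 lnm_mono ?inv2X_gt0 // invf_le1 ?exprn_gt0 // exprn_ege1 // ler1n.
Qed.

Lemma measurable_g z k : measurable_fun setT (g z k).
Proof. by apply/measurable_EFinP/measurable_funB; apply: measurable_lnm; rewrite ?inv2X_gt0. Qed.

(** The positive part of log|w - z| is [lnm] at level 1 and its negative part is the increasing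
    limit of [lnm] at level 1 minus [lnm] at level 2^-k. Monotone convergence applies whether or not
    the potential is finite at z. *)
Lemma potE z : log_potential mu z =
  ((Lpot 1 z)%:E - limn (fun k => (Lpot 1 z - Lpot (2 ^- k) z)%:E))%E.
Proof.
rewrite /log_potential integralE; congr (_ - _)%E.
  by under eq_integral do rewrite lnm1_pos; rewrite LpotE.
transitivity (\int[mu]_w limn (g z ^~ w))%E.
  by apply: eq_integral => w _; apply/esym/cvg_lim => //; exact: g_neg_cvg.
rewrite monotone_convergence //.
- by congr (limn _); apply/funext => k; rewrite Lpot_diff // inv2X_gt0.
- by move=> k; exact: measurable_g.
- by move=> k w _; exact: g_ge0.
- by move=> w _; exact: g_nd.
Qed.

Lemma Lpot_seq_nd z : nondecreasing_seq (fun k => (Lpot 1 z - Lpot (2 ^- k) z)%:E).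
Proof. by move=> k l kl; rewrite lee_fin lerB // Lpot_le ?inv2X_gt0 // inv2X_le. Qed.

Lemma pot_le (r : R) z : 0 < r -> (log_potential mu z <= (Lpot r z)%:E)%E.
Proof.
move=> r0; have [k kr] : exists k, 2 ^- k <= r.
  exists (Num.truncn r^-1).+1; rewrite -[leRHS]invrK lef_pV2 ?posrE ?invr_gt0 ?exprn_gt0 //.
  apply: le_trans (ltW (truncnS_gt _)) _; rewrite -natrX ler_nat ltnW // ltn_expl //.
apply: (@le_trans _ _ (Lpot (2 ^- k) z)%:E); last by rewrite lee_fin Lpot_le // inv2X_gt0.
rewrite potE; have -> : ((Lpot (2 ^- k) z)%:E = (Lpot 1 z)%:E - (Lpot 1 z - Lpot (2 ^- k) z)%:E)%E.
  by rewrite -EFinB subKr.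
apply: leeB => //; have /ereal_nondecreasing_cvgn/cvg_lim -> // := @Lpot_seq_nd z.
by apply: ereal_sup_ubound; exists k.
Qed.

Lemma pot_lim (b : R) z : (log_potential mu z < b%:E)%E ->
  exists2 r0, 0 < r0 & forall r, 0 < r <= r0 -> Lpot r z < b.
Proof.
move=> h; have [[k kb]|nk] := pselect (exists k, Lpot (2 ^- k) z < b).
  exists (2 ^- k); first exact: inv2X_gt0.
  by move=> r /andP[r0 rk]; apply: le_lt_trans kb; exact: Lpot_le.
exfalso; move: h; apply/negP; rewrite -leNgt potE.
have -> : (b%:E = (Lpot 1 z)%:E - (Lpot 1 z - b)%:E)%E by rewrite -EFinB subKr.
apply: leeB => //; apply: lime_le; first exact/ereal_nondecreasing_is_cvgn/Lpot_seq_nd.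
near=> k; rewrite lee_fin lerB // leNgt; apply/negP => hk; apply: nk; by exists k.
Unshelve. all: by end_near. Qed.

Lemma lnm_half (t : R) v : 0 < t -> lnm t v - lnm (t / 2) v <= \1_[set v : C | normc v <= t] v.
Proof.
move=> t0; have t2 : 0 < t / 2 by rewrite divr_gt0.
rewrite indicE; case: (leP (normc v) t) => h.
  rewrite mem_set //= /lnm (max_r h); have h2 := lnm_ge v t2; rewrite /lnm in h2.
  have : ln t <= ln (t / 2) + 1; last by lra.
  have -> : t = t / 2 + t / 2 by lra.
  apply: le_trans (ln_addr t2 (ltW t2)) _.
  have -> : t / 2 + t / 2 = t by lra.
  by rewrite divff // gt_eqF.
rewrite memNset /=; last by apply/negP; rewrite -ltNge.
by rewrite /lnm !max_l ?subrr //; lra.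
Qed.

(** * Choice of a shift by averaging *)

Section Tonelli.
Context (dy : measure_display) (Y : measurableType dy) (m : {sigma_finite_measure set Y -> \bar R}).
Variables X1 X2 : Y -> R.
Hypothesis mX1 : measurable_fun setT X1.
Hypothesis mX2 : measurable_fun setT X2.
Hypothesis boxm : forall a b t : R, 0 < t ->
  (m [set y | (`|a - X1 y| <= t)%R /\ (`|b - X2 y| <= t)%R] <= (4 * t ^+ 2)%:E)%E.

Let pt (y : Y) : C := X1 y +i* X2 y.

(** A square instead of the disc of [lnm_half]: its measurability and the measure of its sections
    are read off the two coordinates. *)
Definition Box (c : C) (t : R) : set (Y * C) :=
  [set p | `|complex.Re p.2 - complex.Re c - X1 p.1| <= t] `&`
  [set p | `|complex.Im p.2 - complex.Im c - X2 p.1| <= t].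

Lemma measurable_Box c t : measurable (Box c t).
Proof.
have key (h : (Y * C)%type -> R) : measurable_fun setT h -> measurable [set p | `|h p| <= t].
  move=> mh; have mh' : measurable_fun setT (fun p => `|h p|) by exact: measurableT_comp.
  have -> : [set p | `|h p| <= t] = setT `&` (fun p => `|h p|) @^-1` `]-oo, t].
    by apply/seteqP; split => p /=; rewrite in_itv /=; tauto.
  by apply: mh' => //; exact: measurable_itv.
apply: measurableI; apply: key; apply: measurable_funB.
- apply: measurable_funB => //.
  by apply: (measurableT_comp (f := @complex.Re R) (g := snd)); [exact: measurable_Re|exact: measurable_snd].
- by apply: (measurableT_comp (f := X1) (g := fst)) => //; exact: measurable_fst.
- apply: measurable_funB => //.
  by apply: (measurableT_comp (f := @complex.Im R) (g := snd)); [exact: measurable_Im|exact: measurable_snd].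
- by apply: (measurableT_comp (f := X2) (g := fst)) => //; exact: measurable_fst.
Qed.

Let bx c t (p : (Y * C)%type) : \bar R := (\1_(Box c t) p)%:E.

Lemma measurable_bx c t : measurable_fun setT (bx c t).
Proof. by apply/measurable_EFinP/measurable_indic; exact: measurable_Box. Qed.

Lemma bx_ge0 c t p : (0 <= bx c t p)%E. Proof. by rewrite lee_fin. Qed.

Let hb c t (y : Y) : \bar R := (\int[mu]_w bx c t (y, w))%E.

Lemma measurable_hb c t : measurable_fun setT (hb c t).
Proof.
have h := measurable_fun_fubini_tonelli_F (m2 := mu) (bx c t) (measurable_bx c t) (@bx_ge0 c t).
by rewrite /fubini_F in h; exact: h.
Qed.

Lemma hb_ge0 c t y : (0 <= hb c t y)%E.
Proof. by apply: integral_ge0 => w _; exact: bx_ge0. Qed.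

Lemma hb_integral c t : 0 < t -> (\int[m]_y hb c t y <= (4 * t ^+ 2)%:E)%E.
Proof.
move=> t0; rewrite /hb (fubini_tonelli (m1 := m) (m2 := mu) (bx c t) (measurable_bx c t) (@bx_ge0 c t)).
apply: (@le_trans _ _ (\int[mu]_w (4 * t ^+ 2)%:E)%E); last first.
  rewrite integral_cst //; set Z := (X in (_ * X)%E).
  by have -> : Z = 1%E; [exact: probability_setT|rewrite mule1].
have inner w : (\int[m]_y bx c t (y, w) <= (4 * t ^+ 2)%:E)%E.
  apply: le_trans (boxm (complex.Re w - complex.Re c) (complex.Im w - complex.Im c) t0).
  set Ew := [set y | _]; have mE : measurable Ew.
    have -> : Ew = ysection (Box c t) w.
      by apply/seteqP; split => y; rewrite /ysection /= inE.
    by apply: measurable_ysection; exact: measurable_Box.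
  have -> : (\int[m]_y bx c t (y, w) = \int[m]_y (\1_Ew y)%:E)%E.
    apply: eq_integral => y _; rewrite /bx !indicE; congr ((nat_of_bool _)%:R%:E).
  have e1 : (\int[m]_y (\1_Ew y)%:E = m (Ew `&` setT))%E by exact: integral_indic.
  by rewrite e1 setIT.
apply: ge0_le_integral => //.
- by move=> w _; apply: integral_ge0 => y _; exact: bx_ge0.
- have h := measurable_fun_fubini_tonelli_G (m1 := m) (bx c t) (measurable_bx c t) (@bx_ge0 c t).
  by rewrite /fubini_G in h; exact: h.
Qed.

Lemma Lpot_half c t (y : Y) : 0 < t ->
  ((Lpot t (pt y + c) - Lpot (t / 2) (pt y + c))%:E <= hb c t y)%E.
Proof.
move=> t0; have t2 : 0 < t / 2 by rewrite divr_gt0.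
rewrite -Lpot_diff //; apply: ge0_le_integral => //.
- by move=> w _; rewrite lee_fin subr_ge0 lnm_mono //; lra.
- by apply/measurable_EFinP/measurable_funB; exact: measurable_lnm.
- by apply: (measurableT_comp (measurable_bx c t)); exact: pair1_measurable.
move=> w _; rewrite lee_fin; apply: le_trans (lnm_half _ t0) _.
rewrite !indicE; case: (boolP (w - _ \in _)) => [|_]; last by rewrite ler0n.
rewrite inE /= => h.
rewrite mem_set // /Box /=; set v := w - _ in h.
have e1 : complex.Re w - complex.Re c - X1 y = complex.Re v.
  by rewrite /v; case: (w) => ? ?; case: (c) => ? ? /=; lra.
have e2 : complex.Im w - complex.Im c - X2 y = complex.Im v.
  by rewrite /v; case: (w) => ? ?; case: (c) => ? ? /=; lra.
by split; rewrite /= ?e1 ?e2; apply: le_trans h; [exact: Re_le_normc|exact: Im_le_normc].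
Qed.

(* By Tonelli the integral of the truncation errors over all shifts [y] is at most [8 t ^ 2] per node. *)
Lemma select_shift (s : seq C) (D A : set Y) (b e t : R) :
  (0 < size s)%N -> measurable D -> m D = b%:E -> measurable A -> m A = 0%E ->
  0 < e -> 0 < t -> 8 * t ^+ 2 < b * e ->
  exists y, [/\ D y, ~ A y &
    forall l, \sum_(x <- s) (Lpot t (pt y + x) - Lpot (t * 2 ^- l) (pt y + x)) <= (size s)%:R * e].
Proof.
move=> s0 mD lD mA A0 e0 t0 te; apply: contrapT => none.
have SR : 0 < (size s)%:R :> R by rewrite ltr0n.
pose h k y : \bar R := (\sum_(x <- s) hb x (t * 2 ^- k) y)%E.
have tk k : 0 < t * 2 ^- k by rewrite mulr_gt0 // inv2X_gt0.
have mh k : measurable_fun setT (h k) by apply: emeasurable_sum => x; exact: measurable_hb.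
have h0 k y : (0 <= h k y)%E by apply: sume_ge0 => x _; exact: hb_ge0.
pose E y : \bar R := (\sum_(k <oo) h k y)%E.
have mE : measurable_fun setT E by apply: ge0_emeasurable_sum => // k y _ _; exact: h0.
have E0 y : (0 <= E y)%E by apply: nneseries_ge0 => k _ _; exact: h0.
have IE : (\int[m]_y E y <= ((size s)%:R * (8 * t ^+ 2))%:E)%E.
  rewrite integral_nneseries //.
  apply: lime_le; first by apply: is_cvg_nneseries => k _ _; apply: integral_ge0 => y _; exact: h0.
  near=> l; apply: (@le_trans _ _ (\sum_(0 <= k < l) ((size s)%:R * (4 * t ^+ 2 * 4 ^- k))%:E)%E).
    apply: lee_sum => k _; rewrite ge0_integral_sum //; last first.
    - by move=> x y _; exact: hb_ge0.
    - by move=> x; exact: measurable_hb.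
    apply: (@le_trans _ _ (\sum_(x <- s) (4 * (t * 2 ^- k) ^+ 2)%:E)%E).
      by apply: lee_sum => x _; exact: hb_integral.
    rewrite sumEFin lee_fin (big_const_seq 0 +%R) count_predT.
    have -> : forall u : R, iter (size s) (+%R u) 0 = (size s)%:R * u.
      by move=> u; elim: (size s) => [|j IH]; rewrite ?mul0r // iterS IH -natr1; ring.
    rewrite ler_pM2l // exprMn exprVn -exprM mulnC exprM.
    by rewrite (_ : 2 ^+ 2 = 4) ?mulrA // expr2; lra.
  rewrite sumEFin lee_fin -mulr_sumr ler_pM2l // -mulr_sumr.
  have : \sum_(0 <= k < l) 4 ^- k <= 2 :> R.
    suff : \sum_(0 <= k < l) 4 ^- k <= 2 - 2 * 4 ^- l :> R.
      by have : 0 < 4 ^- l :> R; [rewrite invr_gt0 exprn_gt0|lra].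
    elim: (l) => [|j IH]; first by rewrite big_nil expr0 invr1; lra.
    rewrite big_nat_recr //= exprS invfM; have : 0 < 4 ^- j :> R by rewrite invr_gt0 exprn_gt0.
    by move: IH; move: (4 ^- j) => b'; lra.
  by have := exprn_gt0 2 t0; move: (t ^+ 2) (\sum_(_ <= _ < _) _) => a1 b1; nra.
(* If no shift were suitable, the total error [E] would be at least e times the number of nodes
   almost everywhere on [D], against the bound 8 t^2 per node on its integral. *)
have : (\int[m]_(y in D) ((size s)%:R * e)%:E <= \int[m]_(y in D) E y)%E.
  apply: ae_ge0_le_integral => //.
  - by move=> y _; rewrite lee_fin mulr_ge0 // ltW.
  - exact: measurable_funTS.
  exists A; split => // y ny; apply: contrapT => nA; apply: ny => yD.
  rewrite leNgt; apply/negP => hE; apply: none; exists y; split => //.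
  move=> l; rewrite -lee_fin; apply: le_trans (ltW hE).
  apply: (@le_trans _ _ (\sum_(0 <= k < l) h k y)%E); last first.
    by apply: nneseries_lim_ge => k _ _; exact: h0.
  elim: l => [|l IH].
    by rewrite big_nil lee_fin expr0 invr1 mulr1 big1 // => x _; rewrite subrr.
  rewrite big_nat_recr //=.
  have hl : t * 2 ^- l.+1 = t * 2 ^- l / 2 by rewrite exprS invfM [2^-1 * _]mulrC mulrA.
  have -> : \sum_(x <- s) (Lpot t (pt y + x) - Lpot (t * 2 ^- l.+1) (pt y + x)) =
    \sum_(x <- s) (Lpot t (pt y + x) - Lpot (t * 2 ^- l) (pt y + x)) +
    \sum_(x <- s) (Lpot (t * 2 ^- l) (pt y + x) - Lpot (t * 2 ^- l / 2) (pt y + x)).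
    by rewrite hl -big_split; apply: eq_bigr => x _; rewrite /= addrA subrK.
  rewrite EFinD; apply: leeD; first exact: IH.
  by rewrite /h -sumEFin; apply: lee_sum => x _; exact: Lpot_half (tk l).
rewrite integral_cst //; set Z := (X in (_ * X <= _)%E).
have -> : Z = b%:E by exact: lD.
rewrite -EFinM => hh.
have : (\int[m]_(y in D) E y <= \int[m]_y E y)%E.
  by apply: ge0_subset_integral => //.
move=> /(le_trans hh) /le_trans/(_ IE); rewrite lee_fin.
by rewrite -mulrA ler_pM2l // mulrC; lra.
Unshelve. all: by end_near. Qed.

End Tonelli.

End Potential.

(** * Null sets and shifts in the plane *)

Section Plane.
Variable R : realType.
Local Notation C := R[i].

Local Notation RT := (measurableTypeR R).
Local Notation leb := (@lebesgue_measure R).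
Let leb2 : {sigma_finite_measure set _ -> \bar R} := @plane_measure R.
Let dom d (T : measurableType d) (m : {sigma_finite_measure set T -> \bar R}) := T.
Local Notation plane := (dom leb2).

Lemma lebesgue_shift (a : R) (A : set RT) : measurable A ->
  leb ((fun x : RT => (x + a : RT)) @^-1` A) = leb A.
Proof.
have ms : @measurable_fun _ _ RT RT setT (fun x => ((x : R) + a : R)) by exact: measurable_funD.
move=> mA; apply/esym.
pose mfs : {mfun RT >-> RT} := @mfun_Sub _ _ RT RT _ (mem_set ms).
apply: (@lebesgue_measure_unique R (pushforward leb mfs)) => //= _ [[b c]] _ <-.
rewrite /pushforward /=; have -> : (fun x : RT => ((x : R) + a : R)) @^-1` `]b, c] = `]b - a, c - a]%classic.
  by apply/seteqP; split => y /=; rewrite !in_itv /= ltrBlDr lerBrDr.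
rewrite !lebesgue_measure_itv /= !lte_fin ltrD2r; case: ifP => // _.
by rewrite -!EFinB; congr EFin; lra.
Qed.

Lemma ae_complexP (Q : C -> Prop) : ae_complex Q <->
  exists A : set plane, [/\ measurable A, leb2 A = 0 & forall p, ~ Q (p.1 +i* p.2) -> A p].
Proof. by split=> -[A [mA A0 AQ]]; exists A; split. Qed.

Lemma ae_complex_and (Q1 Q2 Q : C -> Prop) : (forall z, Q1 z -> Q2 z -> Q z) ->
  ae_complex Q1 -> ae_complex Q2 -> ae_complex Q.
Proof.
move=> h /ae_complexP[A [mA A0 AQ]] /ae_complexP[B [mB B0 BQ]]; apply/ae_complexP.
exists (A `|` B); split; first exact: measurableU.
  apply/eqP; rewrite eq_le measure_ge0 andbT.
  by apply: (@le_trans _ _ (leb2 A + leb2 B)%E); [exact: measureU2|rewrite A0 B0 add0e].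
move=> p np; have [q1|q1] := pselect (Q1 (p.1 +i* p.2)); last by left; exact: AQ.
have [q2|q2] := pselect (Q2 (p.1 +i* p.2)); last by right; exact: BQ.
by exfalso; apply: np; exact: h.
Qed.

Lemma ae_complexT (Q : C -> Prop) : (forall z, Q z) -> ae_complex Q.
Proof. by move=> h; apply/ae_complexP; exists set0; split => // p; case. Qed.

Lemma ae_complex_mono (Q1 Q : C -> Prop) : (forall z, Q1 z -> Q z) ->
  ae_complex Q1 -> ae_complex Q.
Proof. by move=> h aq; apply: (ae_complex_and _ aq aq) => z q _; exact: h. Qed.

Lemma ae_complex_shift (Q : C -> Prop) (a : C) : ae_complex Q -> ae_complex (fun z => Q (z + a)).
Proof.
move=> /ae_complexP[A [mA A0 AQ]]; apply/ae_complexP.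
pose s1 (x : RT) : RT := (x : R) + complex.Re a; pose s2 (x : RT) : RT := (x : R) + complex.Im a.
have m1 : @measurable_fun _ _ RT RT setT s1 by exact: measurable_funD.
have m2 : @measurable_fun _ _ RT RT setT s2 by exact: measurable_funD.
pose sh (p : plane) : plane := (s1 p.1, s2 p.2).
have msh : @measurable_fun _ _ plane plane setT sh.
  apply/measurable_fun_pairP; split.
    by apply: (measurableT_comp m1); exact: measurable_fst.
  by apply: (measurableT_comp m2); exact: measurable_snd.
have mB : measurable (sh @^-1` A) by rewrite -[X in measurable X]setTI; exact: msh.
pose mfs : {mfun plane >-> plane} := @mfun_Sub _ _ plane plane _ (mem_set msh).
have eqm : (leb \x leb)%E A = pushforward leb2 mfs A.
  apply: (product_measure_unique (m1 := leb) (m2 := leb) (m' := pushforward leb2 mfs)) => // A1 A2 mA1 mA2.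
  have mm (k : RT -> RT) (B : set RT) : @measurable_fun _ _ RT RT setT k -> measurable B -> measurable (k @^-1` B).
    by move=> mk mB'; rewrite -[X in measurable X]setTI; exact: mk.
  transitivity (leb (s1 @^-1` A1) * leb (s2 @^-1` A2))%E.
    exact: (product_measure1E leb leb (mm _ _ m1 mA1) (mm _ _ m2 mA2)).
  by congr (_ * _)%E; exact: lebesgue_shift.
exists (sh @^-1` A); split.
- exact: mB.
- by rewrite -A0; exact/esym/eqm.
- move=> p np; apply: AQ => h; apply: np.
  have <- : (p.1 + complex.Re a) +i* (p.2 + complex.Im a) = (p.1 +i* p.2) + a by case: (a).
  exact: h.
Qed.

Lemma ae_complex_all (s : seq C) (Q : C -> Prop) : ae_complex Q ->
  ae_complex (fun z => forall x, x \in s -> Q (z + x)).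
Proof.
move=> aq; elim: s => [|x s IH]; first by apply: ae_complexT => z y; rewrite in_nil.
apply: (ae_complex_and _ (ae_complex_shift x aq) IH) => z h1 h2 y.
by rewrite inE => /orP[/eqP ->|/h2].
Qed.

(** [select_shift] in the square of side del with corner y0. The exceptional set contains the
    translates of a null set by all nodes; they are finitely many, so it is still null. *)
Lemma ae_complex_select (mu : probability C R) (s : seq C) (Q : C -> Prop) (y0 : C) (del e t : R) :
  (\int[mu]_z (normc z ^+ 2)%:E < +oo)%E ->
  (0 < size s)%N -> ae_complex Q -> 0 < del -> 0 < e -> 0 < t -> 8 * t ^+ 2 < del ^+ 2 * e ->
  exists y, [/\ normc (y - y0) <= 2 * del, forall x, x \in s -> Q (y + x) &
    forall l, \sum_(x <- s) (Lpot mu t (y + x) - Lpot mu (t * 2 ^- l) (y + x)) <= (size s)%:R * e].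
Proof.
move=> mom s0 aQ d0 e0 t0 te.
pose a1 := complex.Re y0; pose a2 := complex.Im y0.
pose D1 : set RT := `[a1, a1 + del]%classic; pose D2 : set RT := `[a2, a2 + del]%classic.
pose D : set plane := D1 `*` D2.
have mD : measurable D by apply: measurableX; exact: measurable_itv.
have lD : leb2 D = (del ^+ 2)%:E.
  transitivity (leb D1 * leb D2)%E.
    by apply: (product_measure1E leb leb); exact: measurable_itv.
  rewrite /D1 /D2 !lebesgue_measure_itv /= !lte_fin !ltrDl d0.
  by rewrite -!EFinB -EFinM; congr EFin; ring.
have [A [mA A0 AQ]] := (ae_complexP _).1 (ae_complex_all s aQ).
have mX1 : @measurable_fun _ _ plane R setT fst by exact: measurable_fst.
have mX2 : @measurable_fun _ _ plane R setT snd by exact: measurable_snd.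
have boxm (a b r : R) : 0 < r ->
    (leb2 [set y : plane | (`|a - y.1| <= r)%R /\ (`|b - y.2| <= r)%R] <= (4 * r ^+ 2)%:E)%E.
  move=> r0; pose I1 : set RT := `[a - r, a + r]%classic; pose I2 : set RT := `[b - r, b + r]%classic.
  have -> : [set y : plane | `|a - y.1| <= r /\ `|b - y.2| <= r] = I1 `*` I2.
    apply/seteqP; split => -[u v] /=; rewrite /I1 /I2 /= !in_itv /= !ler_norml.
      by move=> [/andP[h1 h2] /andP[h3 h4]]; split; apply/andP; split; lra.
    by move=> [/andP[h1 h2] /andP[h3 h4]]; split; apply/andP; split; lra.
  have -> : leb2 (I1 `*` I2) = (leb I1 * leb I2)%E.
    by apply: (product_measure1E leb leb); exact: measurable_itv.
  rewrite /I1 /I2 !lebesgue_measure_itv /= !lte_fin.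
  have -> : a - r < a + r by lra.
  have -> : b - r < b + r by lra.
  by rewrite -!EFinB -EFinM lee_fin; lra.
have [y [yD nA h]] := select_shift mom mX1 mX2 boxm s0 mD lD mA A0 e0 t0 te.
exists (y.1 +i* y.2); split => //; last by apply: contrapT => nq; apply: nA; exact: AQ.
have n1 (v : C) : normc v <= `|complex.Re v| + `|complex.Im v|.
  case: v => p q /=; rewrite -[leRHS]ger0_norm ?addr_ge0 // -sqrtr_sqr ler_wsqrtr //.
  rewrite sqrrD !real_normK ?num_real //; have := normr_ge0 p; have := normr_ge0 q; nra.
apply: le_trans (n1 _) _; move: yD; rewrite /D /D1 /D2 /= !in_itv /= /a1 /a2.
move=> [/andP[u1 u2] /andP[u3 u4]]; case: (y0) u1 u2 u3 u4 => p q /= *.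
rewrite !ger0_norm; lra.
Qed.

End Plane.

(** * Measurability of the spectral functionals *)

Section Measurability.
Local Open Scope sesquilinear_scope.
Context (R : realType) (d : measure_display) (T : measurableType d).
Local Notation C := R[i].

(** Read through the two real coordinates, so that ring operations and determinants reduce to real
    measurable functions. *)
Definition cmeas (f : T -> C) : Prop :=
  measurable_fun setT (fun w => complex.Re (f w)) /\ measurable_fun setT (fun w => complex.Im (f w)).

Lemma cmeas_cst c : cmeas (fun=> c). Proof. by split; exact: measurable_cst. Qed.

Lemma cmeasD f g : cmeas f -> cmeas g -> cmeas (fun w => f w + g w).
Proof.
move=> [f1 f2] [g1 g2]; split.
  rewrite (_ : (fun w => _) = fun w => complex.Re (f w) + complex.Re (g w)); first exact: measurable_funD.
  by apply/funext => w; case: (f w) (g w) => a b [].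
rewrite (_ : (fun w => _) = fun w => complex.Im (f w) + complex.Im (g w)); first exact: measurable_funD.
by apply/funext => w; case: (f w) (g w) => a b [].
Qed.

Lemma cmeasM f g : cmeas f -> cmeas g -> cmeas (fun w => f w * g w).
Proof.
move=> [f1 f2] [g1 g2]; split.
  rewrite (_ : (fun w => _) = fun w => complex.Re (f w) * complex.Re (g w) - complex.Im (f w) * complex.Im (g w)).
    by apply: measurable_funB; exact: measurable_funM.
  by apply/funext => w; case: (f w) (g w) => a b [].
rewrite (_ : (fun w => _) = fun w => complex.Re (f w) * complex.Im (g w) + complex.Im (f w) * complex.Re (g w)).
  by apply: measurable_funD; exact: measurable_funM.
by apply/funext => w; case: (f w) (g w) => a b [].
Qed.

Lemma cmeas_conj f : cmeas f -> cmeas (fun w => Num.conj (f w)).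
Proof.
move=> [f1 f2]; split.
  rewrite (_ : (fun w => _) = fun w => complex.Re (f w)) //.
  by apply/funext => w; case: (f w).
rewrite (_ : (fun w => _) = fun w => - complex.Im (f w)); first exact: measurable_funN.
by apply/funext => w; case: (f w).
Qed.

Lemma cmeas_sum (I : Type) (s : seq I) (F : I -> T -> C) :
  (forall i, cmeas (F i)) -> cmeas (fun w => \sum_(i <- s) F i w).
Proof.
move=> hF; elim: s => [|i s IH].
  by rewrite (_ : (fun w => _) = fun=> 0); [exact: cmeas_cst|apply/funext => w; rewrite big_nil].
rewrite (_ : (fun w => _) = fun w => F i w + \sum_(j <- s) F j w); first exact: cmeasD.
by apply/funext => w; rewrite big_cons.
Qed.

Lemma cmeas_prod (I : Type) (s : seq I) (F : I -> T -> C) :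
  (forall i, cmeas (F i)) -> cmeas (fun w => \prod_(i <- s) F i w).
Proof.
move=> hF; elim: s => [|i s IH].
  by rewrite (_ : (fun w => _) = fun=> 1); [exact: cmeas_cst|apply/funext => w; rewrite big_nil].
rewrite (_ : (fun w => _) = fun w => F i w * \prod_(j <- s) F j w); first exact: cmeasM.
by apply/funext => w; rewrite big_cons.
Qed.

Definition mmeas n (A : T -> 'M[C]_n) : Prop := forall i j, cmeas (fun w => A w i j).

Lemma cmeas_det n (A : T -> 'M[C]_n) : mmeas A -> cmeas (fun w => \det (A w)).
Proof.
move=> mA; rewrite /determinant; apply: cmeas_sum => s.
apply: cmeasM; first exact: cmeas_cst.
by apply: cmeas_prod => i; exact: mA.
Qed.

Lemma measurable_normc_cmeas f : cmeas f -> measurable_fun setT (fun w => normc (f w)).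
Proof.
move=> [f1 f2].
rewrite (_ : (fun w => _) = fun w => Num.sqrt (complex.Re (f w) ^+ 2 + complex.Im (f w) ^+ 2)).
  apply: (measurableT_comp (f := @Num.sqrt R)).
    by apply: continuous_measurable_fun; exact: sqrt_continuous.
  by apply: measurable_funD; exact: measurable_funX.
by apply/funext => w; case: (f w).
Qed.

Lemma mmeasB n (A B : T -> 'M[C]_n) : mmeas A -> mmeas B -> mmeas (fun w => A w - B w).
Proof.
move=> mA mB i j; rewrite (_ : (fun w => _) = fun w => A w i j + (-1) * B w i j).
  by apply: cmeasD => //; apply: cmeasM => //; exact: cmeas_cst.
by apply/funext => w; rewrite !mxE mulN1r.
Qed.

Lemma mmeas_cst n (A : 'M[C]_n) : mmeas (fun=> A).
Proof. by move=> i j; exact: cmeas_cst. Qed.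

Lemma measurable_absdet n (A : T -> 'M[C]_n) z : mmeas A ->
  measurable_fun setT (fun w => normc (\det (A w - z%:M))).
Proof.
by move=> mA; apply/measurable_normc_cmeas/cmeas_det/mmeasB => //; exact: mmeas_cst.
Qed.

Lemma measurable_regdet n (A : T -> 'M[C]_n) e : mmeas A ->
  measurable_fun setT (fun w => complex.Re (\det (gram (A w) + (e%:C)%:M))).
Proof.
move=> mA; apply: (@cmeas_det n (fun w => gram (A w) + (e%:C)%:M) _).1 => i j.
rewrite (_ : (fun w => _) = fun w => \sum_k A w i k * Num.conj (A w j k) + (e%:C)%:M i j).
  apply: cmeasD; last exact: cmeas_cst.
  by apply: cmeas_sum => k; apply: cmeasM => //; exact: cmeas_conj.
by apply/funext => w; rewrite !mxE; congr (_ + _); apply: eq_bigr => k _; rewrite !mxE.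
Qed.

(* [mahler] for the powers [(l - z) ^ N], whose values at [x] are products of [\det (A - (z + y))] over
   [y ^ N = x], brackets the N-th power of the product of the maxima up to a factor [2 ^ n]. *)
Lemma measurable_avg n (A : T -> 'M[C]_n) (r : R) z : (0 < n)%N -> 0 < r -> mmeas A ->
  measurable_fun setT (fun w => eig_avg (A w) (fun l => lnm r (l - z))).
Proof.
move=> n0 r0 mA; have nR : 0 < n%:R :> R by rewrite ltr0n.
pose N p := (2 ^ p)%N.
have NR p : 0 < (N p)%:R :> R by rewrite ltr0n expn_gt0.
pose H p w : R := ((2 ^ n)%:R)^-1 * \sum_(x <- nodes n ((r ^+ N p) ^+ (2 ^ n))%:C)
    \prod_(y <- nodes p x) normc (\det (A w - (z + y)%:M)).
have mH p : measurable_fun setT (H p).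
  apply: measurable_funM => //; apply: measurable_sum => x.
  by apply: measurable_prod => y _; exact: measurable_absdet.
pose Pi w := \prod_(l <- eigenvalues (A w)) Num.max (normc (l - z)) r.
have Pi0 w : 0 < Pi w by have [] := ln_prod_max (eigenvalues (A w)) z r0.
have PiE w : eig_avg (A w) (fun l => lnm r (l - z)) = n%:R^-1 * ln (Pi w).
  by rewrite /eig_avg; have [_ ->] := ln_prod_max (eigenvalues (A w)) z r0.
have rp p : 0 < r ^+ N p by rewrite exprn_gt0.
have inner p w x : \prod_(y <- nodes p x) normc (\det (A w - (z + y)%:M)) =
    \prod_(l <- eigenvalues (A w)) normc ((l - z) ^+ N p - x).
  under eq_bigr do rewrite det_eigen.
  rewrite exchange_big /=; apply: eq_bigr => l _; rewrite -nodes_prod normc_prod.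
  by apply: eq_bigr => y _; rewrite opprD addrA.
have maxX p (a : R) : 0 <= a -> Num.max a r ^+ N p = Num.max (a ^+ N p) (r ^+ N p).
  move=> a0; case: (leP a r) => h.
    by rewrite max_r // lerXn2r ?nnegrE // ltW.
  by rewrite max_l // lerXn2r ?nnegrE // ltW.
have Hlow p w : Pi w ^+ N p <= H p w.
  have sz : (size [seq (l - z) ^+ N p | l <- eigenvalues (A w)] < 2 ^ n)%N.
    by rewrite size_map size_eigenvalues ltn_expl.
  have := mahler 0 (rp p) sz; rewrite /H -ler_pdivlMl ?ltr0n ?expn_gt0 //.
  rewrite big_map; under eq_bigr do rewrite subr0 normcX -maxX ?normc_ge0 //.
  rewrite prodrXl => /le_trans; apply; rewrite ler_pM2l ?invr_gt0 ?ltr0n ?expn_gt0 //.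
  by apply: ler_sum => x _; rewrite inner big_map; under [leLHS]eq_bigr do rewrite add0r.
have Hup p w : H p w <= 2 ^+ n * Pi w ^+ N p.
  rewrite /H ler_pdivrMl ?ltr0n ?expn_gt0 //.
  apply: (@le_trans _ _ (\sum_(x <- nodes n ((r ^+ N p) ^+ (2 ^ n))%:C) 2 ^+ n * Pi w ^+ N p)).
    rewrite big_seq [leRHS]big_seq; apply: ler_sum => x xs; rewrite inner.
    have xr := nodes_normr (rp p) xs.
    have -> : 2 ^+ n = \prod_(l <- eigenvalues (A w)) (2 : R).
      by rewrite (big_const_seq 1 *%R) count_predT size_eigenvalues; elim: (n) => [|m IH]; rewrite ?expr0 // exprS IH.
    rewrite -prodrXl -big_split /=; apply: ler_prod => l _; rewrite normc_ge0 /=.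
    apply: le_trans (le_normcD _ _) _; rewrite normcN xr normcX maxX ?normc_ge0 //.
    by rewrite mulr2n mulrDl mul1r lerD // le_max lexx ?orbT.
  rewrite (big_const_seq 0 +%R) count_predT size_nodes.
  have -> : forall u : R, iter (2 ^ n) (+%R u) 0 = (2 ^ n)%:R * u => //.
  by move=> u; elim: (2 ^ n)%N => [|j IH]; rewrite ?mul0r // iterS IH -natr1; ring.
apply: (measurable_fun_cvg (h := fun p w => n%:R^-1 * ((N p)%:R^-1 * ln (H p w)))).
  by move=> p; do 2 apply: measurable_funM => //; apply: measurableT_comp => //; exact: measurable_ln.
move=> w _; rewrite PiE; apply: cvgMr.
have H0 p : 0 < H p w by apply: lt_le_trans (Hlow p w); rewrite exprn_gt0.
have lo p : ln (Pi w) <= (N p)%:R^-1 * ln (H p w).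
  rewrite ler_pdivlMl // mulr_natl -lnXn // ler_ln ?posrE ?exprn_gt0 //.
have up p : (N p)%:R^-1 * ln (H p w) <= ln (Pi w) + n%:R * ln 2 / (N p)%:R.
  rewrite ler_pdivrMl // mulrDr mulrCA mulfV ?gt_eqF // mulr1 !mulr_natl -!lnXn //.
  apply: (@le_trans _ _ (ln (2 ^+ n * Pi w ^+ N p))).
    by rewrite ler_ln ?posrE ?H0 // mulr_gt0 // exprn_gt0.
  by rewrite lnM ?posrE ?exprn_gt0 // addrC.
apply/cvgrPdist_le => /= e e0; near=> p.
rewrite ler_norml; apply/andP; split; last by have := lo p; lra.
have h : n%:R * ln 2 / e <= p%:R by near: p; exact: nbhs_infty_ger.
have h2 : n%:R * ln 2 / (N p)%:R <= e.
  rewrite ler_pdivrMr //; rewrite ler_pdivrMr // in h; apply: le_trans h _.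
  by rewrite mulrC ler_pM2l // ler_nat ltnW // ltn_expl.
by have := up p; lra.
Unshelve. all: by end_near. Qed.

End Measurability.

(** * Uniform approximation of test functions by logarithmic bumps *)

Section Approximation.
Variable R : realType.
Local Notation C := R[i].

Definition center (k : nat) (a b : int) : C := (2 ^- k * a%:~R) +i* (2 ^- k * b%:~R).

Definition bump (k : nat) (a b : int) (w : C) : R :=
  lnm (2 * 2 ^- k) (w - center k a b) - lnm (2 ^- k) (w - center k a b).

Lemma bump_ge0 k a b w : 0 <= bump k a b w.
Proof.
have p0 := inv2X_gt0 R k; rewrite subr_ge0 lnm_mono //; lra.
Qed.

Lemma bump_le k a b w : bump k a b w <= ln 2.
Proof.
have p0 := inv2X_gt0 R k; rewrite /bump /lnm; set v := normc _.
have v0 : 0 <= v by exact: normc_ge0.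
have m0 : 0 < Num.max v (2 ^- k) by rewrite lt_max p0 orbT.
rewrite lerBlDr -lnM ?posrE // ler_ln ?posrE ?mulr_gt0 //; last by rewrite lt_max mulr_gt0 ?orbT.
rewrite ge_max; apply/andP; split.
  have : v <= Num.max v (2 ^- k) by rewrite le_max lexx.
  by lra.
by rewrite ler_pM2l // le_max lexx orbT.
Qed.

Lemma bump_near k a b w : normc (w - center k a b) <= 2 ^- k -> bump k a b w = ln 2.
Proof.
move=> h; have p0 := inv2X_gt0 R k; rewrite /bump /lnm (max_r h) max_r; last by lra.
by rewrite lnM ?posrE // addrK.
Qed.

Lemma bump_far k a b w : 2 * 2 ^- k <= normc (w - center k a b) -> bump k a b w = 0.
Proof.
move=> h; have p0 := inv2X_gt0 R k; rewrite /bump /lnm !max_l ?subrr //; lra.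
Qed.

Lemma test_local (f : C -> R) : continuous f ->
  forall z (e : R), 0 < e -> exists2 r : R, 0 < r & forall w, normc (z - w) < r -> `|f z - f w| < e.
Proof.
move=> cf z e e0; have := cf z => /cvgrPdist_lt/(_ e e0)/nbhs_ballP[r /= r0 rP].
have rr : 0 < complex.Re r by move: r0; rewrite ltcE /= => /andP[].
exists (complex.Re r) => // w zw; apply: rP; rewrite /ball /=.
have -> : r = (complex.Re r)%:C by move: r0; rewrite ltcE /=; case: (r) => u v /= /andP[/eqP -> _].
by rewrite ltcR.
Qed.

Lemma nbhs_normc (z : C) (r : R) : 0 < r -> nbhs z [set w : C | normc (z - w) < r].
Proof.
move=> r0; apply/nbhs_ballP; exists r%:C => /=; first by rewrite ltcR.
by move=> w; rewrite /ball /= => zw; rewrite -ltcR.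
Qed.

Lemma local_continuous (f : C -> R) :
  (forall z (e : R), 0 < e -> exists2 r : R, 0 < r & forall w, normc (z - w) < r -> `|f z - f w| < e) ->
  continuous f.
Proof.
move=> h z A /nbhs_ballP[e /= e0 eA]; have [r r0 rP] := h z e e0.
have : nbhs (z : C) (f @^-1` A).
  apply/nbhs_ballP; exists r%:C => /=; first by rewrite ltcR.
  by move=> w; rewrite /ball /= => zw; apply: eA; apply: rP; rewrite -ltcR.
by [].
Qed.

Lemma test_bounded (f : C -> R) : test_function f ->
  exists2 K : nat, (forall z, `|f z| <= K%:R) & forall z, f z != 0 -> normc z <= K%:R.
Proof.
move=> [cf /compact_near_coveringP kf].
have [] := kf nat \oo (fun k z => `|f z| <= k%:R /\ normc z <= k%:R) _.
  move=> z _; have [r r0 rP] := test_local cf z (@ltr01 R).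
  near=> w k; have zw : normc (z - w) < Num.min r 1.
    by near: w; apply: nbhs_normc; rewrite lt_min r0 ltr01.
  have kz : `|f z| + normc z + 1 <= k%:R by near: k; exact: nbhs_infty_ger.
  move: zw; rewrite lt_min => /andP[/rP h1 h2]; split.
    have : `|f w| <= `|f z| + `|f z - f w|.
      by have := ler_normB (f z) (f z - f w); rewrite subKr.
    by have := normc_ge0 z; lra.
  have := le_normcD (w - z) z; rewrite subrK [normc (w - z)]normc_distC.
  by have := normr_ge0 (f z); lra.
move=> K _ hK; have {}hK z : f z != 0 -> `|f z| <= K%:R /\ normc z <= K%:R.
  by move=> fz; apply: (hK K) => //=; apply: subset_closure.
exists K => z; last by move=> /hK[].
by have [->|/hK[]//] := eqVneq (f z) 0; rewrite normr0.
Unshelve. all: by end_near. Qed.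

Lemma test_uniform (f : C -> R) (e : R) : test_function f -> 0 < e ->
  exists k : nat, forall z w, normc (z - w) <= 2 * 2 ^- k -> `|f z - f w| <= e.
Proof.
move=> [cf /compact_near_coveringP kf] e0; have e2 : 0 < e / 2 by rewrite divr_gt0.
have [] := kf nat \oo (fun k z => forall w, normc (z - w) <= 2 * 2 ^- k -> `|f z - f w| <= e) _.
  move=> z _; have [r r0 rP] := test_local cf z e2.
  near=> y k => w yw; have zy : normc (z - y) < r / 2.
    by near: y; apply: nbhs_normc; rewrite divr_gt0.
  have kr : 2 * 2 ^- k < r / 2.
    have : 4 / r < k%:R by near: k; exact: nbhs_infty_gtr.
    have h2 : k%:R < 2 ^+ k :> R by rewrite -natrX ltr_nat ltn_expl.
    move=> h1; have h3 := lt_trans h1 h2; move: h3; have p0 : 0 < 2 ^+ k :> R by rewrite exprn_gt0.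
    rewrite ltr_pdivrMr // ltr_pdivrMr //; rewrite mulrAC ltr_pdivlMr //.
    by move: (2 ^+ k) => q; lra.
  have zw : normc (z - w) < r by have := normc_triangle z y w; lra.
  have h1 := rP w zw; have h2 : `|f z - f y| < e / 2 by apply: rP; lra.
  have -> : f y - f w = (f z - f w) - (f z - f y) by ring.
  by have := ler_normB (f z - f w) (f z - f y); lra.
move=> k _ hk; exists k.+1 => z w zw.
have hh : 2 * 2 ^- k.+1 <= 2 * 2 ^- k :> R by rewrite ler_pM2l // inv2X_le.
have [fz|fz] := eqVneq (f z) 0; last first.
  by apply: (hk k _ z) => //=; [apply: subset_closure|exact: le_trans hh].
have [fw|fw] := eqVneq (f w) 0; first by rewrite fz fw subrr normr0 ltW.
rewrite distrC; apply: (hk k _ w) => //=; first exact: subset_closure.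
by rewrite normc_distC; exact: le_trans hh.
Unshelve. all: by end_near. Qed.

(** What the contraction uses of a test function, uniform continuity and bounded support, in a form
    that survives the subtraction of bumps. *)
Definition nice (f : C -> R) : Prop :=
  (forall e : R, 0 < e -> exists k : nat, forall z w, normc (z - w) <= 2 * 2 ^- k -> `|f z - f w| <= e) /\
  exists K : nat, forall z, f z != 0 -> normc z <= K%:R.

Lemma test_nice (f : C -> R) : test_function f -> nice f.
Proof.
move=> tf; split => [e e0|]; first exact: test_uniform.
by have [K _ hK] := test_bounded tf; exists K.
Qed.

(** Origin of the overlap 25 = 5 * 5 in the grid of bumps. *)
Lemma count_close (x : R) (s : seq nat) : uniq s ->
  (size [seq a <- s | (`|x - a%:R| <= 2)%R] <= 5)%N.
Proof.
move=> us; pose t := [seq a <- s | (`|x - a%:R| <= 2)%R]; rewrite -/t; have ut : uniq t by exact: filter_uniq.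
have [->//|[a0 at0]] : t = [::] \/ exists a, a \in t.
  by case: (t) => [|a t']; [left|right; exists a; rewrite mem_head].
have [m mt mmin] : exists2 m, m \in t & forall a, a \in t -> (m <= a)%N.
  have ex : exists a, a \in t by exists a0.
  by exists (ex_minn ex); case: ex_minnP => // m _ h a; exact: h.
have := mt; rewrite mem_filter => /andP[hm _].
apply: leq_trans (uniq_leq_size ut _) (_ : size (iota m 5) <= 5)%N => // a ta.
rewrite mem_iota mmin //=; have := ta; rewrite mem_filter => /andP[ha _].
have : a%:R <= m%:R + 4 :> R by move: hm ha; rewrite !ler_norml => /andP[? ?] /andP[? ?]; lra.
by rewrite -natrD ler_nat => h; rewrite addnS ltnS.
Qed.

Lemma grid_point (k m : nat) (u : R) : `|u| <= m%:R ->
  exists2 a : nat, (a < (2 * m * 2 ^ k).+1)%N & `|u - 2 ^- k * (a%:Z - (m * 2 ^ k)%:Z)%:~R| <= 2 ^- k / 2.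
Proof.
move=> um; have p0 : 0 < 2 ^+ k :> R by rewrite exprn_gt0.
pose v := (u + m%:R) * 2 ^+ k + 2^-1; have v0 : 0 <= v.
  by rewrite addr_ge0 // mulr_ge0 ?(ltW p0) //; move: um; rewrite ler_norml => /andP[]; lra.
have /andP[t1 t2] := truncn_itv v0; set a := Num.trunc v in t1 t2.
have vm : v <= (2 * m * 2 ^ k)%:R + 2^-1.
  rewrite lerD2r !natrM natrX ler_pM2r //; move: um; rewrite ler_norml => /andP[]; lra.
exists a.
  by rewrite ltnS -(ler_nat R) leNgt; apply/negP; rewrite ltr_nat -(ler_nat R) -natr1 => h; lra.
have -> : (a%:Z - (m * 2 ^ k)%:Z)%:~R = a%:R - m%:R * 2 ^+ k :> R.
  by rewrite rmorphB /= -!pmulrn natrM natrX.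
have -> : u - 2 ^- k * (a%:R - m%:R * 2 ^+ k) = 2 ^- k * (v - 2^-1 - a%:R).
  by rewrite /v; field; rewrite gt_eqF.
rewrite normrM ger0_norm ?invr_ge0 ?(ltW p0) // ler_pM2l ?invr_gt0 // ler_norml.
by rewrite -natr1 in t2; apply/andP; split; lra.
Qed.

Definition bump_sum (s : seq (R * (nat * int * int))) (w : C) : R :=
  \sum_(p <- s) p.1 * bump p.2.1.1 p.2.1.2 p.2.2 w.

(* One step of a contraction: a grid of bumps, normalised by the maximal overlap [25 * ln 2], sums to a
   weight in [1/25, 1] on the support of [f]. *)
Lemma approx_step (f : C -> R) (b e : R) : nice f -> (forall z, `|f z| <= b) -> 0 < e ->
  exists s, forall z, `|f z - bump_sum s z| <= (1 - 25^-1) * b + e.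
Proof.
move=> [uf [K Kf]] fb e0; have [k kf] := uf e e0.
have l2 : 0 < ln 2 :> R by rewrite ln_gt0 // ltr1n.
pose sh (a : nat) : int := a%:Z - (K * 2 ^ k)%:Z.
pose L := iota 0 (2 * K * 2 ^ k).+1.
pose c : R := (25 * ln 2)^-1; have c0 : 0 < c by rewrite invr_gt0 mulr_gt0.
pose s := [seq (c * f (center k (sh ab.1) (sh ab.2)), (k, sh ab.1, sh ab.2)) | ab <- [seq (a, a') | a <- L, a' <- L]].
exists s => z; have p0 := inv2X_gt0 R k.
have bsE (F : R * (nat * int * int) -> R) : \sum_(p <- s) F p = \sum_(a <- L) \sum_(a' <- L) F (c * f (center k (sh a) (sh a')), (k, sh a, sh a')).
  by rewrite /s big_map big_allpairs_dep.
pose S := \sum_(a <- L) \sum_(a' <- L) bump k (sh a) (sh a') z.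
have S0 : 0 <= S by apply: sumr_ge0 => a _; apply: sumr_ge0 => a' _; exact: bump_ge0.
have shE a : (sh a)%:~R = a%:R - (K * 2 ^ k)%:R :> R by rewrite rmorphB /= -!pmulrn.
have Sup : S <= 25 * ln 2.
  pose good (u : R) := [seq a <- L | `|u * 2 ^+ k + (K * 2 ^ k)%:R - a%:R| <= 2].
  have sg u : (size (good u) <= 5)%N by exact: count_close (iota_uniq _ _).
  have out (u : R) (a : nat) : a \notin good u -> a \in L -> 2 * 2 ^- k <= `|u - 2 ^- k * (sh a)%:~R|.
    rewrite mem_filter => + aL; rewrite aL andbT -ltNge => h.
    have pk : 0 < 2 ^+ k :> R by rewrite exprn_gt0.
    have -> : u - 2 ^- k * (sh a)%:~R = 2 ^- k * (u * 2 ^+ k + (K * 2 ^ k)%:R - a%:R).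
      by rewrite shE; field; rewrite gt_eqF.
    by rewrite normrM (ger0_norm (ltW p0)) mulrC ler_pM2l // ltW.
  have zero a a' : a \in L -> a' \in L -> (a \notin good (complex.Re z)) || (a' \notin good (complex.Im z)) ->
      bump k (sh a) (sh a') z = 0.
    move=> aL aL' /orP[/out/(_ aL)|/out/(_ aL')] h; apply: bump_far; apply: le_trans h _.
      by apply: le_trans (Re_le_normc _); case: (z).
    by apply: le_trans (Im_le_normc _); case: (z).
  have -> : S = \sum_(a <- good (complex.Re z)) \sum_(a' <- good (complex.Im z)) bump k (sh a) (sh a') z.
    rewrite /S big_filter [RHS]big_mkcond /= big_seq [RHS]big_seq; apply: eq_bigr => a aL.
    rewrite big_filter; case: ifP => ha.
      rewrite [RHS]big_mkcond /= big_seq [RHS]big_seq; apply: eq_bigr => a' aL'.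
      by case: ifP => ha' //; apply: zero => //; rewrite /good !mem_filter ha ha' aL aL'.
    by rewrite big_seq big1 // => a' aL'; apply: zero => //; rewrite /good mem_filter ha.
  have cst (t : seq nat) (F : nat -> R) (v : R) : (size t <= 5)%N -> 0 <= v -> (forall a, F a <= v) ->
      \sum_(a <- t) F a <= 5 * v.
    move=> t5 v0 Fv; apply: (@le_trans _ _ (\sum_(a <- t) v)); first exact: ler_sum.
    rewrite (big_const_seq 0 +%R) count_predT.
    have -> : iter (size t) (+%R v) 0 = (size t)%:R * v.
      by elim: (size t) => [|j IH]; rewrite ?mul0r // iterS IH -natr1; ring.
    by rewrite ler_wpM2r // ler_nat.
  have -> : 25 * ln 2 = 5 * (5 * ln 2) :> R by ring.
  have h5 : 0 <= 5 * ln 2 :> R by rewrite mulr_ge0 // ltW.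
  apply: (cst _ _ _ (sg _) h5) => a; apply: (cst _ _ _ (sg _) (ltW l2)) => a'; exact: bump_le.
have Slow : f z != 0 -> ln 2 <= S.
  move=> /Kf zK.
  have [a aL ha] := @grid_point k K (complex.Re z) (le_trans (Re_le_normc z) zK).
  have [a' aL' ha'] := @grid_point k K (complex.Im z) (le_trans (Im_le_normc z) zK).
  have aI : a \in L by rewrite mem_iota.
  have aI' : a' \in L by rewrite mem_iota.
  rewrite -(@bump_near k (sh a) (sh a') z); last first.
    have n1 (v : C) : normc v <= `|complex.Re v| + `|complex.Im v|.
      case: v => p q /=; rewrite -[leRHS]ger0_norm ?addr_ge0 // -sqrtr_sqr ler_wsqrtr //.
      rewrite sqrrD !real_normK ?num_real //; have := normr_ge0 p; have := normr_ge0 q; nra.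
    apply: le_trans (n1 _) _; have -> : 2 ^- k = 2 ^- k / 2 + 2 ^- k / 2 :> R by lra.
    by apply: lerD; [apply: le_trans ha|apply: le_trans ha']; case: (z).
  rewrite /S (big_rem a) //= (big_rem a') //= -addrA lerDl addr_ge0 //.
    by apply: sumr_ge0 => *; exact: bump_ge0.
  by apply: sumr_ge0 => *; apply: sumr_ge0 => *; exact: bump_ge0.
have cS : c * S <= 1 by rewrite mulrC ler_pdivrMr ?mulr_gt0 // mul1r.
have cS0 : 0 <= c * S by rewrite mulr_ge0 // ltW.
have b0 : 0 <= b by exact: le_trans (normr_ge0 _) (fb z).
have d1 : `|f z * (c * S) - bump_sum s z| <= e.
  rewrite /bump_sum bsE /= /S !mulr_sumr -sumrB.
  apply: (@le_trans _ _ (e * (c * S))); last by rewrite -[leRHS]mulr1 ler_pM2l.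
  apply: le_trans (ler_norm_sum _ _ _) _; rewrite /S !mulr_sumr; apply: ler_sum => a _.
  rewrite !mulr_sumr -sumrB; apply: le_trans (ler_norm_sum _ _ _) _; apply: ler_sum => a' _.
  set q := bump _ _ _ _; have q0 : 0 <= q by exact: bump_ge0.
  have -> : f z * (c * q) - c * f (center k (sh a) (sh a')) * q = (f z - f (center k (sh a) (sh a'))) * (c * q) by ring.
  have cq : 0 <= c * q by rewrite mulr_ge0 // ltW.
  rewrite normrM (ger0_norm cq).
  have [h|h] := leP (normc (z - center k (sh a) (sh a'))) (2 * 2 ^- k).
    by apply: ler_wpM2r; [rewrite mulr_ge0 // ltW|exact: kf].
  by rewrite /q bump_far ?(ltW h) // !mulr0.
have d2 : `|f z - f z * (c * S)| <= (1 - 25^-1) * b.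
  have [->|fz] := eqVneq (f z) 0; first by rewrite mul0r subrr normr0 mulr_ge0 //; lra.
  have h25 : 25^-1 <= c * S.
    have -> : 25^-1 = c * ln 2 by rewrite /c; field; rewrite gt_eqF.
    by rewrite ler_pM2l // Slow.
  have -> : f z - f z * (c * S) = (1 - c * S) * f z by ring.
  rewrite normrM ger0_norm ?subr_ge0 //; apply: ler_pM; rewrite ?subr_ge0 //; lra.
have -> : f z - bump_sum s z = (f z - f z * (c * S)) + (f z * (c * S) - bump_sum s z) by ring.
by apply: le_trans (ler_normD _ _) _; apply: lerD.
Qed.

Lemma bump_sum_cat s t w : bump_sum (s ++ t) w = bump_sum s w + bump_sum t w.
Proof. by rewrite /bump_sum big_cat. Qed.

Lemma bump_lip k a b v w : `|bump k a b v - bump k a b w| <= 2 * 2 ^+ k * normc (v - w).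
Proof.
have p0 := inv2X_gt0 R k; have q0 : 0 < 2 * 2 ^- k :> R by rewrite mulr_gt0.
rewrite /bump; set x := center k a b.
have e1 : normc (v - x - (w - x)) = normc (v - w) by rewrite opprB addrA subrK.
have e2 : normc (w - x - (v - x)) = normc (v - w) by rewrite opprB addrA subrK normc_distC.
have h1 := lnm_lip (v - x) (w - x) p0; have h2 := lnm_lip (w - x) (v - x) p0.
have h3 := lnm_lip (v - x) (w - x) q0; have h4 := lnm_lip (w - x) (v - x) q0.
rewrite e1 invrK in h1; rewrite e2 invrK in h2.
have hq : (2 * 2 ^- k)^-1 <= 2 ^+ k :> R.
  by rewrite invfM invrK ler_piMl ?exprn_ge0 // invf_le1 // ler1n.
have hn := ler_wpM2l (normc_ge0 (v - w)) hq; rewrite e1 in h3; rewrite e2 in h4.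
rewrite [2 * _ * _]mulrC mulrA [normc _ * 2]mulrC -mulrA.
by rewrite ler_norml; apply/andP; split; lra.
Qed.

Lemma bump_support k a b w : bump k a b w != 0 -> normc w <= normc (center k a b) + 2 * 2 ^- k.
Proof.
have [h _|h] := leP (normc (w - center k a b)) (2 * 2 ^- k).
  by have := le_normcD (w - center k a b) (center k a b); rewrite subrK; lra.
by rewrite bump_far ?eqxx // ltW.
Qed.

Lemma nice_bump_sum (f : C -> R) s : nice f -> nice (fun z => f z - bump_sum s z).
Proof.
move=> [uf [K Kf]].
elim: s => [|[c [[k a] b]] s IH].
  have -> : (fun z => f z - bump_sum [::] z) = f by apply/funext => z; rewrite /bump_sum big_nil subr0.
  by split => //; exists K.
move: IH; set g := (fun z => f z - bump_sum s z).
have -> : (fun z => f z - bump_sum ((c, (k, a, b)) :: s) z) = (fun z => g z - c * bump k a b z).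
  by apply/funext => z; rewrite /bump_sum big_cons /g /bump_sum /=; ring.
clearbody g => -[ug [K' Kg]]; split => [e e0|].
  have [m mP] := ug (e / 2) (divr_gt0 e0 (ltr0n _ 2)).
  pose q := `|c| * (2 * 2 ^+ k); have q0 : 0 <= q by rewrite mulr_ge0 // mulr_ge0 // exprn_ge0.
  pose l := (Num.trunc (4 * (q + 1) / e)).+1.
  have le : 2 * 2 ^- l * q <= e / 2.
    have h1 : 4 * (q + 1) / e < l%:R by exact: truncnS_gt.
    have h2 : l%:R < 2 ^+ l :> R by rewrite -natrX ltr_nat ltn_expl.
    have p0 : 0 < 2 ^+ l :> R by rewrite exprn_gt0.
    have := lt_trans h1 h2; rewrite ltr_pdivrMr // => h3.
    rewrite mulrAC ler_pdivrMr //; move: h3; move: (2 ^+ l) => v; lra.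
  exists (maxn m l) => z w zw /=.
  have zm : normc (z - w) <= 2 * 2 ^- m by apply: le_trans zw _; rewrite ler_pM2l // inv2X_le // leq_maxl.
  have zl : normc (z - w) <= 2 * 2 ^- l by apply: le_trans zw _; rewrite ler_pM2l // inv2X_le // leq_maxr.
  have hz : `|(g z - g w) - c * (bump k a b z - bump k a b w)| <= e.
    apply: le_trans (ler_normB _ _) _; have := mP z w zm.
    have : `|c * (bump k a b z - bump k a b w)| <= e / 2; last by lra.
    rewrite normrM; apply: le_trans (ler_wpM2l (normr_ge0 c) (bump_lip k a b z w)) _.
    by rewrite mulrA -/q; apply: le_trans le; rewrite mulrC ler_wpM2r.
  apply: le_trans hz; rewrite le_eqVlt; apply/orP; left; apply/eqP; congr `|_| => /=; ring.
exists (K' + Num.trunc (normc (center k a b) + 2 * 2 ^- k)).+1%N => z /=.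
have [gz|gz] := eqVneq (g z) 0.
  rewrite gz sub0r oppr_eq0 mulf_eq0 negb_or => /andP[_ /bump_support h].
  apply: le_trans h _; apply: le_trans (ltW (truncnS_gt _)) _.
  by rewrite ler_nat ltnS leq_addl.
by move=> _; apply: le_trans (Kg z gz) _; rewrite ler_nat leqW // leq_addr.
Qed.

(** Iteration of [approx_step] with error e/50 in each round: the sup norm contracts by 24/25
    towards the fixed point 25 * e/50 = e/2. *)
Lemma approx_bump (f : C -> R) (e : R) : test_function f -> 0 < e ->
  exists s, forall z, `|f z - bump_sum s z| <= e.
Proof.
move=> tf e0; have [K fK _] := test_bounded tf; have nf := test_nice tf.
have step k : exists s, forall z, `|f z - bump_sum s z| <= (24 / 25) ^+ k * K%:R + e / 2.
  elim: k => [|k [s hs]].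
    exists [::] => z; rewrite /bump_sum big_nil subr0 mul1r; have := fK z; lra.
  have e50 : 0 < e / 50 by rewrite divr_gt0.
  have [t ht] := approx_step (nice_bump_sum s nf) hs e50.
  exists (s ++ t) => z; rewrite bump_sum_cat opprD addrA; apply: le_trans (ht z) _.
  rewrite exprS; move: ((24 / 25) ^+ k * K%:R) (24 / 25 * (24 / 25) ^+ k * K%:R) (mulrA (24 / 25 : R) ((24 / 25) ^+ k) K%:R) => u v <-; lra.
have [k hk] : exists k, (24 / 25) ^+ k * K%:R <= e / 2.
  pose k := (Num.trunc (50 * K%:R / e)).+1; exists k.
  have h1 : 50 * K%:R / e < k%:R by exact: truncnS_gt.
  have i0 : 0 <= 24^-1 :> R by lra.
  have h2 : k%:R * 24^-1 <= (25 / 24) ^+ k :> R.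
    have := binomial_le (Num.trunc (50 * K%:R / e)) (@ler01 R) i0.
    rewrite -/k !expr1n mulr1 => /(le_trans _) h; apply: (@le_trans _ _ (1 + k%:R * 24^-1)); first lra.
    by apply: le_trans (h _ (lexx _)) _; rewrite (_ : 1 + 24^-1 = 25 / 24) //; lra.
  have h3 : (24 / 25) ^+ k * (25 / 24) ^+ k = 1 :> R.
    by rewrite -exprMn (_ : 24 / 25 * (25 / 24) = 1) ?expr1n //; lra.
  have p0 : 0 < (24 / 25) ^+ k :> R by rewrite exprn_gt0.
  rewrite ltr_pdivrMr // in h1; move: h1 h2 h3 p0 e0; move: ((24 / 25) ^+ k) ((25 / 24) ^+ k) (k%:R) (K%:R) => a b c d' h1 h2 h3 p0 e0'.
  have : a * (c * 24^-1) <= 1 by rewrite -[leRHS]h3 ler_pM2l.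
  have : a * (50 * d') <= a * (c * e) by rewrite ler_pM2l // ltW.
  nra.
have [s hs] := step k; exists s => z; have := hs z; lra.
Qed.

Lemma test_bumpK (r K : R) (y : C) : 0 < r -> r <= K ->
  test_function (fun w => lnm K (w - y) - lnm r (w - y)).
Proof.
move=> r0 rK; have K0 := lt_le_trans r0 rK; split.
  apply: local_continuous => z e e0.
  have q0 : 0 < e / (2 / r) by rewrite !divr_gt0.
  exists (e / (2 / r)) => // w zw.
  have e1 : normc (z - y - (w - y)) = normc (z - w) by rewrite opprB addrA subrK.
  have e2 : normc (w - y - (z - y)) = normc (z - w) by rewrite opprB addrA subrK normc_distC.
  have h1 := lnm_lip (z - y) (w - y) r0; have h2 := lnm_lip (w - y) (z - y) r0.
  have h3 := lnm_lip (z - y) (w - y) K0; have h4 := lnm_lip (w - y) (z - y) K0.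
  rewrite e1 in h1 h3; rewrite e2 in h2 h4; rewrite ltr_pdivlMr ?divr_gt0 // in zw.
  have h5 : normc (z - w) / K <= normc (z - w) / r.
    by rewrite ler_wpM2l ?normc_ge0 // lef_pV2 ?posrE.
  have h6 : normc (z - w) * (2 / r) = normc (z - w) / r + normc (z - w) / r by ring.
  by rewrite ltr_norml; apply/andP; split; lra.
(* The function vanishes beyond distance K from y. Compactness of its support comes from that of a
   square in the plane, carried to the complex numbers by a continuous map. *)
pose m := normc y + K.
pose S : set (R * R) := `[- m, m] `*` `[- m, m].
have cS : compact S by apply: compact_setX; exact: segment_compact.
pose h (p : R * R) : C := p.1 +i* p.2.
have n1 (v : C) : normc v <= `|complex.Re v| + `|complex.Im v|.
  case: v => p q /=; rewrite -[leRHS]ger0_norm ?addr_ge0 // -sqrtr_sqr ler_wsqrtr //.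
  rewrite sqrrD !real_normK ?num_real //; have := normr_ge0 p; have := normr_ge0 q; nra.
have ch : continuous h.
  move=> p A /nbhs_ballP[e /= e0 eA].
  have e'0 : 0 < complex.Re e / 2 by move: e0; rewrite ltcE /= => /andP[_ h0]; rewrite divr_gt0.
  have ee : e = (complex.Re e)%:C by move: e0; rewrite ltcE /=; case: (e) => u v /= /andP[/eqP -> _].
  suff : \forall q \near p, A (h q) by [].
  near=> q; have q1 : `|p.1 - q.1| < complex.Re e / 2.
    near: q; have c1 : (fun q : R * R => q.1) @ p --> p.1 by exact: cvg_fst.
    by have /cvgrPdist_lt := c1; apply.
  have q2 : `|p.2 - q.2| < complex.Re e / 2.
    near: q; have c1 : (fun q : R * R => q.2) @ p --> p.2 by exact: cvg_snd.
    by have /cvgrPdist_lt := c1; apply.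
  by apply: eA; rewrite /ball /= ee ltcR; apply: le_lt_trans (n1 _) _; rewrite /h /=; lra.
have chS : compact (h @` S).
  by apply: continuous_compact => //; exact: continuous_subspaceT.
apply: (subclosed_compact _ chS); first exact: closed_closure.
pose D : set C := [set z | normc z <= m].
have DS : D `<=` h @` S.
  move=> z zm; exists (complex.Re z, complex.Im z); last by case: (z).
  have := le_trans (Re_le_normc z) zm; have := le_trans (Im_le_normc z) zm.
  by rewrite /S /= !in_itv /= !ler_norml.
have cD : closed D.
  rewrite -openC; apply: open_normc => z /= /negP; rewrite -ltNge => zm.
  exists (normc z - m); first by rewrite subr_gt0.
  move=> w zw; apply/negP; rewrite -ltNge; have := le_normcD (z - w) w; rewrite subrK; lra.
apply: subset_trans DS; have cDE := (closure_id D).1 cD; rewrite cDE; apply: closureS => z /=.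
apply: contraNT; rewrite /D -ltNge /m => zm; have := le_normcD (z - y) y; rewrite subrK => h1.
by rewrite /lnm !max_l ?subrr //; lra.
Unshelve. all: by end_near. Qed.

End Approximation.

(** * Equivalence of the modes of convergence *)

Lemma close_of_sums (K : realFieldType) (N eta L A V SLt SLr SA k1 k2 rq l2 : K) : 0 < N ->
  N * L <= SLt + k1 -> SLt <= V + 2 * (N * eta) -> V <= SLr -> SLr <= N * L + (N * rq + l2) ->
  N * rq <= N * eta -> k1 <= N * eta -> l2 <= N * eta -> N * A <= SA + k2 -> k2 <= N * eta ->
  SA <= V + N * (2 * eta) -> V - N * eta <= SA -> SA <= N * A + (N * rq + l2) ->
  `|A - L| <= 6 * eta.
Proof.
move=> N0 *; rewrite ler_norml; apply/andP; split.
  by rewrite -(ler_pM2l N0); lra.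
by rewrite -(ler_pM2l N0); lra.
Qed.

Lemma shift_close (K : realFieldType) (A0 A L0 L q eta : K) :
  A0 <= A + q -> A <= A0 + q -> L0 <= L + q -> L <= L0 + q -> q <= eta -> `|A - L| <= 6 * eta ->
  0 <= eta -> `|A0 - L0| <= 16 * eta.
Proof.
move=> h1 h2 h3 h4 h5; rewrite !ler_norml => /andP[h6 h7] h8; apply/andP; split; lra.
Qed.

Lemma add_gap (K : realFieldType) (a b v q : K) : a - b <= q -> b <= v + q -> a <= v + 2 * q.
Proof. by move=> *; lra. Qed.

Lemma le_near (K : realFieldType) (a u v q : K) : a <= u + q -> `|u - v| <= q -> a <= v + 2 * q.
Proof. by rewrite ler_norml => h1 /andP[_ h2]; lra. Qed.

Lemma ge_near (K : realFieldType) (a u v q : K) : u <= a -> `|u - v| <= q -> v - q <= a.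
Proof. by rewrite ler_norml => h1 /andP[h2 _]; lra. Qed.

Lemma tail_close (K : realFieldType) (aK ar LK Lr lK x y z e : K) :
  `|aK - ar - (LK - Lr)| <= e / 4 -> lK <= aK -> aK <= lK + y + z -> lK <= LK -> LK <= lK + x ->
  x + y + z <= e / 4 -> 0 <= x -> 0 <= y -> 0 <= z -> 0 < e -> `|ar - Lr| <= e.
Proof. by rewrite !ler_norml => /andP[h1 h2] *; apply/andP; split; lra. Qed.

Lemma diff_close (K : realFieldType) (a b L M e : K) :
  `|a - L| <= e / 2 -> `|b - M| <= e / 2 -> `|a - b - (L - M)| <= e.
Proof. by rewrite !ler_norml => /andP[? ?] /andP[? ?]; apply/andP; split; lra. Qed.

Section Limits.
Variable R : realType.
Local Notation C := R[i].
Context (I : Type) (F : set_system I) {FF : ProperFilter F}.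
Variables (dim : I -> nat) (B : forall i, 'M[C]_(dim i)).
Variable mu : probability C R.
Hypothesis mom : (\int[mu]_z (normc z ^+ 2)%:E < +oo)%E.
Hypothesis dimF : forall m : nat, \forall i \near F, (m <= dim i)%N.
Variable s0 : R.
Hypothesis s00 : 0 < s0.
Hypothesis hsF : \forall i \near F, hs_norm (B i) ^+ 2 <= (dim i)%:R * s0 ^+ 2.
Hypothesis compF : forall eta : R, 0 < eta -> exists2 e : R, 0 < e <= 1 & forall z, \forall i \near F,
  complex.Re (\det (gram (B i - z%:M) + (e%:C)%:M)) <=
  expR ((dim i)%:R * eta) * normc (\det (B i - z%:M)) ^+ 2.

Definition Cv (Y : I -> R) (c : R) := forall e : R, 0 < e -> \forall i \near F, `|Y i - c| <= e.

(** Two one-sided conditions, which keep their meaning for infinite limits such as a potential equal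
    to -oo. *)
Definition CvE (Y : I -> \bar R) (c : \bar R) :=
  (forall b : R, (b%:E < c)%E -> \forall i \near F, (b%:E < Y i)%E) /\
  (forall b : R, (c < b%:E)%E -> \forall i \near F, (Y i < b%:E)%E).

Local Notation a i r z := (eig_avg (B i) (fun l => lnm r (l - z))).
Local Notation U i z := (mean_log_absdet (B i - z%:M)).
Local Notation u i z := ((dim i)%:R^-1 * ln (normc (\det (B i - z%:M)))).

Lemma mean_log_absdetE i z : \det (B i - z%:M) != 0 -> U i z = (u i z)%:E.
Proof. by move=> d0; rewrite /mean_log_absdet lne_EFin ?normc_gt0. Qed.

Lemma regdet_mono n (A : 'M[C]_n) (e e' : R) : 0 <= e <= e' ->
  normc (\det A) ^+ 2 <= complex.Re (\det (gram A + (e%:C)%:M)) <=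
  complex.Re (\det (gram A + (e'%:C)%:M)).
Proof.
move=> /andP[e0 ee]; have [g [gd g0 _ _]] := gram_spectrum A.
have d0 : complex.Re (\det (gram A + (0%:C)%:M)) = normc (\det A) ^+ 2.
  have -> : (0%:C : C)%:M = 0 :> 'M[C]_n by apply/matrixP => i j; rewrite !mxE mul0rn.
  by rewrite addr0 det_gram.
rewrite -d0 !gd /=; apply/andP; split; apply: ler_prod => i _; have := g0 i => gi.
  by rewrite addr0 gi /= lerDl.
by rewrite addr_ge0 //= lerD2l.
Qed.

(** Complement of [absdet_le]. The choice r1 = min(1, e eta) makes ln(1 + r^2/e) <= eta, so the
    truncation in [avg_le_regdet] costs at most eta/2, and the comparison of determinants costs the
    other half. *)
Lemma gap_near (eta : R) : 0 < eta -> exists2 r1 : R, 0 < r1 & forall r z, 0 < r <= r1 ->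
  \forall i \near F, [/\ (0 < dim i)%N, \det (B i - z%:M) != 0 & a i r z <= u i z + eta].
Proof.
move=> eta0; have [e /andP[e0 e1] he] := compF eta0.
have r10 : 0 < Num.min 1 (e * eta) by rewrite lt_min ltr01 mulr_gt0.
exists (Num.min 1 (e * eta)) => // r z /andP[r0]; rewrite le_min => /andP[r1 r2].
apply: filterS2 (he z) (dimF 1) => i hi n0.
have nR : 0 < (dim i)%:R :> R by rewrite ltr0n.
have D0 := regdet_gt0 (B i - z%:M) e0.
have d0 : \det (B i - z%:M) != 0.
  apply/eqP => d0; move: hi; rewrite d0 ComplexField.Normc.normc0 expr0n mulr0 leNgt D0 //.
split => //; apply: le_trans (avg_le_regdet (B i) z n0 r0 e0) _.
have dn : 0 < normc (\det (B i - z%:M)) by rewrite normc_gt0.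
have h1 : ln (complex.Re (\det (gram (B i - z%:M) + (e%:C)%:M))) <=
    (dim i)%:R * eta + 2 * ln (normc (\det (B i - z%:M))).
  rewrite -(expRK ((dim i)%:R * eta)) [2 * ln _]mulr_natl -lnXn // -lnM ?posrE ?expR_gt0 ?exprn_gt0 //.
  by rewrite ler_ln ?posrE // mulr_gt0 ?expR_gt0 ?exprn_gt0.
have h2 : ln (1 + r ^+ 2 / e) <= eta.
  apply: le_trans (ln_addr ltr01 _) _; first by rewrite divr_ge0 ?sqr_ge0 // ltW.
  rewrite ln1 add0r divr1 ler_pdivrMr // [leRHS]mulrC; apply: le_trans r2.
  by rewrite expr2 ler_piMl // ltW.
have h3 : (dim i)%:R^-1 * ln (complex.Re (\det (gram (B i - z%:M) + (e%:C)%:M))) <= eta + 2 * u i z.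
  by rewrite ler_pdivrMl // mulrDr mulrCA [_ * (_^-1 * _)]mulrA mulfV ?gt_eqF // mul1r.
move: h2 h3; move: (ln (1 + _)) (_ * ln (complex.Re _)) (u i z) => p q v; lra.
Qed.

Lemma avg_lip i (r : R) z z' : (0 < dim i)%N -> 0 < r -> a i r z <= a i r z' + normc (z - z') / r.
Proof.
move=> n0 r0; rewrite -[X in _ <= _ + X](avg_cst (B i) _ n0) -avgD; apply: le_avg => l.
by apply: le_trans (lnm_lip _ (l - z') r0) _; rewrite opprB [l - z + _]addrC addrA subrK normc_distC.
Qed.

(** The common middle term of the equivalences. It concerns every z, even when it is derived from a
    statement about almost every z. *)
Definition Star := forall (r : R) z, 0 < r -> Cv (fun i => a i r z) (Lpot mu r z).

Lemma pot_lt_pinfty z : (log_potential mu z < +oo)%E.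
Proof. by apply: le_lt_trans (pot_le mom z ltr01) _; rewrite ltry. Qed.

(** From below, [gap_near] and the fact that truncation only increases the potential; from above,
    [absdet_le] at a level r for which the truncated potential is already below the given bound. *)
Lemma star_absdet : Star -> forall z, CvE (fun i => U i z) (log_potential mu z).
Proof.
move=> st z; split => b.
  have := pot_lt_pinfty z; case E : (log_potential mu z) => [v| |] // _; rewrite lte_fin => bv.
  have e0 : 0 < (v - b) / 4 by rewrite divr_gt0 // subr_gt0.
  have [r1 r10 hr] := gap_near e0.
  have r11 : 0 < r1 <= r1 by rewrite r10 lexx.
  have := pot_le mom z r10; rewrite E lee_fin => vL.
  apply: filterS2 (hr r1 z r11) (st r1 z r10 _ e0) => i [n0 d0 h1] h2.
  rewrite mean_log_absdetE // lte_fin; move: h2; rewrite ler_norml => /andP[h2 _]; lra.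
move=> vb; have [r r0 hr] := pot_lim mom vb.
have rr : 0 < r <= r by rewrite r0 lexx.
have Lb := hr r rr; have e0 : 0 < (b - Lpot mu r z) / 2 by rewrite divr_gt0 // subr_gt0.
have [r1 r10 h1] := gap_near ltr01; have r11 : 0 < r1 <= r1 by rewrite r10 lexx.
apply: filterS2 (h1 r1 z r11) (st r z r0 _ e0) => i [n0 d0 _] h2.
rewrite mean_log_absdetE // lte_fin; apply: le_lt_trans (absdet_le n0 r0 d0) _.
move: h2; rewrite ler_norml => /andP[_ h2]; lra.
Qed.

Lemma near_all (J : eqType) (s : seq J) (Q : J -> I -> Prop) :
  (forall j, j \in s -> \forall i \near F, Q j i) -> \forall i \near F, forall j, j \in s -> Q j i.
Proof.
elim: s => [|j s IH] h; first by apply: nearW => i j; rewrite in_nil.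
have h1 := h j (mem_head _ _).
have h2 : \forall i \near F, forall k, k \in s -> Q k i.
  by apply: IH => k ks; apply: h; rewrite inE ks orbT.
by apply: filterS2 h1 h2 => i q1 q2 k; rewrite inE => /orP[/eqP ->|/q2].
Qed.

Lemma avg_sum i (s : seq C) (f : C -> C -> R) :
  eig_avg (B i) (fun l => \sum_(x <- s) f x l) = \sum_(x <- s) eig_avg (B i) (f x).
Proof. by rewrite /eig_avg exchange_big mulr_sumr. Qed.

Lemma Lpot_sum (s : seq C) (r : R) y : 0 < r ->
  mu.-integrable setT (fun w => (\sum_(x <- s) lnm r (w - (y + x)))%:E) /\
  \int[mu]_w (\sum_(x <- s) lnm r (w - (y + x))) = \sum_(x <- s) Lpot mu r (y + x).
Proof.
move=> r0; pose G (t : seq C) (w : C) : R := \sum_(x <- t) lnm r (w - (y + x)).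
suff : mu.-integrable setT (fun w => (G s w)%:E) /\ \int[mu]_w G s w = \sum_(x <- s) Lpot mu r (y + x) by [].
elim: s => [|x s [IH1 IH2]].
  have -> : G [::] = fun=> 0 by apply/funext => w; rewrite /G big_nil.
  by rewrite big_nil; split; [exact: (integrable_cst mu 0)|exact: Lpot_cst].
have -> : G (x :: s) = fun w => lnm r (w - (y + x)) + G s w by apply/funext => w; rewrite /G big_cons.
have i1 := integrable_lnm mom (y + x) r0.
rewrite big_cons; split; first by apply: (integrableD measurableT i1 IH1).
by rewrite RintegralD // IH2.
Qed.

Lemma nodes_Lpot (Q r : R) m y : 0 < Q -> 0 < r ->
  let s := nodes m (Q ^+ (2 ^ m))%:C in
  (2 ^ m)%:R * Lpot mu Q y <= \sum_(x <- s) Lpot mu r (y + x) + (ln 2 + Q / r) /\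
  \sum_(x <- s) Lpot mu r (y + x) <= (2 ^ m)%:R * Lpot mu Q y + ((2 ^ m)%:R * (r / Q) + ln 2).
Proof.
move=> Q0 r0 s; have [iS eS] := Lpot_sum s y r0.
have iQ := integrable_lnm mom y Q0.
have iNQ : mu.-integrable setT (fun w => ((2 ^ m)%:R * lnm Q (w - y))%:E) by exact: (integrableZl measurableT _ iQ).
have eN : \int[mu]_w ((2 ^ m)%:R * lnm Q (w - y)) = (2 ^ m)%:R * Lpot mu Q y by exact: RintegralZl.
have sh w x : w - (y + x) = w - y - x by rewrite opprD addrA.
split.
  rewrite -eS -eN -[X in _ <= _ + X](Lpot_cst mu) -RintegralD //; last exact: integrable_cst.
  apply: le_Rintegral => //; first by apply: (integrableD measurableT iS (integrable_cst mu _)).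
  move=> w _; have := nodes_lower m (w - y) Q0 r0; rewrite addrA.
  by under [X in _ <= X + _ + _ -> _]eq_bigr do rewrite -sh.
rewrite -eS -eN -[X in _ <= _ + X](Lpot_cst mu) -RintegralD //; last exact: integrable_cst.
apply: le_Rintegral => //; first by apply: (integrableD measurableT iNQ (integrable_cst mu _)).
move=> w _; have := nodes_upper m (w - y) Q0 r0; rewrite mulrDr -addrA.
by under [X in X <= _ -> _]eq_bigr do rewrite -sh.
Qed.

Lemma nodes_avg i (Q r : R) m y : (0 < dim i)%N -> 0 < Q -> 0 < r ->
  let s := nodes m (Q ^+ (2 ^ m))%:C in
  (2 ^ m)%:R * a i Q y <= \sum_(x <- s) a i r (y + x) + (ln 2 + Q / r) /\
  \sum_(x <- s) a i r (y + x) <= (2 ^ m)%:R * a i Q y + ((2 ^ m)%:R * (r / Q) + ln 2).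
Proof.
move=> n0 Q0 r0 s; have sh w x : w - (y + x) = w - y - x by rewrite opprD addrA.
rewrite -(avg_sum i s (fun x l => lnm r (l - (y + x)))) -avgZ; split.
  rewrite -[X in _ <= _ + X](avg_cst (B i) _ n0) -avgD; apply: le_avg => l.
  have := nodes_lower m (l - y) Q0 r0; rewrite addrA.
  by under [X in _ <= X + _ + _ -> _]eq_bigr do rewrite -sh.
rewrite -[X in _ <= _ + X](avg_cst (B i) _ n0) -avgD; apply: le_avg => l.
have := nodes_upper m (l - y) Q0 r0; rewrite mulrDr -addrA.
by under [X in X <= _ -> _]eq_bigr do rewrite -sh.
Qed.

(** At such a point the potential cannot be -oo: the normalised log-determinant is eventually at
    least the truncated average minus 1, hence at least ln r1 - 1. *)
Lemma absdet_fin z : CvE (fun i => U i z) (log_potential mu z) ->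
  exists2 v : R, log_potential mu z = v%:E & Cv (fun i => u i z) v.
Proof.
move=> [lo up]; have [r1 r10 hr] := gap_near ltr01; have r11 : 0 < r1 <= r1 by rewrite r10 lexx.
have hr1 := hr r1 z r11.
have := pot_lt_pinfty z; case E : (log_potential mu z) => [v| |] // _.
  exists v => // e e0; rewrite E in lo up.
  have hl : ((v - e)%:E < v%:E)%E by rewrite lte_fin; lra.
  have hu : (v%:E < (v + e)%:E)%E by rewrite lte_fin; lra.
  apply: filterS3 hr1 (lo _ hl) (up _ hu) => i [_ d0 _].
  rewrite mean_log_absdetE // !lte_fin => h1 h2; rewrite ler_norml; apply/andP; split; lra.
exfalso; rewrite E in up.
have hu := up (ln r1 - 2) (ltNyr _).
have [i [h1 [n0 d0 h2]]] : exists i, (U i z < (ln r1 - 2)%:E)%E /\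
    [/\ (0 < dim i)%N, \det (B i - z%:M) != 0 & a i r1 z <= u i z + 1].
  by apply: (@filter_ex _ F FF); exact: (filterI hu hr1).
move: h1; rewrite mean_log_absdetE // lte_fin => h1.
have : ln r1 <= a i r1 z.
  by rewrite -(avg_cst (B i) (ln r1) n0); apply: le_avg => l; exact: lnm_ge.
lra.
Qed.

(** Both potentials truncated at level Q are compared with their averages over the nodes of the
    circle of radius Q around y. The shift moves the centre by at most eta Q, which the Lipschitz
    bounds absorb; it makes the convergence hold at every node. The number of nodes must make N eta
    exceed the constants ln 2 + Q/r and ln 2 + Q/t, which do not depend on N. *)
Lemma absdet_star : ae_complex (fun z => CvE (fun i => U i z) (log_potential mu z)) -> Star.
Proof.
move=> aeU Q y0 Q0 eps eps0.
pose eta := eps / 16; have eta0 : 0 < eta by rewrite divr_gt0.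
have [r1 r10 hr] := gap_near eta0.
pose r := Num.min r1 (eta * Q); have r0 : 0 < r by rewrite lt_min r10 mulr_gt0.
have rr1 : 0 < r <= r1 by rewrite r0 ge_min lexx.
have rQ : r / Q <= eta by rewrite ler_pdivrMr // ge_min lexx orbT.
pose del := eta * Q / 2; have del0 : 0 < del by rewrite divr_gt0 // mulr_gt0.
pose t := Num.min 1 (del ^+ 2 * eta / 16).
have de : 0 < del ^+ 2 * eta by rewrite mulr_gt0 // exprn_gt0.
have t0 : 0 < t by rewrite lt_min ltr01 divr_gt0.
have tt : 8 * t ^+ 2 < del ^+ 2 * eta.
  have t1 : t <= 1 by rewrite ge_min lexx.
  have t2 : t <= del ^+ 2 * eta / 16 by rewrite ge_min lexx orbT.
  have : t ^+ 2 <= t by rewrite expr2 ler_piMl // ltW.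
  lra.
pose K := (ln 2 + Q / r) + (ln 2 + Q / t); have l2 : 0 < ln 2 :> R by rewrite ln_gt0 // ltr1n.
have Qr : 0 < Q / r by rewrite divr_gt0.
have Qt : 0 < Q / t by rewrite divr_gt0.
pose m := (Num.trunc (K / eta)).+1.
pose N : R := (2 ^ m)%:R; have N0 : 0 < N by rewrite ltr0n expn_gt0.
have KN : K <= N * eta.
  have h1 : K / eta < m%:R by exact: truncnS_gt.
  have h2 : m%:R <= N by rewrite ler_nat ltnW // ltn_expl.
  by rewrite -ler_pdivrMr // ltW // (lt_le_trans h1 h2).
pose s := nodes m (Q ^+ (2 ^ m))%:C.
have sz : (size s)%:R = N by rewrite size_nodes.
have s00' : (0 < size s)%N by rewrite size_nodes expn_gt0.
have [y [yy0 yU ye]] := ae_complex_select y0 mom s00' aeU del0 eta0 t0 tt.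
have /choice[v vP] : forall x, exists v : R, x \in s -> log_potential mu (y + x) = v%:E /\ Cv (fun i => u i (y + x)) v.
  move=> x; have [xs|xs] := boolP (x \in s); last by exists 0.
  by have [v v1 v2] := absdet_fin (yU x xs); exists v.
have lowL : \sum_(x <- s) Lpot mu t (y + x) <= \sum_(x <- s) v x + 2 * (N * eta).
  (* At the chosen y the truncation errors are controlled for all depths l at once, so l can be
     fixed afterwards, deep enough for each of the finitely many nodes. *)
  have [l hl] : exists l : nat, forall x, x \in s -> Lpot mu (t * 2 ^- l) (y + x) < v x + eta.
    have : \forall l \near \oo, forall x, x \in s -> Lpot mu (t * 2 ^- l) (y + x) < v x + eta.
      have key x : x \in s -> \forall l \near \oo, Lpot mu (t * 2 ^- l) (y + x) < v x + eta.
        move=> xs; have [E _] := vP x xs.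
        have lt1 : (log_potential mu (y + x)%R < (v x + eta)%R%:E)%E by rewrite E lte_fin ltrDl.
        have [q q0 hq] := pot_lim mom lt1.
        near=> l; apply: hq; rewrite mulr_gt0 ?inv2X_gt0 //=.
        have h : t / q <= l%:R by near: l; exact: nbhs_infty_ger.
        have h2 : l%:R <= 2 ^+ l :> R by rewrite -natrX ler_nat ltnW // ltn_expl.
        rewrite ler_pdivrMr ?exprn_gt0 //; rewrite ler_pdivrMr // in h.
        by apply: le_trans h _; rewrite mulrC ler_pM2l.
      elim: (s) key => [|x s' IH] key; first by apply: nearW => l x; rewrite in_nil.
      have h1 := key x (mem_head _ _).
      have h2 : \forall l \near \oo, forall k, k \in s' -> Lpot mu (t * 2 ^- l) (y + k) < v k + eta.
        by apply: IH => k ks; apply: key; rewrite inE ks orbT.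
      by apply: filterS2 h1 h2 => l q1 q2 k; rewrite inE => /orP[/eqP ->|/q2].
    by move=> /filter_ex.
  have := ye l; rewrite sumrB sz => h1.
  have : \sum_(x <- s) Lpot mu (t * 2 ^- l) (y + x) <= \sum_(x <- s) (v x + eta).
    by rewrite big_seq [leRHS]big_seq; apply: ler_sum => x xs; exact/ltW/hl.
  rewrite big_split /= (big_const_seq 0 +%R) count_predT.
  have -> : iter (size s) (+%R eta) 0 = N * eta.
    by rewrite -sz; elim: (size s) => [|j IH]; rewrite ?mul0r // iterS IH -natr1; ring.
  exact: add_gap h1.
have upL : \sum_(x <- s) v x <= \sum_(x <- s) Lpot mu r (y + x).
  rewrite big_seq [leRHS]big_seq; apply: ler_sum => x xs; have [E _] := vP x xs.
  by have := pot_le mom (y + x) r0; rewrite E lee_fin.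
have [n1 _] := nodes_Lpot m y Q0 t0; have [_ n2] := nodes_Lpot m y Q0 r0.
rewrite -/s -/N in n1 n2.
have rQN : N * (r / Q) <= N * eta by rewrite ler_pM2l.
have nearU : \forall i \near F, forall x, x \in s ->
    [/\ (0 < dim i)%N, \det (B i - (y + x)%:M) != 0, a i r (y + x) <= u i (y + x) + eta & `|u i (y + x) - v x| <= eta].
  apply: near_all => x xs; have [_ cv] := vP x xs.
  by apply: filterS2 (hr r (y + x) rr1) (cv eta eta0) => i [h1 h2 h3] h4.
apply: filterS2 nearU (dimF 1) => i hi n0.
have [m1 _] := nodes_avg m y n0 Q0 r0; have [_ m2] := nodes_avg m y n0 Q0 r0.
rewrite -/s -/N in m1 m2.
have iN (c : R) : \sum_(x <- s) c = N * c.
  rewrite (big_const_seq 0 +%R) count_predT -sz.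
  by elim: (size s) => [|j IH]; rewrite ?mul0r // iterS IH -natr1; ring.
have e1 : \sum_(x <- s) a i r (y + x) <= \sum_(x <- s) v x + N * (2 * eta).
  rewrite -iN -big_split /= big_seq [leRHS]big_seq; apply: ler_sum => x xs.
  by have [_ _ h1 h2] := hi x xs; exact: le_near h1 h2.
have e2 : \sum_(x <- s) v x - N * eta <= \sum_(x <- s) a i r (y + x).
  rewrite -iN -sumrB big_seq [leRHS]big_seq; apply: ler_sum => x xs.
  by have [_ d0 _ h2] := hi x xs; exact: ge_near (absdet_le n0 r0 d0) h2.
have l2N : ln 2 <= N * eta by apply: le_trans KN; rewrite /K -!addrA lerDl !addr_ge0 // ltW.
have k1N : ln 2 + Q / t <= N * eta by apply: le_trans KN; rewrite /K lerDr addr_ge0 // ltW.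
have k2N : ln 2 + Q / r <= N * eta by apply: le_trans KN; rewrite /K lerDl addr_ge0 // ltW.
have aL : `|a i Q y - Lpot mu Q y| <= 6 * eta.
  exact: (close_of_sums N0 n1 lowL upL n2 rQN k1N l2N m1 k2N e1 e2 m2).
have yQ : normc (y - y0) / Q <= eta.
  by rewrite ler_pdivrMr //; apply: le_trans yy0 _; rewrite /del mulrC divfK.
have b1 := avg_lip (i := i) y0 y n0 Q0; have b2 := avg_lip (i := i) y y0 n0 Q0.
have b3 := Lpot_lip mom y0 y Q0; have b4 := Lpot_lip mom y y0 Q0.
rewrite [normc (y0 - y)]normc_distC in b1 b3.
have ee : 16 * eta = eps by rewrite /eta mulrC divfK.
by rewrite -ee; exact: shift_close b1 b2 b3 b4 yQ aL (ltW eta0).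
Unshelve. all: by end_near. Qed.

Lemma Lpot_tail z : exists2 c : R, 0 <= c & forall K, 0 < K -> ln K <= Lpot mu K z <= ln K + c / K.
Proof.
have i2 := integrable_normc2 mom.
exists (1 + normc z + \int[mu]_w (normc w ^+ 2)).
  by rewrite !addr_ge0 ?normc_ge0 //; apply: Rintegral_ge0 => w _; exact: sqr_ge0.
move=> K K0; apply/andP; split.
  rewrite -[leLHS](Lpot_cst mu); apply: le_Rintegral => //; first exact: integrable_cst.
    exact: integrable_lnm.
  by move=> w _; exact: lnm_ge.
have ik : mu.-integrable setT (fun w => (K^-1 * normc w ^+ 2)%:E) by exact: (integrableZl measurableT K^-1 i2).
have -> : ln K + (1 + normc z + \int[mu]_w (normc w ^+ 2)) / K =
    \int[mu]_w ((ln K + (1 + normc z) / K) + K^-1 * normc w ^+ 2).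
  rewrite RintegralD //; last exact: integrable_cst.
  by rewrite Lpot_cst RintegralZl //; ring.
apply: le_Rintegral => //; first exact: integrable_lnm.
  by apply: (integrableD measurableT (integrable_cst mu _) ik).
move=> w _; apply: le_trans (lnm_shift _ K0) _.
rewrite -addrA lerD2l [K^-1 * _]mulrC -mulrDl ler_pM2r ?invr_gt0 //.
apply: le_trans (le_normcD _ _) _; rewrite normcN.
by move: (normc_ge0 w); move: (normc w) (normc z) => p q; nra.
Qed.

(** The difference of the truncations at K and r is a test function. At a large level K both
    potentials are within O(1/K) of ln K, by the second moment of mu on one side and by [avg_le_hs]
    on the other. *)
Lemma vague_star :
  (forall f, test_function f -> Cv (fun i => eig_avg (B i) f) (\int[mu]_w f w)) -> Star.
Proof.
move=> vg r z r0 e e0; have [c c0 hc] := Lpot_tail z.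
have z0 := normc_ge0 z.
pose K := Num.max r (4 * (c + s0 + normc z) / e).
have rK : r <= K by rewrite le_max lexx.
have K0 := lt_le_trans r0 rK.
have Ke : (c + s0 + normc z) / K <= e / 4.
  have : 4 * (c + s0 + normc z) / e <= K by rewrite le_max lexx orbT.
  by rewrite ler_pdivrMr // => h; rewrite ler_pdivrMr //; lra.
have e4 : 0 < e / 4 by rewrite divr_gt0.
have eI : \int[mu]_w (lnm K (w - z) - lnm r (w - z)) = Lpot mu K z - Lpot mu r z.
  by rewrite RintegralB //; exact: integrable_lnm.
apply: filterS3 (vg _ (test_bumpK z r0 rK) _ e4) hsF (dimF 1) => i.
rewrite eI => h1 h2 n0.
have eA : eig_avg (B i) (fun w => lnm K (w - z) - lnm r (w - z)) = a i K z - a i r z.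
  by rewrite /eig_avg sumrB mulrBr.
rewrite eA in h1; have /andP[k1 k2] := hc K K0.
have k3 : ln K <= a i K z.
  by rewrite -(avg_cst (B i) (ln K) n0); apply: le_avg => l; exact: lnm_ge.
have k4 : a i K z <= ln K + s0 / K + normc z / K.
  apply: le_trans (avg_lip (i := i) z 0 n0 K0) _; rewrite subr0 lerD2r.
  have := avg_le_hs n0 K0 s00 h2; congr (_ <= _); congr (_ * _); apply: eq_bigr => l _.
  by rewrite subr0.
have c3 : (c + s0 + normc z) / K = c / K + s0 / K + normc z / K by ring.
have p1 : 0 <= c / K by rewrite divr_ge0 // ltW.
have p2 : 0 <= s0 / K by rewrite divr_ge0 // ltW.
have p3 : 0 <= normc z / K by rewrite divr_ge0 // ltW.
rewrite c3 in Ke.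
exact: tail_close h1 k3 k4 k1 k2 Ke p1 p2 p3 e0.
Qed.

Lemma integrable_bump_sum s : mu.-integrable setT (fun w => (bump_sum s w)%:E) /\
  \int[mu]_w bump_sum s w = \sum_(p <- s) p.1 * (\int[mu]_w bump p.2.1.1 p.2.1.2 p.2.2 w).
Proof.
have ib k p q : mu.-integrable setT (fun w => (bump k p q w)%:E).
  have k0 := inv2X_gt0 R k; have k20 : 0 < 2 * 2 ^- k :> R by rewrite mulr_gt0.
  exact: (integrableB measurableT (integrable_lnm mom (center R k p q) k20)
    (integrable_lnm mom (center R k p q) k0)).
elim: s => [|[c [[k p] q]] s [IH1 IH2]].
  have -> : bump_sum [::] = (fun=> 0) :> (C -> R) by apply/funext => w; rewrite /bump_sum big_nil.
  by rewrite big_nil; split; [exact: (integrable_cst mu 0)|exact: Lpot_cst].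
have -> : bump_sum ((c, (k, p, q)) :: s) = (fun w => c * bump k p q w + bump_sum s w) :> (C -> R).
  by apply/funext => w; rewrite /bump_sum big_cons.
have i1 : mu.-integrable setT (fun w => (c * bump k p q w)%:E) by exact: (integrableZl measurableT c (ib k p q)).
rewrite big_cons /= -IH2; split; first by apply: (integrableD measurableT i1 IH1).
rewrite RintegralD //; congr (_ + _); apply: RintegralZl => //; exact: ib.
Qed.

Lemma bump_vague :
  (forall k p q, Cv (fun i => eig_avg (B i) (bump k p q)) (\int[mu]_w bump k p q w)) ->
  forall f, test_function f -> Cv (fun i => eig_avg (B i) f) (\int[mu]_w f w).
Proof.
move=> hb f tf e e0; have e4 : 0 < e / 4 by rewrite divr_gt0.
have [s hs] := approx_bump tf e4.
have [iS eS] := integrable_bump_sum s.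
have cs : Cv (fun i => eig_avg (B i) (bump_sum s)) (\int[mu]_w bump_sum s w).
  rewrite eS; elim: (s) => [|[c [[k p] q]] s' IH] e' e'0.
    apply: nearW => i; rewrite big_nil subr0 /eig_avg big1 ?mulr0 ?normr0 ?ltW // => l _.
    by rewrite /bump_sum big_nil.
  have e2 : 0 < e' / 2 by rewrite divr_gt0.
  have e3 : 0 < e' / 2 / (`|c| + 1) by rewrite divr_gt0 // ltr_wpDl.
  apply: filterS2 (IH _ e2) (hb k p q _ e3) => i h1 h2.
  have -> : eig_avg (B i) (bump_sum ((c, (k, p, q)) :: s')) = c * eig_avg (B i) (bump k p q) + eig_avg (B i) (bump_sum s').
    rewrite -avgZ -avgD; congr (_ * _); apply: eq_bigr => l _.
    by rewrite /bump_sum big_cons.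
  rewrite big_cons /= opprD addrACA -mulrBr; apply: le_trans (ler_normD _ _) _.
  rewrite normrM; rewrite ler_pdivlMr ?ltr_wpDl // in h2.
  have n1 := normr_ge0 (eig_avg (B i) (bump k p q) - \int[mu]_w bump k p q w).
  by move: h1 h2 n1; move: `|_ - _| `|c| `|_ - _| => A D E; nra.
have [cf _] := tf; have mf : measurable_fun setT f.
  by apply: continuous_measurableC => z e' e'0; exact: test_local.
have [Kf fK _] := test_bounded tf.
have iF : mu.-integrable setT (fun w => (f w)%:E).
  apply: le_integrable (integrable_cst mu Kf%:R) => //; first exact/measurable_EFinP.
  by move=> w _; rewrite /= lee_fin; apply: le_trans (fK w) _; exact: ler_norm.
have ie : mu.-integrable setT (fun w => (bump_sum s w + e / 4)%:E).
  by apply: (integrableD measurableT iS (integrable_cst mu _)).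
have ie' : mu.-integrable setT (fun w => (bump_sum s w - e / 4)%:E).
  by apply: (integrableB measurableT iS (integrable_cst mu _)).
have d1 : \int[mu]_w f w <= \int[mu]_w bump_sum s w + e / 4.
  rewrite -[X in _ <= _ + X](Lpot_cst mu) -RintegralD //; last exact: integrable_cst.
  by apply: le_Rintegral => // w _; have := hs w; rewrite ler_norml => /andP[_ h]; lra.
have d2 : \int[mu]_w bump_sum s w - e / 4 <= \int[mu]_w f w.
  rewrite -[X in _ - X <= _](Lpot_cst mu) -RintegralB //; last exact: integrable_cst.
  by apply: le_Rintegral => // w _; have := hs w; rewrite ler_norml => /andP[h _]; lra.
apply: filterS2 (cs _ e4) (dimF 1) => i h n0.
have a1 : eig_avg (B i) f <= eig_avg (B i) (bump_sum s) + e / 4.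
  rewrite -[X in _ <= _ + X](avg_cst (B i) _ n0) -avgD; apply: le_avg => l.
  by have := hs l; rewrite ler_norml => /andP[_ h']; lra.
have a2 : eig_avg (B i) (bump_sum s) <= eig_avg (B i) f + e / 4.
  rewrite -[X in _ <= _ + X](avg_cst (B i) _ n0) -avgD; apply: le_avg => l.
  by have := hs l; rewrite ler_norml => /andP[h' _]; lra.
by move: h; rewrite !ler_norml => /andP[h1 h2]; apply/andP; split; lra.
Qed.

Lemma star_bump : Star -> forall k p q, Cv (fun i => eig_avg (B i) (bump k p q)) (\int[mu]_w bump k p q w).
Proof.
move=> st k p q e e0; have e2 : 0 < e / 2 by rewrite divr_gt0.
have k0 := inv2X_gt0 R k; have k20 : 0 < 2 * 2 ^- k :> R by rewrite mulr_gt0.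
have eI : \int[mu]_w bump k p q w = Lpot mu (2 * 2 ^- k) (center R k p q) - Lpot mu (2 ^- k) (center R k p q).
  by rewrite RintegralB //; exact: integrable_lnm.
rewrite eI; apply: filterS2 (st _ (center R k p q) k20 _ e2) (st _ (center R k p q) k0 _ e2) => i h1 h2.
have -> : eig_avg (B i) (bump k p q) = a i (2 * 2 ^- k) (center R k p q) - a i (2 ^- k) (center R k p q).
  by rewrite /eig_avg sumrB mulrBr.
exact: diff_close h1 h2.
Qed.

Local Notation V e i z := (mean_log_regdet e (B i - z%:M)).

(** The regularised determinant increases with the regularisation. As soon as eps is below the e of
    the comparison it lies between |det|^2 and the value at e, whatever the rate at which eps tends
    to zero. *)
Lemma regdet_gap (eps : nat -> R) z (eta : R) : (forall n, 0 < eps n) -> eps n @[n --> \oo] --> 0 ->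
  0 < eta -> \forall i \near F, exists2 v : R, V (eps (dim i)) i z = v%:E &
    [/\ U i z = (u i z)%:E, 2 * u i z <= v & v <= 2 * u i z + eta].
Proof.
move=> p0 /cvgrPdist_lt pl eta0; have [e /andP[e0 e1] he] := compF eta0.
have [m _ mP] := pl e e0.
apply: filterS3 (he z) (dimF m) (dimF 1) => i hi mi n0.
have pe : eps (dim i) <= e by have := mP _ mi; rewrite /= sub0r normrN ger0_norm ?(ltW (p0 _)) // => /ltW.
have nR : 0 < (dim i)%:R :> R by rewrite ltr0n.
have D0 := regdet_gt0 (B i - z%:M) e0.
have d0 : \det (B i - z%:M) != 0.
  apply/eqP => d0; move: hi; rewrite d0 ComplexField.Normc.normc0 expr0n mulr0 leNgt D0 //.
have dn : 0 < normc (\det (B i - z%:M)) by rewrite normc_gt0.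
have pp : 0 <= eps (dim i) <= e by rewrite ltW.
have /andP[g1 g2] := regdet_mono (B i - z%:M) pp.
have D1 := regdet_gt0 (B i - z%:M) (p0 (dim i)).
exists ((dim i)%:R^-1 * ln (complex.Re (\det (gram (B i - z%:M) + ((eps (dim i))%:C)%:M)))) => //.
split; first exact: mean_log_absdetE.
  rewrite mulrCA ler_pM2l ?invr_gt0 // mulr_natl -lnXn // ler_ln ?posrE ?exprn_gt0 //.
have h5 : ln (complex.Re (\det (gram (B i - z%:M) + ((eps (dim i))%:C)%:M))) <=
    (dim i)%:R * eta + 2 * ln (normc (\det (B i - z%:M))).
  have hh := le_trans g2 hi.
  rewrite -(expRK ((dim i)%:R * eta)) [2 * ln _]mulr_natl -lnXn // -lnM ?posrE ?expR_gt0 ?exprn_gt0 //.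
  by rewrite ler_ln ?posrE // mulr_gt0 ?expR_gt0 ?exprn_gt0.
by rewrite [leRHS]addrC ler_pdivrMl // mulrDr mulrCA [_ * (_^-1 * _)]mulrA mulfV ?gt_eqF // mul1r.
Qed.

Lemma absdet_regdet (eps : nat -> R) z : (forall n, 0 < eps n) -> eps n @[n --> \oo] --> 0 ->
  CvE (fun i => U i z) (log_potential mu z) <->
  CvE (fun i => V (eps (dim i)) i z) (2%:E * log_potential mu z)%E.
Proof.
move=> p0 pl; have := pot_lt_pinfty z; case E : (log_potential mu z) => [v| |] // _; last first.
  have -> : (2%:E * -oo = -oo :> \bar R)%E by rewrite mulrNy gtr0_sg // mul1e.
  split=> -[_ up]; split=> // b _.
    apply: filterS2 (regdet_gap z p0 pl ltr01) (up (b / 2 - 1) (ltNyr _)) => i [w -> [-> h1 h2]].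
    by rewrite !lte_fin; lra.
  apply: filterS2 (regdet_gap z p0 pl ltr01) (up (2 * b) (ltNyr _)) => i [w -> [-> h1 h2]].
  by rewrite !lte_fin; lra.
rewrite -EFinM; split=> -[lo up]; split=> b; rewrite lte_fin => hb.
- have h : ((b / 2)%:E < v%:E)%E by rewrite lte_fin; lra.
  apply: filterS2 (regdet_gap z p0 pl ltr01) (lo _ h) => i [w -> [-> h1 h2]].
  by rewrite !lte_fin; lra.
- have h : (v%:E < ((2 * v + b) / 4)%:E)%E by rewrite lte_fin; lra.
  have e0 : 0 < (b - 2 * v) / 2 by rewrite divr_gt0 // subr_gt0.
  apply: filterS2 (regdet_gap z p0 pl e0) (up _ h) => i [w -> [-> h1 h2]].
  by rewrite !lte_fin; lra.
- have h : ((b + v)%:E < (2 * v)%:E)%E by rewrite lte_fin; lra.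
  have e0 : 0 < v - b by rewrite subr_gt0.
  apply: filterS2 (regdet_gap z p0 pl e0) (lo _ h) => i [w -> [-> h1 h2]].
  by rewrite !lte_fin; lra.
- have h : ((2 * v)%:E < (2 * b)%:E)%E by rewrite lte_fin; lra.
  apply: filterS2 (regdet_gap z p0 pl ltr01) (up _ h) => i [w -> [-> h1 h2]].
  by rewrite !lte_fin; lra.
Qed.

End Limits.

(** * Convergence almost surely and in probability as convergence along a filter *)

Section Modes.
Context (R : realType) (d : measure_display) (T : measurableType d) (P : probability T R).

(** Convergence along this filter is almost sure convergence with the exceptional null set allowed
    to depend on the precision; a countable union removes this dependence. *)
Definition Fas : set_system (nat * T) :=
  [set E | {ae P, forall w, \forall n \near \oo, E (n, w)}].

(** Only the exceptional sets are required to be measurable, not the property, so that supersets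
    stay in the filter. *)
Definition Fpr : set_system (nat * T) := [set E | exists G : nat -> set T,
  [/\ forall n, measurable (G n), forall n w, ~ G n w -> E (n, w) &
   forall e : R, 0 < e -> \forall n \near \oo, (P (G n) <= e%:E)%E]].

Global Instance Fas_proper : ProperFilter Fas.
Proof.
apply: Build_ProperFilter.
  move=> [A [mA A0 AE]]; have : A = setT.
    apply/seteqP; split => // w _; apply: AE => /= -[n _ h]; exact: (h n (leqnn n)).
  move=> AT; move: A0; rewrite AT => h; have := probability_setT P; rewrite h => /eqP.
  by rewrite lt_eqF // lte01.
apply: Build_Filter.
- by apply: aeW => w; apply: nearW.
- move=> E1 E2 h1 h2.
  have g1 : {ae P, forall w, \forall n \near \oo, E1 (n, w)} := h1.
  have g2 : {ae P, forall w, \forall n \near \oo, E2 (n, w)} := h2.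
  suff : {ae P, forall w, \forall n \near \oo, E1 (n, w) /\ E2 (n, w)} by [].
  by apply: filterS2 g1 g2 => w; exact: filterI.
- move=> E1 E2 E12 h1.
  have g1 : {ae P, forall w, \forall n \near \oo, E1 (n, w)} := h1.
  suff : {ae P, forall w, \forall n \near \oo, E2 (n, w)} by [].
  by apply: filterS g1 => w; apply: filterS => n; exact: E12.
Qed.

Global Instance Fpr_proper : ProperFilter Fpr.
Proof.
apply: Build_ProperFilter_ex.
  move=> E [G [mG GE G0]]; have h20 : 0 < 2^-1 :> R by rewrite invr_gt0.
  have [n _ hn] := G0 _ h20.
  have [w nw] : exists w, ~ G n w.
    apply: contrapT => hw; have GT : G n = setT.
      by apply/seteqP; split => // w _; apply: contrapT => nw; apply: hw; exists w.
    have := hn n (leqnn n); rewrite /= GT probability_setT lee_fin; lra.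
  by exists (n, w); exact: GE.
apply: Build_Filter.
- exists (fun=> set0); split => // e e0; apply: nearW => n; by rewrite measure0 lee_fin ltW.
- move=> E1 E2 [G1 [m1 g1 p1]] [G2 [m2 g2 p2]]; exists (fun n => G1 n `|` G2 n); split.
  + by move=> n; exact: measurableU.
  + by move=> n w /not_orP[h1 h2]; split; [exact: g1|exact: g2].
  + move=> e e0; have e2 : 0 < e / 2 by rewrite divr_gt0.
    apply: filterS2 (p1 _ e2) (p2 _ e2) => n h1 h2.
    apply: (@le_trans _ _ (P (G1 n) + P (G2 n))%E); first exact: measureU2.
    by apply: le_trans (leeD h1 h2) _; rewrite -EFinD lee_fin; lra.
- by move=> E1 E2 E12 [G [m g p]]; exists G; split => // n w /g; exact: E12.
Qed.

Lemma Fas_dim m : \forall p \near Fas, (m <= p.1)%N.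
Proof. by apply: aeW => w; exists m. Qed.

Lemma Fpr_dim m : \forall p \near Fpr, (m <= p.1)%N.
Proof.
exists (fun n => if (n < m)%N then setT else set0); split.
- by move=> n; case: ifP.
- by move=> n w /=; case: ltnP => // _ [].
- move=> e e0; exists m => // n /= mn; rewrite ltnNge mn /= measure0 lee_fin ltW //.
Qed.

(** The unions of the failures from rank m on decrease to a null set, so their probabilities tend to
    zero. *)
Lemma Fas_Fpr (E : set (nat * T)) : (forall n, measurable [set w | E (n, w)]) -> Fas E -> Fpr E.
Proof.
move=> mE [A [mA A0 AE]]; exists (fun n => ~` [set w | E (n, w)]); split.
- by move=> n; exact: measurableC.
- by move=> n w /contrapT.
pose H m := \bigcup_(n in [set n | (m <= n)%N]) ~` [set w | E (n, w)].
have mH m : measurable (H m) by apply: bigcup_measurable => n _; exact: measurableC.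
have HA : \bigcap_m H m `<=` A.
  move=> w hw; apply: AE => -[m _ hm]; have [n /= mn nE] := hw m I; apply: nE; exact: hm.
have H0 : P (\bigcap_m H m) = 0%E.
  apply/eqP; rewrite eq_le measure_ge0 andbT -A0 le_measure ?inE //.
  exact: bigcapT_measurable.
have Hoo : (P (H 0%N) < +oo)%E by apply: le_lt_trans (probability_le1 P (mH 0%N)) _; rewrite ltry.
have Hnd : {homo H : n m / (n <= m)%N >-> (m <= n)%O}.
  by move=> n m nm; apply/subsetPset => w [k /= mk h]; exists k => //=; exact: leq_trans mk.
have hc : P (H n) @[n --> \oo] --> 0%E.
  by rewrite -H0; exact: (nonincreasing_cvg_mu Hoo mH (bigcapT_measurable mH) Hnd).
move: hc => /fine_cvgP[_ /cvgrPdist_le h] e e0.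
apply: filterS (h e e0) => n; rewrite sub0r normrN ger0_norm ?fine_ge0 // => hn.
apply: (@le_trans _ _ (P (H n))).
  by apply: le_measure; rewrite ?inE //; [exact: measurableC|move=> w nw; exists n => /=].
rewrite -(@fineK _ (P (H n))) ?lee_fin //; exact: fin_num_measure.
Qed.

Lemma prob_cvg1 (S : nat -> set T) : (forall n, measurable (S n)) ->
  (P (S n) @[n --> \oo] --> 1%E <->
   forall e : R, 0 < e -> \forall n \near \oo, (P (~` S n) <= e%:E)%E).
Proof.
move=> mS.
have fS n : P (S n) = (fine (P (S n)))%:E by rewrite fineK //; exact: fin_num_measure.
have cS n : P (~` S n) = (1 - fine (P (S n)))%:E by rewrite probability_setC // fS EFinB /= .
split=> [/fine_cvgP[_ /cvgrPdist_le h] e e0|h].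
  apply: filterS (h e e0) => n hn; rewrite cS lee_fin; exact: le_trans (ler_norm _) hn.
apply/fine_cvgP; split; first by apply: nearW => n; exact: fin_num_measure.
apply/cvgrPdist_le => e e0; apply: filterS (h e e0) => n; rewrite cS lee_fin => hn.
rewrite ger0_norm // subr_ge0 -lee_fin -fS; exact: probability_le1.
Qed.

(** A countable base of neighbourhoods, needed to gather countably many almost sure events into
    one. *)
Definition basic_nbhs (c : \bar R) (k : nat) : set (\bar R) :=
  match c with
  | r%:E => [set y | ((r - k.+1%:R^-1)%:E < y)%E /\ (y < (r + k.+1%:R^-1)%:E)%E]
  | +oo%E => [set y | (k%:R%:E < y)%E]
  | -oo%E => [set y | (y < (- k%:R)%:E)%E]
  end.

Lemma basic_nbhsP (c : \bar R) (V : set (\bar R)) : nbhs c V -> exists k, basic_nbhs c k `<=` V.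
Proof.
case: c => [r| |] /=.
- move=> hV; have : nbhs (r : R) (EFin @^-1` V) by exact: hV.
  move=> /nbhs_ballP[e /= e0 he]; exists (Num.trunc e^-1) => y /= [].
  have kp : (Num.trunc e^-1).+1%:R^-1 < e.
    by rewrite -[ltRHS]invrK ltf_pV2 ?posrE ?invr_gt0 // truncnS_gt.
  case: y => [y| |] //; rewrite !lte_fin => h1 h2; have hb : `|r - y| < e.
    move: kp h1 h2; move: ((Num.trunc e^-1).+1%:R^-1) => q kp h1 h2.
    by rewrite ltr_norml; apply/andP; split; lra.
  exact: (he y hb).
- move=> [M [_ hM]]; exists (Num.trunc M).+1 => y /= hy; apply: hM; apply: le_lt_trans hy.
  by rewrite lee_fin ltW // truncnS_gt.
- move=> [M [_ hM]]; exists (Num.trunc (- M)).+1 => y /= hy; apply: hM; apply: lt_le_trans hy _.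
  by rewrite lee_fin; have := truncnS_gt (- M); lra.
Qed.

Lemma CvE_basic (F : set_system (nat * T)) {FF : ProperFilter F} (Y : nat -> T -> \bar R) c k :
  CvE F (fun p => Y p.1 p.2) c -> \forall p \near F, basic_nbhs c k (Y p.1 p.2).
Proof.
move=> [lo up]; case: c lo up => [r| |] lo up /=.
- have k0 : 0 < k.+1%:R^-1 :> R by rewrite invr_gt0.
  apply: filterS2 (lo (r - k.+1%:R^-1) _) (up (r + k.+1%:R^-1) _) => //.
    by rewrite lte_fin gtrBl.
  by rewrite lte_fin ltrDl.
- by apply: lo; rewrite ltry.
- by apply: up; rewrite ltNyr.
Qed.

Lemma measurable_open_ereal (V : set (\bar R)) : open V -> measurable V.
Proof.
move=> oV; have -> : V = (EFin @` (EFin @^-1` V)) `|` (V `&` [set +oo%E]) `|` (V `&` [set -oo%E]).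
  apply/seteqP; split => [[y| |] Vy|y].
  - by left; left; exists y.
  - by left; right.
  - by right.
  by case=> [[[z Vz <-]|[Vy _]]|[Vy _]].
have inf (y : \bar R) : measurable (V `&` [set y]).
  have [Vy|Vy] := pselect (V y).
    by rewrite (_ : _ `&` _ = [set y]); [exact: emeasurable_set1|apply/seteqP; split => [z []|z ->]].
  by rewrite (_ : _ `&` _ = set0) //; apply/seteqP; split => // z [Vz zy]; apply: Vy; rewrite -zy.
apply: measurableU => //; apply: measurableU => //.
apply: measurable_image_EFin; apply: open_measurable.
rewrite openE => y Vy; have : nbhs (y%:E) V by exact: open_nbhs_nbhs.
by [].
Qed.

Lemma cvg_as_CvE (Y : nat -> T -> \bar R) c :
  cvg_almost_surely P Y c <-> CvE Fas (fun p => Y p.1 p.2) c.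
Proof.
split=> [h|h].
  split=> b bc; apply: filterS h => w hw.
    by apply: (hw [set y | (b%:E < y)%E]); exact: open_ereal_gt'.
  by apply: (hw [set y | (y < b%:E)%E]); exact: open_ereal_lt'.
have hk k : P.-negligible [set w | ~ \forall n \near \oo, basic_nbhs c k (Y n w)].
  exact: (CvE_basic (F := Fas) k h).
have := negligible_bigcup hk; apply: negligibleS => w /= nw.
apply: contrapT => hw; apply: nw => V /basic_nbhsP[k kV].
suff : \forall n \near \oo, V (Y n w) by [].
have : \forall n \near \oo, basic_nbhs c k (Y n w).
  by apply: contrapT => hn; apply: hw; exists k.
by apply: filterS => n; exact: kV.
Qed.

Lemma cvg_pr_CvE (Y : nat -> T -> \bar R) c : (forall n, measurable_fun setT (Y n)) ->
  cvg_in_probability P Y c <-> CvE Fpr (fun p => Y p.1 p.2) c.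
Proof.
move=> mY; have mV (V : set (\bar R)) n : open V -> measurable [set w | V (Y n w)].
  by move=> oV; rewrite -[X in measurable X]setTI; apply: mY => //; exact: measurable_open_ereal.
split=> [h|h].
  have key (V : set (\bar R)) : open V -> V c -> Fpr [set p | V (Y p.1 p.2)].
    move=> oV Vc; have /(prob_cvg1 (fun n => mV V n oV)) hV := h V (conj oV Vc).
    exists (fun n => ~` [set w | V (Y n w)]); split => //.
      by move=> n; apply: measurableC; exact: mV.
    by move=> n w /contrapT.
  split=> b bc.
    by apply: (key [set y | (b%:E < y)%E]) => //; exact: open_ereal_gt_ereal.
  by apply: (key [set y | (y < b%:E)%E]) => //; exact: open_ereal_lt_ereal.
move=> V oV; apply/(prob_cvg1 (fun n => mV V n oV.1)) => e e0.
have [k kV] := basic_nbhsP (open_nbhs_nbhs oV).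
have [G [mG GE G0]] := CvE_basic (F := Fpr) k h.
apply: filterS (G0 e e0) => n; apply: le_trans; apply: le_measure; rewrite ?inE //.
  by apply: measurableC; exact: mV oV.1.
by move=> w nV; apply: contrapT => nG; apply: nV; apply: kV; exact: GE nG.
Qed.

Lemma cvg_pr_Cv (Y : nat -> T -> R) c : (forall n, measurable_fun setT (Y n)) ->
  cvg_in_probability P Y c <-> Cv Fpr (fun p => Y p.1 p.2) c.
Proof.
move=> mY; have mV (V : set R) n : open V -> measurable [set w | V (Y n w)].
  by move=> oV; rewrite -[X in measurable X]setTI; apply: mY => //; exact: open_measurable.
split=> [h e e0|h V oV].
  have ob : open_nbhs c (ball c e : set R) by split; [exact: ball_open|exact: ballxx].
  have /(prob_cvg1 (fun n => mV _ n ob.1)) hV := h _ ob.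
  exists (fun n => ~` [set w | ball c e (Y n w)]); split => //.
    by move=> n; apply: measurableC; exact: mV ob.1.
  by move=> n w /contrapT /=; rewrite /ball /= distrC => /ltW.
apply/(prob_cvg1 (fun n => mV V n oV.1)) => e e0.
have /nbhs_ballP[r /= r0 rV] := open_nbhs_nbhs oV.
have r2 : 0 < r / 2 by rewrite divr_gt0.
have [G [mG GE G0]] := h _ r2.
apply: filterS (G0 e e0) => n; apply: le_trans; apply: le_measure; rewrite ?inE //.
  by apply: measurableC; exact: mV oV.1.
move=> w nV; apply: contrapT => nG; apply: nV; apply: rV; have := GE n w nG.
by rewrite /ball /= distrC => hh; apply: le_lt_trans hh _; lra.
Qed.

End Modes.

(** * The theorem *)

Section Assembly.
Local Open Scope sesquilinear_scope.
Context (R : realType) (d0 : measure_display) (T0 : measurableType d0) (P0 : probability T0 R)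
  (d : measure_display) (T : measurableType d) (P : probability T R).
Local Notation C := R[i].
Variables (x : {RV P0 >-> C}) (X : nat * nat -> {RV P >-> C}).
Variable M : forall n : nat, 'M[C]_n.
Variable mu : probability C R.
Hypothesis x01 : zero_mean_unit_variance x.
Hypothesis Xx : iid_copies X x.
Variable Kb : R.
Hypothesis Kb0 : 0 <= Kb.
Hypothesis M_le : forall n, (0 < n)%N -> hs_norm (M n) ^+ 2 / n%:R ^+ 2 <= Kb.
Hypothesis mom : (\int[mu]_z (normc z ^+ 2)%:E < +oo)%E.

Let Bn n (w : T) : 'M[C]_n := rescale (M n + random_matrix X n w).
Let B (p : nat * T) : 'M[C]_(p.1) := Bn p.1 p.2.
(** From |a + b|^2 <= 2|a|^2 + 2|b|^2 with the bounds Kb n^2 for M and 24 n^2 for X; as s0 >= 1, it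
    is at most its own square. *)
Let s0 : R := 2 * Kb + 48.

Lemma mmeas_B n : mmeas (Bn n).
Proof.
move=> i j; rewrite (_ : (fun w => _) =
  fun w => ((Num.sqrt n%:R)^-1)%:C * (M n i j + X (val i, val j) w)).
  apply: cmeasM; first exact: cmeas_cst.
  apply: cmeasD; first exact: cmeas_cst.
  split; first by apply: (measurableT_comp (f := @complex.Re R)); [exact: measurable_Re|exact: measurable_funPT].
  by apply: (measurableT_comp (f := @complex.Im R)); [exact: measurable_Im|exact: measurable_funPT].
by apply/funext => w; rewrite /Bn /rescale !mxE.
Qed.

Lemma measurable_le_set (f g : T -> R) : measurable_fun setT f -> measurable_fun setT g ->
  measurable [set w | f w <= g w].
Proof.
move=> mf mg; have mh : measurable_fun setT (fun w => g w - f w) by exact: measurable_funB.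
have -> : [set w | f w <= g w] = setT `&` (fun w => g w - f w) @^-1` `[0, +oo[.
  by apply/seteqP; split => w /=; rewrite in_itv /= andbT subr_ge0; tauto.
by apply: mh => //; exact: measurable_itv.
Qed.

Lemma s0_gt0 : 0 < s0. Proof. by rewrite /s0; have := Kb0; lra. Qed.

Lemma hs_as : \forall p \near Fas P, hs_norm (B p) ^+ 2 <= p.1%:R * s0 ^+ 2.
Proof.
have h := hs_bound_as Xx x01.
suff : {ae P, forall w, \forall n \near \oo, hs_norm (Bn n w) ^+ 2 <= n%:R * s0 ^+ 2} by [].
apply: filterS h => w; apply: filterS2 (nbhs_infty_gt 0) => n n0 hX.
have nR : 0 < n%:R :> R by rewrite ltr0n.
have hM := M_le n0; rewrite ler_pdivrMr ?exprn_gt0 // hs_norm_sqr in hM.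
rewrite hs_norm_sqr.
have ent i j : normc (Bn n w i j) ^+ 2 <= n%:R^-1 * (2 * normc (M n i j) ^+ 2 + 2 * normc (X (val i, val j) w) ^+ 2).
  have -> : Bn n w i j = ((Num.sqrt n%:R)^-1)%:C * (M n i j + X (val i, val j) w).
    by rewrite /Bn /rescale !mxE.
  rewrite normc_cmul ?invr_ge0 ?sqrtr_ge0 // exprMn exprVn sqr_sqrtr //.
  rewrite ler_pM2l ?invr_gt0 //; have h1 := le_normcD (M n i j) (X (val i, val j) w).
  have h2 := normc_ge0 (M n i j + X (val i, val j) w).
  move: h1 h2; move: (normc (M n i j + _)) (normc (M n i j)) (normc (X _ w)) => a b c h1 h2.
  have h3 : a ^+ 2 <= (b + c) ^+ 2 by rewrite lerXn2r ?nnegrE // (le_trans h2 h1).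
  by have := sqr_ge0 (b - c); rewrite sqrrB; move: h3; rewrite sqrrD !mulr2n; lra.
apply: (@le_trans _ _ (\sum_(i < n) \sum_(j < n) n%:R^-1 * (2 * normc (M n i j) ^+ 2 + 2 * normc (X (val i, val j) w) ^+ 2))).
  by apply: ler_sum => i _; apply: ler_sum => j _; exact: ent.
under eq_bigr do rewrite -mulr_sumr big_split -!mulr_sumr /=.
rewrite -mulr_sumr big_split -!mulr_sumr /= ler_pdivrMl //.
move: hM hX; set u := \sum_(i < n) _; set v := \sum_(i < n) _ => hM hX.
have s1 : s0 <= s0 ^+ 2 by rewrite expr2 ler_peMl ?(ltW s0_gt0) // /s0; have := Kb0; lra.
have hk : n%:R * (n%:R * s0) <= n%:R * (n%:R * s0 ^+ 2) by rewrite !ler_pM2l.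
apply: le_trans hk; have -> : n%:R * (n%:R * s0) = n%:R ^+ 2 * (2 * Kb + 48) by rewrite /s0; ring.
by move: hM hX; move: (n%:R ^+ 2) => q hM hX; lra.
Qed.

Lemma comp_as (eta : R) : 0 < eta -> exists2 e : R, 0 < e <= 1 & forall z, \forall p \near Fas P,
  complex.Re (\det (gram (B p - z%:M) + (e%:C)%:M)) <=
  expR (p.1%:R * eta) * normc (\det (B p - z%:M)) ^+ 2.
Proof. by move=> eta0; have [e e01 he] := comparison_as Xx x01 M_le eta0; exists e. Qed.

Lemma hs_pr : \forall p \near Fpr P, hs_norm (B p) ^+ 2 <= p.1%:R * s0 ^+ 2.
Proof.
apply: (Fas_Fpr _ hs_as) => n.
rewrite -[X in measurable X]/[set w | hs_norm (Bn n w) ^+ 2 <= n%:R * s0 ^+ 2].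
apply: measurable_le_set; last exact: measurable_cst.
rewrite (_ : (fun w => _) = fun w => \sum_i \sum_j normc (Bn n w i j) ^+ 2); last first.
  by apply/funext => w; rewrite hs_norm_sqr.
apply: measurable_sum => i; apply: measurable_sum => j; apply: measurable_funX.
by apply/measurable_normc_cmeas; exact: mmeas_B.
Qed.

Lemma mmeas_Bz n z : mmeas (fun w => Bn n w - z%:M).
Proof. by apply: (mmeasB (@mmeas_B n)); exact: (@mmeas_cst _ _ _ n z%:M). Qed.

Lemma comp_pr (eta : R) : 0 < eta -> exists2 e : R, 0 < e <= 1 & forall z, \forall p \near Fpr P,
  complex.Re (\det (gram (B p - z%:M) + (e%:C)%:M)) <=
  expR (p.1%:R * eta) * normc (\det (B p - z%:M)) ^+ 2.
Proof.
move=> eta0; have [e e01 he] := comp_as eta0; exists e => // z; apply: (Fas_Fpr _ (he z)) => n.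
rewrite -[X in measurable X]/[set w | complex.Re (\det (gram (Bn n w - z%:M) + (e%:C)%:M)) <=
  expR (n%:R * eta) * normc (\det (Bn n w - z%:M)) ^+ 2].
apply: measurable_le_set; first exact: (measurable_regdet e (@mmeas_Bz n z)).
apply: measurable_funM; first exact: measurable_cst.
by apply: measurable_funX; exact: (measurable_absdet z (@mmeas_B n)).
Qed.

Lemma measurable_mean_absdet n z :
  measurable_fun setT (fun w => mean_log_absdet (Bn n w - z%:M)).
Proof.
rewrite /mean_log_absdet; apply: measurable_funeM.
have mf : measurable_fun setT (fun w => normc (\det (Bn n w - z%:M))).
  exact: (measurable_absdet z (@mmeas_B n)).
rewrite (_ : (fun w => _) = fun w => if normc (\det (Bn n w - z%:M)) <= 0 then -oo%E
   else (ln (normc (\det (Bn n w - z%:M))))%:E) //.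
apply: measurable_fun_ifT => //; first exact: measurable_fun_ler.
by apply/measurable_EFinP; apply: measurableT_comp => //; exact: measurable_ln.
Qed.

Lemma measurable_mean_regdet n e z :
  measurable_fun setT (fun w => mean_log_regdet e (Bn n w - z%:M)).
Proof.
rewrite /mean_log_regdet; apply/measurable_EFinP; apply: measurable_funM; first exact: measurable_cst.
apply: measurableT_comp; first exact: measurable_ln.
exact: (measurable_regdet e (@mmeas_Bz n z)).
Qed.

(** The list of eigenvalues comes from an abstract choice of roots, with no measurability of its
    own. The average is therefore obtained as a limit of averages of bump sums, to which
    [measurable_avg] applies. *)
Lemma measurable_avg_test n f : test_function f -> measurable_fun setT (fun w => eig_avg (Bn n w) f).
Proof.
move=> tf; have [n0|] := posnP n.
  rewrite (_ : (fun w => _) = fun=> 0); first exact: measurable_cst.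
  by apply/funext => w; rewrite /eig_avg /= n0 invr0 mul0r.
move=> n0; have /choice[s hs] : forall k : nat, exists s, forall z, `|f z - bump_sum s z| <= k.+1%:R^-1.
  by move=> k; apply: approx_bump => //; rewrite invr_gt0.
apply: (measurable_fun_cvg (h := fun k w => eig_avg (Bn n w) (bump_sum (s k)))).
  move=> k; elim: (s k) => [|[c [[l p] q]] t IH].
    rewrite (_ : (fun w => _) = fun=> 0); first exact: measurable_cst.
    by apply/funext => w; rewrite /eig_avg big1 ?mulr0 // => z _; rewrite /bump_sum big_nil.
  have l0 := inv2X_gt0 R l; have l20 : 0 < 2 * 2 ^- l :> R by rewrite mulr_gt0.
  rewrite (_ : (fun w => _) = fun w => c * (eig_avg (Bn n w) (fun z => lnm (2 * 2 ^- l) (z - center R l p q)) -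
      eig_avg (Bn n w) (fun z => lnm (2 ^- l) (z - center R l p q))) + eig_avg (Bn n w) (bump_sum t)).
    apply: measurable_funD => //; apply: measurable_funM; first exact: measurable_cst.
    by apply: measurable_funB; apply: measurable_avg => //; exact: mmeas_B.
  apply/funext => w; apply/esym; rewrite /eig_avg -mulrBr -sumrB mulrCA [c * _]mulr_sumr -mulrDr -big_split /=.
  by congr (_ * _); apply: eq_bigr => z _; rewrite /bump_sum big_cons.
move=> w _; apply/cvgrPdist_le => e e0; near=> k.
have ke : k.+1%:R^-1 <= e.
  rewrite -[leRHS]invrK lef_pV2 ?posrE ?invr_gt0 //.
  by apply: (@le_trans _ _ k%:R); [near: k; exact: nbhs_infty_ger|rewrite ler_nat].
rewrite /eig_avg -mulrBr -sumrB; apply: le_trans ke.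
have -> : k.+1%:R^-1 = eig_avg (Bn n w) (fun=> k.+1%:R^-1) by rewrite avg_cst.
rewrite normrM ger0_norm ?invr_ge0 // /eig_avg ler_wpM2l ?invr_ge0 //.
by apply: le_trans (ler_norm_sum _ _ _) _; apply: ler_sum => z _; exact: hs.
Unshelve. all: by end_near. Qed.

Lemma integral_esd_test n w f : test_function f -> \int[esd (Bn n w)]_z f z = eig_avg (Bn n w) f.
Proof.
move=> [cf _]; rewrite /Rintegral integral_esd //.
by apply: continuous_measurableC => z e e0; exact: test_local.
Qed.

Section Mode.
Context (F : set_system (nat * T)) {FF : ProperFilter F}.
Hypothesis dimF : forall m : nat, \forall p \near F, (m <= p.1)%N.
Hypothesis compF : forall eta : R, 0 < eta -> exists2 e : R, 0 < e <= 1 & forall z, \forall p \near F,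
  complex.Re (\det (gram (B p - z%:M) + (e%:C)%:M)) <=
  expR (p.1%:R * eta) * normc (\det (B p - z%:M)) ^+ 2.
Variable conv : (nat -> T -> \bar R) -> \bar R -> Prop.
Hypothesis convE : forall Y c, (forall n, measurable_fun setT (Y n)) ->
  conv Y c <-> CvE F (fun p => Y p.1 p.2) c.

Let ii : Prop := ae_complex (fun z =>
  conv (fun n w => mean_log_absdet (Bn n w - z%:M)) (log_potential mu z)).

Lemma conv_absdet z : conv (fun n w => mean_log_absdet (Bn n w - z%:M)) (log_potential mu z) <->
  CvE F (fun p => mean_log_absdet (B p - z%:M)) (log_potential mu z).
Proof.
have -> : (fun p => mean_log_absdet (B p - z%:M)) = (fun p : nat * T => mean_log_absdet (Bn p.1 p.2 - z%:M)).
  by apply/funext => -[].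
by apply: (convE (Y := fun n w => mean_log_absdet (Bn n w - z%:M))) => n; exact: measurable_mean_absdet.
Qed.

Lemma mode_star : ii <-> Star F B mu.
Proof.
split=> [h|st].
  apply: absdet_star => //; apply: ae_complex_mono h => z; exact: (conv_absdet z).1.
by apply: ae_complexT => z; apply/conv_absdet; exact: star_absdet.
Qed.

(** Towards the regularised determinants the sequence 1/(n+1) serves for every z; in the other
    direction [absdet_regdet] accepts whatever sequence is given at z. *)
Lemma mode_regdet : ii <-> ae_complex (fun z => exists eps : nat -> R,
  [/\ forall n, 0 < eps n, eps n @[n --> \oo] --> 0 &
    conv (fun n w => mean_log_regdet (eps n) (Bn n w - z%:M)) (2%:E * log_potential mu z)%E]).
Proof.
have cr eps z : conv (fun n w => mean_log_regdet (eps n) (Bn n w - z%:M)) (2%:E * log_potential mu z)%E <->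
    CvE F (fun p => mean_log_regdet (eps p.1) (B p - z%:M)) (2%:E * log_potential mu z)%E.
  have -> : (fun p => mean_log_regdet (eps p.1) (B p - z%:M)) =
      (fun p : nat * T => mean_log_regdet (eps p.1) (Bn p.1 p.2 - z%:M)) by apply/funext => -[].
  apply: (convE (Y := fun n w => mean_log_regdet (eps n) (Bn n w - z%:M))) => n.
  exact: measurable_mean_regdet.
split; apply: ae_complex_mono => z.
  move=> /conv_absdet h; exists (fun n => n.+1%:R^-1); split.
  - by move=> n; rewrite invr_gt0.
  - exact: cvg_harmonic.
  apply/cr; apply: ((absdet_regdet (B := B) mom dimF compF (eps := fun n => n.+1%:R^-1) z _ _).1 h).
    by move=> n; rewrite invr_gt0.
  exact: cvg_harmonic.
move=> [eps [p0 pl /cr h]]; apply/conv_absdet.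
exact: ((absdet_regdet (B := B) mom dimF compF z p0 pl).2 h).
Qed.

End Mode.

Lemma pr_star : vague_cvg_in_probability P (fun n w => esd (Bn n w)) mu <-> Star (Fpr P) B mu.
Proof.
have cv f : test_function f -> cvg_in_probability P (fun n w => \int[esd (Bn n w)]_z f z) (\int[mu]_z f z) <->
    Cv (Fpr P) (fun p => eig_avg (B p) f) (\int[mu]_z f z).
  move=> tf; have -> : (fun n w => \int[esd (Bn n w)]_z f z) = (fun n w => eig_avg (Bn n w) f).
    by apply/funext => n; apply/funext => w; exact: integral_esd_test.
  have -> : (fun p => eig_avg (B p) f) = (fun p : nat * T => eig_avg (Bn p.1 p.2) f) by apply/funext => -[].
  by apply: cvg_pr_Cv => n; exact: measurable_avg_test.
split=> [h|st].
  apply: (vague_star mom (@Fpr_dim _ _ _ P) s0_gt0 hs_pr) => f tf; exact: (cv f tf).1 (h f tf).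
move=> f tf; apply/(cv f tf); apply: (bump_vague mom (@Fpr_dim _ _ _ P)) => // k p q.
exact: star_bump.
Qed.

(** One null set has to serve all test functions. Bumps with rational thresholds form a countable
    family, enumerated by [pickle]; outside the resulting null set [bump_vague] is applied to each
    outcome separately, along the natural numbers. *)
Lemma as_star : vague_cvg_almost_surely P (fun n w => esd (Bn n w)) mu <-> Star (Fas P) B mu.
Proof.
split=> [h|st].
  apply: (vague_star mom (@Fas_dim _ _ _ P) s0_gt0 hs_as) => f tf e e0.
  suff : {ae P, forall w, \forall n \near \oo, `|eig_avg (Bn n w) f - \int[mu]_z f z| <= e} by [].
  apply: filterS h => w /(_ f tf) /cvgrPdist_le/(_ e e0); apply: filterS => n.
  by rewrite integral_esd_test // distrC.
have hb k p q j : {ae P, forall w, \forall n \near \oo,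
    `|eig_avg (Bn n w) (bump k p q) - \int[mu]_z bump k p q z| <= j.+1%:R^-1}.
  have j0 : 0 < j.+1%:R^-1 :> R by rewrite invr_gt0.
  exact: (star_bump mom st k p q j0).
pose Q (c : nat * int * int * nat) w := \forall n \near \oo,
  `|eig_avg (Bn n w) (bump c.1.1.1 c.1.1.2 c.1.2) - \int[mu]_z bump c.1.1.1 c.1.1.2 c.1.2 z| <= c.2.+1%:R^-1.
have hQ (m : nat) : P.-negligible (fun w : T => ~ (forall c, choice.unpickle m = Some c -> Q c w)).
  case E : (choice.unpickle m) => [c|]; last by apply: negligibleS (negligible_set0 P) => w; apply.
  by apply: negligibleS (hb c.1.1.1 c.1.1.2 c.1.2 c.2) => w /= nw qw; apply: nw => c' [<-].
apply: negligibleS (negligible_bigcup hQ) => w /= nw; apply: contrapT => hw; apply: nw.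
have all c : Q c w.
  apply: contrapT => nq; apply: hw; exists (choice.pickle c) => //= h; apply: nq; apply: h; exact: choice.pickleK.
have star_w k p q : Cv \oo (fun n => eig_avg (Bn n w) (bump k p q)) (\int[mu]_z bump k p q z).
  move=> e e0; pose j := Num.trunc e^-1.
  have je : j.+1%:R^-1 <= e.
    by rewrite -[leRHS]invrK lef_pV2 ?posrE ?invr_gt0 // ltW // truncnS_gt.
  by apply: filterS (all (k, p, q, j)) => n h; exact: le_trans h je.
move=> f tf; apply/cvgrPdist_le => e e0.
have dn (m : nat) : \forall n \near \oo, (m <= n)%N by exact: nbhs_infty_ge.
have [m _ hm] := bump_vague (B := fun n => Bn n w) mom dn star_w tf e0.
by exists m => // n mn; rewrite /= integral_esd_test // distrC; exact: (hm n mn).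
Qed.

End Assembly.

Theorem theorem1p20
  (R : realType)
  (d0 : measure_display) (T0 : measurableType d0) (P0 : probability T0 R)
  (x : {RV P0 >-> R[i]})
  (d : measure_display) (T : measurableType d) (P : probability T R)
  (X : nat * nat -> {RV P >-> R[i]})
  (M : forall n : nat, 'M[R[i]]_n)
  (mu : probability R[i] R) :
  zero_mean_unit_variance x ->
  iid_copies X x ->
  has_ubound [set hs_norm (M n) ^+ 2 / n%:R ^+ 2 | n in [set n | (0 < n)%N]] ->
  (\int[mu]_z (normc z ^+ 2)%:E < +oo)%E ->
  let A (n : nat) (w : T) : 'M[R[i]]_n :=
    M n + random_matrix X n w in
  [/\ (vague_cvg_in_probability P (fun n w => esd (rescale (A n w))) mu <->
       ae_complex (fun z =>
         cvg_in_probability P (fun n w => mean_log_absdet (rescale (A n w) - z%:M))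
           (log_potential mu z))),
      (ae_complex (fun z =>
         cvg_in_probability P (fun n w => mean_log_absdet (rescale (A n w) - z%:M))
           (log_potential mu z)) <->
       ae_complex (fun z =>
         exists eps : nat -> R,
           [/\ forall n, 0 < eps n, eps n @[n --> \oo] --> 0 &
             cvg_in_probability P
               (fun n w => mean_log_regdet (eps n) (rescale (A n w) - z%:M))
               (2%:E * log_potential mu z)%E]))
    & ae_complex (fun z => exists nu : probability R[i] R,
        vague_cvg (fun n => esd (gram (rescale (M n) - z%:M))) nu) ->
      (vague_cvg_almost_surely P (fun n w => esd (rescale (A n w))) mu <->
       ae_complex (fun z =>
         cvg_almost_surely P (fun n w => mean_log_absdet (rescale (A n w) - z%:M))
           (log_potential mu z))) /\
      (ae_complex (fun z =>
         cvg_almost_surely P (fun n w => mean_log_absdet (rescale (A n w) - z%:M))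
           (log_potential mu z)) <->
       ae_complex (fun z =>
         exists eps : nat -> R,
           [/\ forall n, 0 < eps n, eps n @[n --> \oo] --> 0 &
             cvg_almost_surely P
               (fun n w => mean_log_regdet (eps n) (rescale (A n w) - z%:M))
               (2%:E * log_potential mu z)%E]))].
Proof.
move=> x01 Xx [K KM] mom A.
have K0 : 0 <= Num.max K 0 by rewrite le_max lexx orbT.
have M_le n : (0 < n)%N -> hs_norm (M n) ^+ 2 / n%:R ^+ 2 <= Num.max K 0.
  by move=> n0; rewrite le_max KM //; exists n.
have cpr := @comp_pr _ _ _ _ _ _ _ x X M x01 Xx _ M_le.
have cas := @comp_as _ _ _ _ _ _ _ x X M x01 Xx _ M_le.
have dpr := @Fpr_dim _ _ _ P; have das := @Fas_dim _ _ _ P.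
have epr (Y : nat -> T -> \bar R) c : (forall n, measurable_fun setT (Y n)) ->
    cvg_in_probability P Y c <-> CvE (Fpr P) (fun p => Y p.1 p.2) c by exact: cvg_pr_CvE.
have eas (Y : nat -> T -> \bar R) c : (forall n, measurable_fun setT (Y n)) ->
    cvg_almost_surely P Y c <-> CvE (Fas P) (fun p => Y p.1 p.2) c by move=> _; exact: cvg_as_CvE.
have spr := pr_star x01 Xx K0 M_le mom.
have sas := as_star x01 Xx K0 M_le mom.
split.
- exact: iff_trans spr (iff_sym (mode_star mom dpr cpr epr)).
- exact: (mode_regdet mom dpr cpr epr).
move=> _; split; last exact: (mode_regdet mom das cas eas).
exact: iff_trans sas (iff_sym (mode_star mom das cas eas)).
Qed.
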